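(* Let $\sigma,b\in C(\mathbb R)$ with $\sigma>0$ be such that $\Sigma$ is well-defined and $\int_{-\infty}^0 e^{-\Sigma(x)}dx=\int_0^{+\infty}e^{-\Sigma(x)}dx=\infty$. Let $\Gamma:\Lambda\to\mathbb R$ be a locally bounded Borel functional, and set $$\tilde\Gamma(s,\eta)=\frac{\Gamma(s,\eta)}{\sigma(\eta(s))},\qquad \bar\Gamma(s,\eta)=h'(h^{-1}(\eta(s)))\,\Gamma(s,h^{-1}\circ\eta^s).$$ Suppose that: (i) there exists a function $l:\mathbb R_+\to\mathbb R_+$ such that $\int_0^\epsilon l^{-2}(u)du=\infty$ for all $\epsilon>0$ and $|\sigma_0(x)-\sigma_0(y)|\le l(|x-y|)$ for all $x,y\in\mathbb R$; (ii) $\sigma_0$ has at most linear growth; (iii) there exists $K>0$ such that $|\bar\Gamma(s,\eta^1)-\bar\Gamma(s,\eta^2)|\le K\big(|\eta^1(s)-\eta^2(s)|+\int_0^s|\eta^1(r)-\eta^2(r)|dr\big)$ for all $(s,\eta^1),(s,\eta^2)\in\Lambda$; (iv) $\sup_{s\in[0,T]}|\bar\Gamma(s,0)|<\infty$. Suppose moreover that one of the following two hypotheses holds: (1) $\tilde\Gamma$ is bounded; (2) $\sigma_0$ and $\frac1{\sigma_0}$ are bounded. Then the martingale problem related to $\mathcal Lf=Lf+\Gamma f'$ with respect to $\mathcal D_L$ admits strong existence and pathwise uniqueness.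
   Context: Fix $T>0$. $C^k=C^k(\mathbb R)$. For $\eta\in C([0,T])$, $s\in[0,T]$, $\eta^s(t)=\eta(t)$ for $t\le s$ and $\eta^s(t)=\eta(s)$ for $t>s$. $\Lambda=\{(s,\eta)\in[0,T]\times C([0,T]):\eta=\eta^s\}$ (with the topology induced by the product topology, $C([0,T])$ having the uniform norm). Functionals on $\Lambda$ are extended by $\Gamma(t,\eta):=\Gamma(t,\eta^t)$. For a continuous process $X$ indexed by $[0,T]$, $X^s$ denotes its path stopped at $s$. In (iii), $\eta^1,\eta^2$ are just two paths (superscripts are indices). For $\sigma,b\in C(\mathbb R)$, $\sigma>0$, let $b_n,\sigma_n$ be the regularizations of $b,\sigma$ by convolution with a fixed sequence of mollifiers $\Phi_n(x)=n\Phi(nx)$. $\Sigma$ is well-defined if the limit $\Sigma(x)=2\lim_{n\to\infty}\int_0^x \frac{b_n'}{\sigma_n^2}(y)\,dy$ exists uniformly in $x$ on each compact set; then $\Sigma\in C(\mathbb R)$. Formally $Lf=\frac{\sigma^2}{2}f''+b'f'$, $b'$ being the distributional derivative of $b$. Precisely, $\mathcal D_L$ is the set of $f\in C^1$ for which there is $\phi\in C^1$ with $f'=e^{-\Sigma}\phi$, and then $Lf=\phi' e^{-\Sigma}\frac{\sigma^2}{2}\in C(\mathbb R)$. The function $h:\mathbb R\to\mathbb R$ is defined by $h(0)=0$, $h'=e^{-\Sigma}$; under the stated integral conditions it is a $C^1$-diffeomorphism of $\mathbb R$ onto $\mathbb R$. $\sigma_0:=(\sigma h')\circ h^{-1}$.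 Strong martingale problem: let $(\Omega,\mathcal F,\mathbb P)$ be a probability space, $W$ a Brownian motion on it, and $\mathfrak F$ the canonical filtration of $W$ (made to satisfy the usual conditions). A continuous $\mathfrak F$-adapted real process $X$ with $X_0=x_0\in\mathbb R$ is a solution to the strong martingale problem with respect to $\mathcal D_L$ and $W$ if for every $f\in\mathcal D_L$ $$f(X_t)-f(x_0)-\int_0^tLf(X_s)ds-\int_0^tf'(X_s)\Gamma(s,X^s)ds=\int_0^tf'(X_s)\sigma(X_s)dW_s,\quad t\in[0,T]$$ (the right-hand side being an $\mathfrak F$-local martingale). Strong existence: for every $x_0\in\mathbb R$ and every probability space carrying a Brownian motion $W$ with its canonical filtration, there is a solution $X$ to the strong martingale problem with respect to $\mathcal D_L$ and $W$ with $X_0=x_0$. Pathwise uniqueness: given any probability space and Brownian motion $W$ on it, any two solutions $X^1,X^2$ of the strong martingale problem with respect to $\mathcal D_L$ and $W$ with $\mathbb P[X^1_0=X^2_0]=1$ are indistinguishable. *)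

(* Defs.v *)
From HB Require Import structures.
From mathcomp Require Import all_boot all_order all_algebra.
From mathcomp Require Import all_classical all_reals all_analysis.

Set Implicit Arguments.
Unset Strict Implicit.
Unset Printing Implicit Defensive.

Import Order.TTheory GRing.Theory Num.Theory.
Import numFieldNormedType.Exports.

Local Open Scope ring_scope.
Local Open Scope classical_set_scope.

Section deterministic.
Context {R : realType}.

Definition C1 (f : R -> R) : Prop :=
  (forall x, derivable f x 1) /\ continuous (derive1 f).

Definition oriented_integral (f : R -> R) (x : R) : R :=
  if 0 <= x then Rintegral lebesgue_measure `[0, x] f
  else - Rintegral lebesgue_measure `[x, 0] f.

Definition mollifier (Phi : R -> R) : Prop :=
  [/\ forall n x, derivable (derive1n n Phi) x 1,
      exists M : R, forall x, M < `|x| -> Phi x = 0 &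
      (\int[lebesgue_measure]_x (Phi x)%:E = 1)%E].

Definition regularization (Phi : R -> R) (n : nat) (g : R -> R) (x : R) : R :=
  Rintegral lebesgue_measure setT
    (fun y => n%:R * Phi (n%:R * (x - y)) * g y).

(* For a given compact set sigma_n may vanish somewhere for finitely many n
   (Phi is not assumed nonnegative), which is irrelevant for the limit. *)
Definition is_Sigma (Phi b sigma Sigma : R -> R) : Prop :=
  forall K : set R, compact K ->
    {uniform K, (fun (n : nat) (x : R) =>
       2 * oriented_integral
             (fun y => derive1 (regularization Phi n b) y
                       / regularization Phi n sigma y ^+ 2) x) @ \oo
     --> Sigma}.

(* Graph of L: f belongs to D_L iff generator sigma Sigma f Lf holds for some
   Lf; phi, and hence Lf, is determined by f. *)
Definition generator (sigma Sigma f Lf : R -> R) : Prop :=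
  C1 f /\ exists phi : R -> R,
    [/\ C1 phi,
        forall x, derive1 f x = expR (- Sigma x) * phi x &
        forall x, Lf x = derive1 phi x * expR (- Sigma x) * (sigma x ^+ 2 / 2)].

Definition is_scale (Sigma h : R -> R) : Prop :=
  h 0 = 0 /\ forall x : R, is_derive x (1 : R) h (expR (- Sigma x)).

Definition invfun (h : R -> R) : R -> R := pinv_ (fun=> 0) setT h.

Definition sigma0 (sigma h : R -> R) (x : R) : R :=
  sigma (invfun h x) * derive1 h (invfun h x).

Definition stop (s : R) (eta : R -> R) : R -> R := fun t => eta (Num.min t s).

(* An element of C([0,T]) is represented by a function R -> R, continuous on
   [0,T], whose values outside [0,T] are irrelevant: the topology of uniform
   convergence on [0,T] does not separate functions equal on [0,T], so that
   every Borel functional takes the same value at such functions. *)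
Definition time_path (T : R) : topologicalType :=
  (R * {uniform` `[0, T]%classic -> R})%type.

Definition Lambda (T : R) : set (time_path T) :=
  [set p | [/\ 0 <= p.1 <= T, {within `[0, T], continuous (p.2 : R -> R)} &
               forall t, 0 <= t <= T -> p.2 t = stop p.1 p.2 t]].
Arguments Lambda T : clear implicits.

Definition borel_functional (T : R) (Gamma : R -> (R -> R) -> R) : Prop :=
  forall B : set R, measurable B ->
    <<s Lambda T, [set Lambda T `&` U | U in @open (time_path T)] >>
      (Lambda T `&` [set p | B (Gamma p.1 p.2)]).

Definition locally_bounded_functional (T : R) (Gamma : R -> (R -> R) -> R)
    : Prop :=
  forall p : time_path T, Lambda T p ->
    bounded_near (fun q : time_path T => Gamma q.1 q.2)
      (within (Lambda T) (nbhs p)).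

Definition Gamma_tilde (sigma : R -> R) (Gamma : R -> (R -> R) -> R)
    (s : R) (eta : R -> R) : R :=
  Gamma s eta / sigma (eta s).

Definition Gamma_bar (h : R -> R) (Gamma : R -> (R -> R) -> R)
    (s : R) (eta : R -> R) : R :=
  derive1 h (invfun h (eta s)) * Gamma s (invfun h \o stop s eta).

Definition linear_growth (g : R -> R) : Prop :=
  exists C : R, forall x, `|g x| <= C * (1 + `|x|).

End deterministic.
Arguments Lambda {R} T.

Section stochastic.
Context {R : realType} {d : measure_display} {Omega : measurableType d}.
Variables (P : probability Omega R) (T : R).
Implicit Types (W X H M : R -> Omega -> R) (F : R -> set (set Omega)).

Definition continuous_process X : Prop :=
  forall w, {within `[0, T], continuous (X ^~ w)}.

Definition generated_events W (u : R) : set (set Omega) :=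
  \bigcup_(r in `[0, T] `&` `[0, u]) preimage_set_system setT (W r) measurable.

Definition increment W (s t : R) : Omega -> R := fun w => W t w - W s w.

Definition brownian_motion W : Prop :=
  [/\ forall t, 0 <= t <= T -> measurable_fun setT (W t),
      continuous_process W,
      {ae P, forall w, W 0 w = 0},
      (forall s t, 0 <= s -> s < t -> t <= T ->
        forall B : set R, measurable B ->
          P (increment W s t @^-1` B) = normal_prob 0 (Num.sqrt (t - s)) B) &
      (forall s t, 0 <= s -> s < t -> t <= T ->
        forall (A : set Omega) (B : set R),
          <<s generated_events W s >> A -> measurable B ->
          (P (A `&` increment W s t @^-1` B) =
             P A * P (increment W s t @^-1` B))%E)].

(* Natural filtration of W, augmented by the subsets of the P-null sets and
   made right-continuous; its events are measurable for the completion of P. *)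
Definition canonical_filtration W (t : R) : set (set Omega) :=
  \bigcap_(u in `]t, +oo[) <<s generated_events W u `|` P.-negligible >>.

Definition adapted F X : Prop :=
  forall t, 0 <= t <= T ->
    forall B : set R, measurable B -> F t (X t @^-1` B).

(* Convergence to 0 in (outer) probability. *)
Definition cvg0_in_probability (Z : nat -> Omega -> \bar R) : Prop :=
  forall eps : R, 0 < eps ->
    exists A : nat -> set Omega,
      [/\ forall n, measurable (A n),
          forall n, [set w | (eps%:E < Z n w)%E] `<=` A n &
          (P \o A) @ \oo --> 0%E].

(* The process with value sp_xi i on ]sp_t i, sp_t i.+1], for i < sp_size. *)
Record simple_process := SimpleProcess {
  sp_size : nat ;
  sp_t : nat -> R ;
  sp_xi : nat -> Omega -> R }.

Definition is_simple F (S : simple_process) : Prop :=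
  [/\ 0 <= sp_t S 0, sp_t S (sp_size S) <= T,
      (forall i, (i < sp_size S)%N -> sp_t S i <= sp_t S i.+1),
      (forall i, (i < sp_size S)%N ->
        forall B : set R, measurable B -> F (sp_t S i) (sp_xi S i @^-1` B)) &
      (forall i, (i < sp_size S)%N ->
        exists C : R, forall w, `|sp_xi S i w| <= C)].

Definition sp_process (S : simple_process) (s : R) (w : Omega) : R :=
  \sum_(i < sp_size S) sp_xi S i w * \1_(`]sp_t S i, sp_t S i.+1]) s.

Definition sp_integral W (S : simple_process) (t : R) (w : Omega) : R :=
  \sum_(i < sp_size S) sp_xi S i w *
    (W (Num.min (sp_t S i.+1) t) w - W (Num.min (sp_t S i) t) w).

(* M is, up to indistinguishability, the Ito integral int_0^. H dW on [0,T],
   with respect to the canonical filtration of W. *)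
Definition is_ito_integral W H M : Prop :=
  exists S : nat -> simple_process,
    [/\ forall n, is_simple (canonical_filtration W) (S n),
        cvg0_in_probability (fun n w =>
          (\int[lebesgue_measure]_(s in `[0%R, T])
             ((sp_process (S n) s w - H s w) ^+ 2)%:E)%E) &
        cvg0_in_probability (fun n w =>
          ereal_sup [set (`|sp_integral W (S n) t w - M t w|)%:E
                    | t in `[0, T]])].

Definition strong_mp_solution (sigma Sigma : R -> R)
    (Gamma : R -> (R -> R) -> R) W (x0 : R) X : Prop :=
  [/\ continuous_process X,
      adapted (canonical_filtration W) X,
      {ae P, forall w, X 0 w = x0} &
      forall f Lf : R -> R, generator sigma Sigma f Lf ->
        is_ito_integral W
          (fun s w => derive1 f (X s w) * sigma (X s w))
          (fun t w => f (X t w) - f x0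
             - Rintegral lebesgue_measure `[0, t] (fun s => Lf (X s w))
             - Rintegral lebesgue_measure `[0, t]
                 (fun s => derive1 f (X s w) * Gamma s (stop s (X ^~ w))))].

Definition indistinguishable X1 X2 : Prop :=
  {ae P, forall w, forall t, 0 <= t <= T -> X1 t w = X2 t w}.

End stochastic.

Definition strong_existence {R : realType} (T : R) (sigma Sigma : R -> R)
    (Gamma : R -> (R -> R) -> R) : Prop :=
  forall (x0 : R) (d : measure_display) (Omega : measurableType d)
    (P : probability Omega R) (W : R -> Omega -> R),
    brownian_motion P T W ->
    exists X : R -> Omega -> R,
      strong_mp_solution P T sigma Sigma Gamma W x0 X.

Definition pathwise_uniqueness {R : realType} (T : R) (sigma Sigma : R -> R)
    (Gamma : R -> (R -> R) -> R) : Prop :=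
  forall (d : measure_display) (Omega : measurableType d)
    (P : probability Omega R) (W : R -> Omega -> R),
    brownian_motion P T W ->
    forall (x1 x2 : R) (X1 X2 : R -> Omega -> R),
      strong_mp_solution P T sigma Sigma Gamma W x1 X1 ->
      strong_mp_solution P T sigma Sigma Gamma W x2 X2 ->
      {ae P, forall w, X1 0 w = X2 0 w} ->
      indistinguishable P T X1 X2.

(* Main.v *)
(** The scale function [h] removes the singular drift: [X] solves the martingale
    problem if and only if [Y = h o X] solves [dY = Gamma_bar(t, Y) dt + sigma0(Y) dW],
    whose diffusion coefficient satisfies the condition of Yamada and Watanabe.
    All estimates are made on the uniform grids [t_j = j T / N], where a solution
    satisfies [Y_(j+1) = Y_j + drift_j + sigma0(Y_j) (W_(j+1) - W_j)] up to an error
    tending to 0 in probability.  Expanding the test functions of Yamada and Watanabe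
    along the difference of two such grid processes, and applying a Gronwall
    inequality that takes the dependence of the drift on the past into account,
    bounds this difference in probability.  This proves uniqueness, and it also
    shows that Euler schemes with finer and finer grids form a Cauchy sequence for
    the uniform convergence in probability.  Their limit [Y] satisfies the Ito formula,
    by a passage to the limit in the discrete expansion, and [X = h^-1 o Y].
    Events of the canonical filtration are only measurable for the completion of
    the probability, so that the estimates are made on the completed space. *)
Require Import Defs.
From HB Require Import structures.
From mathcomp Require Import all_boot all_order all_algebra.
From mathcomp Require Import all_classical all_reals all_analysis.
From mathcomp Require Import measurable_realfun ring lra.

Set Implicit Arguments.
Unset Strict Implicit.
Unset Printing Implicit Defensive.

Import Order.TTheory GRing.Theory Num.Theory.
Import numFieldNormedType.Exports.

Local Open Scope ring_scope.
Local Open Scope classical_set_scope.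

(** The obstacle is that [sigma0] need not be Lipschitz, so the difference of two solutions is
    controlled in mean rather than in mean square. A smooth [f] close to the absolute value is
    wanted for which [f''(x - y) (sigma0 x - sigma0 y)^2] is uniformly small; it exists because
    [1 / l^2] is not integrable at 0. Expectations require boundedness, which is obtained by
    switching the coefficients off once a path leaves a bounded interval. This is why estimates hold
    outside events of small outer probability, and why convergence is in probability. On a grid a
    stochastic integral is a finite sum of martingale increments [v]. What is used of them are
    conditional moments of orders 1, 2 and 4; the last one allows [v^2] to be replaced by the time
    step. Euler schemes of sizes [N] and [N'] are compared on the grid of size [N N'], which refines
    both. The singular drift disappears in the coordinate [h] for two reasons: [h] is in the domain
    with [L h = 0], and for every [f] in the domain [f o h^-1] has the continuously differentiable
    derivative [phi o h^-1]. *)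

Lemma ler_sum_widen {R : realType} (f : nat -> R) m n : (forall i, 0 <= f i) ->
  (m <= n)%N -> \sum_(i < m) f i <= \sum_(i < n) f i.
Proof.
move=> f0 mn; rewrite -!(big_mkord xpredT) [leRHS](big_cat_nat (n := m))//= lerDl.
exact: sumr_ge0.
Qed.

Ltac nonneg := repeat first [ assumption | by apply: ltW | exact: ler0n
  | exact: ler01 | exact: sqr_ge0 | exact: normr_ge0 | exact: expR_ge0
  | apply: addr_ge0 | apply: mulr_ge0 | rewrite invr_ge0 | apply: exprn_ge0 ].

(** * Measurability and expectation *)

Section measurability_wrt.
Context {R : realType} {Om : pointedType}.
Implicit Types (G : set (set Om)) (f g : Om -> R) (A : set Om).

(* An inductive type rather than an abbreviation, which would be unfolded during unification. *)
Variant meas_wrt G f : Prop :=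
  MeasWrt of forall B : set R, measurable B -> G (f @^-1` B).

Lemma meas_preimage G f B : meas_wrt G f -> measurable B -> G (f @^-1` B).
Proof. by case=> h; exact: h. Qed.

Lemma meas_wrtP G f : sigma_algebra setT G ->
  meas_wrt G f <-> measurable_fun setT (f : g_sigma_algebraType G -> R).
Proof.
move=> sG; split=> [mf _ B mB|mf]; last split=> B mB.
  by rewrite setTI; apply: sub_sigma_algebra; exact: meas_preimage.
have := mf measurableT B mB; rewrite setTI.
by rewrite /measurable/= sigma_algebra_id.
Qed.

Lemma sub_meas_wrt G1 G2 f : G1 `<=` G2 -> meas_wrt G1 f -> meas_wrt G2 f.
Proof. by move=> s12 mf; split=> B mB; apply: s12; exact: meas_preimage. Qed.

Section closure.
Variable G : set (set Om).
Hypothesis sG : sigma_algebra setT G.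

Lemma sa_set0 : G set0. Proof. by case: sG. Qed.

Lemma sa_setC A : G A -> G (~` A).
Proof. by move=> GA; rewrite -setTD; case: sG => _ + _; exact. Qed.

Lemma sa_setT : G setT. Proof. by rewrite -setC0; exact/sa_setC/sa_set0. Qed.

Lemma sa_bigcup (A : nat -> set Om) : (forall i, G (A i)) -> G (\bigcup_i A i).
Proof. by case: sG => _ _; exact. Qed.

Lemma sa_setU A B : G A -> G B -> G (A `|` B).
Proof.
move=> GA GB; rewrite -bigcup2E; apply: sa_bigcup => -[|[|i]] //=.
exact: sa_set0.
Qed.

Lemma sa_setI A B : G A -> G B -> G (A `&` B).
Proof.
move=> GA GB; rewrite -[X in G X]setCK setCI.
by apply/sa_setC/sa_setU; exact/sa_setC.
Qed.

Lemma sa_bigcup_count (I : countType) (A : I -> set Om) (D : set I) :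
  (forall i, D i -> G (A i)) -> G (\bigcup_(i in D) A i).
Proof.
move=> GA; rewrite [X in G X](_ : _ = \bigcup_n
   (if @unpickle I n is Some i then
      (if `[< D i >] then A i else set0) else set0)).
  apply: sa_bigcup => n; case: unpickle => [i|]; last exact: sa_set0.
  by case: asboolP => [/GA//|_]; exact: sa_set0.
apply/seteqP; split=> w.
  by move=> [i Di Aw]; exists (pickle i) => //; rewrite pickleK asboolT.
move=> [n _]; case: unpickle => [i|]//; case: asboolP => // Di Aw.
by exists i.
Qed.

Lemma sa_bigcap_count (I : countType) (A : I -> set Om) (D : set I) :
  (forall i, D i -> G (A i)) -> G (\bigcap_(i in D) A i).
Proof.
move=> GA; rewrite -[X in G X]setCK setC_bigcap.
by apply/sa_setC/sa_bigcup_count => i Di; exact/sa_setC/GA.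
Qed.

Lemma meas_cst r : meas_wrt G (cst r).
Proof. exact/(meas_wrtP _ sG)/measurable_cst. Qed.

Lemma measD f g : meas_wrt G f -> meas_wrt G g ->
  meas_wrt G (fun w => f w + g w).
Proof.
move=> /(meas_wrtP _ sG) mf /(meas_wrtP _ sG) mg.
exact/(meas_wrtP _ sG)/measurable_funD.
Qed.

Lemma measM f g : meas_wrt G f -> meas_wrt G g ->
  meas_wrt G (fun w => f w * g w).
Proof.
move=> /(meas_wrtP _ sG) mf /(meas_wrtP _ sG) mg.
exact/(meas_wrtP _ sG)/measurable_funM.
Qed.

Lemma meas_comp (k : R -> R) f : measurable_fun setT k -> meas_wrt G f ->
  meas_wrt G (fun w => k (f w)).
Proof.
move=> mk mf; split=> B mB; have := mk measurableT B mB; rewrite setTI.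
exact: meas_preimage.
Qed.

Lemma meas_compc (k : R -> R) f : continuous k -> meas_wrt G f ->
  meas_wrt G (fun w => k (f w)).
Proof. by move=> ck; apply: meas_comp; exact: continuous_measurable_fun. Qed.

Lemma measN f : meas_wrt G f -> meas_wrt G (fun w => - f w).
Proof. by apply: meas_comp; exact: oppr_measurable. Qed.

Lemma measB f g : meas_wrt G f -> meas_wrt G g ->
  meas_wrt G (fun w => f w - g w).
Proof. by move=> mf mg; apply: measD => //; exact: measN. Qed.

Lemma measZ r f : meas_wrt G f -> meas_wrt G (fun w => r * f w).
Proof. by apply: measM; exact: meas_cst. Qed.

Lemma measX n f : meas_wrt G f -> meas_wrt G (fun w => f w ^+ n).
Proof. by apply: (@meas_comp (fun x => x ^+ n)); exact: measurable_funX. Qed.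

Lemma meas_norm f : meas_wrt G f -> meas_wrt G (fun w => `|f w|).
Proof. by apply: meas_comp; exact: normr_measurable. Qed.

Lemma meas_sum (I : Type) (s : seq I) (h : I -> Om -> R) :
  (forall i, meas_wrt G (h i)) -> meas_wrt G (fun w => \sum_(i <- s) h i w).
Proof.
move=> mh; apply/(meas_wrtP _ sG)/measurable_sum => i.
exact/(meas_wrtP _ sG).
Qed.

Lemma meas_sum_ord n (h : nat -> Om -> R) :
  (forall i, (i < n)%N -> meas_wrt G (h i)) ->
  meas_wrt G (fun w => \sum_(i < n) h i w).
Proof. by move=> mh; apply: (@meas_sum _ _ (fun i : 'I_n => h i)) => i; exact: mh. Qed.

Lemma sa_lt f g : meas_wrt G f -> meas_wrt G g -> G [set w | f w < g w].
Proof.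
move=> mf mg; have mh := measB mg mf.
rewrite [X in G X](_ : _ = (fun w => g w - f w) @^-1` `]0, +oo[).
  by apply: meas_preimage => //; exact: measurable_itv.
by apply/seteqP; split=> w /=; rewrite in_itv/= subr_gt0 andbT.
Qed.

Lemma sa_le f g : meas_wrt G f -> meas_wrt G g -> G [set w | f w <= g w].
Proof.
move=> mf mg; rewrite [X in G X](_ : _ = ~` [set w | g w < f w]).
  exact/sa_setC/sa_lt.
by apply/seteqP; split=> w /=; rewrite leNgt => /negP.
Qed.

Lemma sa_lec f r : meas_wrt G f -> G [set w | f w <= r].
Proof. by move=> mf; apply: (sa_le (g := cst r)) => //; exact: meas_cst. Qed.

Lemma sa_ltc f r : meas_wrt G f -> G [set w | f w < r].
Proof. by move=> mf; apply: (sa_lt (g := cst r)) => //; exact: meas_cst. Qed.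

Lemma meas_ind A : G A -> meas_wrt G (\1_A : Om -> R).
Proof.
move=> GA; apply/(meas_wrtP _ sG)/measurable_indic.
exact: sub_sigma_algebra.
Qed.

Lemma meas_wrt_gt f : (forall a, G [set w | a < f w]) -> meas_wrt G f.
Proof.
move=> h; apply/(meas_wrtP _ sG).
apply: (@measurability _ _ _ _ _ _ _ (@RGenOInfty.measurableE R)).
move=> /= _ [_ [a ->] <-]; rewrite setTI; apply: sub_sigma_algebra.
rewrite [X in G X](_ : _ = [set w | a < f w])//.
by apply/seteqP; split=> w /=; rewrite in_itv/= andbT.
Qed.

Lemma meas_wrt_cvg (h : nat -> Om -> R) f : (forall n, meas_wrt G (h n)) ->
  (forall w, (fun n => h n w) @ \oo --> f w) -> meas_wrt G f.
Proof.
move=> mh hf; apply/(meas_wrtP _ sG).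
apply: (@measurable_fun_cvg _ _ _ _ (fun n => h n : g_sigma_algebraType G -> R)).
  by move=> n; exact/(meas_wrtP _ sG).
by move=> w _; exact: hf.
Qed.

End closure.
End measurability_wrt.

Section expectation.
Context {R : realType} {d : measure_display} {Om : measurableType d}.
Variable P : probability Om R.
Implicit Types (f g : Om -> R) (A : set Om).

Definition L1 f := P.-integrable setT (EFin \o f).
Definition Ex f : R := Rintegral P setT f.
(* An outer probability: the events of interest involve suprema over uncountably
   many times, and need not be measurable. *)
Definition pbnd A (e : R) :=
  exists B, [/\ measurable B, A `<=` B & (P B <= e%:E)%E].

Lemma sa_measurable : sigma_algebra setT (@measurable d Om).
Proof.
split; first exact: measurable0.
  by move=> A mA; exact: measurableD.
by move=> F mF; exact: bigcupT_measurable.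
Qed.

Lemma meas_mfun f : meas_wrt measurable f <-> measurable_fun setT f.
Proof.
split=> [mf _ B mB|mf]; first by rewrite setTI; exact: meas_preimage.
split=> B mB.
by have := mf measurableT B mB; rewrite setTI.
Qed.

Lemma L1_meas f : L1 f -> meas_wrt measurable f.
Proof.
by move=> /(measurable_int P) /measurable_EFinP /meas_mfun.
Qed.

Lemma L1_le f g : meas_wrt measurable f -> L1 g -> (forall w, `|f w| <= g w) ->
  L1 f.
Proof.
move=> /meas_mfun mf ig fg; apply: le_integrable ig => //.
  exact/measurable_EFinP.
move=> w _ /=; by rewrite lee_fin (le_trans (fg w))// ler_norm.
Qed.

Lemma L1_cst r : L1 (cst r).
Proof. exact: finite_measure_integrable_cst. Qed.

Lemma L1_bnd f (C : R) : meas_wrt measurable f -> (forall w, `|f w| <= C) -> L1 f.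
Proof. by move=> mf; apply: L1_le => //; exact: L1_cst. Qed.

Lemma L1D f g : L1 f -> L1 g -> L1 (fun w => f w + g w).
Proof. by move=> If Ig; have := integrableD measurableT If Ig. Qed.

Lemma L1Z r f : L1 f -> L1 (fun w => r * f w).
Proof. by move=> If; have := integrableZl measurableT r If. Qed.

Lemma L1N f : L1 f -> L1 (fun w => - f w).
Proof. by move=> If; have := integrableN If. Qed.

Lemma L1B f g : L1 f -> L1 g -> L1 (fun w => f w - g w).
Proof. by move=> If Ig; apply: L1D => //; exact: L1N. Qed.

Lemma L1_norm f : L1 f -> L1 (fun w => `|f w|).
Proof. by move=> If; exact: integrable_norm. Qed.

Lemma L1_sum (I : Type) (s : seq I) (h : I -> Om -> R) :
  (forall i, L1 (h i)) -> L1 (fun w => \sum_(i <- s) h i w).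
Proof.
move=> ih; elim: s => [|i s ih'].
  by under eq_fun do rewrite big_nil; exact: L1_cst.
by under eq_fun do rewrite big_cons; exact: L1D.
Qed.

Lemma L1M f g (C : R) : meas_wrt measurable f -> (forall w, `|f w| <= C) -> L1 g ->
  L1 (fun w => f w * g w).
Proof.
move=> mf fC Ig; apply: (@L1_le _ (fun w => C * `|g w|)).
- by apply: (measM sa_measurable) => //; exact: L1_meas.
- exact/L1Z/L1_norm.
- by move=> w; rewrite normrM ler_wpM2r.
Qed.

Lemma ExD f g : L1 f -> L1 g -> Ex (fun w => f w + g w) = Ex f + Ex g.
Proof. by move=> If Ig; rewrite /Ex RintegralD. Qed.

Lemma ExB f g : L1 f -> L1 g -> Ex (fun w => f w - g w) = Ex f - Ex g.
Proof. by move=> If Ig; rewrite /Ex RintegralB. Qed.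

Lemma ExZ r f : L1 f -> Ex (fun w => r * f w) = r * Ex f.
Proof. by move=> If; rewrite /Ex RintegralZl. Qed.

Lemma Ex_cst r : Ex (cst r) = r.
Proof. have h : r * fine (P setT) = r by rewrite probability_setT mulr1.
exact: etrans (Rintegral_cst P measurableT r) h. Qed.

Lemma Ex_sum (I : Type) (s : seq I) (h : I -> Om -> R) :
  (forall i, L1 (h i)) ->
  Ex (fun w => \sum_(i <- s) h i w) = \sum_(i <- s) Ex (h i).
Proof.
move=> ih; elim: s => [|i s ih'].
  by under eq_fun do rewrite big_nil; rewrite big_nil; exact: Ex_cst.
under eq_fun do rewrite big_cons.
by rewrite big_cons ExD// ?ih'//; exact: L1_sum.
Qed.

Lemma le_Ex f g : L1 f -> L1 g -> (forall w, f w <= g w) -> Ex f <= Ex g.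
Proof. by move=> If Ig fg; exact: le_Rintegral. Qed.

Lemma Ex_ge0 f : (forall w, 0 <= f w) -> 0 <= Ex f.
Proof. by move=> f0; exact: Rintegral_ge0. Qed.

Lemma le_ExN f : L1 f -> `|Ex f| <= Ex (fun w => `|f w|).
Proof. by move=> If; exact: le_normr_Rintegral. Qed.

Lemma Ex_ind A : measurable A -> Ex (\1_A) = fine (P A).
Proof. by move=> mA; rewrite /Ex /Rintegral integral_indic// setIT. Qed.

Lemma norm_ind A (w : Om) : `|\1_A w : R| <= 1.
Proof. by rewrite indicE; case: (_ \in _); rewrite ?normr1 ?normr0. Qed.

Lemma L1_ind A : measurable A -> L1 (\1_A).
Proof.
move=> mA; apply: (@L1_bnd _ 1); first exact: (meas_ind sa_measurable).
exact: norm_ind.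
Qed.

Lemma PfineK A : measurable A -> ((fine (P A))%:E = P A)%E.
Proof. by move=> mA; rewrite fineK// fin_num_measure. Qed.

Lemma pbnd_le A B e1 e2 : A `<=` B -> e1 <= e2 -> pbnd B e1 -> pbnd A e2.
Proof.
move=> AB e12 [C [mC BC PC]]; exists C; split => //.
  exact: subset_trans BC.
by rewrite (le_trans PC)// lee_fin.
Qed.

Lemma pbndU A B e1 e2 : pbnd A e1 -> pbnd B e2 -> pbnd (A `|` B) (e1 + e2).
Proof.
move=> [C [mC AC PC]] [D [mD BD PD]]; exists (C `|` D); split.
- exact: measurableU.
- exact: setUSS.
- by rewrite EFinD (le_trans (measureU2 _ mC mD))// leeD.
Qed.

Lemma markov_L1 f (a : R) : 0 < a -> L1 f -> (forall w, 0 <= f w) ->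
  pbnd [set w | a <= f w] (Ex f / a).
Proof.
move=> a0 If f0; set A := [set w | _].
have mA : measurable A.
  by apply: (sa_le sa_measurable); [exact: (meas_cst sa_measurable)|exact: L1_meas].
exists A; split=> //.
rewrite -PfineK// lee_fin ler_pdivlMr// mulrC -Ex_ind// -ExZ; last exact: L1_ind.
apply: le_Ex => //; first exact/L1Z/L1_ind.
move=> w; rewrite indicE; have [|] := boolP (w \in A); last by rewrite mulr0.
by rewrite inE mulr1.
Qed.

End expectation.

(** * Martingale sums over a finite grid *)

Section discrete_martingale.
Context {R : realType} {d : measure_display} {Om : measurableType d}.
Variables (P : probability Om R) (N : nat) (F : nat -> set (set Om)).
Hypothesis sF : forall j, sigma_algebra setT (F j).
Hypothesis FS : forall j, F j `<=` F j.+1.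
Hypothesis Fm : forall j, F j `<=` measurable.
Local Notation E := (Ex P).
Local Notation L1 := (L1 P).

(** Martingale increments of conditional variance [c], the conditional expectation given [F j] being
    expressed through bounded [F j]-measurable factors [xi]. It is used both for Brownian increments
    [v] and for [v ^+ 2 - Dt]. *)
Definition noise (v : nat -> Om -> R) (c : R) := forall j, (j < N)%N ->
  [/\ meas_wrt (F j.+1) (v j), L1 (v j), L1 (fun w => v j w ^+ 2) &
   forall (xi : Om -> R) (C : R), meas_wrt (F j) xi -> (forall w, `|xi w| <= C) ->
    E (fun w => xi w * v j w) = 0 /\
    E (fun w => xi w * v j w ^+ 2) = c * E xi].

Definition dsum (b v : nat -> Om -> R) n w := \sum_(i < n) b i w * v i w.

Lemma filtration_le i j : (i <= j)%N -> F i `<=` F j.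
Proof.
elim: j => [|j ih]; first by rewrite leqn0 => /eqP ->.
rewrite leq_eqVlt => /predU1P[->//|]; rewrite ltnS => /ih h.
exact: subset_trans (@FS j).
Qed.

Lemma meas_dsum b v (c : R) n : noise v c -> (n <= N)%N ->
  (forall j, (j < n)%N -> meas_wrt (F j) (b j)) -> meas_wrt (F n) (dsum b v n).
Proof.
move=> nv nN mb.
apply: (@meas_sum_ord _ _ _ (sF n) n (fun i w => b i w * v i w)) => i iN.
have [mv _ _ _] := nv i (leq_trans iN nN).
apply: measM => //; first exact: sub_meas_wrt (filtration_le (ltnW iN)) (mb _ iN).
exact: sub_meas_wrt (filtration_le iN) mv.
Qed.

(** Orthogonality of martingale increments: when the recursion is squared, the cross term [2 b M v]
    has expectation zero because [b M] is a bounded variable of the past. Boundedness is required of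
    this product and not of the sum [M], since [v] is unbounded. *)
Lemma isometry b v (c C : R) n : noise v c -> (n <= N)%N ->
  (forall j, (j < n)%N -> meas_wrt (F j) (b j)) ->
  (forall j w, (j < n)%N -> `|b j w| <= C) ->
  (forall j w, (j < n)%N -> `|b j w * dsum b v j w| <= C) ->
  [/\ L1 (dsum b v n), E (dsum b v n) = 0, L1 (fun w => dsum b v n w ^+ 2) &
  E (fun w => dsum b v n w ^+ 2) = c * \sum_(i < n) E (fun w => b i w ^+ 2)].
Proof.
move=> nv; elim: n => [|n ih] nN mb bC bMC.
  have -> : dsum b v 0 = cst 0 by apply/funext => w; rewrite /dsum big_ord0.
  rewrite big_ord0 mulr0; split; [exact: L1_cst|exact: Ex_cst| |].
    by under eq_fun do rewrite expr0n/=; exact: L1_cst.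
  by under eq_fun do rewrite expr0n/=; exact: Ex_cst.
have [IM EM IM2 EM2] := ih (ltnW nN) (fun j jn => mb j (ltnW jn))
  (fun j w jn => bC j w (ltnW jn)) (fun j w jn => bMC j w (ltnW jn)).
have [mv Iv Iv2 vE] := nv n nN.
have mbn : meas_wrt (F n) (b n) by exact: mb.
have mMn : meas_wrt (F n) (dsum b v n).
  by apply: meas_dsum nv (ltnW nN) _ => j jn; apply: mb; exact: ltnW.
have mm : forall f : Om -> R, meas_wrt (F n) f -> meas_wrt measurable f.
  by move=> f; exact: sub_meas_wrt.
have C0 : 0 <= C by rewrite (le_trans _ (bC n point _)).
have DS w : dsum b v n.+1 w = dsum b v n w + b n w * v n w.
  by rewrite /dsum big_ord_recr.
have Ibv : L1 (fun w => b n w * v n w).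
  by apply: (L1M (C := C)) => //; [exact: mm|move=> w; exact: bC].
have IMbv : L1 (fun w => (2 * (b n w * dsum b v n w)) * v n w).
  apply: (L1M (C := 2 * C)) => //; first by apply/mm/measZ => //; exact: measM.
  by move=> w; rewrite normrM ger0_norm// ler_pM2l// bMC.
have Ib2 : L1 (fun w => b n w ^+ 2 * v n w ^+ 2).
  apply: (L1M (C := C ^+ 2)) => //; first by apply/mm/measX.
  by move=> w; rewrite normrX ler_sqr ?nnegrE// bC.
have D2 w : dsum b v n.+1 w ^+ 2 = dsum b v n w ^+ 2 +
   ((2 * (b n w * dsum b v n w)) * v n w + b n w ^+ 2 * v n w ^+ 2).
  by rewrite DS; ring.
rewrite (funext D2) (funext DS : dsum b v n.+1 = _); split.
- exact: L1D.
- rewrite ExD// EM add0r; have [-> //] := vE (b n) C mbn (fun w => bC n w (ltnSn n)).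
- by apply: L1D => //; exact: L1D.
- rewrite ExD//; last exact: L1D.
  rewrite ExD// EM2 big_ord_recr/= mulrDr; congr (_ + _).
  have [|w|-> _] := vE (fun w => 2 * (b n w * dsum b v n w)) (2 * C).
  + by apply: measZ => //; exact: measM.
  + by rewrite normrM ger0_norm// ler_pM2l// bMC.
  have [|w|_ ->] := vE (fun w => b n w ^+ 2) (C ^+ 2); last by rewrite add0r.
  + exact: measX.
  + by rewrite normrX ler_sqr ?nnegrE// bC.
Qed.

End discrete_martingale.

Section maximal_inequality.
Context {R : realType} {d : measure_display} {Om : measurableType d}.
Variables (P : probability Om R) (N : nat) (F : nat -> set (set Om)).
Hypothesis sF : forall j, sigma_algebra setT (F j).
Hypothesis FS : forall j, F j `<=` F j.+1.
Hypothesis Fm : forall j, F j `<=` measurable.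

(* Stopping the integrand as soon as the sum exceeds [lam] or its bracket
   exceeds [kap] reduces the maximal inequality to the isometry. *)
Lemma lenglart b v (c : R) n (lam kap : R) : noise P N F v c -> 0 < c ->
  (n <= N)%N -> (forall j, (j < n)%N -> meas_wrt (F j) (b j)) ->
  0 < lam -> 0 <= kap ->
  pbnd P [set w | c * (\sum_(i < n) b i w ^+ 2) <= kap /\
                  exists2 m, (m <= n)%N & lam <= `|dsum b v m w| ]
       (kap / lam ^+ 2).
Proof.
move=> nv c0 nN mb lam0 kap0.
(* [J j] involves the sums before step [j] and the bracket including step [j]. It is therefore known
   at time [j], and the stopped integrand [g] remains predictable. *)
pose J j := [set w | (forall i, (i <= j)%N -> `|dsum b v i w| < lam) /\
                     c * (\sum_(i < j.+1) b i w ^+ 2) <= kap].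
pose g j w : R := \1_(J j) w * b j w.
have gE j w : J j w -> g j w = b j w.
  by move=> Jw; rewrite /g indicE mem_set// mul1r.
have gE0 j w : ~ J j w -> g j w = 0.
  by move=> Jw; rewrite /g indicE memNset// mul0r.
have JS i j : (i <= j)%N -> J j `<=` J i.
  move=> ij w [Jw1 Jw2]; split=> [l li|]; first exact/Jw1/(leq_trans li).
  rewrite (le_trans _ Jw2)// ler_pM2l//.
  by apply: (ler_sum_widen (f := fun i => b i w ^+ 2)) => // l; exact: sqr_ge0.
have FJ j : (j < n)%N -> F j (J j).
  move=> jn; apply: sa_setI => //.
    rewrite [X in F j X](_ : _ = \bigcap_(i in [set i | (i <= j)%N])
        [set w | `|dsum b v i w| < lam]).
      apply: sa_bigcap_count => // i /= ij; apply: sa_ltc => //.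
      apply: meas_norm => //; apply: (sub_meas_wrt (filtration_le FS ij)).
      apply: (meas_dsum sF FS nv (leq_trans ij (ltnW (leq_trans jn nN)))) => l li.
      by apply: mb; rewrite (leq_trans li)// (leq_trans ij)// ltnW.
    by apply/seteqP; split=> w h i ij; exact: h.
  apply: sa_lec => //; apply: measZ => //.
  apply: (@meas_sum_ord _ _ _ (sF j) j.+1 (fun i w => b i w ^+ 2)) => i ij.
  apply: measX => //; apply: (sub_meas_wrt (filtration_le FS (ltnSE ij))).
  by apply: mb; rewrite (leq_trans ij).
have mg j : (j < n)%N -> meas_wrt (F j) (g j).
  by move=> jn; apply: measM => //; [exact/meas_ind/FJ|exact: mb].
have gs m w : c * (\sum_(i < m) g i w ^+ 2) <= kap.
  elim: m => [|m ih]; first by rewrite big_ord0 mulr0.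
  have [Jm|nJm] := pselect (J m w); last first.
    by rewrite big_ord_recr/= gE0// expr0n addr0.
  case: (Jm) => _; congr (c * _ <= _); apply: eq_bigr => i _.
  by rewrite gE//; apply: JS Jm; rewrite -ltnS.
(* A single term of the bracket of [g] is at most [kap / c], which bounds [g] whatever [b] is. *)
pose C0 := Num.sqrt (kap / c).
have gC j w : `|g j w| <= C0.
  rewrite -sqrtr_sqr ler_wsqrtr// ler_pdivlMr// mulrC.
  apply: le_trans (gs j.+1 w); rewrite ler_pM2l// big_ord_recr/= lerDr.
  by apply: sumr_ge0 => l _; exact: sqr_ge0.
have DJ j w : J j w -> dsum g v j w = dsum b v j w.
  move=> Jw; apply: eq_bigr => i _; rewrite gE//.
  by apply: JS Jw; rewrite ltnW.
have C00 : 0 <= C0 by exact: sqrtr_ge0.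
have gD j w : `|g j w * dsum g v j w| <= C0 * lam.
  have [Jw|nJw] := pselect (J j w); last first.
    by rewrite gE0// mul0r normr0 mulr_ge0// ltW.
  by rewrite normrM ler_pM// DJ// ltW//; case: Jw => + _; exact.
have [|||_ _ I2 E2] := @isometry _ _ _ _ _ _ sF FS Fm g v c
    (Num.max C0 (C0 * lam)) n nv nN.
- by move=> j jn; exact: mg.
- by move=> j w _; rewrite le_max gC.
- by move=> j w _; rewrite le_max gD orbT.
apply: (@pbnd_le _ _ _ _ _ [set w | lam ^+ 2 <= dsum g v n w ^+ 2]
   (Ex P (fun w => dsum g v n w ^+ 2) / lam ^+ 2)); last first.
- by apply: markov_L1 => // [|w]; [rewrite exprn_gt0|exact: sqr_ge0].
- rewrite ler_pM2r ?invr_gt0 ?exprn_gt0// E2.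
  have Ig2 (i : 'I_n) : L1 P (fun w => g i w ^+ 2).
    apply: (@L1_bnd _ _ _ _ _ (C0 ^+ 2)).
      by apply: measX; exact: sub_meas_wrt (@Fm i) (mg i (ltn_ord i)).
    by move=> w; rewrite normrX ler_sqr ?nnegrE.
  rewrite -(Ex_sum _ Ig2) -ExZ; last exact: L1_sum.
  rewrite -[leRHS](Ex_cst P kap); apply: le_Ex => //.
  + by apply: L1Z; exact: L1_sum.
  + exact: L1_cst.
  + by move=> w; exact: gs.
- move=> w [bk [m0 m0n lm0]].
  have ex : exists m, (m <= n)%N && (lam <= `|dsum b v m w|).
    by exists m0; rewrite m0n.
  case: (ex_minnP ex) => m /andP[mn lm] mmin.
  have Ji i : (i < m)%N -> J i w.
    move=> im; split=> [l li|].
      rewrite ltNge; apply/negP => h.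
      have := mmin l; rewrite h (leq_trans li)/= ?(leq_trans (ltnW im))//.
      by move=> /(_ isT) /(leq_trans im); rewrite ltnNge li.
    rewrite (le_trans _ bk)// ler_pM2l//.
    apply: (ler_sum_widen (f := fun i => b i w ^+ 2)) => [l|].
      exact: sqr_ge0.
    exact: leq_trans im mn.
  have nJi i : (m <= i)%N -> ~ J i w.
    by move=> mi [/(_ _ mi)]; rewrite ltNge lm.
  (* From the first exceedance [m] on the integrand is switched off for good, so the stopped sum at
     time [n] still shows the value at time [m]. *)
  have Dm : dsum g v n w = dsum b v m w.
    rewrite /dsum -(big_mkord xpredT (fun i => g i w * v i w)).
    rewrite (big_cat_nat (n := m))//= big_mkord.
    rewrite [X in _ + X](_ : _ = 0) ?addr0.
      by apply: eq_bigr => i _; rewrite gE//; exact: Ji.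
    rewrite big_nat_cond big1// => i /andP[/andP[mi _] _].
    by rewrite gE0 ?mul0r//; exact: nJi.
  by rewrite /= Dm -[leRHS]real_normK ?num_real// ler_sqr ?nnegrE// ltW.
Qed.

End maximal_inequality.

(** * The discrete Ito formula and the stability of grid solutions *)

Section discrete_ito.
Context {R : realType} {d : measure_display} {Om : measurableType d}.
Variables (P : probability Om R) (N : nat) (F : nat -> set (set Om)).
Hypothesis sF : forall j, sigma_algebra setT (F j).
Hypothesis FS : forall j, F j `<=` F j.+1.
Hypothesis Fm : forall j, F j `<=` measurable.
Variables (v : nat -> Om -> R) (Dt : R).
Hypothesis Dt0 : 0 < Dt.
Hypothesis nv : noise P N F v Dt.
Hypothesis nv2 : noise P N F (fun j w => v j w ^+ 2 - Dt) (2 * Dt ^+ 2).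
Local Notation E := (Ex P).
Local Notation L1 := (L1 P).

(** The test variable 1 in the noise condition gives plain moments; the fourth one comes from
    [v^4 = (v^2 - Dt)^2 + 2 Dt v^2 - Dt^2]. *)
Lemma noise_moments j : (j < N)%N ->
  [/\ L1 (fun w => v j w ^+ 2), E (fun w => v j w ^+ 2) = Dt,
      L1 (fun w => v j w ^+ 4) & E (fun w => v j w ^+ 4) = 3 * Dt ^+ 2].
Proof.
move=> jN; have [_ _ I2 vE] := nv jN; have [_ _ I4 v2E] := nv2 jN.
have n1 (w : Om) : `|cst (1 : R) w| <= 1 by rewrite normr1.
have m1 : meas_wrt (F j) (cst (1 : R) : Om -> R) by exact: meas_cst.
have E2 : E (fun w => v j w ^+ 2) = Dt.
  have [_] := vE (cst 1) 1 m1 n1; rewrite Ex_cst mulr1 => <-.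
  by congr E; apply/funext => w; rewrite /cst mul1r.
have eq4 w : v j w ^+ 4 = (v j w ^+ 2 - Dt) ^+ 2 +
    (2 * Dt * v j w ^+ 2 - cst (Dt ^+ 2) w) by rewrite /cst; ring.
have I : L1 (fun w => 2 * Dt * v j w ^+ 2 - cst (Dt ^+ 2) w).
  by apply: L1B; [exact: L1Z|exact: L1_cst].
rewrite (funext eq4); split => //; first exact: L1D.
rewrite ExD// ExB; [|exact: L1Z|exact: L1_cst].
rewrite ExZ// E2 Ex_cst.
have [_] := v2E (cst 1) 1 m1 n1; rewrite Ex_cst mulr1 => e.
rewrite (_ : E _ = 2 * Dt ^+ 2); first by ring.
by rewrite -e; congr E; apply/funext => w; rewrite /cst mul1r.
Qed.

Variables (D0 : R) (al be : nat -> Om -> R) (C : R).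
Hypothesis mal : forall j, (j < N)%N -> meas_wrt (F j) (al j).
Hypothesis mbe : forall j, (j < N)%N -> meas_wrt (F j) (be j).
Hypothesis alC : forall j w, (j < N)%N -> `|al j w| <= C * Dt.
Hypothesis beC : forall j w, (j < N)%N -> `|be j w| <= C.
Variables (f f1 f2 : R -> R) (B : R).
Hypothesis cf1 : continuous f1.
Hypothesis cf2 : continuous f2.
Hypothesis cf : continuous f.
Hypothesis f1B : forall x, `|f1 x| <= B.
Hypothesis f2B : forall x, `|f2 x| <= B.

Definition dproc j w := D0 + \sum_(i < j) (al i w + be i w * v i w).

(** The second order term contains only the noise part [be v] of the increment: the contribution of
    [al], of order [Dt], is left to the remainder. *)
Definition ito_rem j w := f (dproc j.+1 w) - f (dproc j w)
  - f1 (dproc j w) * (al j w + be j w * v j w)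
  - 2^-1 * f2 (dproc j w) * (be j w * v j w) ^+ 2.

Lemma meas_dproc j : (j <= N)%N -> meas_wrt (F j) (dproc j).
Proof.
move=> jN; apply: measD => //; first exact: meas_cst.
apply: (@meas_sum_ord _ _ _ (sF j) j (fun i w => al i w + be i w * v i w)).
move=> i ij; have iN := leq_trans ij jN; have [mv _ _ _] := nv iN.
apply: (sub_meas_wrt (filtration_le FS ij)).
have up g : meas_wrt (F i) g -> meas_wrt (F i.+1) (g : Om -> R).
  exact: sub_meas_wrt.
apply: measD => //; first exact/up/mal.
by apply: measM => //; exact/up/mbe.
Qed.

Lemma C_ge0 j : (j < N)%N -> 0 <= C.
Proof. by move=> jN; rewrite (le_trans _ (beC point jN)). Qed.

Lemma B_ge0 : 0 <= B. Proof. exact: le_trans (f1B 0). Qed.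

(** The remainder is dominated pointwise by a combination of 1, [v^2] and [v^4], whose expectations
    are known. The bound is [Dt] times a quantity that is small with [e] and [Dt], so that even the
    sum of [T / Dt] remainders is small. *)
Lemma ito_rem_bound (e K : R) j : (j < N)%N -> 0 < e -> 0 <= K -> Dt <= 1 ->
  (forall x t, `|f (x + t) - f x - f1 x * t - 2^-1 * f2 x * t ^+ 2|
     <= (e + K * t ^+ 2) * t ^+ 2) ->
  L1 (ito_rem j) /\ E (fun w => `|ito_rem j w|) <=
    Dt * ((4 * C ^+ 2 + 32 * C ^+ 4 + B * C ^+ 2) * (e + Dt * (1 + K + e^-1))).
Proof.
move=> jN e0 K0 Dt1 tay.
have C0 := C_ge0 jN; have B0 := B_ge0.
have [I2 E2 I4 E4] := noise_moments jN.
pose x2 w := v j w ^+ 2; pose x4 w := v j w ^+ 4.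
pose c0 : R := e * (2 * C ^+ 2 * Dt ^+ 2) + K * (8 * C ^+ 4 * Dt ^+ 4)
  + 2^-1 * B * (C ^+ 2 * Dt ^+ 2 + C ^+ 2 * Dt * e).
pose c2 : R := e * (2 * C ^+ 2) + 2^-1 * B * (C ^+ 2 * Dt / e).
pose c4 : R := K * (8 * C ^+ 4).
pose bd w := cst c0 w + (c2 * x2 w + c4 * x4 w).
have le_bd w : `|ito_rem j w| <= bd w.
  rewrite /ito_rem /dproc big_ord_recr/= addrA -/(dproc j w).
  set t := al j w + be j w * v j w; set D := dproc j w.
  set a := al j w; set b := be j w; set x := v j w.
  have ha : `|a| <= C * Dt by exact: alC.
  have hb : `|b| <= C by exact: beC.
  have -> : f (D + t) - f D - f1 D * t - 2^-1 * f2 D * (b * x) ^+ 2 =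
    (f (D + t) - f D - f1 D * t - 2^-1 * f2 D * t ^+ 2) +
    2^-1 * f2 D * (t ^+ 2 - (b * x) ^+ 2) by ring.
  apply: (le_trans (ler_normD _ _)).
  have a2 : a ^+ 2 <= C ^+ 2 * Dt ^+ 2.
    rewrite -exprMn -[a ^+ 2]real_normK ?num_real//.
    by rewrite ler_sqr ?nnegrE// mulr_ge0// ltW.
  have b2 : b ^+ 2 <= C ^+ 2.
    by rewrite -[b ^+ 2]real_normK ?num_real// ler_sqr ?nnegrE.
  have bx2 : (b * x) ^+ 2 <= C ^+ 2 * x ^+ 2.
    by rewrite exprMn ler_wpM2r// sqr_ge0.
  have t2 : t ^+ 2 <= 2 * C ^+ 2 * Dt ^+ 2 + 2 * C ^+ 2 * x ^+ 2.
    have : 0 <= (a - b * x) ^+ 2 by exact: sqr_ge0.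
    rewrite /t -/a -/b -/x; nra.
  have t4 : t ^+ 4 <= 8 * C ^+ 4 * Dt ^+ 4 + 8 * C ^+ 4 * x ^+ 4.
    apply: (@le_trans _ _ ((2 * C ^+ 2 * Dt ^+ 2 + 2 * C ^+ 2 * x ^+ 2) ^+ 2)).
      rewrite (_ : t ^+ 4 = (t ^+ 2) ^+ 2); last by ring.
      rewrite ler_sqr ?nnegrE// ?sqr_ge0//.
      have h1 : 0 <= C ^+ 2 * Dt ^+ 2 by rewrite -exprMn sqr_ge0.
      have h2 : 0 <= C ^+ 2 * x ^+ 2 by rewrite -exprMn sqr_ge0.
      lra.
    have := sqr_ge0 (C ^+ 2 * Dt ^+ 2 - C ^+ 2 * x ^+ 2); nra.
  have td : `|t ^+ 2 - (b * x) ^+ 2| <=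
      C ^+ 2 * Dt ^+ 2 + C ^+ 2 * Dt * (e + x ^+ 2 / e).
    have -> : t ^+ 2 - (b * x) ^+ 2 = a ^+ 2 + 2 * a * b * x.
      by rewrite /t -/a -/b -/x; ring.
    apply: (le_trans (ler_normD _ _)); apply: lerD.
      by rewrite ger0_norm// sqr_ge0.
    (* The cross term [2 a b x] is only of order [Dt |x|]; splitting [2 |x|] into [e + x^2 / e]
       trades it for terms of known expectation. *)
    have xe : 2 * `|x| <= e + x ^+ 2 / e.
      rewrite -(ler_pM2r e0) [leRHS]mulrDl divfK ?gt_eqF//.
      rewrite -[x ^+ 2]real_normK ?num_real//.
      have := sqr_ge0 (e - `|x|); nra.
    rewrite !normrM (ger0_norm (ler0n _ 2)).
    have -> : C ^+ 2 * Dt * (e + x ^+ 2 / e) = (C * Dt) * C * (e + x ^+ 2 / e).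
      by ring.
    have -> : 2 * `|a| * `|b| * `|x| = `|a| * `|b| * (2 * `|x|) by ring.
    by rewrite ler_pM// ?mulr_ge0// ler_pM.
  apply: (@le_trans _ _ ((e * t ^+ 2 + K * t ^+ 4) +
      2^-1 * B * (C ^+ 2 * Dt ^+ 2 + C ^+ 2 * Dt * (e + x ^+ 2 / e)))).
    apply: lerD.
      apply: (le_trans (tay D t)); rewrite le_eqVlt; apply/orP; left; apply/eqP.
      by ring.
    rewrite !normrM (ger0_norm (_ : 0 <= 2^-1)) ?invr_ge0//.
    by rewrite ler_pM// ?mulr_ge0// ?invr_ge0// ler_wpM2l// invr_ge0.
  have -> : bd w = (e * (2 * C ^+ 2 * Dt ^+ 2 + 2 * C ^+ 2 * x ^+ 2) +
      K * (8 * C ^+ 4 * Dt ^+ 4 + 8 * C ^+ 4 * x ^+ 4)) +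
      2^-1 * B * (C ^+ 2 * Dt ^+ 2 + C ^+ 2 * Dt * (e + x ^+ 2 / e)).
    by rewrite /bd /cst /c0 /c2 /c4 /x2 /x4 -/x; ring.
  by rewrite lerD2r lerD// ler_wpM2l// ltW.
have mm i (g : Om -> R) : (i <= N)%N -> meas_wrt (F i) g -> meas_wrt measurable g.
  by move=> _; exact: sub_meas_wrt.
have [mv _ _ _] := nv jN.
have sm := @sa_measurable _ Om.
have mD : meas_wrt measurable (dproc j) by apply: mm (meas_dproc _); exact: ltnW.
have mD1 : meas_wrt measurable (dproc j.+1) by apply: mm (meas_dproc _).
have mv' : meas_wrt measurable (v j) by apply: (mm j.+1).
have ma' : meas_wrt measurable (al j) by apply: (mm j); [exact: ltnW|exact: mal].
have mb' : meas_wrt measurable (be j) by apply: (mm j); [exact: ltnW|exact: mbe].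
have mr : meas_wrt measurable (ito_rem j).
  apply: measB => //; first apply: measB => //; first apply: measB => //.
  - exact: meas_compc.
  - exact: meas_compc.
  - by apply: measM => //; [exact: meas_compc|apply: measD => //; exact: measM].
  - apply: measM => //; last by apply: measX => //; exact: measM.
    by apply: measZ => //; exact: meas_compc.
have Ibd24 : L1 (fun w => c2 * x2 w + c4 * x4 w) by apply: L1D; exact: L1Z.
have Ibd : L1 bd by apply: L1D => //; exact: L1_cst.
have Ir : L1 (ito_rem j) by exact: L1_le Ibd _.
split => //; apply: (le_trans (le_Ex (L1_norm Ir) Ibd le_bd)).
rewrite /bd (ExD (L1_cst P c0) Ibd24) (ExD (L1Z c2 I2) (L1Z c4 I4)).
rewrite Ex_cst (ExZ c2 I2) (ExZ c4 I4) E2 E4 /c0 /c2 /c4.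
have D0' := ltW Dt0.
have ei : 0 <= e^-1 by rewrite invr_ge0 ltW.
have -> : e * (2 * C ^+ 2 * Dt ^+ 2) + K * (8 * C ^+ 4 * Dt ^+ 4) +
  2^-1 * B * (C ^+ 2 * Dt ^+ 2 + C ^+ 2 * Dt * e) +
  ((e * (2 * C ^+ 2) + 2^-1 * B * (C ^+ 2 * Dt / e)) * Dt +
   K * (8 * C ^+ 4) * (3 * Dt ^+ 2)) =
  Dt * (C ^+ 2 * (e * (2 * Dt + 2)) + C ^+ 4 * (Dt * K * (8 * Dt ^+ 2 + 24)) +
    B * C ^+ 2 * (2^-1 * (Dt + e + Dt / e))) by ring.
rewrite ler_wpM2l//.
set S := e + Dt * (1 + K + e^-1).
have C2 : 0 <= C ^+ 2 by exact: sqr_ge0.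
have C4 : 0 <= C ^+ 4 by exact: exprn_ge0.
have DK : 0 <= Dt * K by exact: mulr_ge0.
have De : 0 <= Dt * e^-1 by exact: mulr_ge0.
have e0' := ltW e0.
have S1 : e * (2 * Dt + 2) <= 4 * S by rewrite /S; nra.
have S2 : Dt * K * (8 * Dt ^+ 2 + 24) <= 32 * S.
  have : Dt ^+ 2 <= 1 by rewrite -[leRHS](expr1n _ 2) ler_sqr ?nnegrE.
  rewrite /S; nra.
have S3 : 2^-1 * (Dt + e + Dt / e) <= S.
  rewrite /S; lra.
have BC : 0 <= B * C ^+ 2 by exact: mulr_ge0.
have -> : (4 * C ^+ 2 + 32 * C ^+ 4 + B * C ^+ 2) * S =
  C ^+ 2 * (4 * S) + C ^+ 4 * (32 * S) + B * C ^+ 2 * S by ring.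
by rewrite !lerD// ler_wpM2l.
Qed.

(** A telescoping identity along one path, in which [v^2] is split into [Dt] and the centred
    increment [v^2 - Dt]. The two sums [dsum] are martingales, the first sum is a discrete time
    integral. *)
Lemma ito_sum n w : f (dproc n w) = f D0 + \sum_(i < n)
  (f1 (dproc i w) * al i w + 2^-1 * f2 (dproc i w) * be i w ^+ 2 * Dt)
  + dsum (fun i w => f1 (dproc i w) * be i w) v n w
  + dsum (fun i w => 2^-1 * f2 (dproc i w) * be i w ^+ 2)
      (fun j w => v j w ^+ 2 - Dt) n w
  + \sum_(i < n) ito_rem i w.
Proof.
elim: n => [|n ih].
  by rewrite /dproc /dsum !big_ord0 !addr0.
have -> : f (dproc n.+1 w) = f (dproc n w) + (f (dproc n.+1 w) - f (dproc n w)).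
  by rewrite subrKC.
have -> : f (dproc n.+1 w) - f (dproc n w) =
    f1 (dproc n w) * (al n w + be n w * v n w)
    + 2^-1 * f2 (dproc n w) * (be n w * v n w) ^+ 2 + ito_rem n w.
  by rewrite /ito_rem; ring.
by rewrite ih /dsum !big_ord_recr/=; ring.
Qed.

(** Both martingale sums of [ito_sum] have expectation zero, their integrands being bounded and
    adapted. *)
Lemma ito_expectation n : (n <= N)%N ->
  (forall i, (i < n)%N -> L1 (ito_rem i)) ->
  L1 (fun w => f (dproc n w)) /\
  E (fun w => f (dproc n w)) = f D0 + \sum_(i < n)
    E (fun w => f1 (dproc i w) * al i w
                + 2^-1 * f2 (dproc i w) * be i w ^+ 2 * Dt)
  + \sum_(i < n) E (ito_rem i).
Proof.
elim: n => [|n ih] nN Ir.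
  have -> : (fun w => f (dproc 0 w)) = cst (f D0).
    by apply/funext => w; rewrite /dproc big_ord0 addr0.
  by rewrite !big_ord0 !addr0; split; [exact: L1_cst|exact: Ex_cst].
have [In En] := ih (ltnW nN) (fun i ni => Ir i (ltnW ni)).
have C0 := C_ge0 nN; have B0 := B_ge0.
have [mv Iv Iv2 vE] := nv nN; have [mv' Iv' Iv2' vE'] := nv2 nN.
have sn := sF n; have mD := meas_dproc (ltnW nN).
have ma := mal nN; have mb := mbe nN.
have mm (g : Om -> R) : meas_wrt (F n) g -> meas_wrt measurable g.
  exact: sub_meas_wrt.
pose g1 w := f1 (dproc n w) * be n w.
pose g2 w := 2^-1 * f2 (dproc n w) * be n w ^+ 2.
have mg1 : meas_wrt (F n) g1 by apply: measM => //; exact: meas_compc.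
have mg2 : meas_wrt (F n) g2.
  by apply: measM => //; [apply: measZ => //; exact: meas_compc|exact: measX].
have g1C w : `|g1 w| <= B * C by rewrite normrM ler_pM// beC.
have g2C w : `|g2 w| <= B * C ^+ 2.
  rewrite normrM normrM ler_pM// ?mulr_ge0//.
    rewrite ger0_norm ?invr_ge0// -[leRHS]mul1r ler_pM// ?invr_ge0//.
    by rewrite invf_le1// ler1n.
  by rewrite normrX ler_sqr ?nnegrE// beC.
have [Eg1 _] := vE g1 _ mg1 g1C; have [Eg2 _] := vE' g2 _ mg2 g2C.
have Ig1 : L1 (fun w => g1 w * v n w) by apply: (L1M (C := B * C)) => //; exact: mm.
have Ig2 : L1 (fun w => g2 w * (v n w ^+ 2 - Dt)).
  by apply: (L1M (C := B * C ^+ 2)) => //; exact: mm.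
have Idr : L1 (fun w => f1 (dproc n w) * al n w + g2 w * Dt).
  apply: (@L1_bnd _ _ _ _ _ (B * (C * Dt) + B * C ^+ 2 * Dt)).
    apply: mm; apply: measD => //; first by apply: measM => //; exact: meas_compc.
    by apply: measM => //; exact: meas_cst.
  move=> w; rewrite (le_trans (ler_normD _ _))// lerD//.
    by rewrite normrM ler_pM// alC.
  by rewrite normrM ler_pM// ger0_norm// ltW.
have fE w : f (dproc n.+1 w) = f (dproc n w) +
   ((f1 (dproc n w) * al n w + g2 w * Dt) +
    (g1 w * v n w + (g2 w * (v n w ^+ 2 - Dt) + ito_rem n w))).
  by rewrite /ito_rem /g1 /g2; ring.
have Irn : L1 (ito_rem n) by exact: Ir.
have I1 : L1 (fun w => g2 w * (v n w ^+ 2 - Dt) + ito_rem n w) by exact: L1D.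
have I2 : L1 (fun w => g1 w * v n w + (g2 w * (v n w ^+ 2 - Dt) + ito_rem n w)).
  exact: L1D.
have I3 : L1 (fun w => (f1 (dproc n w) * al n w + g2 w * Dt) +
    (g1 w * v n w + (g2 w * (v n w ^+ 2 - Dt) + ito_rem n w))) by exact: L1D.
rewrite (funext fE); split; first exact: L1D.
rewrite (ExD In I3) En (ExD Idr I2) (ExD Ig1 I1) (ExD Ig2 Irn) Eg1 Eg2.
by rewrite !big_ord_recr/= /g2; ring.
Qed.

End discrete_ito.

(** The majorant [A + c * sum x] is multiplied by at most [1 + c] at each step, and
    [1 + c <= exp c]. *)
Lemma discrete_gronwall {R : realType} (x : nat -> R) (A c : R) N :
  0 <= c -> 0 <= A ->
  (forall n, (n <= N)%N -> x n <= A + c * \sum_(i < n) x i) ->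
  forall n, (n <= N)%N -> x n <= A * expR (c * n%:R).
Proof.
move=> c0 A0 h.
have A1 n : (n <= N)%N -> A + c * \sum_(i < n) x i <= A * (1 + c) ^+ n.
  elim: n => [|n ih] nN; first by rewrite big_ord0 mulr0 addr0 expr0 mulr1.
  rewrite big_ord_recr/= mulrDr addrA.
  have := ih (ltnW nN); have := h n (ltnW nN).
  set S := A + _ => h1 h2.
  rewrite (@le_trans _ _ (S + c * S))// ?lerD2l ?ler_wpM2l//.
  rewrite exprSr mulrA (_ : S + c * S = S * (1 + c)); last by ring.
  by rewrite ler_wpM2r// addr_ge0.
move=> n nN.
rewrite (le_trans (h n nN))// (le_trans (A1 n nN))// ler_wpM2l//.
rewrite mulrC expRM_natl lerXn2r ?nnegrE ?addr_ge0 ?expR_ge0//.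
exact: expR_ge1Dx.
Qed.

(** The Taylor condition is the form in which uniform continuity and boundedness of the second
    derivative are used: an error [e t^2] for small [t], and for large [t] a term [K t^4], which the
    fourth moment of the noise controls. *)
Definition smooth2 {R : realType} (f f1 f2 : R -> R) (B : R) :=
  [/\ continuous f, continuous f1, continuous f2,
      forall x, `|f1 x| <= B & forall x, `|f2 x| <= B] /\
  forall e : R, 0 < e -> exists2 K : R, 0 <= K &
    forall x t, `|f (x + t) - f x - f1 x * t - 2^-1 * f2 x * t ^+ 2|
     <= (e + K * t ^+ 2) * t ^+ 2.

(* Smooth approximations of the absolute value whose second order term in the Ito
   formula for the difference of two solutions is small. *)
Definition yamada_watanabe {R : realType} (s0 : R -> R) :=
  forall r h : R, 0 < r -> 0 < h -> exists f f1 f2 B,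
  [/\ smooth2 f f1 f2 B, f 0 = 0 /\ forall x, `|x| - h <= f x,
      forall x, `|f1 x| <= 1,
      forall x y, `|x| <= r -> `|y| <= r -> f2 (x - y) * (s0 x - s0 y) ^+ 2 <= h &
      forall e : R, 0 < e -> exists2 dl : R, 0 < dl &
        forall x y, `|x - y| <= dl -> `|f2 x - f2 y| <= e].

(** * Stability of approximate solutions on a grid *)

Section stability.
Context {R : realType} {d : measure_display} {Om : measurableType d}.
Variables (P : probability Om R).

Definition grid_error (y0 : R) (s0 : R -> R) (v b U : nat -> Om -> R) j w :=
  U j w - y0 - \sum_(i < j) (b i w + s0 (U i w) * v i w).

Definition grid_basis (T : R) (N : nat) (F : nat -> set (set Om))
    (v : nat -> Om -> R) :=
  [/\ (0 < N)%N, forall j, sigma_algebra setT (F j), forall j, F j `<=` F j.+1,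
      forall j, F j `<=` measurable &
      noise P N F v (T / N%:R) /\
      noise P N F (fun j w => v j w ^+ 2 - T / N%:R) (2 * (T / N%:R) ^+ 2)].

(** The drifts [bU] and [bV] are arbitrary adapted variables, compared only through a Lipschitz
    bound with memory, so that the same statement serves for two solutions and for two Euler
    schemes. The thresholds [dl] and [Dt0] are common to all grids. *)
Definition stability_at (T K y0 : R) (s0 : R -> R) (r eta : R) (dl Dt0 : R) :=
  forall N F v (U V bU bV : nat -> Om -> R), grid_basis T N F v ->
  T / N%:R <= Dt0 ->
  (forall j, (j <= N)%N -> meas_wrt (F j) (U j)) ->
  (forall j, (j <= N)%N -> meas_wrt (F j) (V j)) ->
  (forall j, (j < N)%N -> meas_wrt (F j) (bU j)) ->
  (forall j, (j < N)%N -> meas_wrt (F j) (bV j)) ->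
  (forall j w, (j < N)%N -> `|bU j w - bV j w| <= K * (T / N%:R) *
     (`|U j w - V j w| + T / N%:R * \sum_(i < j) `|U i w - V i w|)) ->
  pbnd P [set w | (exists2 j, (j <= N)%N & eta < `|U j w - V j w|) /\
    forall j, (j <= N)%N -> [/\ `|U j w| <= r, `|V j w| <= r,
      `|grid_error y0 s0 v bU U j w| <= dl &
      `|grid_error y0 s0 v bV V j w| <= dl]] eta.

(** The difference is replaced by a process [D] that follows the scheme exactly, with coefficients
    switched off from the first bad index on; before that index it stays within [2 dl] of [U - V].
    Then [E |D| <= h + E f(D)], the second order term of [f] costs at most a multiple of [h], and
    the Gronwall recursion bounds [E |D N|]. As [D] keeps its value after the first exceedance,
    Markov's inequality at the final index is enough. *)
Lemma stability (T K y0 : R) (s0 : R -> R) (r eta : R) : 0 < T -> 0 < K ->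
  continuous s0 -> yamada_watanabe s0 -> 0 < r -> 0 < eta ->
  exists2 dl, 0 < dl & exists2 Dt0, 0 < Dt0 &
    stability_at T K y0 s0 r eta dl Dt0.
Proof.
move=> T0 K0 cs0 yw r0 eta0.
have [S S0 s0S] : exists2 S : R, 0 < S & forall x, `|x| <= r -> `|s0 x| <= S.
  have [M [_ hM]] := @compact_bounded _ _ _
    (continuous_compact (continuous_subspaceT cs0) (@segment_compact R (- r) r)).
  exists (Num.max (M + 1) 1); first by rewrite lt_max ltr01 orbT.
  move=> x xr; rewrite le_max; apply/orP; left.
  apply: (hM (M + 1)); first by rewrite ltrDl.
  by exists x => //=; rewrite in_itv/= -ler_norml.
pose K' := K * (1 + T).
(* [h * G] will bound the expectation of [|D N|]. The choice of [h] makes it [eta ^+ 2 / 2], from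
   which Markov's inequality at level [eta / 2] returns [eta]. *)
pose G := (2 + T + 2 * K * T * (1 + T)) * expR (K' * T).
have G0 : 0 < G.
  rewrite mulr_gt0 ?expR_gt0// addr_gt0 ?addr_gt0// !mulr_gt0// addr_gt0//.
pose h := eta ^+ 2 / 2 / G.
have h0 : 0 < h by rewrite !divr_gt0 ?exprn_gt0.
have [f [f1 [f2 [B [sm2 [f00 fh] f11 f2h f2u]]]]] := yw r h r0 h0.
case: sm2 => -[cf cf1 cf2 f1B f2B] tay.
have B0 : 0 <= B := le_trans (normr_ge0 _) (f1B 0).
have [h0' T0' K0' S0'] : [/\ 0 <= h, 0 <= T, 0 <= K & 0 <= S] by split; exact: ltW.
(* Bounds the truncated diffusion difference by [2 S], and the truncated drift difference by
   [2 K r (1 + T)] per unit of time. *)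
pose C := Num.max (2 * S) (2 * K * r * (1 + T)).
have C0 : 0 <= C by rewrite le_max mulr_ge0// ltW.
pose C' := 4 * C ^+ 2 + 32 * C ^+ 4 + B * C ^+ 2.
have C'0 : 0 <= C'.
  by rewrite !addr_ge0// mulr_ge0// exprn_ge0.
(* Makes the sum of the Taylor remainders at most [h]. *)
pose e := h / (2 * T * (C' + 1)).
have C'1 : 0 < C' + 1 by rewrite ltr_wpDl.
have e0 : 0 < e by rewrite divr_gt0// !mulr_gt0.
have [Kt Kt0 tayK] := tay e e0.
have [d1 d10 hd1] := f2u (h / (2 * S) ^+ 2) (divr_gt0 h0 (exprn_gt0 _ (mulr_gt0 (ltr0Sn _ 1) S0))).
(* [d1 / 2] allows [f2] to be evaluated at [D] instead of [U - V], [h] absorbs the error in the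
   Lipschitz bound of the drift, and [eta / 4] makes an exceedance of [eta] by [U - V] visible as an
   exceedance of [eta / 2] by [D]. *)
pose dl := Num.min (d1 / 2) (Num.min h (eta / 4)).
have dl0 : 0 < dl by rewrite !lt_min h0 !divr_gt0.
exists dl => //.
pose Q := 1 + Kt + e^-1.
have Q0 : 0 < Q by rewrite ltr_wpDl ?invr_gt0// addr_ge0.
exists (Num.min 1 (e / Q)); first by rewrite lt_min ltr01 divr_gt0.
move=> N F v U V bU bV [N0 sF FS Fm [nv nv2]].
set Dt := T / N%:R; rewrite le_min => /andP[Dt1 DtQ].
have N0' : 0 < N%:R :> R by rewrite ltr0n.
have Dt0 : 0 < Dt by rewrite divr_gt0.
have Dt0' := ltW Dt0.
have NDt : N%:R * Dt = T by rewrite /Dt mulrC divfK// gt_eqF.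
move=> mU mV mbU mbV bUV.
have nDt n : (n <= N)%N -> n%:R * Dt <= T.
  by move=> nN; rewrite -NDt ler_pM2r// ler_nat.
have DtS n (z : R) : 0 <= z -> (n <= N)%N -> Dt * \sum_(i < n) z <= T * z.
  move=> z0 nN; rewrite big_const_ord iter_addr_0 -mulr_natl mulrA (mulrC Dt).
  by rewrite ler_wpM2r// nDt.
set eU := grid_error y0 s0 v bU U; set eV := grid_error y0 s0 v bV V.
(* The bound on [U - V] belongs to [J] so that [D] stops moving at the first exceedance. *)
pose J j := [set w | forall i, (i <= j)%N -> [/\ `|U i w| <= r, `|V i w| <= r,
  `|eU i w| <= dl, `|eV i w| <= dl & `|U i w - V i w| <= eta]].
have JS i j : (i <= j)%N -> J j `<=` J i.
  by move=> ij w Jw l li; apply: Jw; exact: leq_trans ij.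
have mono i j (g : Om -> R) : (i <= j)%N -> meas_wrt (F i) g -> meas_wrt (F j) g.
  by move=> ij; exact: sub_meas_wrt (filtration_le FS ij).
have me b W j : (j <= N)%N -> (forall j, (j <= N)%N -> meas_wrt (F j) (W j)) ->
    (forall j, (j < N)%N -> meas_wrt (F j) (b j)) ->
    meas_wrt (F j) (grid_error y0 s0 v b W j).
  move=> jN mW mb; apply: measB => //.
    by apply: measB => //; [exact: mW|exact: meas_cst].
  apply: (@meas_sum_ord _ _ _ (sF j) j (fun i w => b i w + s0 (W i w) * v i w)).
  move=> i ij; have iN := leq_trans ij jN; have [mv _ _ _] := nv _ iN.
  apply: (mono i.+1) => //; apply: measD => //; first exact/(mono i)/mb.
  apply: measM => //; apply: meas_compc => //.
  by apply/(mono i)/mW => //; exact: ltnW.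
have FJ j : (j <= N)%N -> F j (J j).
  move=> jN; have sj := sF j.
  rewrite [X in F j X](_ : _ = \bigcap_(i in [set i | (i <= j)%N])
    ([set w | `|U i w| <= r] `&` [set w | `|V i w| <= r] `&`
     [set w | `|eU i w| <= dl] `&` [set w | `|eV i w| <= dl] `&`
     [set w | `|U i w - V i w| <= eta])); last first.
    apply/seteqP; split=> w /= h1 i ij; have := h1 i ij.
      by move=> [].
    by move=> [[[[]]]].
  apply: sa_bigcap_count => // i /= ij; have iN := leq_trans ij jN.
  have lec (g : Om -> R) (z : R) : meas_wrt (F i) g -> F j [set w | `|g w| <= z].
    by move=> mg; apply: sa_lec => //; apply: meas_norm; exact: mono mg.
  repeat apply: sa_setI => //; apply: lec.
  - exact: mU.
  - exact: mV.
  - exact: me.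
  - exact: me.
  - by apply: measB => //; [exact: mU|exact: mV].
pose be j w : R := \1_(J j) w * (s0 (U j w) - s0 (V j w)).
pose al j w : R := \1_(J j) w * (bU j w - bV j w).
have indT j w : J j w -> \1_(J j) w = 1 :> R by move=> Jw; rewrite indicE mem_set.
have indF j w : ~ J j w -> \1_(J j) w = 0 :> R.
  by move=> Jw; rewrite indicE memNset.
have mal j : (j < N)%N -> meas_wrt (F j) (al j).
  move=> jN; apply: measM => //; first exact/meas_ind/FJ/ltnW.
  by apply: measB => //; [exact: mbU|exact: mbV].
have mbe j : (j < N)%N -> meas_wrt (F j) (be j).
  move=> jN; apply: measM => //; first exact/meas_ind/FJ/ltnW.
  by apply: measB => //; apply: meas_compc => //; [exact/mU/ltnW|exact/mV/ltnW].
have UVr j w : J j w -> forall i, (i <= j)%N -> `|U i w - V i w| <= 2 * r.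
  move=> Jw i ij; have [Ur Vr _ _ _] := Jw i ij.
  by rewrite mulr_natl mulr2n (le_trans (ler_normB _ _))// lerD.
have beS j w : `|be j w| <= 2 * S.
  have [Jw|nJw] := pselect (J j w); last first.
    by rewrite /be indF// mul0r normr0 mulr_ge0// ltW.
  have [Ur Vr _ _ _] := Jw j (leqnn j).
  rewrite /be indT// mul1r mulr_natl mulr2n (le_trans (ler_normB _ _))// lerD//.
    exact: s0S.
  exact: s0S.
have beC j w : (j < N)%N -> `|be j w| <= C by rewrite /C le_max beS.
have alC j w : (j < N)%N -> `|al j w| <= C * Dt.
  move=> jN; have [Jw|nJw] := pselect (J j w); last first.
    by rewrite /al indF// mul0r normr0 mulr_ge0// ltW.
  rewrite /al indT// mul1r (le_trans (bUV j w jN))// -/Dt.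
  rewrite (@le_trans _ _ (2 * K * r * (1 + T) * Dt))//; last first.
    by rewrite ler_pM2r// /C le_max lexx orbT.
  rewrite (_ : 2 * K * r * (1 + T) * Dt = K * Dt * (2 * r + T * (2 * r))).
    have KDt : 0 <= K * Dt by rewrite mulr_ge0// ltW.
    apply: ler_wpM2l => //; apply: lerD; first exact: UVr Jw _ _.
    apply: le_trans (DtS j (2 * r) _ (ltnW jN)); last by rewrite mulr_ge0// ltW.
    apply: ler_wpM2l; first exact: ltW.
    by apply: ler_sum => i _; apply: UVr Jw _ _; exact: ltnW.
  by ring.
pose D := dproc v 0 al be.
have DE j w : (forall i, (i < j)%N -> J i w) ->
    D j w = U j w - V j w - (eU j w - eV j w).
  move=> Ji; rewrite /D /dproc add0r /eU /eV /grid_error.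
  rewrite (eq_bigr (fun i : 'I_j => (bU i w + s0 (U i w) * v i w) -
      (bV i w + s0 (V i w) * v i w))).
    by rewrite sumrB; ring.
  by move=> i _; rewrite /al /be (indT _ _ (Ji _ (ltn_ord i))); ring.
have DJ j w : J j w -> `|D j w - (U j w - V j w)| <= 2 * dl.
  move=> Jw; rewrite DE; last by move=> i ij; apply: JS Jw; exact: ltnW.
  have [_ _ h1 h2 _] := Jw j (leqnn j).
  rewrite addrAC subrr add0r normrN mulr_natl mulr2n.
  by rewrite (le_trans (ler_normB _ _))// lerD.
have rem j : (j < N)%N -> L1 P (ito_rem v 0 al be f f1 f2 j) /\
    Ex P (fun w => `|ito_rem v 0 al be f f1 f2 j w|) <= Dt * (h / T).
  move=> jN.
  have [I1 I2] := ito_rem_bound sF FS Fm Dt0 nv nv2 0 mal mbe alC beC cf1 cf2 cf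
    f1B f2B jN e0 Kt0 Dt1 tayK.
  split => //; apply: (le_trans I2); rewrite ler_pM2l// -/C' -/Q.
  apply: (@le_trans _ _ (C' * (2 * e))).
    rewrite ler_wpM2l// mulr_natl mulr2n lerD2l.
    by move: DtQ; rewrite ler_pdivlMr.
  rewrite /e ler_pdivlMr// (_ : _ * _ * T = h * (C' / (C' + 1))).
    by rewrite ler_piMr ?(ltW h0)// ler_pdivrMr// mul1r lerDl.
  by field; rewrite !gt_eqF.
have sm := @sa_measurable _ Om.
have mD j : (j <= N)%N -> meas_wrt measurable (D j).
  move=> jN; apply: (sub_meas_wrt (@Fm j)).
  exact: (meas_dproc sF FS nv 0 mal mbe jN).
have ID j : (j <= N)%N -> L1 P (D j).
  elim: j => [|j ih] jN.
    rewrite (_ : D 0 = cst 0); first exact: L1_cst.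
    by apply/funext => w; rewrite /D /dproc big_ord0 addr0.
  have [_ Iv _ _] := nv j jN.
  have DS w : D j.+1 w = D j w + (al j w + be j w * v j w).
    by rewrite /D /dproc big_ord_recr/= addrA.
  rewrite (funext DS : D j.+1 = _); apply: L1D; first exact/ih/ltnW.
  apply: L1D.
    apply: (@L1_bnd _ _ _ _ _ (C * Dt)) => [|w]; last exact: alC.
    exact: (sub_meas_wrt (@Fm j) (mal _ jN)).
  apply: (L1M (C := C)) => // [|w]; last exact: beC.
  exact: (sub_meas_wrt (@Fm j) (mbe _ jN)).
pose x j := Ex P (fun w => `|D j w|).
have step i : (i < N)%N ->
    Ex P (fun w => f1 (D i w) * al i w + 2^-1 * f2 (D i w) * be i w ^+ 2 * Dt)
    <= K * Dt * (x i + Dt * \sum_(l < i) x l + 2 * h * (1 + T)) + Dt * h.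
  move=> iN; have iN' := ltnW iN.
  have In l : (l <= i)%N -> L1 P (fun w => `|D l w|).
    by move=> li; apply/L1_norm/ID; rewrite (leq_trans li).
  have Is : L1 P (fun w => Dt * \sum_(l < i) `|D l w|).
    by apply: L1Z; apply: L1_sum => l; apply: In; exact: ltnW.
  pose z0 := 2 * h * (1 + T).
  have Ic := L1_cst P z0.
  have Isum : L1 P (fun w => `|D i w| + Dt * (\sum_(l < i) `|D l w|) + cst z0 w).
    by apply: L1D => //; apply: L1D => //; exact: In.
  pose bd w := K * Dt * (`|D i w| + Dt * (\sum_(l < i) `|D l w|) + cst z0 w)
    + cst (Dt * h) w.
  have Ibd : L1 P bd by apply: L1D; [exact: L1Z|exact: L1_cst].
  have -> : K * Dt * (x i + Dt * \sum_(l < i) x l + 2 * h * (1 + T)) + Dt * h =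
      Ex P bd.
    rewrite /bd ExD; [|exact: L1Z|exact: L1_cst].
    rewrite ExZ// (ExD _ Ic); last by apply: L1D => //; exact: In.
    rewrite (ExD (In i (leqnn i)) Is) !Ex_cst ExZ; last first.
      by apply: L1_sum => l; apply: In; exact: ltnW.
    by rewrite Ex_sum// => l; apply: In; exact: ltnW.
  have mDi : meas_wrt measurable (D i) by exact: mD.
  have mali := sub_meas_wrt (@Fm i) (mal _ iN).
  have mbei := sub_meas_wrt (@Fm i) (mbe _ iN).
  apply: le_Ex => //.
    apply: (@L1_bnd _ _ _ _ _ (C * Dt + 2^-1 * B * C ^+ 2 * Dt)).
      apply: measD => //; first by apply: measM => //; exact: meas_compc.
      apply: measM => //; last exact: meas_cst.
      apply: measM => //; last exact: measX.
      by apply: measZ => //; exact: meas_compc.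
    move=> w; rewrite (le_trans (ler_normD _ _))// lerD//.
      by rewrite normrM -[leRHS]mul1r ler_pM// alC.
    rewrite normrM (gtr0_norm Dt0) ler_pM2r// normrM normrX ler_pM// ?exprn_ge0//.
      by rewrite normrM ger0_norm ?invr_ge0// ler_pM2l ?invr_gt0.
    by rewrite lerXn2r ?nnegrE// beC.
  move=> w; rewrite /bd /cst /=.
  have ssum : 0 <= \sum_(l < i) `|D l w| by exact: sumr_ge0.
  have KDt : 0 <= K * Dt by rewrite mulr_ge0// ltW.
  have z00 : 0 <= z0.
    by rewrite /z0; nonneg.
  have [Jw|nJw] := pselect (J i w); last first.
    rewrite /al /be indF// !mul0r expr0n/= !mulr0 !mul0r addr0.
    by nonneg.
  apply: lerD.
    apply: (@le_trans _ _ `|al i w|).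
      by rewrite (le_trans (ler_norm _))// normrM -[leRHS]mul1r ler_wpM2r.
    rewrite /al indT// mul1r (le_trans (bUV i w iN))// -/Dt ler_wpM2l//.
    have UD l : (l <= i)%N -> `|U l w - V l w| <= `|D l w| + 2 * h.
      move=> li; have Jl := JS _ _ li _ Jw.
      rewrite -[U l w - V l w](subKr (D l w)) (le_trans (ler_normB _ _))//.
      rewrite lerD2l (le_trans (DJ l w Jl))// ler_pM2l//.
      by rewrite /dl ge_min ge_min lexx orbT.
    apply: (@le_trans _ _ ((`|D i w| + 2 * h) +
        Dt * \sum_(l < i) (`|D l w| + 2 * h))).
      rewrite lerD ?UD// ler_pM2l// ler_sum// => l _; apply: UD; exact: ltnW.
    rewrite big_split/= mulrDr.
    have := DtS i (2 * h) (ltW (mulr_gt0 (ltr0Sn _ 1) h0)) iN'.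
    by rewrite /z0; lra.
  rewrite mulrC ler_pM2l//.
  have [Ur Vr _ _ _] := Jw i (leqnn i).
  have b2 : be i w ^+ 2 = (s0 (U i w) - s0 (V i w)) ^+ 2 by rewrite /be indT// mul1r.
  (* The smallness of the second order term is available at [U - V]; [q2] moves it to [D] by uniform
     continuity of [f2]. *)
  have q1 : f2 (U i w - V i w) * be i w ^+ 2 <= h by rewrite b2 f2h.
  have q2 : (f2 (D i w) - f2 (U i w - V i w)) * be i w ^+ 2 <= h.
    apply: (@le_trans _ _ (h / (2 * S) ^+ 2 * (2 * S) ^+ 2)); last first.
      by rewrite divfK// gt_eqF// exprn_gt0// mulr_gt0.
    apply: (le_trans (ler_norm _)); rewrite normrM normrX ler_pM ?exprn_ge0//.
      apply: hd1; rewrite (le_trans (DJ i w Jw))// mulrC -ler_pdivlMr//.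
      by rewrite /dl ge_min lexx.
    by rewrite lerXn2r ?nnegrE ?beS// mulr_ge0// ltW.
  by rewrite -mulrA; lra.
have xn n : (n <= N)%N -> x n <= h * (2 + T + 2 * K * T * (1 + T)) +
    K' * Dt * \sum_(i < n) x i.
  move=> nN.
  have [If Ef] := ito_expectation sF FS Fm Dt0 nv nv2 mal mbe alC beC cf1 cf2
    f1B f2B nN (fun i ni => (rem i (leq_trans ni nN)).1).
  have xf : x n <= h + Ex P (fun w => f (D n w)).
    have -> : h + Ex P (fun w => f (D n w)) = Ex P (fun w => cst h w + f (D n w)).
      by rewrite ExD ?Ex_cst//; exact: L1_cst.
    apply: le_Ex; first exact/L1_norm/ID.
      by apply: L1D => //; exact: L1_cst.
    by move=> w; have := fh (D n w); rewrite /cst; lra.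
  apply: (le_trans xf); rewrite Ef f00 add0r.
  have x0 i : 0 <= x i by apply: Ex_ge0 => w; exact: normr_ge0.
  have r1 : \sum_(i < n) Ex P (ito_rem v 0 al be f f1 f2 i) <= h.
    apply: (@le_trans _ _ (\sum_(i < n) Dt * (h / T))).
      apply: ler_sum => i _; have [Ir Er] := rem i (leq_trans (ltn_ord i) nN).
      by rewrite (le_trans (ler_norm _))// (le_trans (le_ExN Ir)).
    have hT : 0 <= h / T by rewrite divr_ge0// ltW.
    rewrite -mulr_sumr (le_trans (DtS n _ hT nN))// mulrC divfK// gt_eqF//.
  have r2 : \sum_(i < n) Ex P (fun w => f1 (D i w) * al i w +
      2^-1 * f2 (D i w) * be i w ^+ 2 * Dt) <=
      \sum_(i < n) (K * Dt * x i + (K * Dt * (T * x i) + Dt * (K * (2 * h * (1 + T)) + h))).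
    apply: (@le_trans _ _ (\sum_(i < n) (K * Dt * x i +
       (K * Dt * (Dt * \sum_(l < n) x l) + Dt * (K * (2 * h * (1 + T)) + h))))).
      apply: ler_sum => i _.
      apply: (le_trans (step i (leq_trans (ltn_ord i) nN))).
      have : K * Dt * (Dt * \sum_(l < i) x l) <= K * Dt * (Dt * \sum_(l < n) x l).
        have KDt : 0 <= K * Dt by rewrite mulr_ge0// ltW.
        by apply: ler_wpM2l => //; rewrite ler_pM2l// ler_sum_widen// ltnW.
      by lra.
    rewrite !big_split/= lerD2l lerD2r -!mulr_sumr.
    apply: ler_wpM2l; first by nonneg.
    by apply: DtS => //; exact: sumr_ge0.
  rewrite (@le_trans _ _ (h + (\sum_(i < n) (K * Dt * x i + (K * Dt * (T * x i) + Dt * (K * (2 * h * (1 + T)) + h))) + h)))//.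
    by rewrite lerD2l lerD.
  rewrite !big_split/= -!mulr_sumr.
  have zz : 0 <= K * (2 * h * (1 + T)) + h.
    by nonneg.
  have := DtS n _ zz nN; rewrite /K'; lra.
have A0 : 0 <= h * (2 + T + 2 * K * T * (1 + T)).
  by nonneg.
have K'Dt : 0 <= K' * Dt.
  by rewrite /K'; nonneg.
have xN : x N <= eta ^+ 2 / 2.
  apply: (le_trans (discrete_gronwall K'Dt A0 xn (leqnn N))).
  rewrite -(mulrA K') (mulrC Dt) NDt -mulrA -/G /h divfK// gt_eqF//.
apply: (@pbnd_le _ _ _ _ _ [set w | eta / 2 <= `|D N w|] (x N / (eta / 2))).
- move=> w [[j0 j0N hj0] good].
  have ex : exists j, (j <= N)%N && (eta < `|U j w - V j w|).
    by exists j0; rewrite j0N.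
  case: (ex_minnP ex) => j /andP[jN hj] jmin.
  have Ji i : (i < j)%N -> J i w.
    move=> ij l li; have lj := leq_ltn_trans li ij.
    have [? ? ? ?] := good l (ltnW (leq_trans lj jN)); split => //.
    rewrite leNgt; apply/negP => hl; have := jmin l.
    by rewrite hl (ltnW (leq_trans lj jN)) => /(_ isT); rewrite leqNgt lj.
  have nJ i : (j <= i)%N -> ~ J i w.
    by move=> ji /(_ j ji)[_ _ _ _]; rewrite leNgt hj.
  have Dc i : (j <= i)%N -> D i w = D j w.
    elim: i => [|i ih]; first by rewrite leqn0 => /eqP ->.
    rewrite leq_eqVlt => /predU1P[->//|]; rewrite ltnS => ji.
    rewrite -(ih ji) /D /dproc big_ord_recr/= /al /be indF; last exact: nJ.
    by rewrite !mul0r addr0 addr0.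
  rewrite /= Dc// DE//; have [_ _ h1 h2] := good j jN.
  have h3 : dl <= eta / 4 by rewrite /dl !ge_min lexx !orbT.
  have := ler_normB (U j w - V j w) (eU j w - eV j w).
  have := ler_normB (eU j w) (eV j w).
  have := lerB_dist (U j w - V j w) (eU j w - eV j w).
  by move: h1 h2 hj; rewrite -/eU -/eV; lra.
- by rewrite ler_pdivrMr ?divr_gt0//; move: xN; rewrite expr2; lra.
- apply: markov_L1; [by rewrite divr_gt0|exact/L1_norm/ID|by move=> w; exact: normr_ge0].
Qed.

End stability.

(** * Brownian increments on the completed space *)

Section gaussian.
Context {R : realType}.
Variable s : R.
Hypothesis s0 : 0 < s.
Notation mu := (@lebesgue_measure R).
Local Notation pdf := (normal_pdf 0 s).
Local Notation nu := (normal_prob 0 s).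

Let sn0 : s != 0. Proof. by rewrite gt_eqF. Qed.

(** The change of variables holds with the Radon-Nikodym derivative of the normal law, which
    coincides almost everywhere with the explicit density since both have the same integrals over
    measurable sets. *)
Lemma ge0_integral_normal (f : R -> R) : measurable_fun setT f ->
  (forall x, 0 <= f x) ->
  (\int[nu]_x (f x)%:E = \int[mu]_x (f x * pdf x)%:E)%E.
Proof.
move=> mf f0.
have dom := @normal_prob_dominates R 0 s.
rewrite -(Radon_Nikodym_SigmaFinite.change_of_variables dom)//=; last first.
  exact/measurable_EFinP.
under [RHS]eq_integral do rewrite EFinM.
have mpdf : measurable_fun setT (EFin \o pdf).
  by apply/measurable_EFinP; exact: measurable_normal_pdf.
apply: ae_eq_integral => //.
- apply: emeasurable_funM; first exact/measurable_EFinP.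
  exact: (measurable_int mu (Radon_Nikodym_SigmaFinite.f_integrable dom)).
- by apply: emeasurable_funM => //; exact/measurable_EFinP.
- apply: ae_eqe_mul2l; apply: integral_ae_eq => //=.
  + exact: Radon_Nikodym_SigmaFinite.f_integrable.
  + by move=> E E01 mE; rewrite -Radon_Nikodym_SigmaFinite.f_integral.
Qed.

Lemma is_derive_pdf x : is_derive x (1 : R) pdf (- (x / s ^+ 2) * pdf x).
Proof.
rewrite normal_pdfE//.
have e y : normal_peak s * normal_fun 0 s y =
    normal_peak s * expR (- (y * y) / (s ^+ 2 *+ 2)).
  by rewrite /normal_fun subr0 expr2.
have -> : (fun y => normal_peak s * normal_fun 0 s y) =
  (fun y : R => normal_peak s * expR (- (y * y) / (s ^+ 2 *+ 2))).
  by apply/funext => y; exact: e.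
rewrite e.
apply: is_derive_eq.
rewrite /GRing.scale/= !mulr1 -mulr_natl; field.
by rewrite gt_eqF.
Qed.

(** From [exp q >= q^2 / 4], the square of [exp (q / 2) >= q / 2], with [q = y^2 / (2 s^2)]. The
    fourth power suffices against boundary terms of degree at most 3. *)
Lemma pdf_decay (n : nat) : pdf n.+1%:R <= normal_peak s * (16 * s ^+ 4) / n.+1%:R ^+ 4.
Proof.
rewrite normal_pdfE// /normal_fun subr0 -mulrA ler_wpM2l ?normal_peak_ge0//.
set y := n.+1%:R : R; have y0 : 0 < y by rewrite ltr0n.
pose q := y ^+ 2 / (s ^+ 2 *+ 2).
have q0 : 0 < q by rewrite divr_gt0 ?exprn_gt0// pmulrn_rgt0// exprn_gt0.
rewrite mulNr expRN -/q.
have h : q ^+ 2 / 4 <= expR q.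
  have -> : expR q = expR (q / 2) ^+ 2 by rewrite -expRM_natl; congr expR; field.
  rewrite (_ : q ^+ 2 / 4 = (q / 2) ^+ 2); last by field.
  have q2 : 0 <= q / 2 by rewrite divr_ge0// ltW.
  by rewrite lerXn2r ?nnegrE ?expR_ge0// (le_trans _ (expR_ge1Dx _))// lerDr.
rewrite -lef_pV2 ?posrE ?invr_gt0 ?expR_gt0//; last first.
  by rewrite divr_gt0 ?mulr_gt0 ?exprn_gt0.
rewrite invrK (le_trans _ h)// le_eqVlt; apply/orP; left; apply/eqP.
by rewrite /q -mulr_natl; field; rewrite !gt_eqF.
Qed.

Let I (n k : nat) := Rintegral mu `[- n.+1%:R, n.+1%:R] (fun x => x ^+ k * pdf x).

Let cpdf : continuous pdf. Proof. exact: continuous_normal_pdf. Qed.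

Let cxk (k : nat) : continuous (fun x : R => x ^+ k * pdf x).
Proof. by move=> x; apply: cvgM; [exact: exprn_continuous|exact: cpdf]. Qed.

Let int_xk k n : mu.-integrable `[- n.+1%:R, n.+1%:R] (EFin \o (fun x => x ^+ k * pdf x)).
Proof.
apply: continuous_compact_integrable; first exact: segment_compact.
by apply: continuous_subspaceT.
Qed.

Lemma pdf_even x : pdf (- x) = pdf x.
Proof. by rewrite !normal_pdfE// /normal_fun !subr0 sqrrN. Qed.

(** Integration by parts on a bounded interval, the derivative of the density being [- x / s^2]
    times the density. For [k = 0] the conventional value of [k.-1] is harmless because of the
    factor [k]. *)
Let moment_rec n k : I n k.+1 = s ^+ 2 * k%:R * I n k.-1
  - s ^+ 2 * (n.+1%:R ^+ k * pdf n.+1%:R - (- n.+1%:R) ^+ k * pdf n.+1%:R).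
Proof.
pose F x : R := - s ^+ 2 * (x ^+ k * pdf x).
pose f x : R := x ^+ k.+1 * pdf x - s ^+ 2 * k%:R * (x ^+ k.-1 * pdf x).
have dF x : is_derive x (1 : R) F (f x).
  have dp := is_derive_pdf x.
  have dk : is_derive x (1 : R) (fun y : R => y ^+ k) (k%:R * x ^+ k.-1).
    apply: DeriveDef; last by rewrite exp_derive /GRing.scale/= mulr1.
    exact: exprn_derivable.
  have dm := is_deriveZ (- s ^+ 2) (is_deriveM dk dp).
  apply: (is_derive_eq dm); rewrite /GRing.scale/= /f (exprS x).
  by field.
have ab : - n.+1%:R < n.+1%:R :> R by rewrite gtrN// ltr0n.
have cf : continuous f.
  move=> x; apply: cvgB; first exact: cxk.
  by apply: cvgM; [exact: cvg_cst|exact: cxk].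
have cF : continuous F.
  move=> x; apply: differentiable_continuous; apply/derivable1_diffP.
  by case: (dF x).
have dcF : derivable_oo_LRcontinuous F (- n.+1%:R) n.+1%:R.
  split; first by move=> x _; case: (dF x).
    by apply: cvg_at_right_filter; exact: cF.
  by apply: cvg_at_left_filter; exact: cF.
have e := continuous_FTC2 ab (continuous_subspaceT cf) dcF.
have {}e := e (fun x _ => etrans (derive1E F x) (@derive_val _ _ _ _ _ _ _ (dF x))).
have eR : Rintegral mu `[- n.+1%:R, n.+1%:R] f = F n.+1%:R - F (- n.+1%:R).
  by rewrite /Rintegral e.
move: eR; rewrite /f RintegralB//; last first.
  have := @integrableZl _ _ _ mu `[- n.+1%:R, n.+1%:R] (measurable_itv _)
    (s ^+ 2 * k%:R) _ (int_xk k.-1 n).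
  by [].
rewrite RintegralZl// -/(I n k.+1) -/(I n k.-1) /F pdf_even => h.
move: h; set a := n.+1%:R ^+ k; set b := (- n.+1%:R) ^+ k; lra.
Qed.

Let moment0 n : I n 1 = 0.
Proof. by rewrite moment_rec !expr0 mulr0 mul0r subrr mulr0 subr0. Qed.

Let cvg_itv (g : R -> R) : continuous g -> (forall x, 0 <= g x) ->
  (Rintegral mu `[- n.+1%:R, n.+1%:R] g)%:E @[n --> \oo] -->
  (\int[mu]_x (g x)%:E)%E.
Proof.
move=> cg g0.
have mg : measurable_fun setT (EFin \o g).
  by apply/measurable_EFinP; exact: continuous_measurable_fun.
have -> : (fun n : nat => (Rintegral mu `[- n.+1%:R, n.+1%:R] g)%:E) =
    (fun n => (\int[mu]_(x in [set` Interval (BLeft (- n.+1%:R)%R) (BRight (n.+1%:R)%R)]) (g x)%:E)%E).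
  apply/funext => n; rewrite /Rintegral fineK//.
  apply: integrable_fin_num => //; apply: continuous_compact_integrable.
    exact: segment_compact.
  exact: continuous_subspaceT.
have UT : \bigcup_n `[- n.+1%:R : R, n.+1%:R]%classic = [set: R].
  apply/seteqP; split=> // x _.
  have [n _ xn] : (\bigcup_n `[- n%:R : R, n%:R]%classic) x by rewrite bigcup_itvT.
  exists n => //; move: xn; rewrite /= !in_itv/= => /andP[h1 h2].
  have h : n%:R <= n.+1%:R :> R by rewrite ler_nat.
  by rewrite (le_trans _ h1) ?lerN2//= (le_trans h2).
rewrite -[X in (\int[mu]_(x in X) _)%E]UT.
apply: ge0_nondecreasing_set_cvg_integral.
- move=> n m nm; apply/subsetPset => x; rewrite /= !in_itv/= => /andP[h1 h2].
  have h : n.+1%:R <= m.+1%:R :> R by rewrite ler_nat.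
  by rewrite (le_trans _ h1) ?lerN2//= (le_trans h2).
- by move=> n; exact: measurable_itv.
- by move=> n; apply: measurable_funS mg.
- by move=> n x _; rewrite lee_fin.
Qed.

Lemma boundary_term (k : nat) : (k <= 3)%N ->
  (n.+1%:R ^+ k * pdf n.+1%:R - (- n.+1%:R) ^+ k * pdf n.+1%:R : R)
    @[n --> \oo] --> (0 : R).
Proof.
move=> k3; pose c : R := 2 * (normal_peak s * (16 * s ^+ 4)).
have c0 : 0 <= c.
  by have := normal_peak_ge0 s; rewrite /c => ?; nonneg.
have h0 : (c * n.+1%:R^-1 : R) @[n --> \oo] --> (0 : R).
  rewrite -(mulr0 c); apply: cvgMr; exact: cvg_harmonic.
apply/cvgr0Pnorm_le => e e0; near=> n.
apply: (@le_trans _ _ (c * n.+1%:R^-1)); last first.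
  rewrite (le_trans (ler_norm _))//; near: n.
  by move/cvgr0Pnorm_le : h0; exact.
set y := n.+1%:R : R; have y0 : 0 < y by rewrite ltr0n.
have y1 : 1 <= y by rewrite ler1n.
have p0 : 0 <= pdf y by exact: normal_pdf_ge0.
have pd := pdf_decay n.
rewrite (le_trans (ler_normB _ _))// !normrM !normrX normrN (gtr0_norm y0).
rewrite (ger0_norm p0) -mulr2n -mulr_natl /c -[leRHS]mulrA ler_pM2l//.
apply: (@le_trans _ _ (y ^+ 3 * pdf y)).
  by rewrite ler_wpM2r// ler_weXn2l.
rewrite (le_trans (ler_wpM2l _ pd)) ?exprn_ge0 ?(ltW y0)//.
rewrite le_eqVlt; apply/orP; left; apply/eqP; rewrite -/y; field.
by rewrite gt_eqF.
Unshelve. all: by end_near. Qed.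

(** The interval grows by monotone convergence, which asks for nonnegative integrands: [k] odd makes
    both exponents even. *)
Let even_moment k m : odd k -> (k <= 3)%N ->
  (\int[mu]_x (x ^+ k.-1 * pdf x)%:E = m%:E)%E ->
  (\int[mu]_x (x ^+ k.+1 * pdf x)%:E = (s ^+ 2 * k%:R * m)%:E)%E.
Proof.
move=> ko k3 hm.
have even_ge0 j x : ~~ odd j -> 0 <= x ^+ j * pdf x.
  by move=> jo; rewrite mulr_ge0 ?normal_pdf_ge0// exprn_even_ge0.
have km : ~~ odd k.-1 by case: k ko {k3 hm}.
have c1 := cvg_itv (@cxk k.-1) (fun x => even_ge0 _ x km).
have c2 := cvg_itv (@cxk k.+1) (fun x => even_ge0 k.+1 x _); rewrite /= ko in c2.
have {}c2 := c2 isT; rewrite hm in c1.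
have {}c1 : I n k.-1 @[n --> \oo] --> m by move/fine_cvg : c1.
have c3 : I n k.+1 @[n --> \oo] --> s ^+ 2 * k%:R * m.
  rewrite (_ : (fun n => I n k.+1) = (fun n => s ^+ 2 * k%:R * I n k.-1 -
    s ^+ 2 * (n.+1%:R ^+ k * pdf n.+1%:R - (- n.+1%:R) ^+ k * pdf n.+1%:R))).
    rewrite -[X in _ --> X]subr0 -[X in _ - X](mulr0 (s ^+ 2)).
    by apply: cvgB; apply: cvgMr => //; exact: boundary_term.
  by apply/funext => n; exact: moment_rec.
have c4 : (I n k.+1)%:E @[n --> \oo] --> (s ^+ 2 * k%:R * m)%:E.
  by apply: cvg_EFin => //; exact: nearW.
by have := cvg_unique _ c2 c4; apply.
Qed.

Lemma normal_moment2 : (\int[nu]_x (x ^+ 2)%:E = (s ^+ 2)%:E)%E.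
Proof.
rewrite ge0_integral_normal//; last by move=> x; exact: sqr_ge0.
rewrite (@even_moment 1 1)//= ?mulr1//.
by under eq_integral do rewrite expr0 mul1r; exact: integral_normal_pdf.
Qed.

Lemma normal_moment4 : (\int[nu]_x (x ^+ 4)%:E = (3 * s ^+ 4)%:E)%E.
Proof.
rewrite ge0_integral_normal//; last by move=> x; exact: exprn_even_ge0.
rewrite (@even_moment 3 (s ^+ 2))//=; first by congr EFin; ring.
by rewrite (@even_moment 1 1)//= ?mulr1//;
  under eq_integral do rewrite expr0 mul1r; exact: integral_normal_pdf.
Qed.

(** Vanishing of the mean, in the form of equal integrals of the positive and negative parts,
    because only nonnegative functions are transported to the law. On symmetric intervals it reduces
    to the vanishing of the odd moment. *)
Lemma normal_mean :
  (\int[nu]_x (Num.max x 0)%:E = \int[nu]_x (Num.max (- x) 0)%:E)%E.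
Proof.
have cid : continuous (id : R -> R) by move=> x; exact: cvg_id.
have cmax (e : R -> R) : continuous e -> continuous (fun x => Num.max (e x) 0).
  by move=> ce x; apply: continuous_max; [exact: ce|exact: cvg_cst].
have cN : continuous (-%R : R -> R) by move=> x; exact: oppr_continuous.
have cp (e : R -> R) : continuous e -> continuous (fun x => Num.max (e x) 0 * pdf x).
  by move=> ce x; apply: cvgM; [exact: cmax|exact: cpdf].
have ge0 (e : R -> R) x : 0 <= Num.max (e x) 0 * pdf x.
  by rewrite mulr_ge0 ?normal_pdf_ge0// le_max lexx orbT.
have ma (e : R -> R) x : 0 <= Num.max (e x) 0 by rewrite le_max lexx orbT.
have mm (e : R -> R) (ce : continuous e) := continuous_measurable_fun (cmax e ce).
rewrite (ge0_integral_normal (mm id cid) (ma id)).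
rewrite (ge0_integral_normal (mm _ cN) (ma -%R)).
have c1 := cvg_itv (cp id cid) (ge0 id).
have c2 := cvg_itv (cp _ cN) (ge0 -%R).
apply: (cvg_unique _ c1) => //.
suff -> : (fun n : nat => (\int[mu]_(x in `[- n.+1%:R, n.+1%:R])
    (Num.max (id x) 0 * pdf x))%:E) =
  (fun n : nat => (\int[mu]_(x in `[- n.+1%:R, n.+1%:R])
    (Num.max (- x) 0 * pdf x))%:E) by [].
apply/funext => n; congr EFin; apply/eqP; rewrite -subr_eq0.
have ic (g : R -> R) : continuous g ->
    mu.-integrable `[- n.+1%:R, n.+1%:R] (EFin \o g).
  move=> cg; apply: continuous_compact_integrable; first exact: segment_compact.
  exact: continuous_subspaceT.
rewrite -RintegralB//; [|exact: ic (cp _ cid)|exact: ic (cp _ cN)].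
rewrite -[X in _ == X](moment0 n) /I; apply/eqP; apply: eq_Rintegral => x _.
rewrite expr1 -mulrBl; congr (_ * _).
have [x0|x0] := leP 0 x.
  by rewrite max_r ?subr0// oppr_le0.
by rewrite max_l ?oppr_ge0 ?(ltW x0)// sub0r opprK.
Qed.

End gaussian.

Section gaussian_variable.
Context {R : realType} {d : measure_display} {Om : measurableType d}.
Variables (P : probability Om R).

Lemma gaussian_moments (w : Om -> R) (s : R) : 0 < s ->
  meas_wrt measurable w ->
  (forall B : set R, measurable B -> P (w @^-1` B) = normal_prob 0 s B) ->
  [/\ L1 P w, Ex P w = 0, L1 P (fun x => w x ^+ 2),
      Ex P (fun x => w x ^+ 2) = s ^+ 2 &
      L1 P (fun x => w x ^+ 4) /\ Ex P (fun x => w x ^+ 4) = 3 * s ^+ 4].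
Proof.
move=> s0 mw law; have mw' : measurable_fun setT w by exact/meas_mfun.
have tr (f : R -> R) : measurable_fun setT f -> (forall x, 0 <= f x) ->
    (\int[P]_x (f (w x))%:E = \int[normal_prob 0 s]_x (f x)%:E)%E.
  move=> mf f0.
  have q := @ge0_integral_pushforward _ _ _ (measurableTypeR R) R w mw' P setT (fun x => (f x)%:E)
    measurableT (measurableT_comp (@EFin_measurable _ _) mf) (fun y _ => f0 y).
  rewrite preimage_setT in q.
  rewrite -[LHS]q.
  apply: (eq_measure_integral (normal_prob 0 s)) => A mA _.
  by rewrite /= /pushforward law.
have mX n : measurable_fun setT (fun x : R => x ^+ n) by exact: measurable_funX.
have e2 : (\int[P]_x (w x ^+ 2)%:E = (s ^+ 2)%:E)%E.
  rewrite -normal_moment2// -(tr (fun x => x ^+ 2))// => x; exact: sqr_ge0.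
have e4 : (\int[P]_x (w x ^+ 4)%:E = (3 * s ^+ 4)%:E)%E.
  by rewrite -normal_moment4// -(tr (fun x => x ^+ 4))// => x; exact: exprn_even_ge0.
have I n : ~~ odd n -> (\int[P]_x (w x ^+ n)%:E < +oo)%E -> L1 P (fun x => w x ^+ n).
  move=> no h; apply/integrableP; split; first exact/measurable_EFinP/measurable_funX.
  under eq_integral do rewrite /= ger0_norm ?exprn_even_ge0//.
  exact: h.
have I2 : L1 P (fun x => w x ^+ 2) by apply: I => //; rewrite e2 ltry.
have I4 : L1 P (fun x => w x ^+ 4) by apply: I => //; rewrite e4 ltry.
have I1 : L1 P w.
  apply: (@L1_le _ _ _ _ _ (fun x => cst 1 x + w x ^+ 2)) => //.
    by apply: L1D => //; exact: L1_cst.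
  move=> x; rewrite /cst -[w x ^+ 2]real_normK ?num_real//.
  have := sqr_ge0 (`|w x| - 1); have := normr_ge0 (w x); nra.
split => //; last by split => //; rewrite /Ex /Rintegral e4.
  have mp : measurable_fun setT (fun x : R => Num.max x 0).
    apply: continuous_measurable_fun => x.
    by apply: continuous_max; [exact: cvg_id|exact: cvg_cst].
  have mn : measurable_fun setT (fun x : R => Num.max (- x) 0).
    apply: continuous_measurable_fun => x.
    by apply: continuous_max; [exact: oppr_continuous|exact: cvg_cst].
  have q : Ex P (fun x => Num.max (w x) 0) = Ex P (fun x => Num.max (- w x) 0).
    rewrite /Ex /Rintegral (tr (fun x => Num.max x 0))//.
      rewrite (tr (fun x => Num.max (- x) 0))// ?normal_mean// => x.
      by rewrite le_max lexx orbT.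
    by move=> x; rewrite le_max lexx orbT.
  have Ip : L1 P (fun x => Num.max (w x) 0).
    apply: (L1_le _ (L1_norm I1)) => [|x]; first exact: meas_comp mp mw.
    by have [h|h] := leP 0 (w x); rewrite ?normr0.
  have In : L1 P (fun x => Num.max (- w x) 0).
    apply: (L1_le _ (L1_norm I1)) => [|x]; first exact: (meas_comp mn mw).
    by have [h|h] := leP 0 (- w x); rewrite ?normr0 ?normrN.
  have -> : w = (fun x => Num.max (w x) 0 - Num.max (- w x) 0).
    apply/funext => x; have [h|h] := leP 0 (w x).
      by rewrite max_r ?subr0// oppr_le0.
    by rewrite max_l ?sub0r ?opprK// oppr_ge0 ltW.
  by rewrite (ExB Ip In) q subrr.
by rewrite /Ex /Rintegral e2.
Qed.

End gaussian_variable.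

(** * From events to test variables; independence of limits *)

Section extend_bounded.
Context {R : realType} {d : measure_display} {Om : measurableType d}.
Variables (P : probability Om R) (G : set (set Om)).
Hypothesis sG : sigma_algebra setT G.
Hypothesis Gm : G `<=` measurable.

(** The sum counts the positive integers up to [m] that do not exceed [y], hence it is the integer
    part of [y]. *)
Lemma floor_sum (y : R) m : 0 <= y <= m%:R ->
  `|y - \sum_(k < m) (k.+1%:R <= y)%R%:R| <= 1.
Proof.
elim: m => [|m ih] /andP[y0 ym].
  have -> : y = 0 by apply/le_anti; rewrite ym.
  by rewrite big_ord0 subrr normr0.
rewrite big_ord_recr/=; have [h|h] := leP m.+1%:R y.
  have -> : y = m.+1%:R by apply/le_anti; rewrite ym.
  rewrite (eq_bigr (fun=> 1)) => [|k _].
    by rewrite big_const_ord iter_addr_0 -natrD addn1 subrr normr0.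
  by rewrite ler_nat ltnS ltnW.
rewrite addr0; have [h'|h'] := leP y m%:R; first by apply: ih; rewrite y0.
rewrite (eq_bigr (fun=> 1)) => [|k _].
  rewrite big_const_ord iter_addr_0 ger0_norm ?subr_ge0 ?ltW//.
  by move: h; rewrite -natr1; lra.
by rewrite (le_trans _ (ltW h'))// ler_nat.
Qed.

(** A bounded variable, made nonnegative by adding [C], is within [1 / (n + 1)] of a combination of
    indicators of its upper level sets, for which the identity holds; both sides are continuous for
    uniform convergence. The identity expresses that the conditional expectation of [Z] given [G] is
    the constant [c]. *)
Lemma Ex_extend (Z : Om -> R) (c : R) : L1 P Z ->
  (forall A, G A -> Ex P (fun w => \1_A w * Z w) = c * fine (P A)) ->
  forall (xi : Om -> R) (C : R), meas_wrt G xi -> (forall w, `|xi w| <= C) ->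
  Ex P (fun w => xi w * Z w) = c * Ex P xi.
Proof.
move=> IZ hA.
have mm (f : Om -> R) : meas_wrt G f -> meas_wrt measurable f.
  exact: sub_meas_wrt.
pose ok (xi : Om -> R) := exists2 C : R, meas_wrt G xi /\ (forall w, `|xi w| <= C) &
  Ex P (fun w => xi w * Z w) = c * Ex P xi.
have okA A : G A -> ok \1_A.
  move=> GA; exists 1; first by split; [exact: meas_ind|exact: norm_ind].
  by rewrite hA// Ex_ind//; exact: Gm.
have okD f g : ok f -> ok g -> ok (fun w => f w + g w).
  move=> [C [mf fC] ef] [D [mg gD] eg]; exists (C + D).
    split; first exact: measD.
    by move=> w; rewrite (le_trans (ler_normD _ _))// lerD.
  have If : L1 P (fun w => f w * Z w) by apply: (L1M (C := C)) => //; exact: mm.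
  have Ig : L1 P (fun w => g w * Z w) by apply: (L1M (C := D)) => //; exact: mm.
  under eq_fun do rewrite mulrDl.
  have If' : L1 P f by apply: (L1_bnd _ (mm _ mf) fC).
  have Ig' : L1 P g by apply: (L1_bnd _ (mm _ mg) gD).
  by rewrite (ExD If Ig) ef eg (ExD If' Ig') mulrDr.
have okZ r f : ok f -> ok (fun w => r * f w).
  move=> [C [mf fC] ef]; exists (`|r| * C).
    split; first exact: measZ.
    by move=> w; rewrite normrM ler_wpM2l.
  have If : L1 P (fun w => f w * Z w) by apply: (L1M (C := C)) => //; exact: mm.
  under eq_fun do rewrite -mulrA.
  have If' : L1 P f by apply: (L1_bnd _ (mm _ mf) fC).
  by rewrite (ExZ r If) ef (ExZ r If'); ring.
have ok0 : ok (cst 0).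
  by have := okA _ (sa_set0 sG); rewrite indic0.
have okS m (f : nat -> Om -> R) : (forall k, ok (f k)) ->
    ok (fun w => \sum_(k < m) f k w).
  move=> hf; elim: m => [|m ih].
    by under eq_fun do rewrite big_ord0; exact: ok0.
  by under eq_fun do rewrite big_ord_recr; exact: okD.
have okc r : ok (cst r).
  have -> : cst r = (fun w : Om => r * \1_setT w).
    by apply/funext => w; rewrite indicT mulr1.
  by apply: okZ; apply: okA; exact: sa_setT.
have pos xi n m : meas_wrt G xi -> (forall w, 0 <= xi w * n.+1%:R <= m%:R) ->
    `|Ex P (fun w => xi w * Z w) - c * Ex P xi| <=
    n.+1%:R^-1 * (Ex P (fun w => `|Z w|) + `|c|).
  move=> mxi xb.
  have n0 : 0 < n.+1%:R :> R by rewrite ltr0n.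
  pose q w : R := n.+1%:R^-1 * \sum_(k < m) \1_[set w | k.+1%:R <= xi w * n.+1%:R] w.
  have [Cq [mq qC] eq] : ok q.
    apply/okZ/(okS m (fun k => \1_[set w | k.+1%:R <= xi w * n.+1%:R])) => k.
    apply: okA; apply: (sa_le sG); first exact: meas_cst.
    by apply: measM => //; exact: meas_cst.
  have qe w : `|xi w - q w| <= n.+1%:R^-1.
    have -> : xi w - q w = n.+1%:R^-1 * (xi w * n.+1%:R -
        \sum_(k < m) (k.+1%:R <= xi w * n.+1%:R)%R%:R).
      rewrite mulrBr mulrCA mulVf ?gt_eqF// mulr1 /q; congr (_ - _ * _).
      apply: eq_bigr => k _; rewrite indicE; congr (nat_of_bool _)%:R.
      by apply/idP/idP; rewrite inE.
    by rewrite normrM ger0_norm ?invr_ge0// ler_piMr ?invr_ge0// floor_sum.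
  have mxq : meas_wrt G (fun w => xi w - q w) by exact: measB.
  have Ixq : L1 P (fun w => xi w - q w) by apply: (L1_bnd _ (mm _ mxq) qe).
  have IxqZ : L1 P (fun w => (xi w - q w) * Z w).
    by apply: (L1M (C := n.+1%:R^-1)) => //; exact: mm.
  have Iq : L1 P q by apply: (L1_bnd _ (mm _ mq) qC).
  have IqZ : L1 P (fun w => q w * Z w) by apply: (L1M (C := Cq)) => //; exact: mm.
  have -> : Ex P (fun w => xi w * Z w) =
      Ex P (fun w => (xi w - q w) * Z w) + Ex P (fun w => q w * Z w).
    by rewrite -(ExD IxqZ IqZ); congr Ex; apply/funext => w; ring.
  have -> : Ex P xi = Ex P (fun w => xi w - q w) + Ex P q.
    by rewrite -(ExD Ixq Iq); congr Ex; apply/funext => w; ring.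
  rewrite eq mulrDr opprD addrACA subrr addr0 (le_trans (ler_normB _ _))//.
  rewrite mulrDr lerD//.
    rewrite (le_trans (le_ExN IxqZ))// -ExZ; last exact: L1_norm.
    apply: le_Ex => //; [exact: L1_norm|exact/L1Z/L1_norm|move=> w].
    by rewrite normrM ler_wpM2r.
  rewrite normrM mulrC ler_wpM2r// (le_trans (le_ExN Ixq))//.
  rewrite -[leRHS](Ex_cst P); apply: le_Ex => //; first exact: L1_norm.
  exact: L1_cst.
move=> xi C mxi xC.
have mx' : meas_wrt G (fun w => xi w + C) by apply: measD => //; exact: meas_cst.
have e0 : Ex P (fun w => (xi w + C) * Z w) - c * Ex P (fun w => xi w + C) = 0.
  apply/eqP; rewrite -normr_le0; apply/ler_addgt0Pl => e e0; rewrite addr0.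
  set r := Ex P (fun w => `|Z w|) + `|c|.
  have r0 : 0 <= r by rewrite addr_ge0// Ex_ge0.
  have [n hn] : exists n : nat, r / e < n.+1%:R.
    exists (Num.truncn (r / e)); exact: truncnS_gt.
  have [m hm] : exists m : nat, 2 * C * n.+1%:R < m.+1%:R.
    exists (Num.truncn (2 * C * n.+1%:R)); exact: truncnS_gt.
  apply: (le_trans (pos _ n m.+1 mx' _)).
    move=> w; have := xC w; rewrite ler_norml => /andP[h1 h2].
    rewrite mulr_ge0//=; last by lra.
    rewrite (le_trans _ (ltW hm))// ler_wpM2r//; lra.
  rewrite -/r mulrC ler_pdivrMr// mulrC -ler_pdivrMr// ltW//.
have Ix : L1 P xi by apply: (L1_bnd _ (mm _ mxi) xC).
have IxZ : L1 P (fun w => xi w * Z w) by apply: (L1M (C := C)) => //; exact: mm.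
have [D _ eC] := okc C.
have IcZ : L1 P (fun w => cst C w * Z w) by exact: L1Z.
move: e0; rewrite (ExD Ix (L1_cst P C)).
have -> : (fun w => (xi w + C) * Z w) = (fun w => xi w * Z w + cst C w * Z w).
  by apply/funext => w; rewrite /cst; ring.
by rewrite (ExD IxZ IcZ) eC mulrDr opprD addrACA subrr addr0 => /eqP; rewrite subr_eq0 => /eqP.
Qed.

Lemma Ex_dct (f : nat -> Om -> R) (f0 g : Om -> R) :
  (forall n, meas_wrt measurable (f n)) -> L1 P g ->
  (forall n w, `|f n w| <= g w) -> (forall w, f n w @[n --> \oo] --> f0 w) ->
  L1 P f0 /\ Ex P (f n) @[n --> \oo] --> Ex P f0.
Proof.
move=> mf Ig fg ff.
have mf0 : meas_wrt measurable f0.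
  by apply: (meas_wrt_cvg sa_measurable) ff => n.
have mE (h : Om -> R) : meas_wrt measurable h -> measurable_fun setT (EFin \o h).
  by move=> /meas_mfun mh; exact/measurable_EFinP.
have [|||||I _ c] := @dominated_convergence _ _ _ P setT measurableT
  (fun n w => (f n w)%:E) (EFin \o f0) (EFin \o g).
- by move=> n; exact: (mE _ (mf n)).
- exact: mE.
- by apply: aeW => w _; apply: cvg_EFin; [exact: nearW|exact: ff].
- exact: Ig.
- by apply: aeW => w n _; rewrite /= lee_fin.
split; first exact: I.
have In n : L1 P (f n) by exact: L1_le (mf n) Ig (fg n).
have e n : (\int[P]_x (f n x)%:E)%E = (Ex P (f n))%:E.
  by rewrite /Ex /Rintegral fineK//; apply: integrable_fin_num => //; exact: In.
have e0 : (\int[P]_x (f0 x)%:E)%E = (Ex P f0)%:E.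
  by rewrite /Ex /Rintegral fineK//; apply: integrable_fin_num.
move: c; rewrite [X in _ --> X -> _]e0.
rewrite (_ : (fun n => (\int[P]_x (f n x)%:E)%E) = (fun n => (Ex P (f n))%:E)).
  by move/fine_cvg.
by apply/funext => n; exact: e.
Qed.

(** Truncation of [xi] and dominated convergence; the bound on [Z] provides the domination. *)
Lemma Ex_extend_L1 (Z : Om -> R) (c : R) :
  meas_wrt measurable Z -> (forall w, `|Z w| <= 1) ->
  (forall A, G A -> Ex P (fun w => \1_A w * Z w) = c * fine (P A)) ->
  forall xi : Om -> R, meas_wrt G xi -> L1 P xi ->
  Ex P (fun w => xi w * Z w) = c * Ex P xi.
Proof.
move=> mZ Z1 hA xi mxi Ixi.
have IZ : L1 P Z by exact: L1_bnd mZ Z1.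
pose f (n : nat) w := Num.max (- n%:R) (Num.min (xi w) n%:R).
have cl (n : nat) : continuous (fun x : R => Num.max (- n%:R) (Num.min x n%:R)).
  move=> x; apply: (@continuous_max R R (fun=> - n%:R) (fun y => Num.min y n%:R)).
    exact: cvg_cst.
  by apply: (@continuous_min R R id (fun=> n%:R)); [exact: cvg_id|exact: cvg_cst].
have mf n : meas_wrt G (f n) by apply: (meas_compc (cl n)).
have fn n w : `|f n w| <= n%:R.
  rewrite ler_norml /f le_max lexx/= ge_max ge_min lexx orbT andbT.
  by rewrite (@le_trans _ _ 0)// oppr_le0.
have fx n w : `|f n w| <= `|xi w|.
  rewrite /f; have n0 : 0 <= n%:R :> R by [].
  have h0 := normr_ge0 (xi w).
  have h1 : - `|xi w| <= xi w by rewrite lerNl -normrN ler_norm.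
  have h2 : - `|xi w| <= n%:R by lra.
  have h3 : - n%:R <= `|xi w| by lra.
  by rewrite ler_norml ge_max ge_min le_max le_min ler_norm /= andbT h1 h2 h3 orbT.
have ff w : f n w @[n --> \oo] --> xi w.
  apply: cvg_near_cst; exists (Num.truncn `|xi w|).+1 => // n /= hn.
  have h : `|xi w| <= n%:R.
    rewrite ltW// (lt_le_trans (truncnS_gt _))// ler_nat//.
  by move: h; rewrite ler_norml /f => /andP[h1 h2]; rewrite min_l// max_r.
have mm (g : Om -> R) : meas_wrt G g -> meas_wrt measurable g by exact: sub_meas_wrt.
have [_ c1] := Ex_dct (fun n => mm _ (mf n)) (L1_norm Ixi) fx ff.
have [||||_ c2] := @Ex_dct (fun n w => f n w * Z w) (fun w => xi w * Z w) (fun w => `|xi w|).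
- by move=> n; apply: (measM sa_measurable) => //; exact: mm.
- exact: L1_norm.
- by move=> n w; rewrite normrM -[leRHS]mulr1 ler_pM.
- by move=> w; apply: cvgMl; exact: ff.
apply: (cvg_unique _ c2) => //.
rewrite (_ : (fun n => _) = (fun n => c * Ex P (f n))); first exact: cvgMr.
by apply/funext => n; exact: (Ex_extend IZ hA (mf n) (fn n)).
Qed.

End extend_bounded.

Section independent_limit.
Context {R : realType} {d : measure_display} {Om : measurableType d}.
Variables (P : probability Om R).

Definition indep_of (A : set Om) (w : Om -> R) := forall B : set R, measurable B ->
  P (A `&` w @^-1` B) = (P A * P (w @^-1` B))%E.

(** The roles are exchanged: [\1_A] is the variable whose conditional expectation given the
    sigma-algebra of [w] is constant, and [f (w)] is the test variable. *)
Lemma indep_Ex (w : Om -> R) (A : set Om) : meas_wrt measurable w ->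
  measurable A -> indep_of A w ->
  forall f : R -> R, measurable_fun setT f -> L1 P (f \o w) ->
  Ex P (fun x => \1_A x * f (w x)) = Ex P (f \o w) * fine (P A).
Proof.
move=> mw mA ind f mf If.
pose G := preimage_set_system setT w measurable.
have sG : sigma_algebra setT G by apply: sigma_algebra_preimage; exact: sa_measurable.
have Gm : G `<=` measurable.
  by move=> _ [B mB <-]; rewrite setTI; exact: meas_preimage.
have mwG : meas_wrt G w by split=> B mB; exists B => //; rewrite setTI.
have mi : meas_wrt measurable (\1_A : Om -> R) by exact: (meas_ind (@sa_measurable _ Om)).
have hA D : G D -> Ex P (fun w => \1_D w * \1_A w) = fine (P A) * fine (P D).
  move=> [B mB <-]; rewrite setTI.
  have -> : (fun x => \1_(w @^-1` B) x * \1_A x) = \1_(A `&` w @^-1` B) :> (Om -> R).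
    by apply/funext => x; rewrite indicI mulrC.
  have mwB := meas_preimage mw mB.
  rewrite Ex_ind; last exact: measurableI.
  by rewrite ind// fineM// fin_num_measure.
rewrite mulrC -(Ex_extend_L1 sG Gm mi (@norm_ind _ _ _ A) hA (meas_comp mf mwG) If).
by congr Ex; apply/funext => x; rewrite mulrC.
Qed.

(** Two limits are taken: in [n] for a truncation of [f], which is bounded and continuous, then in
    the truncation level, with domination by [|f (w)|]. *)
Lemma indep_limit (w_ : nat -> Om -> R) (w : Om -> R) (A : set Om) (f : R -> R) :
  (forall n, meas_wrt measurable (w_ n)) -> measurable A ->
  (forall n, indep_of A (w_ n)) ->
  (forall x, w_ n x @[n --> \oo] --> w x) -> continuous f -> L1 P (f \o w) ->
  Ex P (fun x => \1_A x * f (w x)) = Ex P (f \o w) * fine (P A).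
Proof.
move=> mw mA ind ww cf If; have sm := @sa_measurable _ Om.
have mA1 : meas_wrt measurable (\1_A : Om -> R) by exact: (meas_ind sm).
pose g (m : nat) x := Num.max (- m%:R) (Num.min (f x) m%:R).
have cg m : continuous (g m).
  move=> x; apply: (@continuous_max R R (fun=> - m%:R) (fun y => Num.min (f y) m%:R)).
    exact: cvg_cst.
  by apply: (@continuous_min R R f (fun=> m%:R)); [exact: cf|exact: cvg_cst].
have gm m x : `|g m x| <= m%:R.
  rewrite ler_norml /g le_max lexx/= ge_max ge_min lexx orbT andbT.
  by rewrite (@le_trans _ _ 0)// oppr_le0.
have gf m x : `|g m x| <= `|f x|.
  rewrite /g; have n0 : 0 <= m%:R :> R by [].
  have h0 := normr_ge0 (f x).
  have h1 : - `|f x| <= f x by rewrite lerNl -normrN ler_norm.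
  have h2 : - `|f x| <= m%:R by lra.
  have h3 : - m%:R <= `|f x| by lra.
  by rewrite ler_norml ge_max ge_min le_max le_min ler_norm /= andbT h1 h2 h3 orbT.
have gl x : g m x @[m --> \oo] --> f x.
  apply: cvg_near_cst; exists (Num.truncn `|f x|).+1 => // n /= hn.
  have h : `|f x| <= n%:R.
    by rewrite ltW// (lt_le_trans (truncnS_gt _))// ler_nat.
  by move: h; rewrite ler_norml /g => /andP[h1 h2]; rewrite min_l// max_r.
have mg m n : meas_wrt measurable (g m \o w_ n) by exact: meas_compc (cg m) (mw n).
have mw' : meas_wrt measurable w by apply: (meas_wrt_cvg sm) ww => n; exact: mw.
have mg' m : meas_wrt measurable (g m \o w) by exact: meas_compc (cg m) mw'.
have bA (z : R) x : `|\1_A x * z| <= `|z|.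
  by rewrite normrM ler_piMl// norm_ind.
have eqm m : Ex P (fun x => \1_A x * g m (w x)) = Ex P (g m \o w) * fine (P A).
  have [_ c1] := @Ex_dct _ _ _ P (fun n => g m \o w_ n) (g m \o w) (cst m%:R)
    (mg m) (L1_cst P _) (fun n x => gm m _) (fun x => continuous_cvg _ (cg m _) (ww x)).
  have [|_ c2] := @Ex_dct _ _ _ P (fun n x => \1_A x * g m (w_ n x))
    (fun x => \1_A x * g m (w x)) (cst m%:R) (fun n => measM sm mA1 (mg m n)) (L1_cst P _)
    (fun n x => le_trans (bA _ _) (gm m _)).
  - by move=> x; apply: cvgMr; apply: continuous_cvg; [exact: cg|exact: ww].
  apply: (cvg_unique _ c2) => //.
  rewrite (_ : (fun n => _) = (fun n => Ex P (g m \o w_ n) * fine (P A))).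
    exact: cvgMl.
  apply/funext => n; apply: indep_Ex => //.
    by apply: continuous_measurable_fun; exact: cg.
  by apply: (L1_bnd _ (mg m n)) => x; exact: gm.
have [|_ c1] := @Ex_dct _ _ _ P (fun m => g m \o w) (f \o w) (fun x => `|f (w x)|)
  mg' (L1_norm If) (fun n x => gf n _).
  by move=> x; exact: gl.
have [|_ c2] := @Ex_dct _ _ _ P (fun m x => \1_A x * g m (w x))
  (fun x => \1_A x * f (w x)) (fun x => `|f (w x)|) (fun n => measM sm mA1 (mg' n))
  (L1_norm If) (fun n x => le_trans (bA _ _) (gf n _)).
- by move=> x; apply: cvgMr; exact: gl.
apply: (cvg_unique _ c2) => //.
rewrite (_ : (fun n => _) = (fun m => Ex P (g m \o w) * fine (P A))).
  exact: cvgMl.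
by apply/funext => n; exact: eqm.
Qed.

End independent_limit.

(** * Completion of the probability space *)

Section completion.
Context {R : realType} {d : measure_display} {Om : measurableType d}.
Variable P : probability Om R.

(** The events are the sets measurable in the sense of Caratheodory for the outer measure of [P]; in
    particular every subset of a null set is an event. *)
Definition completed := caratheodory_type (mu_ext P).
HB.instance Definition _ := Measurable.on completed.

Lemma completed_setT : (completed_measure_extension (mu := P) (setT : set completed) = 1)%E.
Proof.
by rewrite -(@probability_setT _ _ _ P); exact: measurable_mu_extE.
Qed.

HB.instance Definition _ := Measure_isProbability.Build _ _ _
  (completed_measure_extension (mu := P) : set completed -> \bar R) completed_setT.

Definition Pbar : probability completed R := completed_measure_extension (mu := P).

Lemma completed_measurable (A : set Om) : measurable A -> measurable (A : set completed).
Proof. exact: caratheodory_measurable_mu_ext. Qed.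

Lemma PbarE (A : set Om) : measurable A -> Pbar A = P A.
Proof. exact: measurable_mu_extE. Qed.

Lemma Pbar_null (A : set Om) : P.-negligible A ->
  measurable (A : set completed) /\ Pbar A = 0%E.
Proof.
move=> [B [mB PB AB]].
have mA : measurable (A : set completed).
  apply: (@measure_is_complete_caratheodory _ _ (mu_ext P)).
  exists B; split => //; first exact: completed_measurable.
  by rewrite -PB; exact: PbarE.
split => //; apply/le_anti; rewrite measure_ge0 andbT -PB -PbarE//.
by apply: le_measure => //; rewrite inE//; exact: completed_measurable.
Qed.

(** The completed probability is an infimum over countable covers by events of the original space. A
    cover of slightly larger cost, hence [e1 < e2], provides an original event. *)
Lemma Pbar_pbnd (A : set completed) (e1 e2 : R) : e1 < e2 -> pbnd Pbar A e1 ->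
  pbnd P (A : set Om) e2.
Proof.
move=> e12 [B [mB AB PB]].
have : (Pbar B < e2%:E)%E by rewrite (le_lt_trans PB)// lte_fin.
rewrite /Pbar/= /completed_measure_extension /mu_ext.
move=> /ereal_inf_lt[_ [F [mF BF] <-]] lt; exists (\bigcup_k F k); split.
- exact: bigcup_measurable.
- exact: subset_trans BF.
- by rewrite (le_trans _ (ltW lt))// measure_sigma_subadditive//; exact: bigcup_measurable.
Qed.

Lemma pbnd_Pbar (A : set Om) (e : R) : pbnd P A e -> pbnd Pbar (A : set completed) e.
Proof.
by move=> [B [mB AB PB]]; exists B; split => //; [exact: completed_measurable|rewrite PbarE].
Qed.

Lemma Pbar_negligible (A : set completed) : Pbar.-negligible A -> P.-negligible (A : set Om).
Proof.
move=> [B [mB PB AB]].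
have h n : pbnd P (A : set Om) n.+1%:R^-1.
  apply: (@Pbar_pbnd _ 0); first by rewrite invr_gt0.
  by exists B; rewrite PB.
pose C n := sval (cid (h n)).
have hC n : [/\ measurable (C n), A `<=` C n & (P (C n) <= n.+1%:R^-1%:E)%E].
  by rewrite /C; case: cid.
exists (\bigcap_n C n); split.
- by apply: bigcapT_measurable => n; have [] := hC n.
- have mC : measurable (\bigcap_n C n) by apply: bigcapT_measurable => n; have [] := hC n.
  apply/le_anti; rewrite measure_ge0 andbT; apply/lee_addgt0Pr => e e0; rewrite add0e.
  have [n hn] : exists n : nat, e^-1 < n.+1%:R by exists (Num.truncn e^-1); exact: truncnS_gt.
  have [mCn _ PCn] := hC n.
  apply: (@le_trans _ _ (P (C n))).
    by apply: le_measure => //; rewrite ?inE//; exact: bigcap_inf.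
  rewrite (le_trans PCn)// lee_fin -[e]invrK lef_pV2 ?posrE ?invr_gt0// ltW//.
- by move=> w Aw n _; have [_ h' _] := hC n; exact: h'.
Qed.

(** The sets that agree with some set of [<<s G>>] outside a negligible set form a sigma-algebra,
    which contains [G] and the negligible sets. *)
Lemma augmented_sigma (G : set (set Om)) (A : set Om) : G `<=` measurable ->
  <<s G `|` P.-negligible >> A ->
  exists2 A0, <<s G >> A0 & exists2 Z, P.-negligible Z & A `\` A0 `|` A0 `\` A `<=` Z.
Proof.
move=> Gm; apply: (@smallest_sub _ (sigma_algebra setT) _
  [set A | exists2 A0, <<s G >> A0 & exists2 Z, P.-negligible Z & A `\` A0 `|` A0 `\` A `<=` Z]).
- split.
  + exists set0; first exact: (sa_set0 (@smallest_sigma_algebra _ _ _)).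
    by exists set0; [exact: negligible_set0|rewrite !setD0 setU0].
  + move=> B [B0 sB0 [Z nZ BZ]]; exists (~` B0).
      exact: (sa_setC (@smallest_sigma_algebra _ _ _)).
    exists Z => // x; rewrite setTD => -[[nB /contrapT B0x]|[nB0 /contrapT Bx]].
      by apply: BZ; right.
    by apply: BZ; left.
  + move=> B hB.
    pose B0 n := s2val (cid2 (hB n)).
    have sB0 n : <<s G >> (B0 n) by rewrite /B0; case: cid2.
    have hB' n : exists2 Z, P.-negligible Z & B n `\` B0 n `|` B0 n `\` B n `<=` Z.
      by rewrite /B0; case: cid2.
    pose Z n := s2val (cid2 (hB' n)).
    exists (\bigcup_n B0 n); first exact: (sa_bigcup (@smallest_sigma_algebra _ _ _)).
    exists (\bigcup_n Z n).
      by apply: negligible_bigcup => n; rewrite /Z; case: cid2.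
    have hZ n : B n `\` B0 n `|` B0 n `\` B n `<=` Z n by rewrite /Z; case: cid2.
    move=> x [[[n _ Bn] nB0]|[[n _ Bn] nB0]]; exists n => //; apply: hZ.
      by left; split => // h; apply: nB0; exists n.
    by right; split => // h; apply: nB0; exists n.
- move=> B [GB|nB].
    by exists B; [exact: sub_gen_smallest|exists set0; [exact: negligible_set0|rewrite !setDv setU0]].
  exists set0; first exact: (sa_set0 (@smallest_sigma_algebra _ _ _)).
  by exists B => //; rewrite setD0 set0D setU0.
Qed.

End completion.

(** * Brownian motion for its augmented right-continuous filtration *)

Section wiener_basis.
Context {R : realType}.

Lemma within_seq_cvg (a b : R) (g : R -> R) (u : nat -> R) (s : R) :
  {within `[a, b], continuous g} -> (forall n, a <= u n <= b) -> a <= s <= b ->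
  u n @[n --> \oo] --> s -> g (u n) @[n --> \oo] --> g s.
Proof.
move=> /subspace_continuousP cg uab sab us B /cg; rewrite /= in_itv/= => /(_ sab) h.
have h' : \forall x \near s, `[a, b] x -> B (g x) by [].
have := us _ h'; rewrite /nbhs/=; apply: filterS => n /=.
by rewrite in_itv/=; apply; exact: uab.
Qed.

(** What the grid estimates use of Brownian motion: a filtration containing the negligible sets,
    continuous adapted paths, and the conditional moments of orders 1, 2 and 4 of the increments,
    tested on events of the past. *)
Record wiener_basis {d : measure_display} {Om : measurableType d}
    (P : probability Om R) (T : R) (W : R -> Om -> R) (F : R -> set (set Om)) : Prop :=
  WienerBasis {
    wb_sigma : forall t, sigma_algebra setT (F t);
    wb_mono : forall s t, s <= t -> F s `<=` F t;
    wb_meas : forall t, F t `<=` measurable;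
    wb_null : forall t A, P.-negligible A -> F t A;
    wb_adapted : forall t, 0 <= t <= T -> meas_wrt (F t) (W t);
    wb_cont : continuous_process T W;
    wb_L1 : forall s t, 0 <= s -> s < t -> t <= T ->
      [/\ L1 P (increment W s t), L1 P (fun w => increment W s t w ^+ 2) &
          L1 P (fun w => increment W s t w ^+ 4)];
    wb_moments : forall s t, 0 <= s -> s < t -> t <= T -> forall A, F s A ->
      [/\ Ex P (fun w => \1_A w * increment W s t w) = 0,
          Ex P (fun w => \1_A w * increment W s t w ^+ 2) = (t - s) * fine (P A) &
          Ex P (fun w => \1_A w * increment W s t w ^+ 4) =
            3 * (t - s) ^+ 2 * fine (P A)] }.

Context {d : measure_display} {Om : measurableType d}.
Variables (P : probability Om R) (T : R) (W : R -> Om -> R).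
Hypothesis bW : brownian_motion P T W.

Let gen_meas u : generated_events T W u `<=` measurable.
Proof.
case: bW => mW _ _ _ _ A [r [/= rT _]] [B mB <-].
by apply: mW => //; move: rT; rewrite in_itv.
Qed.

Let gen_mono s t : s <= t -> generated_events T W s `<=` generated_events T W t.
Proof.
move=> st A [r [/= rT rs] GA]; exists r => //; split => //.
by move: rs; rewrite /= !in_itv/= => /andP[-> /=] h; exact: le_trans st.
Qed.

Lemma canonical_meas t :
  canonical_filtration P T W t `<=` (measurable : set (set (completed P))).
Proof.
move=> A /(_ (t + 1)); rewrite /= in_itv/= andbT ltrDl => /(_ ltr01).
apply: smallest_sub; first exact: (@sa_measurable _ (completed P)).
move=> B [/gen_meas mB|nB]; first exact: completed_measurable.
exact: (Pbar_null nB).1.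
Qed.

Lemma canonical_sigma t : sigma_algebra setT (canonical_filtration P T W t).
Proof.
split.
- by move=> u _; exact: (sa_set0 (@smallest_sigma_algebra _ _ _)).
- move=> A FA u ut; rewrite setTD.
  by apply: (sa_setC (@smallest_sigma_algebra _ _ _)); exact: FA.
- move=> A FA u ut.
  by apply: (sa_bigcup (@smallest_sigma_algebra _ _ _)) => n; exact: FA.
Qed.

(** An event of time [s] belongs to the augmented natural sigma-algebra of each later time [u].
    There it coincides, up to a null set, with an event generated by [W], and the increment after
    [u] is independent of the latter. *)
Lemma canonical_indep s u t (A : set (completed P)) : 0 <= s -> s < u -> u < t ->
  t <= T -> canonical_filtration P T W s A ->
  indep_of (Pbar P) A (increment W u t : completed P -> R).
Proof.
move=> s0 su ut tT FA B mB; have u0 : 0 <= u by rewrite (le_trans s0) ?ltW.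
have [mW _ _ _ /(_ u t u0 ut tT) ind] := bW.
have := FA u; rewrite /= in_itv/= andbT => /(_ su).
move=> /(augmented_sigma (@gen_meas u))[A0 GA0 [Z nZ AZ]].
have mA0 : measurable A0.
  by move: GA0; apply: smallest_sub => //; exact: sa_measurable.
have [mZ PZ] := Pbar_null nZ.
have mA : measurable A by exact: canonical_meas FA.
have mI : measurable (increment W u t @^-1` B).
  have : meas_wrt measurable (increment W u t).
    apply: (measB (@sa_measurable _ Om)); apply/meas_mfun; apply: mW.
      by rewrite tT andbT (le_trans u0) ?ltW.
    by rewrite u0 (le_trans (ltW ut)).
  by move=> /meas_preimage; exact.
have mIc := completed_measurable P mI.
have mA0c := completed_measurable P mA0.
have eqP C : measurable C -> Pbar P (A `&` C) = Pbar P (A0 `&` C).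
  move=> mC; apply/le_anti; apply/andP; split.
    rewrite -[leRHS]adde0 -PZ.
    apply: (@le_trans _ _ (Pbar P ((A0 `&` C) `|` Z))).
      apply: le_measure; rewrite ?inE; [exact: measurableI| |].
        by apply: measurableU => //; exact: measurableI.
      move=> x [Ax Cx]; have [A0x|A0x] := pselect (A0 x); first by left.
      by right; apply: AZ; left.
    by apply: measureU2 => //; exact: measurableI.
  rewrite -[leRHS]adde0 -PZ.
  apply: (@le_trans _ _ (Pbar P ((A `&` C) `|` Z))).
    apply: le_measure; rewrite ?inE; [exact: measurableI| |].
      by apply: measurableU => //; exact: measurableI.
    move=> x [A0x Cx]; have [Ax|Ax] := pselect (A x); first by left.
    by right; apply: AZ; right.
  by apply: measureU2 => //; exact: measurableI.
rewrite eqP// -[in RHS](setIT A) eqP// setIT.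
have e1 := PbarE P mA0; have e2 := PbarE P mI.
have e3 := PbarE P (measurableI _ _ mA0 mI).
by rewrite e3 ind// -e1 -e2.
Qed.

Lemma canonical_wiener_basis :
  wiener_basis (Pbar P) T W (canonical_filtration P T W).
Proof.
have [mW cW _ gW _] := bW.
have adW t : 0 <= t <= T -> meas_wrt (canonical_filtration P T W t) (W t).
  move=> /andP[t0 tT]; split=> B mB u; rewrite /= in_itv/= andbT => tu.
  apply: sub_gen_smallest; left; exists t.
    by split; rewrite /= in_itv/= t0//= ltW.
  by exists B => //; rewrite setTI.
have mWc t : 0 <= t <= T -> meas_wrt (measurable : set (set (completed P))) (W t).
  by move=> /adW; apply: sub_meas_wrt; exact: canonical_meas.
have mIc s t : 0 <= s -> s < t -> t <= T ->
    meas_wrt (measurable : set (set (completed P))) (increment W s t).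
  move=> s0 st tT; apply: (measB (@sa_measurable _ (completed P))); apply: mWc.
    by rewrite tT (le_trans s0 (ltW st)).
  by rewrite s0 (le_trans (ltW st)).
have mom s t : 0 <= s -> s < t -> t <= T ->
  [/\ L1 (Pbar P) (increment W s t), Ex (Pbar P) (increment W s t) = 0,
      L1 (Pbar P) (fun x => increment W s t x ^+ 2),
      Ex (Pbar P) (fun x => increment W s t x ^+ 2) = t - s &
      L1 (Pbar P) (fun x => increment W s t x ^+ 4) /\
      Ex (Pbar P) (fun x => increment W s t x ^+ 4) = 3 * (t - s) ^+ 2].
  move=> s0 st tT; have q0 : 0 < Num.sqrt (t - s) by rewrite sqrtr_gt0 subr_gt0.
  have q2 : Num.sqrt (t - s) ^+ 2 = t - s by rewrite sqr_sqrtr// subr_ge0 ltW.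
  have := @gaussian_moments _ _ _ (Pbar P) _ _ q0 (mIc _ _ s0 st tT).
  rewrite (_ : Num.sqrt (t - s) ^+ 4 = (t - s) ^+ 2) ?q2; last first.
    by rewrite -[in RHS]q2; ring.
  apply=> B mB; rewrite -gW//.
  apply: PbarE; apply: (meas_preimage _ mB).
  apply: (measB (@sa_measurable _ Om)); apply/meas_mfun; apply: mW.
    by rewrite tT (le_trans s0 (ltW st)).
  by rewrite s0 (le_trans (ltW st)).
split.
- exact: canonical_sigma.
- move=> s t st A FA u; rewrite /= in_itv/= andbT => tu.
  by apply: FA; rewrite /= in_itv/= andbT (le_lt_trans st).
- exact: canonical_meas.
- move=> t A /Pbar_negligible nA u _; apply: sub_gen_smallest; by right.
- exact: adW.
- exact: cW.
- by move=> s t s0 st tT; have [? ? ? ? []] := mom s t s0 st tT.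
- move=> s t s0 st tT A FA.
  have [I1 E1 I2 E2 [I4 E4]] := mom s t s0 st tT.
  (* Starting times that decrease to [s]; the denominator [n.+2] keeps them below [t]. Independence
     of the increments after [u n] passes to the limit by continuity of the paths. *)
  pose u n := s + (t - s) / n.+2%:R.
  have st' : 0 < t - s by rewrite subr_gt0.
  have su n : s < u n by rewrite ltrDl divr_gt0.
  have ut n : u n < t.
    rewrite /u -ltrBrDl ltr_pdivrMr// ltr_pMr// ltr1n//.
  have u0 n : 0 <= u n by rewrite (le_trans s0) ?ltW.
  have uT n : u n <= T by rewrite (le_trans (ltW (ut n))).
  have cu : u n @[n --> \oo] --> s.
    rewrite -[X in _ --> X]addr0 -[X in _ + X](mulr0 (t - s)).
    apply: cvgD; [exact: cvg_cst|apply: cvgMr].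
    rewrite -(cvg_shiftS) /=.
    have := @cvg_harmonic R; rewrite -(cvg_shiftS); rewrite -(cvg_shiftS); exact.
  have cI w : increment W (u n) t w @[n --> \oo] --> increment W s t w.
    apply: cvgB; first exact: cvg_cst.
    apply: (within_seq_cvg (cW w)) cu => [n|]; first by rewrite u0 uT.
    by rewrite s0 (le_trans (ltW st)).
  have lim (f : R -> R) : continuous f ->
      L1 (Pbar P) (f \o increment W s t) ->
      Ex (Pbar P) (fun x => \1_A x * f (increment W s t x)) =
      Ex (Pbar P) (f \o increment W s t) * fine (Pbar P A).
    move=> cf If; apply: (@indep_limit _ _ (completed P) (Pbar P) (fun n => increment W (u n) t)) => //.
    - by move=> n; exact: mIc.
    - exact: canonical_meas FA.
    - by move=> n; exact: (canonical_indep s0).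
  split.
  + by rewrite (lim id)//= ?E1 ?mul0r// => x; exact: cvg_id.
  + rewrite (lim (fun x => x ^+ 2))//= ?E2//; exact: exprn_continuous.
  + rewrite (lim (fun x => x ^+ 4))//= ?E4//; exact: exprn_continuous.
Qed.

End wiener_basis.

Section grid.
Context {R : realType} {d : measure_display} {Om : measurableType d}.
Variables (P : probability Om R) (T : R) (W : R -> Om -> R) (F : R -> set (set Om)).
Hypothesis T0 : 0 < T.
Hypothesis wb : wiener_basis P T W F.

Definition gridt (N j : nat) : R := j%:R * (T / N%:R).

Lemma gridt_step N j : gridt N j.+1 = gridt N j + T / N%:R.
Proof. by rewrite /gridt -natr1 mulrDl mul1r. Qed.

Lemma gridt0 N : gridt N 0 = 0.
Proof. by rewrite /gridt mul0r. Qed.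

Lemma gridtN N : (0 < N)%N -> gridt N N = T.
Proof. by move=> N0; rewrite /gridt mulrC divfK// gt_eqF// ltr0n. Qed.

Lemma gridt_ge0 N j : 0 <= gridt N j.
Proof. by rewrite mulr_ge0// divr_ge0// ltW. Qed.

Lemma gridt_le N i j : (i <= j)%N -> gridt N i <= gridt N j.
Proof. by move=> ij; rewrite ler_wpM2r ?ler_nat// divr_ge0// ltW. Qed.

Lemma gridt_lt N j : (0 < N)%N -> gridt N j < gridt N j.+1.
Proof. by move=> N0; rewrite gridt_step ltrDl divr_gt0// ltr0n. Qed.

Lemma gridt_leT N j : (0 < N)%N -> (j <= N)%N -> gridt N j <= T.
Proof. by move=> N0 jN; rewrite -[leRHS](gridtN N0) gridt_le. Qed.

(** The conditional variance of [v^2 - D] is [3 D^2 - 2 D^2 + D^2 = 2 D^2], from the moments of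
    orders 2 and 4. *)
Lemma wiener_grid_basis N : (0 < N)%N ->
  grid_basis P T N (fun j => F (gridt N j))
    (fun j => increment W (gridt N j) (gridt N j.+1)).
Proof.
move=> N0; have [sF mF Fm _ aW _ iL mW] := wb.
have fm j (f : Om -> R) : meas_wrt (F (gridt N j)) f -> meas_wrt measurable f.
  by apply: sub_meas_wrt; exact: Fm.
have ad j : (j < N)%N ->
    meas_wrt (F (gridt N j.+1)) (increment W (gridt N j) (gridt N j.+1)).
  move=> jN; apply: (measB (sF _)).
    by apply: aW; rewrite gridt_ge0 gridt_leT.
  apply: sub_meas_wrt (aW _ _); first by apply: mF; exact: gridt_le.
  by rewrite gridt_ge0 gridt_leT// ltnW.
split => //; first by move=> j; apply: mF; exact: gridt_le.
have IL j : (j < N)%N -> _ := fun jN => iL _ _ (gridt_ge0 N j) (gridt_lt j N0) (gridt_leT N0 jN).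
have MO j : (j < N)%N -> _ := fun jN => mW _ _ (gridt_ge0 N j) (gridt_lt j N0) (gridt_leT N0 jN).
have dt j : gridt N j.+1 - gridt N j = T / N%:R by rewrite gridt_step addrC addKr.
set v := fun j => increment _ _ _; set D := T / N%:R.
have LZ j (g : Om -> R) : L1 P g -> forall A : set Om, F (gridt N j) A ->
    L1 P (fun w => \1_A w * g w).
  move=> Ig A FA; apply: (L1M (C := 1)) => //; last exact: norm_ind.
  by apply: (meas_ind (@sa_measurable _ Om)); exact: Fm FA.
split=> j jN.
- have [I1 I2 I4] := IL j jN.
  split; [exact: ad|exact: I1|exact: I2|move=> xi C mxi xiC].
  split.
    rewrite (Ex_extend (sF (gridt N j)) (@Fm _) (c := 0) I1 _ mxi xiC) ?mul0r//.
    by move=> A FA; have [-> _ _] := MO j jN A FA; rewrite mul0r.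
  apply: (Ex_extend (sF (gridt N j)) (@Fm _) I2 _ mxi xiC).
  by move=> A FA; have [_ -> _] := MO j jN A FA; rewrite dt.
- have [I1 I2 I4] := IL j jN.
  have IB : L1 P (fun w => v j w ^+ 2 - D) by apply: L1B => //; exact: L1_cst.
  have e4 w : (v j w ^+ 2 - D) ^+ 2 = v j w ^+ 4 + (- (2 * D) * v j w ^+ 2 + D ^+ 2).
    by ring.
  have I4' : L1 P (fun w => - (2 * D) * v j w ^+ 2 + D ^+ 2).
    by apply: L1D; [exact: L1Z|exact: L1_cst].
  have IB2 : L1 P (fun w => (v j w ^+ 2 - D) ^+ 2).
    by rewrite (funext e4); exact: L1D.
  split => //.
    by apply: (measB (sF _)); [exact/measX/ad|exact: (meas_cst (sF _))].
  move=> xi C mxi xiC; split.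
    rewrite (Ex_extend (sF (gridt N j)) (@Fm _) (c := 0) IB _ mxi xiC) ?mul0r//.
    move=> A FA; have [_ e2 _] := MO j jN A FA; rewrite mul0r.
    have mA := Fm _ _ FA.
    under eq_fun do rewrite mulrBr [_ * D]mulrC.
    rewrite (ExB (LZ _ _ I2 _ FA))//; last exact/L1Z/L1_ind.
    rewrite e2 (ExZ D (L1_ind P mA)) Ex_ind// dt subrr//.
  apply: (Ex_extend (sF (gridt N j)) (@Fm _) IB2 _ mxi xiC).
  move=> A FA; have [_ e2 e4'] := MO j jN A FA; have mA := Fm _ _ FA.
  have -> : (fun w => \1_A w * (v j w ^+ 2 - D) ^+ 2) = (fun w => \1_A w * v j w ^+ 4 +
     (- (2 * D) * (\1_A w * v j w ^+ 2) + D ^+ 2 * \1_A w)).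
    by apply/funext => w; ring.
  have L2 : L1 P (fun w => - (2 * D) * (\1_A w * v j w ^+ 2)) by apply/L1Z/(LZ j).
  have L0 : L1 P (fun w => D ^+ 2 * \1_A w) by exact/L1Z/L1_ind.
  rewrite (ExD (LZ _ _ I4 _ FA) (L1D L2 L0)) (ExD L2 L0).
  rewrite (ExZ _ (LZ _ _ I2 _ FA)) (ExZ _ (L1_ind P mA)) Ex_ind// e2 e4' !dt -/D.
  by ring.
Qed.

End grid.

(** * Oscillation of continuous paths *)

Section uniform_continuity.
Context {R : realType}.

Lemma within_itv_cvg (a b : R) (g : R -> R) : {within `[a, b], continuous g} ->
  forall s, a <= s <= b -> forall e, 0 < e -> exists2 dl, 0 < dl &
  forall t, a <= t <= b -> `|t - s| < dl -> `|g t - g s| < e.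
Proof.
move=> /subspace_continuousP cg s sab e e0.
have := cg s; rewrite /= in_itv/= => /(_ sab) /cvgrPdist_lt /(_ e e0).
rewrite /nbhs/= /within/= -nbhs_nearE => /nbhs_ballP [dl /= dl0 h]; exists dl => // t tab ts.
by rewrite distrC; apply: h; rewrite /ball/= ?in_itv//= distrC.
Qed.

(** Heine's theorem by a covering argument: [dl] is a parameter tending to 0 from the right, and a
    property that holds near each point of a compact set for small parameters holds on the whole
    set. *)
Lemma itv_unif_cont (a b : R) (g : R -> R) : {within `[a, b], continuous g} ->
  forall e, 0 < e -> exists2 dl, 0 < dl &
  forall s t, a <= s <= b -> a <= t <= b -> `|t - s| < dl -> `|g t - g s| < e.
Proof.
move=> cg e e0; have e20 : 0 < e / 2 by rewrite divr_gt0.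
have /compact_near_coveringP := @segment_compact R a b.
move=> /(_ R (0:R)^'+ (fun dl s => a <= s <= b -> forall t, a <= t <= b ->
  `|t - s| < dl -> `|g t - g s| < e) _) [].
  move=> s; rewrite /= in_itv/= => sab.
  have [dl dl0 h] := within_itv_cvg cg sab e20.
  have dl20 : 0 < dl / 2 by rewrite divr_gt0.
  exists ([set x | `|s - x| < dl / 2], [set y | 0 < y < dl / 2]) => /=.
    split; first by have := nbhsx_ballx s _ dl20.
    by near=> y; apply/andP; split.
  move=> [x y]/= [sx /andP[y0 yd]] xab t tab tx.
  have h1 : `|g x - g s| < e / 2.
    by apply: h => //; rewrite distrC; move: sx; lra.
  have h2 : `|g t - g s| < e / 2.
    apply: h => //; rewrite (le_lt_trans (ler_distD x _ _))//.
    rewrite [`|x - s|]distrC; lra.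
  rewrite (le_lt_trans (ler_distD (g s) _ _))//.
  by rewrite [`|g s - g x|]distrC; lra.
move=> dl /= dl0 h; exists (dl / 2); first by rewrite divr_gt0.
move=> s t sab tab ts; have dl20 : 0 < dl / 2 by rewrite divr_gt0.
have b1 : ball_ Num.norm 0 dl (dl / 2).
  by rewrite /ball_/= sub0r normrN ger0_norm ?ltW//; lra.
by apply: (h _ b1 dl20 s).
Unshelve. all: by end_near.
Qed.

Lemma rat_approx (T s dl : R) : 0 < T -> 0 <= s <= T -> 0 < dl ->
  exists q : rat, 0 <= ratr q * T <= T /\ `|ratr q * T - s| < dl.
Proof.
move=> T0 /andP[s0 sT] dl0.
have lt : Num.max 0 (s - dl) / T < Num.min T (s + dl) / T.
  rewrite ltr_pM2r ?invr_gt0// lt_min !gt_max T0/=.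
  by apply/andP; split; lra.
have [q] := rat_in_itvoo lt; rewrite in_itv/= ltr_pdivrMr// ltr_pdivlMr//.
rewrite gt_max lt_min => /andP[/andP[q0 q1] /andP[q2 q3]].
exists q; split; first by apply/andP; split; exact: ltW.
by rewrite ltr_norml; apply/andP; split; lra.
Qed.

Context {d : measure_display} {Om : measurableType d}.
Variables (P : probability Om R) (T : R) (T0 : 0 < T).

Definition osc_gt (Z : R -> Om -> R) (dl om : R) : set Om :=
  [set w | exists s t, [/\ 0 <= s <= T, 0 <= t <= T, `|t - s| < dl &
    om < `|Z t w - Z s w|]].

Lemma osc_gt_le Z dl1 dl2 om : dl1 <= dl2 -> osc_gt Z dl1 om `<=` osc_gt Z dl2 om.
Proof. by move=> h w [s [t [? ? ? ?]]]; exists s, t; split => //; exact: lt_le_trans h. Qed.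

(** The inequalities on [|t - s|] and on the increment are strict, hence stable under small changes
    of [s] and [t] along a continuous path: rational multiples of [T] suffice, and they are
    countably many. *)
Lemma osc_gt_meas Z dl om : continuous_process T Z ->
  (forall t, 0 <= t <= T -> meas_wrt measurable (Z t)) ->
  measurable (osc_gt Z dl om).
Proof.
move=> cZ mZ; have sm := @sa_measurable _ Om.
rewrite (_ : osc_gt _ _ _ = \bigcup_(pq in [set pq : rat * rat |
   [/\ 0 <= ratr pq.1 * T <= T, 0 <= ratr pq.2 * T <= T & `|ratr pq.2 * T - ratr pq.1 * T| < dl]])
   [set w | om < `|Z (ratr pq.2 * T) w - Z (ratr pq.1 * T) w|]).
  apply: (sa_bigcup_count sm) => -[p q] [/= hp hq _].
  apply: (sa_lt sm); first exact: (meas_cst sm).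
  by apply: meas_norm; apply: (measB sm); exact: mZ.
apply/seteqP; split=> w.
  move=> [s [t [hs ht st lt]]].
  pose e := (`|Z t w - Z s w| - om) / 2.
  pose r := (dl - `|t - s|) / 2.
  have e0 : 0 < e by rewrite divr_gt0// subr_gt0.
  have r0 : 0 < r by rewrite divr_gt0// subr_gt0.
  have [d1 d10 h1] := within_itv_cvg (cZ w) hs e0.
  have [d2 d20 h2] := within_itv_cvg (cZ w) ht e0.
  have [p [pT ps]] := rat_approx T0 hs (dl := Num.min d1 r) ltac:(by rewrite lt_min d10).
  have [q [qT qt]] := rat_approx T0 ht (dl := Num.min d2 r) ltac:(by rewrite lt_min d20).
  move: ps qt; rewrite !lt_min => /andP[p1 p2] /andP[q1 q2].
  have {}h1 := h1 _ pT p1; have {}h2 := h2 _ qT q1.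
  exists (p, q) => /=; first split => //.
    move: p2 q2; rewrite /r.
    set x := ratr p * T; set y := ratr q * T => p2 q2.
    have -> : y - x = (y - t) + (t - s) - (x - s) by ring.
    rewrite (le_lt_trans (ler_normB _ _))// (le_lt_trans (lerD (ler_normD _ _) (lexx _)))//.
    by lra.
  move: h1 h2; rewrite /e; set x := Z (ratr p * T) w; set y := Z (ratr q * T) w.
  move=> h1 h2; have : `|Z t w - Z s w| <= `|Z t w - y| + `|y - x| + `|x - Z s w|.
    have -> : Z t w - Z s w = (Z t w - y) + (y - x) + (x - Z s w) by ring.
    by rewrite (le_trans (ler_normD _ _))// lerD// ler_normD.
  by rewrite [`|Z t w - y|]distrC; lra.
move=> [[p q] [/= hp hq pq] lt].
by exists (ratr p * T), (ratr q * T).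
Qed.

(** By uniform continuity of each path these events decrease to the empty set as [dl] tends to 0. *)
Lemma osc_small Z (om e : R) : continuous_process T Z ->
  (forall t, 0 <= t <= T -> meas_wrt measurable (Z t)) -> 0 < om -> 0 < e ->
  exists2 dl, 0 < dl & pbnd P (osc_gt Z dl om) e.
Proof.
move=> cZ mZ om0 e0; pose A n := osc_gt Z n.+1%:R^-1 om.
have mA n : measurable (A n) by exact: osc_gt_meas.
have A0 : \bigcap_n A n = set0.
  apply/seteqP; split=> // w Aw.
  have [dl dl0 h] := itv_unif_cont (cZ w) om0.
  have [n hn] : exists n : nat, dl^-1 < n.+1%:R by exists (Num.truncn dl^-1); exact: truncnS_gt.
  have [s [t [hs ht st]]] := Aw n I; apply/negP; rewrite -leNgt ltW// h//.
  rewrite (lt_trans st)// -[ltRHS]invrK ltf_pV2 ?posrE ?invr_gt0//.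
have cA : P (A n) @[n --> \oo] --> 0%E.
  rewrite -(measure0 P) -A0; apply: nonincreasing_cvg_mu => //.
  - by rewrite ltey_eq fin_num_measure.
  - by rewrite A0; exact: measurable0.
  - apply/nonincreasing_seqP => n; apply/subsetPset/osc_gt_le.
    by rewrite lef_pV2 ?posrE// ler_nat.
have : \forall n \near \oo, fine (P (A n)) < e.
  apply: (@cvgr_lt _ _ _ _ (fine \o (P \o A)) 0) => //; exact: fine_cvg cA.
move=> [n _ /(_ n (leqnn n)) h]; exists n.+1%:R^-1; first by rewrite invr_gt0.
by exists (A n); split => //; rewrite -(PfineK P (mA n)) lee_fin ltW.
Qed.

End uniform_continuity.

(** * Interval integrals and the functions of Yamada and Watanabe *)

Section interval_integral.
Context {R : realType}.
Implicit Types (f g : R -> R) (a b c x : R).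
Local Notation mu := (@lebesgue_measure R).

Definition integ a b f : R := Rintegral mu `[a, b] f.
Definition intble a b f := mu.-integrable `[a, b] (EFin \o f).

Lemma intble_sub a b c e f : intble a b f -> a <= c -> e <= b -> intble c e f.
Proof.
move=> If ac eb; apply: integrableS If => //.
by apply: subset_itv; rewrite bnd_simp.
Qed.

Lemma intble_cont a b f : {within `[a, b], continuous f} -> intble a b f.
Proof. by move=> cf; apply: continuous_compact_integrable => //; exact: segment_compact. Qed.

Lemma intble_continuous a b f : continuous f -> intble a b f.
Proof. by move=> cf; apply: intble_cont; exact: continuous_subspaceT. Qed.

Lemma itv_finite a b : (mu `[a, b] < +oo)%E.
Proof. by rewrite lebesgue_measure_itv/=; case: ifP; rewrite // -EFinB ltry. Qed.

Lemma intble_bnd a b f (M : R) : measurable_fun `[a, b] f ->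
  (forall x, a <= x <= b -> `|f x| <= M) -> intble a b f.
Proof.
move=> mf fM; apply: measurable_bounded_integrable => //; first exact: itv_finite.
exists M; split; first exact: num_real.
move=> y My x /=; rewrite in_itv/= => xab; exact: le_trans (fM _ xab) (ltW My).
Qed.

Lemma intbleD a b f g : intble a b f -> intble a b g -> intble a b (fun x => f x + g x).
Proof. by move=> If Ig; have := integrableD _ If Ig; exact. Qed.

Lemma intbleB a b f g : intble a b f -> intble a b g -> intble a b (fun x => f x - g x).
Proof. by move=> If Ig; have := integrableB _ If Ig; exact. Qed.

Lemma intbleZ a b f (r : R) : intble a b f -> intble a b (fun x => r * f x).
Proof. by move=> If; have := integrableZl _ r If; exact. Qed.

Lemma intble_norm a b f : intble a b f -> intble a b (fun x => `|f x|).
Proof. by move=> If; exact: integrable_norm. Qed.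

Lemma intble_cst a b (r : R) : intble a b (fun=> r).
Proof. by apply: intble_continuous => x; exact: cvg_cst. Qed.

Lemma integD a b f g : intble a b f -> intble a b g ->
  integ a b (fun x => f x + g x) = integ a b f + integ a b g.
Proof. by move=> If Ig; rewrite /integ RintegralD. Qed.

Lemma integB a b f g : intble a b f -> intble a b g ->
  integ a b (fun x => f x - g x) = integ a b f - integ a b g.
Proof. by move=> If Ig; rewrite /integ RintegralB. Qed.

Lemma integZ a b f (r : R) : intble a b f -> integ a b (fun x => r * f x) = r * integ a b f.
Proof. by move=> If; rewrite /integ RintegralZl. Qed.

Lemma integ_cst a b r : a <= b -> integ a b (fun=> r) = r * (b - a).
Proof.
move=> ab; have q : fine (mu `[a, b]) = b - a.
  rewrite lebesgue_measure_itv/= lte_fin.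
  by case: ltgtP ab => // -> _; rewrite subrr.
exact: (etrans (Rintegral_cst mu (measurable_itv `[a, b]%R) r) (congr1 _ q)).
Qed.

Lemma le_integ a b f g : intble a b f -> intble a b g ->
  (forall x, a <= x <= b -> f x <= g x) -> integ a b f <= integ a b g.
Proof.
move=> If Ig fg; apply: le_Rintegral => // x; rewrite /= in_itv/=; exact: fg.
Qed.

Lemma integ_ge0 a b f : (forall x, a <= x <= b -> 0 <= f x) -> 0 <= integ a b f.
Proof. by move=> h; apply: Rintegral_ge0 => x; rewrite /= in_itv/=; exact: h. Qed.

Lemma eq_integ a b f g : (forall x, a <= x <= b -> f x = g x) -> integ a b f = integ a b g.
Proof. by move=> h; apply: eq_Rintegral => x; rewrite inE/= in_itv/=; exact: h. Qed.

Lemma eq_intble a b f g : (forall x, a <= x <= b -> f x = g x) -> intble a b f -> intble a b g.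
Proof.
move=> h; apply: eq_integrable => // x; rewrite inE/= in_itv/= => xab.
by rewrite h.
Qed.

Lemma integ_norm_le a b f (M : R) : a <= b -> intble a b f ->
  (forall x, a <= x <= b -> `|f x| <= M) -> `|integ a b f| <= M * (b - a).
Proof.
move=> ab If fM; rewrite -integ_cst//.
apply: (le_trans (le_normr_Rintegral _ If)) => //.
by apply: le_integ fM; [exact: intble_norm|exact: intble_cst].
Qed.

Lemma integ_dist_le a b f g (M : R) : a <= b -> intble a b f -> intble a b g ->
  (forall x, a <= x <= b -> `|f x - g x| <= M) ->
  `|integ a b f - integ a b g| <= M * (b - a).
Proof.
by move=> ab If Ig fM; rewrite -integB//; apply: integ_norm_le fM => //; exact: intbleB.
Qed.

Lemma integ_add a b c f : a <= b -> b <= c -> intble a c f ->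
  integ a c f = integ a b f + integ b c f.
Proof.
move=> ab bc If; have := @Rintegral_itvB _ f (BLeft a) (BRight c) b If.
rewrite !bnd_simp => /(_ ab bc) h.
have e : integ b c f = Rintegral mu `]b, c] f.
  rewrite /integ Rintegral_itv_obnd_cbnd//; apply: integrableS If => //.
  by apply: subset_itv; rewrite bnd_simp.
by rewrite e -h /integ addrC subrK.
Qed.

Lemma integ_refl a f : integ a a f = 0.
Proof. by rewrite /integ set_itv1 Rintegral_set1. Qed.

Lemma oriented_ge0 x f : 0 <= x -> oriented_integral f x = integ 0 x f.
Proof. by rewrite /oriented_integral => ->. Qed.

Lemma oriented_integralE a x f : a <= 0 -> a <= x -> (forall b, intble a b f) ->
  oriented_integral f x = integ a x f - integ a 0 f.
Proof.
move=> a0 ax If; rewrite /oriented_integral; case: ifPn => [x0|].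
  by rewrite (integ_add a0 x0)// addrAC subrr add0r.
by rewrite -ltNge => /ltW x0; rewrite (integ_add ax x0)// opprD addrA subrr sub0r.
Qed.

Lemma oriented_integral_derive f : continuous f ->
  forall x, is_derive x 1 (oriented_integral f) (f x).
Proof.
move=> cf x; pose a := Num.min x 0 - 1.
have ax : a < x by rewrite /a ltrBlDr gt_min ltrDl ltr01.
have a0 : a < 0 by rewrite /a ltrBlDr gt_min ltrDl ltr01 orbT.
have If b : intble a b f by exact: intble_continuous.
have [d e] := continuous_FTC1_closed (ltr_pwDr ltr01 (lexx x)) (If _) ax (cf x).
apply: (@near_eq_is_derive _ _ _ (fun y => integ a y f + (- integ a 0 f))).
  near=> y; rewrite (oriented_integralE (ltW a0) _ If)//.
  by apply/ltW; near: y; exact: lt_nbhsr.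
rewrite -[f x]addr0; apply: is_deriveD.
by apply: DeriveDef; [exact: d|rewrite -derive1E].
Unshelve. all: by end_near. Qed.

Lemma derive_continuous (f f' : R -> R) : (forall x, is_derive x 1 f (f' x)) -> continuous f.
Proof.
move=> df z; apply: differentiable_continuous; apply/derivable1_diffP.
by have [] := df z.
Qed.

Lemma mean_value (f f' : R -> R) : (forall x, is_derive x 1 f (f' x)) ->
  forall x y, exists2 c, `|c - x| <= `|y - x| & f y - f x = f' c * (y - x).
Proof.
move=> df x y; have cf := derive_continuous df.
have [xy|yx|->] := ltgtP x y.
- have [c] := MVT xy (fun z _ => df z) (continuous_subspaceT cf).
  rewrite in_itv/= => /andP[xc cy] e; exists c => //.
  by rewrite !ger0_norm ?subr_ge0 ?lerB// ltW.
- have [c] := MVT yx (fun z _ => df z) (continuous_subspaceT cf).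
  rewrite in_itv/= => /andP[yc cx] e; exists c.
    by rewrite !ler0_norm ?subr_le0 ?lerN2 ?lerB// ltW.
  by rewrite -opprB e -mulrN opprB.
- by exists y; rewrite ?subrr ?mulr0.
Qed.

(** The remainder vanishes at 0 together with its derivative, so two uses of the mean value theorem
    bound it by [M t^2], where [M] bounds the variation of [f2]. This variation is at most [e] for
    [|t| <= dl], and at most [2 B <= (2 B / dl^2) t^2] otherwise. *)
Lemma taylor_smooth2 (f f1 f2 : R -> R) (B : R) :
  (forall x, is_derive x 1 f (f1 x)) -> (forall x, is_derive x 1 f1 (f2 x)) ->
  continuous f2 -> (forall x, `|f1 x| <= B) -> (forall x, `|f2 x| <= B) ->
  (forall e : R, 0 < e -> exists2 dl : R, 0 < dl &
    forall x y, `|x - y| <= dl -> `|f2 x - f2 y| <= e) ->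
  smooth2 f f1 f2 B.
Proof.
move=> df df1 cf2 f1B f2B uf2; have B0 : 0 <= B by exact: le_trans (f1B 0).
have rem x t M : (forall y, `|y - x| <= `|t| -> `|f2 y - f2 x| <= M) ->
    `|f (x + t) - f x - f1 x * t - 2^-1 * f2 x * t ^+ 2| <= M * t ^+ 2.
  move=> hM.
  pose r s := f (x + s) - f x - f1 x * s - 2^-1 * f2 x * s ^+ 2.
  pose r1 s := f1 (x + s) - f1 x - f2 x * s.
  have dr (s : R) : is_derive s (1 : R) r (r1 s).
    by rewrite /r /r1; apply: is_derive_eq; rewrite /GRing.scale/=; field.
  have dr1 (s : R) : is_derive s (1 : R) r1 (f2 (x + s) - f2 x).
    by rewrite /r1; apply: is_derive_eq; rewrite /GRing.scale/=; ring.
  have r0 : r 0 = 0 by rewrite /r addr0; ring.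
  have r10 : r1 0 = 0 by rewrite /r1 addr0; ring.
  have [c] := mean_value dr 0 t; rewrite r0 !subr0 => ct er.
  have [c'] := mean_value dr1 0 c; rewrite r10 !subr0 => cc er1.
  rewrite -/(r t) er er1 !normrM.
  have hc' : `|f2 (x + c') - f2 x| <= M.
    by apply: hM; rewrite addrC addKr (le_trans cc).
  rewrite -[t ^+ 2]real_normK ?num_real// expr2 mulrA ler_wpM2r//.
  by rewrite ler_pM.
split; first by split => //; [exact: derive_continuous df|exact: derive_continuous df1].
move=> e e0; have [dl dl0 hdl] := uf2 _ e0.
exists (2 * B / dl ^+ 2); first by rewrite divr_ge0 ?mulr_ge0 ?exprn_ge0// ltW.
move=> x t; have [h|h] := leP `|t| dl.
  apply: (le_trans (rem x t e _)) => [y yx|]; first by apply: hdl; exact: le_trans h.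
  rewrite ler_wpM2r ?sqr_ge0// lerDl mulr_ge0 ?sqr_ge0// divr_ge0 ?mulr_ge0 ?exprn_ge0// ltW//.
apply: (le_trans (rem x t (2 * B) _)) => [y yx|].
  by rewrite (le_trans (ler_normB _ _))// mulrDl mul1r lerD.
rewrite ler_wpM2r ?sqr_ge0// -[leLHS]add0r lerD//; first exact: ltW.
rewrite mulrAC ler_pdivlMr ?exprn_gt0// ler_wpM2l ?mulr_ge0//.
by rewrite -[t ^+ 2]real_normK ?num_real// lerXn2r ?nnegrE// ltW.
Qed.

End interval_integral.

Section yamada_watanabe_functions.
Context {R : realType}.
Variables (s0 l : R -> R).
Local Notation mu := (@lebesgue_measure R).
Hypothesis cs0 : continuous s0.
Hypothesis l0 : forall u, 0 <= u -> 0 <= l u.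
Hypothesis ml : measurable_fun (`[0, +oo[ : set R) l.
Hypothesis l_div : forall eps : R, 0 < eps ->
  (\int[mu]_(u in `]0%R, eps]) inve (l u ^+ 2)%:E = +oo)%E.
Hypothesis s0l : forall x y, `|s0 x - s0 y| <= l `|x - y|.

Lemma near_dist (x dl : R) : 0 < dl -> \forall v \near x, `|x - v| < dl.
Proof. by move=> dl0; have := nbhsx_ballx x _ dl0. Qed.

(** A continuous substitute for [l], which is only measurable: it is at most [l] and still dominates
    the increments of [s0] from points of [[-r, r]]. *)
Definition modulus (r u : R) : R := sup [set `|s0 (y + u) - s0 y| | y in `[- r, r]].

Lemma modulus_ge r u y : `|y| <= r -> `|s0 (y + u) - s0 y| <= modulus r u.
Proof.
move=> yr; apply: ub_le_sup; last first.
  by exists y => //=; rewrite in_itv/= -ler_norml.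
exists (l `|u|) => _ [z _ <-]; rewrite (le_trans (s0l _ _))//.
by rewrite [_ + u]addrC addrK.
Qed.

Lemma modulus_le r u C : 0 < r -> (forall y, `|y| <= r -> `|s0 (y + u) - s0 y| <= C) ->
  modulus r u <= C.
Proof.
move=> r0 h; apply: ge_sup; first by exists `|s0 (0 + u) - s0 0|, 0; rewrite //= in_itv/= oppr_le0 ltW.
by move=> _ [y /= + <-]; rewrite in_itv/= -ler_norml; exact: h.
Qed.

Lemma modulus_continuous r : 0 < r -> continuous (modulus r).
Proof.
move=> r0 u; apply/cvgrPdist_le => e e0.
pose A := r + `|u| + 1.
have [dl dl0 h] := itv_unif_cont (@continuous_subspaceT _ _ `[- A, A] _ cs0) e0.
have u0 := normr_ge0 u.
have key v v' : `|v| <= `|u| + 1 -> `|v'| <= `|u| + 1 -> `|v - v'| < dl ->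
    modulus r v <= modulus r v' + e.
  move=> hv hv' vv'; apply: modulus_le => // y yr.
  have -> : s0 (y + v) - s0 y = (s0 (y + v) - s0 (y + v')) + (s0 (y + v') - s0 y) by ring.
  rewrite (le_trans (ler_normD _ _))// addrC lerD//; first exact: modulus_ge.
  apply/ltW/h.
  - rewrite -ler_norml (le_trans (ler_normD _ _))// /A; lra.
  - rewrite -ler_norml (le_trans (ler_normD _ _))// /A; lra.
  - by have -> : y + v - (y + v') = v - v' by ring.
near=> v.
have d1 : `|u - v| < dl by near: v; exact: near_dist.
have d2 : `|u - v| < 1 by near: v; exact: near_dist.
have nv : `|v| <= `|u| + 1.
  have -> : v = u - (u - v) by ring.
  by rewrite (le_trans (ler_normB _ _))// lerD2l ltW.
have nu : `|u| <= `|u| + 1 by lra.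
have k1 := key u v nu nv d1.
have k2 := key v u nv nu ltac:(by rewrite distrC).
by rewrite ler_norml; apply/andP; split; lra.
Unshelve. all: by end_near. Qed.

(** A continuous version of [1 / l^2], supported in [[-eps, eps]]; the constant [c] removes the
    singularity where the modulus vanishes. *)
Definition yw_density (r eps c x : R) : R :=
  Num.max 0 (1 - `|x| / eps) / (modulus r `|x| ^+ 2 + c).

Lemma yw_density_ge0 r eps c x : 0 < c -> 0 <= yw_density r eps c x.
Proof.
move=> c0; rewrite divr_ge0 ?le_max ?lexx// addr_ge0 ?sqr_ge0// ltW//.
Qed.

Lemma yw_density_continuous r eps c : 0 < r -> 0 < c -> continuous (yw_density r eps c).
Proof.
move=> r0 c0 x; apply: (@cvgM _ _ _ _ (fun x => Num.max 0 (1 - `|x| / eps))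
   (fun x => (modulus r `|x| ^+ 2 + c)^-1)).
  apply: (@continuous_max R R (fun=> 0) (fun x => 1 - `|x| / eps)); first exact: cvg_cst.
  apply: cvgB; first exact: cvg_cst.
  by apply: cvgMl; exact: norm_continuous.
apply: cvgV; first by rewrite gt_eqF// ltr_wpDl// sqr_ge0.
apply: cvgD; last exact: cvg_cst.
apply: (@continuous_comp _ _ _ (fun x => modulus r `|x|) (fun x => x ^+ 2)).
  apply: (@continuous_comp _ _ _ (fun x : R => `|x|) (modulus r)).
    exact: norm_continuous.
  exact: modulus_continuous.
exact: exprn_continuous.
Qed.

Lemma yw_density0 r eps c x : 0 < eps -> eps <= `|x| -> yw_density r eps c x = 0.
Proof.
move=> e0 ex; rewrite /yw_density max_l ?mul0r// subr_le0 ler_pdivlMr// mul1r//.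
Qed.

(** As [c] decreases to 0, monotone convergence brings in the divergent integral of [1 / l^2]. On
    []0, eps / 2]] the cutoff factor is at least 1/2, whence the target [2 * M]. *)
Lemma yw_mass r eps M : 0 < r -> 0 < eps ->
  exists2 c, 0 < c & M <= integ 0 eps (yw_density r eps c).
Proof.
move=> r0 eps0; pose D : set R := `]0, (eps / 2)].
have mD : measurable (D : set (measurableTypeR R)) by exact: measurable_itv.
have mlD : measurable_fun D l.
  apply: measurable_funS ml => // x; rewrite /D /= !in_itv/= andbT => /andP[/ltW//].
pose g (n : nat) u : \bar R := ((l u ^+ 2 + n.+1%:R^-1)^-1)%:E.
have cpos n : 0 < n.+1%:R^-1 :> R by rewrite invr_gt0.
have dpos n u : 0 < l u ^+ 2 + n.+1%:R^-1 by rewrite ltr_wpDl// sqr_ge0.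
have mg n : measurable_fun D (g n).
  apply/measurable_EFinP; apply: (measurable_comp (F := [set: R])
    (f := fun y => (y ^+ 2 + n.+1%:R^-1)^-1)) => //.
  apply: continuous_measurable_fun => y; apply: cvgV.
    by rewrite gt_eqF// ltr_wpDl// sqr_ge0.
  by apply: cvgD; [exact: exprn_continuous|exact: cvg_cst].
have g0 n u : D u -> (0 <= g n u)%E by move=> _; rewrite lee_fin invr_ge0 ltW.
have nd u : D u -> {homo g ^~ u : n m / (n <= m)%N >-> (n <= m)%E}.
  move=> _ n m nm; rewrite lee_fin lef_pV2 ?posrE// lerD2l lef_pV2 ?posrE// ler_nat//.
have := @cvg_monotone_convergence _ _ _ mu D mD g mg g0 nd.
have -> : (\int[mu]_(x in D) limn (g ^~ x) = +oo)%E.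
  rewrite -(l_div (divr_gt0 eps0 (ltr0Sn _ 1))); apply: eq_integral => u _.
  have hc : l u ^+ 2 + n.+1%:R^-1 @[n --> \oo] --> l u ^+ 2.
    rewrite -[X in _ --> X]addr0; apply: cvgD; first exact: cvg_cst.
    exact: cvg_harmonic.
  apply: cvg_lim => //; have [lu|lu] := eqVneq (l u ^+ 2) 0.
    rewrite /inve lu eqxx /g; under eq_fun do rewrite lu add0r invrK.
    by apply/cvgeryP; rewrite (cvg_shiftS (fun n => n%:R : R)); exact: cvgr_idn.
  rewrite /inve (negbTE lu); apply: cvg_EFin; first exact: nearW.
  by apply: cvgV.
move=> /cvgeyPge /(_ (2 * M)) [n _ /(_ n (leqnn n)) /= hn].
exists n.+1%:R^-1; first exact: cpos.
set c := n.+1%:R^-1; have c0 : 0 < c := cpos n; set psi := yw_density r eps c.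
have Ip : intble 0 eps psi by apply/intble_continuous/yw_density_continuous.
rewrite -lee_fin /integ /Rintegral fineK; last exact: integrable_fin_num.
have mpsi : measurable_fun setT psi.
  by apply: continuous_measurable_fun; exact: yw_density_continuous.
apply: (@le_trans _ _ (\int[mu]_(x in D) (psi x)%:E)%E); last first.
  apply: ge0_subset_integral => //.
  - apply/measurable_EFinP; exact: measurable_funTS.
  - by move=> x _; rewrite lee_fin yw_density_ge0.
  - move=> x; rewrite /D /= !in_itv/= => /andP[/ltW -> h]/=; lra.
apply: (@le_trans _ _ (\int[mu]_(x in D) ((2^-1)%:E * g n x))%E).
  rewrite (@ge0_integralZl _ _ _ mu D mD (g n) (mg n) _ (g0 n))//.
  apply: (@le_trans _ _ ((2^-1)%:E * (2 * M)%:E)%E); last by apply: lee_wpmul2l.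
  by rewrite -EFinM mulrA mulVf// mul1r.
apply: ge0_le_integral => //.
- by move=> x Dx; rewrite mule_ge0// g0.
- by apply: measurable_funeM; exact: mg.
- by apply/measurable_EFinP; exact: measurable_funTS.
- move=> x; rewrite /D /= in_itv/= => /andP[x0 xe].
  rewrite lee_fin /psi /yw_density ger0_norm ?(ltW x0)//.
  have h1 : 2^-1 <= Num.max 0 (1 - x / eps).
    rewrite le_max; apply/orP; right; rewrite lerBrDr -lerBrDl ler_pdivrMr//; lra.
  apply: ler_pM => //; first by rewrite invr_ge0 ltW.
  have m0 : 0 <= modulus r x.
    by rewrite (le_trans _ (@modulus_ge r x 0 _))// normr0 ltW.
  have ml' : modulus r x <= l x.
    apply: modulus_le => // y _; rewrite (le_trans (s0l _ _))// [_ + x]addrC addrK ger0_norm// ltW//.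
  rewrite lef_pV2 ?posrE ?dpos//; last by rewrite ltr_wpDl// sqr_ge0.
  by rewrite lerD2r lerXn2r ?nnegrE// l0// ltW.
Qed.

(** [f2] is the density divided by its mass [I >= 1 / h] on [[0, h]]. Hence its primitive [f1] is
    odd, bounded by 1 and equal to 1 beyond [h], which gives [f x >= |x| - h]. The denominator of
    the density dominates [(s0 x - s0 y)^2], so the second order term is at most [1 / I <= h]. *)
Lemma yamada_watanabe_modulus : yamada_watanabe s0.
Proof.
move=> r h r0 h0.
have [c c0 hI] := yw_mass h^-1 r0 h0.
set psi := yw_density r h c in hI.
set I := integ 0 h psi in hI.
have I0 : 0 < I by rewrite (lt_le_trans _ hI)// invr_gt0.
pose f2 x := psi x / I.
pose f1 := oriented_integral f2.
pose f := oriented_integral f1.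
have cpsi : continuous psi by exact: yw_density_continuous.
have cf2 : continuous f2 by move=> x; apply: cvgMl; exact: cpsi.
have psi0 x : 0 <= psi x by exact: yw_density_ge0.
have f20 x : 0 <= f2 x by rewrite divr_ge0// ltW.
have df1 : forall x : R, is_derive x (1 : R) f1 (f2 x) by exact: oriented_integral_derive.
have cf1 : continuous f1 by exact: derive_continuous df1.
have df : forall x : R, is_derive x (1 : R) f (f1 x) by exact: oriented_integral_derive.
have or0 g : oriented_integral g 0 = 0 :> R by rewrite oriented_ge0// integ_refl.
have f10 : f1 0 = 0 by exact: or0.
have f0 : f 0 = 0 by exact: or0.
have f2E x : f2 (- x) = f2 x by rewrite /f2 /psi /yw_density normrN.
have dN (g g' : R -> R) : (forall x : R, is_derive x (1 : R) g (g' x)) ->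
    forall x : R, is_derive x (1 : R) (fun y => g (- y)) (- g' (- x)).
  move=> dg x; rewrite -mulrN1.
  exact: (@is_derive1_comp _ g (fun y => - y)).
have f1N x : f1 (- x) = - f1 x.
  have d (x0 : R) : is_derive x0 (1 : R) (fun y => f1 (- y) + f1 y) 0.
    have := is_deriveD (dN _ _ df1 x0) (df1 x0).
    by rewrite f2E addNr.
  apply/eqP; rewrite -subr_eq0 opprK; apply/eqP.
  by have := is_derive_0_is_cst x 0 d; rewrite /= oppr0 f10 addr0.
have fN x : f (- x) = f x.
  have d (x0 : R) : is_derive x0 (1 : R) (fun y => f (- y) - f y) 0.
    have := is_deriveB (dN _ _ df x0) (df x0).
    by rewrite f1N opprK subrr.
  apply/eqP; rewrite -subr_eq0; apply/eqP.
  by have := is_derive_0_is_cst x 0 d; rewrite /= oppr0 f0 subr0.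
have f1h : f1 h = 1.
  rewrite /f1 oriented_ge0 ?ltW// -(@divff _ I) ?gt_eqF//.
  rewrite /f2; under [X in integ _ _ X]eq_fun do rewrite mulrC.
  by rewrite (integZ _ (intble_continuous 0 h cpsi)) -/I mulrC.
have f1mono x y : x <= y -> f1 x <= f1 y.
  move=> xy; rewrite -subr_ge0; have [z _ ->] := mean_value df1 x y.
  by rewrite mulr_ge0// subr_ge0.
have f1big x : h <= x -> f1 x = 1.
  move=> hx; have x0 : 0 <= x by rewrite (le_trans (ltW h0)).
  have e y : 0 <= y -> f1 y = integ 0 y f2 by exact: oriented_ge0.
  rewrite (e _ x0) (integ_add (ltW h0) hx (intble_continuous 0 x cf2)) -e ?ltW// f1h.
  rewrite [X in _ + X](_ : _ = integ h x (fun=> 0)); first by rewrite integ_cst// mul0r addr0.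
  apply: eq_integ => y /andP[hy _]; rewrite /f2 /psi yw_density0 ?mul0r//.
  by rewrite (le_trans hy)// ler_norm.
have f1b x : `|f1 x| <= 1.
  have p y : 0 <= y -> 0 <= f1 y <= 1.
    move=> y0; rewrite -{1}f10 f1mono//=.
    have [yh|/ltW yh] := leP y h; last by rewrite f1big.
    by rewrite -f1h f1mono.
  have [x0|/ltW x0] := leP 0 x.
    by have /andP[? ?] := p _ x0; rewrite ger0_norm.
  have /andP[a b] : 0 <= f1 (- x) <= 1 by rewrite p// oppr_ge0.
  by rewrite -normrN -f1N ger0_norm.
have fpos x : 0 <= x -> 0 <= f x.
  move=> x0; rewrite /f oriented_ge0//; apply: integ_ge0 => y /andP[y0 _].
  by rewrite -f10 f1mono.
have [B hB] : exists B, forall x, `|f2 x| <= B.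
  have [M [_ hM]] := @compact_bounded _ _ _
    (continuous_compact (continuous_subspaceT cf2) (@segment_compact R (- h) h)).
  exists (Num.max (M + 1) 0) => x; have [xh|/ltW xh] := leP `|x| h.
    rewrite le_max; apply/orP; left.
    apply: (hM (M + 1)); first by rewrite ltrDl.
    by exists x => //=; rewrite in_itv/= -ler_norml.
  by rewrite /f2 /psi yw_density0// mul0r normr0 le_max lexx orbT.
have uc e : 0 < e -> exists2 dl : R, 0 < dl & forall x y, `|x - y| <= dl -> `|f2 x - f2 y| <= e.
  move=> e0; pose A := h + 1.
  have [dl dl0 hd] := itv_unif_cont (@continuous_subspaceT _ _ `[- A, A] _ cf2) e0.
  exists (Num.min (dl / 2) 1); first by rewrite lt_min divr_gt0/=.
  move=> x y; rewrite le_min => /andP[xy xy1].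
  have [hx|/ltW hx] := leP `|x| A; have [hy|/ltW hy] := leP `|y| A.
  - apply/ltW/hd; rewrite -?ler_norml// (le_lt_trans xy)//; lra.
  - have : h <= `|x|.
      have -> : x = y + (x - y) by ring.
      have := ler_normB (y + (x - y)) (x - y); rewrite addrK /A in hy *; lra.
    move=> hx'; rewrite /f2 /psi !yw_density0// ?mul0r ?subrr ?normr0 ?ltW//.
    by rewrite (lt_le_trans _ hy)// ltrDl.
  - have : h <= `|y|.
      have -> : y = x - (x - y) by ring.
      have := ler_normD (x - (x - y)) (x - y); rewrite subrK /A in hx *; lra.
    move=> hy'; rewrite /f2 /psi !yw_density0// ?mul0r ?subrr ?normr0 ?ltW//.
    by rewrite (lt_le_trans _ hx)// ltrDl.
  - have hA : h < A by rewrite ltrDl.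
    rewrite /f2 /psi !yw_density0// ?mul0r ?subrr ?normr0 ?ltW//.
      exact: lt_le_trans hy.
    exact: lt_le_trans hx.
exists f, f1, f2, (Num.max B 1); split.
- apply: taylor_smooth2 => //.
  + by move=> x; rewrite le_max f1b orbT.
  + by move=> x; rewrite le_max hB.
- split => // x; wlog x0 : x / 0 <= x => [W|].
    have [x0|/ltW x0] := leP 0 x; first exact: W.
    by rewrite -normrN -fN; apply: W; rewrite oppr_ge0.
  rewrite ger0_norm//; have [xh|/ltW xh] := leP x h.
    by rewrite (le_trans _ (fpos _ x0))// subr_le0.
  rewrite /f oriented_ge0// (integ_add (ltW h0) xh); last exact: intble_continuous.
  have p1 : 0 <= integ 0 h f1.
    by apply: integ_ge0 => y /andP[y0 _]; rewrite -f10 f1mono.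
  have -> : integ h x f1 = integ h x (fun=> 1).
    by apply: eq_integ => y /andP[hy _]; exact: f1big.
  by rewrite integ_cst// mul1r; lra.
- exact: f1b.
- move=> x y xr yr.
  wlog xy : x y xr yr / y <= x => [W|].
    have [xy|/ltW xy] := leP y x; first exact: W.
    have -> : x - y = - (y - x) by ring.
    have -> : (s0 x - s0 y) ^+ 2 = (s0 y - s0 x) ^+ 2 by ring.
    by rewrite f2E; exact: W.
  have d0 : 0 <= x - y by rewrite subr_ge0.
  have hm : `|s0 x - s0 y| <= modulus r `|x - y|.
    by have := modulus_ge (x - y) yr; rewrite [y + _]addrC subrK (ger0_norm d0).
  rewrite /f2 /psi /yw_density.
  set m := modulus r _ in hm *; set k := Num.max 0 _.
  have k1 : 0 <= k <= 1.
    rewrite /k le_max lexx/= ge_max ler01/= lerBlDr lerDl divr_ge0// ltW//.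
  have hs : (s0 x - s0 y) ^+ 2 <= m ^+ 2 + c.
    rewrite -real_normK ?num_real// (@le_trans _ _ (m ^+ 2)) ?lerDl ?(ltW c0)//.
    by rewrite lerXn2r ?nnegrE// (le_trans _ hm).
  have mc : 0 < m ^+ 2 + c by rewrite ltr_wpDl// sqr_ge0.
  rewrite (@le_trans _ _ (I^-1))//.
    have -> : k / (m ^+ 2 + c) / I * (s0 x - s0 y) ^+ 2 = k * ((s0 x - s0 y) ^+ 2 / (m ^+ 2 + c)) / I by ring.
    case/andP: k1 => k0 k1.
    rewrite -[leRHS]mul1r ler_wpM2r ?invr_ge0 ?(ltW I0)//.
    rewrite mulr_ile1// ?divr_ge0 ?sqr_ge0 ?(ltW mc)// ler_pdivrMr// mul1r//.
  by rewrite -[leRHS]invrK lef_pV2 ?posrE ?invr_gt0.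
- exact: uc.
Qed.

End yamada_watanabe_functions.

(** * Drifts depending on the past *)

Section borel_functional_path.
Context {R : realType}.
Variables (T : R).
Hypothesis T0 : 0 < T.

(** Makes the curve of stopped paths defined for all real times, so that it stays in [Lambda T]
    everywhere. *)
Definition clamp (s : R) : R := Num.max 0 (Num.min s T).

Lemma clamp_itv s : 0 <= clamp s <= T.
Proof. by rewrite /clamp le_max lexx/= ge_max ge_min lexx orbT (ltW T0). Qed.

Lemma clamp_id s : 0 <= s <= T -> clamp s = s.
Proof. by move=> /andP[s0 sT]; rewrite /clamp min_l// max_r. Qed.

Lemma clamp_lip s t : `|clamp s - clamp t| <= `|s - t|.
Proof.
have min_lip (x y z : R) : `|Num.min x z - Num.min y z| <= `|x - y|.
  by case: (leP x z); case: (leP y z) => h1 h2; rewrite ?ler_norml; case: (ger0P (x - y)) => h3; apply/andP; split; lra.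
have max_lip (x y z : R) : `|Num.max z x - Num.max z y| <= `|x - y|.
  by case: (leP z x); case: (leP z y) => h1 h2; rewrite ?ler_norml; case: (ger0P (x - y)) => h3; apply/andP; split; lra.
exact: le_trans (max_lip _ _ _) (min_lip _ _ _).
Qed.

Lemma min_dist (x y z : R) : `|Num.min z x - Num.min z y| <= `|x - y|.
Proof.
by case: (leP z x); case: (leP z y) => h1 h2; rewrite ?ler_norml; case: (ger0P (x - y)) => h3; apply/andP; split; lra.
Qed.

Lemma clamp_continuous : continuous clamp.
Proof.
move=> s; apply: (@continuous_max R R (fun=> 0) (fun s => Num.min s T)); first exact: cvg_cst.
by apply: (@continuous_min R R id (fun=> T)); [exact: cvg_id|exact: cvg_cst].
Qed.

Lemma stop_in s t : 0 <= s <= T -> 0 <= t <= T -> 0 <= Num.min t s <= T.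
Proof.
by move=> /andP[s0 sT] /andP[t0 tT]; rewrite le_min t0 s0/= ge_min tT.
Qed.

Lemma continuous_path_eps (z : R -> R) :
  (forall s, 0 <= s <= T -> forall e, 0 < e -> exists2 dl, 0 < dl &
    forall t, 0 <= t <= T -> `|t - s| < dl -> `|z t - z s| < e) ->
  {within `[0, T], continuous z}.
Proof.
move=> h; apply/subspace_continuousP => s; rewrite /= in_itv/= => sT.
apply/cvgrPdist_lt => e e0; have [dl dl0 hd] := h s sT e e0.
have := near_dist s dl0; rewrite /nbhs/= /within/=; apply: filterS => t st.
by rewrite in_itv/= => tT; rewrite distrC; apply: hd; rewrite // distrC.
Qed.

Lemma continuous_stop (z : R -> R) s : 0 <= s <= T -> {within `[0, T], continuous z} ->
  {within `[0, T], continuous (stop s z)}.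
Proof.
move=> sT cz; apply: continuous_path_eps => t tT e e0.
have [dl dl0 h] := within_itv_cvg cz (stop_in sT tT) e0.
exists dl => // u uT ut; apply: h; first exact: stop_in.
by apply: le_lt_trans ut; rewrite ![Num.min _ s]minC; exact: min_dist.
Qed.

Lemma stop_Lambda (z : R -> R) s : 0 <= s <= T -> {within `[0, T], continuous z} ->
  Lambda T (s, stop s z).
Proof.
move=> sT cz; split => //=; first exact: continuous_stop.
by move=> t _; rewrite /stop -minA minxx.
Qed.

(** Moving the stopping time by less than [dl] changes the stopped path, uniformly, by at most the
    oscillation of [z] over distances below [dl]. *)
Lemma stopped_path_continuous (z : R -> R) : {within `[0, T], continuous z} ->
  continuous (fun s : R => (clamp s, stop (clamp s) z) : time_path T).
Proof.
move=> cz s.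
apply: (@cvg_pair _ _ {uniform` `[0, T]%classic -> R} (nbhs s) (nbhs (clamp s))
  (nbhs (stop (clamp s) z : {uniform` `[0, T]%classic -> R})) _ _ _
  clamp (fun s => stop (clamp s) z)); first exact: clamp_continuous.
move=> A /uniform_nbhs [E [entE EA]].
move: entE; rewrite -entourage_ballE => -[e /= e0 eE].
have [dl dl0 h] := itv_unif_cont cz e0.
have := near_dist s dl0; apply: filterS => s' ss'; apply: EA => t; rewrite /= in_itv/= => tT.
apply: eE; rewrite /ball/=; apply: h; try by apply: stop_in => //; exact: clamp_itv.
by apply: (le_lt_trans (min_dist _ _ _)); exact: le_lt_trans (clamp_lip _ _) ss'.
Qed.

(** The curve of stopped paths is continuous and stays in [Lambda T], so it pulls Borel subsets of
    [Lambda T] back to Borel sets of times. *)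
Lemma borel_functional_path (Gamma : R -> (R -> R) -> R) (z : R -> R) :
  borel_functional T Gamma -> {within `[0, T], continuous z} ->
  measurable_fun `[0, T] (fun s => Gamma s (stop s z)).
Proof.
move=> bG cz; pose io (s : R) : time_path T := (clamp s, stop (clamp s) z).
have ioL s : Lambda T (io s) by apply: stop_Lambda => //; exact: clamp_itv.
have cio : continuous io by exact: stopped_path_continuous.
have key : forall C : set (time_path T),
    <<s Lambda T, [set Lambda T `&` U | U in @open (time_path T)] >> C ->
    measurable (io @^-1` C : set R).
  apply: smallest_sub.
    split.
    - by rewrite /= preimage_set0; exact: measurable0.
    - move=> A mA /=; rewrite (_ : _ @^-1` _ = ~` (io @^-1` A)); first exact: measurableC.
      by apply/seteqP; split=> s; [case|split => //; exact: ioL].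
    - by move=> A mA /=; rewrite preimage_bigcup; exact: bigcupT_measurable.
  move=> _ [U oU <-] /=; rewrite preimage_setI.
  rewrite (_ : io @^-1` Lambda T = setT); last by apply/seteqP; split=> // s _; exact: ioL.
  rewrite setTI; apply: open_measurable.
  by move/continuousP : cio; exact.
move=> mT B mB; have := key _ (bG B mB) => mI.
rewrite (_ : _ `&` _ = `[0, T] `&` (io @^-1` (Lambda T `&` [set p | B (Gamma p.1 p.2)]))).
  exact: measurableI.
apply/seteqP; split => s [sT]; rewrite /= in_itv/= in sT => Bs; split.
- by rewrite /= in_itv.
- by split; [exact: ioL|rewrite /= clamp_id].
- by rewrite /= in_itv.
- by case: Bs => _ /=; rewrite clamp_id.
Qed.

End borel_functional_path.

(** * Piecewise linear interpolation *)

Section interpolation.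
Context {R : realType}.
Variables (D : R).
Hypothesis D0 : 0 < D.

Definition ramp (x : R) : R := Num.min (Num.max x 0) 1.

Lemma ramp_itv x : 0 <= ramp x <= 1.
Proof. by rewrite /ramp le_min le_max lexx orbT ler01/= ge_min lexx orbT. Qed.

Lemma ramp0 x : x <= 0 -> ramp x = 0.
Proof. by move=> x0; rewrite /ramp max_r// min_l. Qed.

Lemma ramp1 x : 1 <= x -> ramp x = 1.
Proof. by move=> x1; rewrite /ramp max_l ?min_r// (le_trans _ x1). Qed.

Lemma ramp_continuous : continuous ramp.
Proof.
move=> x; apply: (@continuous_min R R (fun x => Num.max x 0) (fun=> 1)); last exact: cvg_cst.
by apply: (@continuous_max R R id (fun=> 0)); [exact: cvg_id|exact: cvg_cst].
Qed.

(* The piecewise linear path through (i * D, u i), i <= j, frozen after time j * D. *)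
Definition lin (j : nat) (u : nat -> R) (r : R) : R :=
  u 0 + \sum_(i < j) (u i.+1 - u i) * ramp (r / D - i%:R).

Lemma linS j u r : lin j.+1 u r = lin j u r + (u j.+1 - u j) * ramp (r / D - j%:R).
Proof. by rewrite /lin big_ord_recr /= addrA. Qed.

Lemma lin_continuous j u : continuous (lin j u).
Proof.
elim: j => [|j ih] r.
  rewrite (_ : lin 0 u = fun=> u 0); first exact: cvg_cst.
  by apply/funext => ?; rewrite /lin big_ord0 addr0.
have c1 : ramp (x / D - j%:R) @[x --> r] --> ramp (r / D - j%:R).
  apply: continuous_cvg; first exact: ramp_continuous.
  by apply: cvgB; [exact: cvgMl|exact: cvg_cst].
rewrite (funext (linS j u)); apply: cvgD; first exact: ih.
exact: cvgMr.
Qed.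

Lemma lin_after j u r : j%:R * D <= r -> lin j u r = u j.
Proof.
move=> jr; rewrite /lin (eq_bigr (fun i : 'I_j => u i.+1 - u i)) => [|i _].
  by rewrite -(big_mkord xpredT (fun i => u i.+1 - u i)) telescope_sumr// addrC subrK.
rewrite ramp1 ?mulr1// lerBrDr addrC natr1 ler_pdivlMr// (le_trans _ jr)//.
by rewrite (ler_wpM2r (ltW D0))// ler_nat.
Qed.

Lemma lin_before j u r : r <= j%:R * D -> lin j.+1 u r = lin j u r.
Proof. by move=> rj; rewrite linS ramp0 ?mulr0 ?addr0// subr_le0 ler_pdivrMr. Qed.

Lemma lin_cell j u r : j%:R * D <= r -> exists2 th, 0 <= th <= 1 &
  lin j.+1 u r = (1 - th) * u j + th * u j.+1.
Proof.
move=> jr; exists (ramp (r / D - j%:R)); first exact: ramp_itv.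
by rewrite linS lin_after//; ring.
Qed.

Lemma linB j u v r : lin j u r - lin j v r = lin j (fun i => u i - v i) r.
Proof.
rewrite /lin opprD addrACA -sumrB; congr (_ + _).
by apply: eq_bigr => i _; ring.
Qed.

Lemma lin0 j r : lin j (fun=> 0) r = 0.
Proof. by rewrite /lin big1 ?addr0// => i _; rewrite subrr mul0r. Qed.

(** On a cell the interpolation is a convex combination of its end values, so that the cell
    contributes at most [D (|u i| + |u i.+1|)]. *)
Lemma integ_lin j u : integ 0 (j%:R * D) (fun r => `|lin j u r|) <=
  D * (2 * \sum_(i < j) `|u i| + `|u j|).
Proof.
have cn k a b v : intble a b (fun r => `|lin k v r|).
  apply: intble_continuous => r; apply: (@continuous_comp _ _ _ (lin k v) (fun x : R => `|x|)).
    exact: lin_continuous.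
  exact: norm_continuous.
elim: j => [|j ih].
  by rewrite mul0r integ_refl big_ord0 mulr0 add0r mulr_ge0// ltW.
have e1 : 0 <= j%:R * D by rewrite mulr_ge0// ltW.
have e2 : j%:R * D <= j.+1%:R * D by rewrite (ler_wpM2r (ltW D0))// ler_nat.
have e3 : j.+1%:R * D - j%:R * D = D by rewrite -natr1; ring.
rewrite (integ_add e1 e2)//.
have -> : integ 0 (j%:R * D) (fun r => `|lin j.+1 u r|) = integ 0 (j%:R * D) (fun r => `|lin j u r|).
  by apply: eq_integ => r /andP[_ rj]; rewrite lin_before.
have : integ (j%:R * D) (j.+1%:R * D) (fun r => `|lin j.+1 u r|) <= (`|u j| + `|u j.+1|) * D.
  rewrite -[X in _ <= _ * X]e3 -integ_cst//; apply: le_integ => //.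
    exact: intble_cst.
  move=> r /andP[jr _]; have [th /andP[th0 th1] ->] := lin_cell u jr.
  rewrite (le_trans (ler_normD _ _))// !normrM lerD//.
    by rewrite ger0_norm ?subr_ge0// ler_piMl// gerBl.
  by rewrite ger0_norm// ler_piMl.
rewrite big_ord_recr/=; move: ih; set S := \sum_(i < j) _; nra.
Qed.

(** The interpolation at [r] averages values of [eta] taken at grid points within [D] of [r]. The
    cell after [j * D], where the interpolation is frozen, is included. *)
Lemma lin_close j (u : nat -> R) (eta : R -> R) (om : R) :
  (forall i, (i <= j)%N -> u i = eta (i%:R * D)) ->
  (forall i r, (i <= j)%N -> `|r - i%:R * D| <= D -> 0 <= r -> r <= j.+1%:R * D ->
     `|eta r - eta (i%:R * D)| <= om) ->
  forall r, 0 <= r <= j.+1%:R * D -> `|lin j u r - eta r| <= om.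
Proof.
elim: j => [|j ih] hu ho r /andP[r0 rj].
  rewrite /lin big_ord0 addr0 hu// distrC ho//.
  by rewrite mul0r subr0 ger0_norm//; move: rj; rewrite mul1r.
have [rj1|jr1] := leP r (j%:R * D).
  rewrite lin_before// ih//.
  - by move=> i ij; apply: hu; exact: leqW.
  - move=> i r' ij h1 h2 h3; apply: ho => //; first exact: leqW.
    by rewrite (le_trans h3)// (ler_wpM2r (ltW D0))// ler_nat.
  - by rewrite r0 (le_trans rj1)// (ler_wpM2r (ltW D0))// ler_nat.
have [rj2|jr2] := leP r (j.+1%:R * D); last first.
  rewrite (lin_after _ (ltW jr2)) hu// distrC ho// ger0_norm ?subr_ge0; last exact: ltW.
  by move: rj; rewrite -[j.+2%:R]natr1; lra.
have [th /andP[th0 th1] ->] := lin_cell u (ltW jr1).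
have h1 : `|eta r - eta (j%:R * D)| <= om.
  apply: ho => //; rewrite ger0_norm ?subr_ge0; last exact: ltW.
  by move: rj2; rewrite -[j.+1%:R]natr1; lra.
have h2 : `|eta r - eta (j.+1%:R * D)| <= om.
  apply: ho => //; rewrite ler0_norm ?subr_le0//.
  by move: jr1; rewrite -[j.+1%:R]natr1; lra.
rewrite !hu//.
have -> : (1 - th) * eta (j%:R * D) + th * eta (j.+1%:R * D) - eta r =
  (1 - th) * - (eta r - eta (j%:R * D)) + th * - (eta r - eta (j.+1%:R * D)) by ring.
rewrite (le_trans (ler_normD _ _))// !normrM !normrN (ger0_norm th0) ger0_norm ?subr_ge0//.
have -> : om = (1 - th) * om + th * om by ring.
by rewrite lerD// ler_wpM2l// subr_ge0.
Qed.

End interpolation.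

Section lipschitz_measurable.
Context {R : realType} {Om : pointedType}.

(* A Lipschitz function of finitely many variables exceeds [a] at [u] if and only if,
   at some rational point, it does so with a margin controlling the distance to [u]. *)
Lemma meas_wrt_lipschitz (G : set (set Om)) (j : nat) (g : (nat -> R) -> R)
  (U : nat -> Om -> R) (L : R) : sigma_algebra setT G -> 0 < L ->
  (forall u v, `|g u - g v| <= L * \sum_(i < j.+1) `|u i - v i|) ->
  (forall i, (i <= j)%N -> meas_wrt G (U i)) ->
  meas_wrt G (fun w => g (U ^~ w)).
Proof.
move=> sG L0 gL mU.
pose ext (q : {ffun 'I_j.+1 -> rat}) (i : nat) : R := ratr (q (inord i)).
apply: (meas_wrt_gt sG) => a.
rewrite (_ : [set w | _] = \bigcup_(q in [set: {ffun 'I_j.+1 -> rat}])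
  [set w | a < g (ext q) - L * \sum_(i < j.+1) `|U i w - ext q i|]).
  apply: (sa_bigcup_count sG) => q _; apply: (sa_lt sG); first exact: (meas_cst sG).
  apply: (measB sG); first exact: (meas_cst sG).
  apply: (measZ sG).
  apply: (@meas_sum_ord _ _ _ sG j.+1 (fun i w => `|U i w - ext q i|)) => i ij.
  apply: meas_norm; apply: (measB sG); last exact: (meas_cst sG).
  exact: mU.
apply/seteqP; split=> w /=.
  (* Rational points within [e] of each of the [j.+1] coordinates cost a quarter of the margin in
     [g] and another quarter in the penalty. *)
  move=> aw; pose e := (g (U ^~ w) - a) / (4 * L * j.+1%:R).
  have j0 : 0 < j.+1%:R :> R by [].
  have e0 : 0 < e by rewrite divr_gt0 ?subr_gt0// !mulr_gt0.
  have hq (i : 'I_j.+1) : exists q : rat, `|U i w - ratr q| <= e.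
    have : U i w - e < U i w + e by lra.
    move=> /rat_in_itvoo[q]; rewrite in_itv/= => /andP[q1 q2]; exists q.
    by rewrite ler_norml; apply/andP; split; lra.
  pose q := [ffun i : 'I_j.+1 => sval (cid (hq i))].
  have hq' (i : 'I_j.+1) : `|U i w - ext q i| <= e.
    by rewrite /ext inord_val ffunE; case: cid.
  exists q => //=.
  have hs : \sum_(i < j.+1) `|U i w - ext q i| <= j.+1%:R * e.
    rewrite (le_trans (ler_sum _ (fun i _ => hq' i)))//.
    by rewrite big_const_ord iter_addr_0 mulr_natl.
  have hL : L * \sum_(i < j.+1) `|U i w - ext q i| <= (g (U ^~ w) - a) / 4.
    have -> : (g (U ^~ w) - a) / 4 = L * (j.+1%:R * e).
      by rewrite /e; field; rewrite gt_eqF//= gt_eqF.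
    by rewrite ler_wpM2l// ltW.
  have := gL (U ^~ w) (ext q); rewrite ler_norml => /andP[h1 h2].
  have : 0 < g (U ^~ w) - a by rewrite subr_gt0.
  lra.
move=> [q _ /=]; have := gL (U ^~ w) (ext q); rewrite ler_norml => /andP[h1 h2].
lra.
Qed.

End lipschitz_measurable.

(** * Lipschitz drifts with memory and their integrals over grid cells *)

Section drift.
Context {R : realType}.

(** [B] takes whole paths as arguments, but [drift_lip] forces [B s] to depend only on the path up
    to time [s]: this makes the drift nonanticipative. *)
Record drift (T K K0 : R) (B : R -> (R -> R) -> R) : Prop := Drift {
  drift_lip : forall s e1 e2, 0 <= s <= T ->
    {within `[0, T], continuous e1} -> {within `[0, T], continuous e2} ->
    `|B s e1 - B s e2| <= K * (`|e1 s - e2 s| + integ 0 s (fun r => `|e1 r - e2 r|));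
  drift_meas : forall e, {within `[0, T], continuous e} -> measurable_fun `[0, T] (B ^~ e);
  drift_bnd : forall s, 0 <= s <= T -> `|B s (fun=> 0)| <= K0 }.

Variables (T K K0 : R) (B : R -> (R -> R) -> R).
Hypothesis T0 : 0 < T.
Hypothesis K_gt0 : 0 < K.
Hypothesis dB : drift T K K0 B.

Let K00 : 0 <= K0.
Proof.
have h : (0 : R) <= 0 <= T by rewrite lexx ltW.
exact: le_trans (normr_ge0 _) (drift_bnd dB h).
Qed.

Lemma intble_dist s (e1 e2 : R -> R) : s <= T ->
  {within `[0, T], continuous e1} -> {within `[0, T], continuous e2} ->
  intble 0 s (fun r => `|e1 r - e2 r|).
Proof.
move=> sT c1 c2; apply: (@intble_sub _ 0 T) => //.
by apply/intble_norm/intbleB; exact: intble_cont.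
Qed.

Lemma drift_dist s (e1 e2 : R -> R) om : 0 <= s <= T ->
  {within `[0, T], continuous e1} -> {within `[0, T], continuous e2} ->
  (forall r, 0 <= r <= s -> `|e1 r - e2 r| <= om) ->
  `|B s e1 - B s e2| <= K * (1 + T) * om.
Proof.
move=> sT c1 c2 h; have /andP[s0 sT'] := sT.
have om0 : 0 <= om by apply: le_trans (h 0 _); rewrite // lexx s0.
rewrite (le_trans (drift_lip dB sT c1 c2))// -mulrA (ler_wpM2l (ltW K_gt0))//.
have h1 : `|e1 s - e2 s| <= om by apply: h; rewrite s0 lexx.
have h2 : integ 0 s (fun r => `|e1 r - e2 r|) <= om * s.
  rewrite -[s in X in _ <= X]subr0 -integ_cst//.
  by apply: le_integ h; [exact: intble_dist|exact: intble_cst].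
have : om * s <= om * T by rewrite ler_wpM2l.
lra.
Qed.

Let cst_cont : {within `[0, T], continuous (fun=> 0 : R)}.
Proof. by apply: continuous_subspaceT => x; exact: cvg_cst. Qed.

Lemma drift_bound s (e : R -> R) M : 0 <= s <= T -> {within `[0, T], continuous e} ->
  (forall r, 0 <= r <= s -> `|e r| <= M) -> `|B s e| <= K0 + K * (1 + T) * M.
Proof.
move=> sT ce h; have := @drift_dist s e (fun=> 0) M sT ce cst_cont.
move=> /(_ _) h1; have {}h1 := h1 (fun r hr => ltac:(by rewrite subr0; exact: h)).
have -> : B s e = B s (fun=> 0) + (B s e - B s (fun=> 0)) by ring.
by rewrite (le_trans (ler_normD _ _))// lerD// (drift_bnd dB).
Qed.

Lemma cont_bounded (e : R -> R) : {within `[0, T], continuous e} ->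
  exists2 M, 0 <= M & forall r, 0 <= r <= T -> `|e r| <= M.
Proof.
move=> ce; have [M [_ hM]] := @compact_bounded _ _ _
  (continuous_compact ce (@segment_compact R 0 T)).
exists (Num.max (M + 1) 0); first by rewrite le_max lexx orbT.
move=> x xT; rewrite le_max; apply/orP; left.
apply: (hM (M + 1)); first by rewrite ltrDl.
by exists x.
Qed.

Lemma drift_intble (e : R -> R) a b : {within `[0, T], continuous e} -> 0 <= a -> b <= T ->
  intble a b (B ^~ e).
Proof.
move=> ce a0 bT; apply: (@intble_sub _ 0 T) => //.
have [M M0 hM] := cont_bounded ce.
apply: (@intble_bnd _ _ _ _ (K0 + K * (1 + T) * M)); first exact: (drift_meas dB).
move=> s sT; apply: drift_bound => // r /andP[r0 rs].
by apply: hM; rewrite r0 (le_trans rs)//; case/andP: sT.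
Qed.

(** The path is interpolated linearly, rather than by steps, because the drift is controlled on
    continuous paths. The interpolation stops at index [j], so that the value depends on
    [u 0, ..., u j] alone. *)
Definition gdrift (D : R) (j : nat) (u : nat -> R) (a b : R) : R :=
  integ a b (B ^~ (lin D j u)).

Definition Kg : R := K * (2 + 2 * T).

Lemma Kg_gt0 : 0 < Kg.
Proof. by rewrite mulr_gt0// addr_gt0// mulr_gt0. Qed.

Variables (D : R) (j : nat) (a b : R).
Hypothesis D0 : 0 < D.
Hypothesis DT : D <= T.
Hypothesis ja : j%:R * D <= a.
Hypothesis ab : a <= b.
Hypothesis bj : b <= j.+1%:R * D.
Hypothesis bT : b <= T.

Let a0 : 0 <= a.
Proof. by rewrite (le_trans _ ja)// mulr_ge0// ltW. Qed.

Let lin_path u : {within `[0, T], continuous (lin D j u)}.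
Proof. by apply: continuous_subspaceT; exact: lin_continuous. Qed.

Lemma gdrift_intble u : intble a b (B ^~ (lin D j u)).
Proof. exact: drift_intble. Qed.

Lemma gdrift_lip u v : `|gdrift D j u a b - gdrift D j v a b| <=
  Kg * (b - a) * (`|u j - v j| + D * \sum_(i < j) `|u i - v i|).
Proof.
set S := \sum_(i < j) _.
have S0 : 0 <= S by apply: sumr_ge0.
rewrite mulrAC; apply: integ_dist_le => //; try exact: gdrift_intble.
move=> s /andP[sa sb].
have js : j%:R * D <= s by exact: le_trans sa.
have s0 : 0 <= s by exact: le_trans sa.
have sT : s <= T by exact: le_trans bT.
have sT' : 0 <= s <= T by rewrite s0.
rewrite (le_trans (drift_lip dB sT' (@lin_path u) (@lin_path v)))// /Kg -mulrA.
rewrite (ler_wpM2l (ltW K_gt0))//.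
rewrite !lin_after//.
rewrite (_ : (fun r => _) = (fun r => `|lin D j (fun i => u i - v i) r|)); last first.
  by apply/funext => r; rewrite linB.
rewrite (@integ_add _ 0 (j%:R * D))//; last 2 first.
- by rewrite mulr_ge0// ltW.
- apply/intble_norm/intble_cont/continuous_subspaceT; exact: lin_continuous.
have h1 := integ_lin D0 j (fun i => u i - v i).
have h2 : integ (j%:R * D) s (fun r => `|lin D j (fun i => u i - v i) r|) <= `|u j - v j| * D.
  rewrite (@eq_integ _ _ _ _ (fun=> `|u j - v j|)); last first.
    by move=> r /andP[jr _]; rewrite lin_after.
  rewrite integ_cst// ler_wpM2l//.
  by move: (le_trans sb bj); rewrite -natr1; lra.
move: h1 h2; rewrite -/S; set x := `|u j - v j|; have x0 : 0 <= x by exact: normr_ge0.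
set I1 := integ _ _ _; set I2 := integ _ _ _ => h1 h2.
have h3 : x * D <= x * T by rewrite ler_wpM2l.
have h4 : 0 <= T * (D * S) by rewrite !mulr_ge0// ltW.
lra.
Qed.

Lemma gdrift_growth u : `|gdrift D j u a b| <=
  (b - a) * (K0 + Kg * (`|u j| + D * \sum_(i < j) `|u i|)).
Proof.
have := gdrift_lip u (fun=> 0).
rewrite subr0; under eq_bigr do rewrite subr0.
set S := \sum_(i < j) _ => h.
have h0 : `|gdrift D j (fun=> 0) a b| <= K0 * (b - a).
  rewrite /gdrift (_ : lin D j (fun=> 0) = fun=> 0); last by apply/funext => r; rewrite lin0.
  apply: integ_norm_le => //; first exact: drift_intble.
  by move=> s /andP[sa sb]; apply: (drift_bnd dB); rewrite (le_trans a0)//= (le_trans sb).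
have -> : gdrift D j u a b = gdrift D j (fun=> 0) a b + (gdrift D j u a b - gdrift D j (fun=> 0) a b) by ring.
rewrite (le_trans (ler_normD _ _))//; lra.
Qed.

Lemma gdrift_close (u : nat -> R) (eta : R -> R) om : {within `[0, T], continuous eta} ->
  (forall i, (i <= j)%N -> u i = eta (i%:R * D)) ->
  (forall i r, (i <= j)%N -> `|r - i%:R * D| <= D -> 0 <= r -> r <= b ->
     `|eta r - eta (i%:R * D)| <= om) ->
  `|gdrift D j u a b - integ a b (B ^~ eta)| <= K * (1 + T) * om * (b - a).
Proof.
move=> ce hu ho; apply: integ_dist_le => //; first exact: gdrift_intble.
  exact: drift_intble.
move=> s /andP[sa sb]; have s0 := le_trans a0 sa; have sT := le_trans sb bT.
apply: drift_dist => //; first by rewrite s0.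
move=> r /andP[r0 rs].
(* [lin_close] is applied to the path stopped at [b], so that only times up to [b] matter. *)
have sr : stop b eta r = eta r by rewrite /stop min_l// (le_trans rs).
rewrite -sr; apply: (lin_close D0).
- move=> i ij; rewrite hu// /stop min_l// (le_trans _ (le_trans ja ab))//.
  by rewrite (ler_wpM2r (ltW D0))// ler_nat.
- move=> i r' ij h1 h2 h3; have ib : i%:R * D <= b.
    by rewrite (le_trans _ (le_trans ja ab))// (ler_wpM2r (ltW D0))// ler_nat.
  rewrite /stop (min_l ib); apply: ho => //; last first.
  + by rewrite ge_min lexx orbT.
  + by rewrite le_min h2 (le_trans a0).
  + move: h1; rewrite !ler_norml => /andP[h1 h4].
    by case: (leP r' b) => h5; apply/andP; split; lra.
- by rewrite r0 (le_trans rs)// (le_trans sb).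
Qed.

(** Measurability of the integral comes from its Lipschitz dependence on finitely many coordinates.
    The Lipschitz constant is increased by 1 to be positive even when [a = b]. *)
Lemma gdrift_meas {Om : pointedType} (G : set (set Om)) (U : nat -> Om -> R) :
  sigma_algebra setT G -> (forall i, (i <= j)%N -> meas_wrt G (U i)) ->
  meas_wrt G (fun w => gdrift D j (U ^~ w) a b).
Proof.
move=> sG mU; have Kg0 := Kg_gt0.
apply: (@meas_wrt_lipschitz _ _ G j (fun u => gdrift D j u a b) U (Kg * (b - a) * (1 + D) + 1)) => //.
  have h1 : 0 <= Kg * (b - a) by rewrite mulr_ge0 ?subr_ge0// ltW.
  have := mulr_ge0 h1 (ltW D0); lra.
move=> u v; rewrite (le_trans (gdrift_lip u v))// big_ord_recr/=.
set S := \sum_(i < j) _; have S0 : 0 <= S by apply: sumr_ge0.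
set x := `|u j - v j|; have x0 : 0 <= x by exact: normr_ge0.
set c := Kg * (b - a); have c0 : 0 <= c by rewrite mulr_ge0 ?subr_ge0// ltW.
have := mulr_ge0 c0 S0; have := mulr_ge0 c0 (mulr_ge0 (ltW D0) x0); lra.
Qed.

End drift.

(** * Uniqueness *)

Section rounding.
Context {R : realType}.
Variables (T : R) (N : nat).
Hypothesis T0 : 0 < T.
Hypothesis N0 : (0 < N)%N.
Local Notation D := (T / N%:R).
Local Notation t_ := (gridt T N).

Lemma grid_step_gt0 : 0 < D.
Proof. by rewrite divr_gt0// ltr0n. Qed.

Lemma gridt_itv j : (j <= N)%N -> 0 <= t_ j <= T.
Proof. by move=> jN; rewrite gridt_ge0// gridt_leT. Qed.

(** The left endpoint is left out because simple processes are constant on intervals open on the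
    left. *)
Lemma eq_integ_obnd (a b : R) f g : intble a b f -> intble a b g ->
  (forall x, a < x <= b -> f x = g x) -> integ a b f = integ a b g.
Proof.
move=> If Ig fg.
have h (k : R -> R) : intble a b k -> integ a b k = Rintegral lebesgue_measure `]a, b] k.
  move=> Ik; rewrite /integ -Rintegral_itv_obnd_cbnd//; apply: integrableS Ik => //.
  by apply: subset_itv; rewrite bnd_simp.
by rewrite !h//; apply: eq_Rintegral => x; rewrite inE/= in_itv/=; exact: fg.
Qed.

Lemma sum_integ_cells n f : intble 0 T f -> (n <= N)%N ->
  \sum_(i < n) integ (t_ i) (t_ i.+1) f = integ 0 (t_ n) f.
Proof.
move=> If; elim: n => [|n ih] nN; first by rewrite big_ord0 gridt0 integ_refl.
rewrite big_ord_recr/= ih ?(ltnW nN)// -integ_add ?gridt_ge0//.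
  by apply: gridt_le.
by apply: (intble_sub If) => //; exact: gridt_leT.
Qed.

(** The open cells are disjoint. Applied to the jump times of a simple process, this counts the
    cells on which it is not constant. *)
Lemma count_cells n (x : R) : \sum_(i < n) (t_ i < x < t_ i.+1)%R%:R <= (x < t_ n)%R%:R :> R.
Proof.
elim: n => [|n ih]; first by rewrite big_ord0.
rewrite big_ord_recr/=; have [h1|h1] := ltP x (t_ n).
  have h2 : x < t_ n.+1 by rewrite (lt_le_trans h1)// gridt_le.
  rewrite h2; have -> : (t_ n < x) = false by apply/negbTE; rewrite -leNgt ltW.
  by rewrite addr0 (le_trans ih)// lern1 leq_b1.
have ih' : \sum_(i < n) (t_ i < x < t_ i.+1)%R%:R <= 0 :> R.
  by move: ih; rewrite ltNge h1.
case: (ltP x (t_ n.+1)) => h2; last by rewrite andbF addr0.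
rewrite (le_trans (lerD ih' (lexx _)))// add0r andbT lern1 leq_b1//.
Qed.

Section path.
Variables (W : R -> R) (om : R).
Hypothesis Wom : forall s t, 0 <= s <= T -> 0 <= t <= T -> `|t - s| <= D -> `|W t - W s| <= om.

Lemma round_up j x : (j <= N)%N -> 0 <= x <= T -> exists y, [/\ 0 <= y <= T,
  `|y - Num.min x (t_ j)| <= D &
  \sum_(i < j) (t_ i < x)%R%:R * (W (t_ i.+1) - W (t_ i)) = W y - W 0].
Proof.
move=> + /andP[x0 xT]; elim: j => [|j ih] jN.
  exists 0; split; first by rewrite lexx ltW.
    by rewrite gridt0 min_r// subrr normr0 ltW// grid_step_gt0.
  by rewrite big_ord0 subrr.
have [h|h] := ltP (t_ j) x; last first.
  have [y [yT yx e]] := ih (ltnW jN); exists y; split => //.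
    have h' : x <= t_ j.+1 by rewrite (le_trans h)// gridt_le.
    by rewrite (min_l h'); rewrite (min_l h) in yx.
  by rewrite big_ord_recr/= e ltNge h mul0r addr0.
exists (t_ j.+1); split; first exact: gridt_itv.
  rewrite ger0_norm; last by rewrite subr_ge0 ge_min lexx orbT.
  case: (leP x (t_ j.+1)) => h'; last by rewrite subrr ltW// grid_step_gt0.
  by rewrite gridt_step; lra.
rewrite (eq_bigr (fun i : 'I_j.+1 => W (t_ i.+1) - W (t_ i))).
  by rewrite -(big_mkord xpredT (fun i => W (t_ i.+1) - W (t_ i))) telescope_sumr// gridt0.
move=> i _; rewrite (_ : t_ i < x) ?mul1r//.
by rewrite (le_lt_trans _ h)// gridt_le// -ltnS.
Qed.

Variables (m : nat) (tk xi : nat -> R) (C : R).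
Hypothesis tk0 : 0 <= tk 0.
Hypothesis tkT : tk m <= T.
Hypothesis tkS : forall k, (k < m)%N -> tk k <= tk k.+1.

Lemma tk_mono i k : (i <= k)%N -> (k <= m)%N -> tk i <= tk k.
Proof.
elim: k => [|k ih]; first by rewrite leqn0 => /eqP ->.
rewrite leq_eqVlt => /orP[/eqP ->//|]; rewrite ltnS => ik km.
by rewrite (le_trans (ih ik (ltnW km)))// tkS.
Qed.

Lemma tk_itv k : (k <= m)%N -> 0 <= tk k <= T.
Proof.
move=> km; rewrite (le_trans tk0 (tk_mono (leq0n k) km))/=.
exact: le_trans (tk_mono km (leqnn m)) tkT.
Qed.

(** The value of the simple process just after [t_ i]. The intervals are closed on the left here, so
    that [xi k] is already known at time [tk k <= t_ i] and the sampled integrand is adapted. *)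
Definition grid_xi (i : nat) : R :=
  \sum_(k < m) xi k * (tk k <= t_ i < tk k.+1)%R%:R.

(** Sampling moves both ends of each interval []tk k, tk k.+1]] to the grid, and each end changes
    the value of [W] by at most [om]. *)
Lemma grid_xi_integral j : (j <= N)%N ->
  `|\sum_(k < m) xi k * (W (Num.min (tk k.+1) (t_ j)) - W (Num.min (tk k) (t_ j)))
    - \sum_(i < j) grid_xi i * (W (t_ i.+1) - W (t_ i))|
  <= 2 * om * \sum_(k < m) `|xi k|.
Proof.
move=> jN.
have -> : \sum_(i < j) grid_xi i * (W (t_ i.+1) - W (t_ i)) =
    \sum_(k < m) xi k * \sum_(i < j)
      (tk k <= t_ i < tk k.+1)%R%:R * (W (t_ i.+1) - W (t_ i)).
  under eq_bigr do rewrite /grid_xi mulr_suml.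
  rewrite exchange_big/=; apply: eq_bigr => k _; rewrite mulr_sumr.
  by apply: eq_bigr => i _; rewrite mulrA.
rewrite -sumrB (le_trans (ler_norm_sum _ _ _))// mulr_sumr; apply: ler_sum => k _.
rewrite -mulrBr normrM mulrC ler_wpM2r//.
have km : (k < m)%N := ltn_ord k.
have [y1 [y1T h1 e1]] := round_up jN (tk_itv (ltnW km)).
have [y2 [y2T h2 e2]] := round_up jN (tk_itv km).
have -> : \sum_(i < j) (tk k <= t_ i < tk k.+1)%R%:R * (W (t_ i.+1) - W (t_ i)) = W y2 - W y1.
  have -> : W y2 - W y1 = (W y2 - W 0) - (W y1 - W 0) by ring.
  rewrite -e1 -e2 -sumrB; apply: eq_bigr => i _; rewrite -mulrBl; congr (_ * _).
  have tt := tkS km; case: (ltP (t_ i) (tk k)) => /= h.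
    by rewrite (lt_le_trans h tt) subrr.
  by rewrite subr0.
have w2 : `|W y2 - W (Num.min (tk k.+1) (t_ j))| <= om.
  by apply: Wom => //; apply: stop_in => //; [exact: gridt_itv|exact: tk_itv].
have w1 : `|W y1 - W (Num.min (tk k) (t_ j))| <= om.
  by apply: Wom => //; apply: stop_in => //; [exact: gridt_itv|exact: tk_itv (ltnW km)].
move: w1 w2; rewrite ![Num.min _ (t_ j)]minC.
set a := W y1; set b := W y2; set c := W _; set e := W _.
rewrite !ler_norml => /andP[? ?] /andP[? ?]; apply/andP; split; lra.
Qed.

Hypothesis xiC : \sum_(k < m) `|xi k| <= C.

Let S (s : R) : R := \sum_(k < m) xi k * \1_(`]tk k, tk k.+1]) s.

Lemma grid_xi_bound i : `|grid_xi i| <= C.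
Proof.
rewrite (le_trans _ xiC)// (le_trans (ler_norm_sum _ _ _))//; apply: ler_sum => k _.
by rewrite normrM ler_piMr// ger0_norm// lern1 leq_b1.
Qed.

Lemma grid_xi_good i s : (forall k, (k <= m)%N -> ~~ (t_ i < tk k < t_ i.+1)) ->
  t_ i < s <= t_ i.+1 -> S s = grid_xi i.
Proof.
move=> good /andP[is1 si]; apply: eq_bigr => k _; congr (_ * _).
have km := ltn_ord k.
have g1 := good _ (ltnW km); have g2 := good _ km.
rewrite indicE; congr (nat_of_bool _)%:R.
apply/idP/idP; rewrite inE/= in_itv/=.
  move=> /andP[h1 h2]; apply/andP; split; last exact: lt_le_trans h2.
  rewrite leNgt; apply/negP => h3; move: g1; rewrite h3/= -leNgt => h4.
  by move: (lt_le_trans h1 si); rewrite ltNge h4.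
move=> /andP[h1 h2]; apply/andP; split; first exact: le_lt_trans is1.
apply: (le_trans si); rewrite leNgt; apply/negP => h3; move: g2.
by rewrite h2 h3.
Qed.

Variables (H : R -> R) (q : nat -> R) (om0 Sr : R).
Hypothesis IS : intble 0 T (fun s => (S s - H s) ^+ 2).
Hypothesis IH : intble 0 T H.
Hypothesis IH2 : intble 0 T (fun s => H s ^+ 2).
Hypothesis Hq : forall i s, (i < N)%N -> t_ i <= s <= t_ i.+1 -> `|H s - q i| <= om0.
Hypothesis qS : forall i, (i < N)%N -> `|q i| <= Sr.

(** On a cell without interior jump time the simple process equals its sample, and the square is
    compared with the integral through [H]. The other cells are at most [m.+1] in number, and each
    is bounded crudely by [D (C + Sr)^2]. *)
Lemma grid_xi_square :
  D * \sum_(i < N) (grid_xi i - q i) ^+ 2 <=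
  2 * integ 0 T (fun s => (S s - H s) ^+ 2) + 2 * T * om0 ^+ 2
  + m.+1%:R * D * (C + Sr) ^+ 2.
Proof.
have D0 := grid_step_gt0.
pose bad (i : nat) : R := \sum_(k < m.+1) (t_ i < tk k < t_ i.+1)%R%:R.
have bad0 i : 0 <= bad i by apply: sumr_ge0.
have sb : \sum_(i < N) bad i <= m.+1%:R.
  rewrite exchange_big/=.
  apply: (@le_trans _ _ (\sum_(k < m.+1) (1 : R))); last first.
    by rewrite big_const_ord iter_addr_0.
  by apply: ler_sum => k _; rewrite (le_trans (count_cells _ _))// lern1 leq_b1.
have cell (i : 'I_N) : D * (grid_xi i - q i) ^+ 2 <=
    2 * integ (t_ i) (t_ i.+1) (fun s => (S s - H s) ^+ 2) + 2 * D * om0 ^+ 2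
    + bad i * (D * (C + Sr) ^+ 2).
  have iN := ltn_ord i.
  have tt : t_ i <= t_ i.+1 by exact: gridt_le.
  have dt : t_ i.+1 - t_ i = D by rewrite gridt_step addrC addKr.
  have ti0 : 0 <= t_ i by exact: gridt_ge0.
  have tiT : t_ i.+1 <= T by exact: gridt_leT.
  have I0 : 0 <= integ (t_ i) (t_ i.+1) (fun s => (S s - H s) ^+ 2).
    by apply: integ_ge0 => s _; exact: sqr_ge0.
  have o0 : 0 <= om0 ^+ 2 by exact: sqr_ge0.
  have CS : (grid_xi i - q i) ^+ 2 <= (C + Sr) ^+ 2.
    rewrite -[_ ^+ 2]real_normK ?num_real// lerXn2r ?nnegrE//.
      by rewrite (le_trans (normr_ge0 (grid_xi i - q i)))// (le_trans (ler_normB _ _))// lerD// ?grid_xi_bound ?qS.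
    by rewrite (le_trans (ler_normB _ _))// lerD// ?grid_xi_bound ?qS.
  have DCS : 0 <= D * (C + Sr) ^+ 2 by rewrite mulr_ge0 ?sqr_ge0// ltW.
  have Do : 0 <= D * om0 ^+ 2 by rewrite mulr_ge0// ltW.
  have [/forallP good|/forallPn[k kb]] :=
      boolP [forall k : 'I_m.+1, ~~ (t_ i < tk k < t_ i.+1)]; last first.
    have b1 : 1 <= bad i.
      rewrite /bad (bigD1 k)//= (negbNE kb) lerDl; apply: sumr_ge0 => //.
    have : D * (grid_xi i - q i) ^+ 2 <= D * (C + Sr) ^+ 2 by rewrite (ler_wpM2l (ltW D0)).
    have : D * (C + Sr) ^+ 2 <= bad i * (D * (C + Sr) ^+ 2) by rewrite ler_peMl.
    lra.
  have good' k : (k <= m)%N -> ~~ (t_ i < tk k < t_ i.+1).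
    by move=> km; have := good (Ordinal (km : (k < m.+1)%N)).
  have IHi : intble (t_ i) (t_ i.+1) H by exact: intble_sub IH ti0 tiT.
  have IH2i : intble (t_ i) (t_ i.+1) (fun s => H s ^+ 2) by exact: intble_sub IH2 ti0 tiT.
  pose c := grid_xi i.
  have Ic : intble (t_ i) (t_ i.+1) (fun s => (c - H s) ^+ 2).
    apply: (eq_intble (f := fun s => (c ^+ 2 + (- (2 * c)) * H s) + H s ^+ 2)).
      by move=> s _; ring.
    by apply: intbleD => //; apply: intbleD; [exact: intble_cst|exact: intbleZ].
  have e1 : integ (t_ i) (t_ i.+1) (fun s => (S s - H s) ^+ 2) =
            integ (t_ i) (t_ i.+1) (fun s => (c - H s) ^+ 2).
    apply: eq_integ_obnd => //; first exact: intble_sub IS ti0 tiT.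
    by move=> s hs; rewrite (grid_xi_good good' hs).
  have e2 : (c - q i) ^+ 2 * D <=
      integ (t_ i) (t_ i.+1) (fun s => 2 * (c - H s) ^+ 2 + 2 * om0 ^+ 2).
    rewrite -[X in _ * X <= _]dt -integ_cst//; apply: le_integ; first exact: intble_cst.
      by apply: intbleD; [exact: intbleZ|exact: intble_cst].
    move=> s hs; have h1 := Hq iN hs.
    have h2 : (H s - q i) ^+ 2 <= om0 ^+ 2.
      by rewrite -[leLHS]real_normK ?num_real// lerXn2r ?nnegrE// (le_trans _ h1).
    have := sqr_ge0 ((c - H s) - (H s - q i)); nra.
  move: e2; rewrite integD; [|exact: intbleZ|exact: intble_cst].
  rewrite (integZ _ Ic) integ_cst// dt -e1 /c.
  have : 0 <= bad i * (D * (C + Sr) ^+ 2) by rewrite mulr_ge0.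
  lra.
set Q := 2 * D * om0 ^+ 2 in cell.
rewrite mulr_sumr (le_trans (ler_sum _ (fun i _ => cell i)))//.
rewrite !big_split/= -[X in X + _ + _]mulr_sumr sum_integ_cells// gridtN//.
rewrite -[X in _ + X]mulr_suml.
have -> : \sum_(i < N) Q = 2 * T * om0 ^+ 2.
  rewrite big_const_ord iter_addr_0 -[_ *+ N]mulr_natl /Q.
  by field; rewrite pnatr_eq0 -lt0n.
rewrite lerD2l -[leRHS]mulrA; apply: ler_wpM2r => //.
by rewrite mulr_ge0 ?sqr_ge0// ltW.
Qed.

End path.
End rounding.

(* Fixing the accuracy instead of a sequence of simple processes; the exceptional
   sets are bounded in outer probability. *)
Definition ito_via_simple {R : realType} {d : measure_display} {Om : measurableType d}
    (P : probability Om R) (T : R) (W : R -> Om -> R) (F : R -> set (set Om))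
    (H M : R -> Om -> R) := forall kap lam e : R, 0 < kap -> 0 < lam -> 0 < e ->
  exists S : simple_process, [/\ is_simple T F S,
    pbnd P [set w | (kap%:E < \int[lebesgue_measure]_(s in `[0%R, T])
      ((sp_process S s w - H s w) ^+ 2)%:E)%E] e &
    pbnd P [set w | exists2 t, 0 <= t <= T &
      lam < `|sp_integral W S t w - M t w|] e].

(** * Solutions satisfy the grid equation up to a small error *)

Section solution_grid_error.
Context {R : realType} {d : measure_display} {Om : measurableType d}.
Variables (P : probability Om R) (T : R) (W : R -> Om -> R) (F : R -> set (set Om)).
Hypothesis T0 : 0 < T.
Hypothesis wb : wiener_basis P T W F.

Lemma decreasing_small (A : nat -> set Om) (e : R) : (forall n, measurable (A n)) ->
  (forall n, A n.+1 `<=` A n) -> \bigcap_n A n = set0 -> 0 < e ->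
  exists n, pbnd P (A n) e.
Proof.
move=> mA dA A0 e0.
have cA : P (A n) @[n --> \oo] --> 0%E.
  rewrite -(measure0 P) -A0; apply: nonincreasing_cvg_mu => //.
  - by rewrite ltey_eq fin_num_measure.
  - by rewrite A0; exact: measurable0.
  - by apply/nonincreasing_seqP => n; exact/subsetPset.
have : \forall n \near \oo, fine (P (A n)) < e.
  apply: (@cvgr_lt _ _ _ _ (fine \o (P \o A)) 0) => //; exact: fine_cvg cA.
move=> [n _ /(_ n (leqnn n)) h]; exists n.
by exists (A n); split => //; rewrite -(PfineK P (mA n)) lee_fin ltW.
Qed.

(** By continuity rational times suffice, which makes the events measurable; they decrease to the
    empty set because a continuous path is bounded. *)
Lemma sup_small (Z : R -> Om -> R) (e : R) : continuous_process T Z ->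
  (forall t, 0 <= t <= T -> meas_wrt measurable (Z t)) -> 0 < e ->
  exists2 r, 0 < r & pbnd P [set w | exists2 t, 0 <= t <= T & r < `|Z t w|] e.
Proof.
move=> cZ mZ e0; have sm := @sa_measurable _ Om.
pose A n := \bigcup_(q in [set q : rat | 0 <= ratr q * T <= T])
   [set w | n.+1%:R < `|Z (ratr q * T) w|].
have AE n : A n = [set w | exists2 t, 0 <= t <= T & n.+1%:R < `|Z t w|].
  apply/seteqP; split=> w; first by move=> [q qT lt]; exists (ratr q * T).
  move=> [t tT lt]; pose e1 := `|Z t w| - n.+1%:R.
  have e10 : 0 < e1 by rewrite subr_gt0.
  have [dl dl0 h] := within_itv_cvg (cZ w) tT e10.
  have [q [qT qt]] := rat_approx T0 tT dl0.
  exists q => //=; have := h _ qT qt; have := ler_normD (Z (ratr q * T) w) (Z t w - Z (ratr q * T) w).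
  by rewrite subrKC [`|Z t w - _|]distrC /e1; lra.
have [||||n] := @decreasing_small A e; last first.
- by rewrite AE => h; exists n.+1%:R.
- exact: e0.
- apply/seteqP; split=> // w Aw.
  have [M M0 hM] := cont_bounded (cZ w).
  have := Aw (Num.truncn M) I; rewrite AE => -[t tT].
  by rewrite ltNge (le_trans (hM _ tT))// ltW// truncnS_gt.
- move=> n w; rewrite !AE => -[t tT lt]; exists t => //.
  by rewrite (le_lt_trans _ lt)// ler_nat.
- move=> n; apply: (sa_bigcup_count sm) => q qT.
  apply: (sa_lt sm); first exact: (meas_cst sm).
  exact/meas_norm/mZ.
Qed.

Variables (K K0 y0 : R) (B : R -> (R -> R) -> R) (s0 : R -> R).
Hypothesis K_gt0 : 0 < K.
Hypothesis dB : drift T K K0 B.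
Hypothesis cs0 : continuous s0.
Variable (Y : R -> Om -> R).
Hypothesis cY : continuous_process T Y.
Hypothesis mY : forall t, 0 <= t <= T -> meas_wrt (F t) (Y t).

Definition solution_via_simple := ito_via_simple P T W F (fun t w => s0 (Y t w))
  (fun t w => Y t w - y0 - integ 0 t (B ^~ (Y ^~ w))).

Definition path_drift N (j : nat) (w : Om) : R :=
  gdrift B (T / N%:R) j (fun i => Y (gridt T N i) w) (gridt T N j) (gridt T N j.+1).

Lemma sp_measurable (S : @simple_process R d Om) w : measurable_fun `[0, T] (fun s => sp_process S s w : R).
Proof.
apply: measurable_sum => k; apply: measurable_funM; first exact: measurable_cst.
by apply: measurable_funTS; exact: measurable_indic.
Qed.

Lemma sp_bound (S : @simple_process R d Om) : is_simple T F S -> exists C, forall w,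
  \sum_(k < sp_size S) `|sp_xi S k w| <= C.
Proof.
move=> [_ _ _ _]; elim: (sp_size S) => [|m ih] h.
  by exists 0 => w; rewrite big_ord0.
have [C hC] := ih (fun i im => h i (leqW im)).
have [C' hC'] := h m (ltnSn m).
by exists (C + C') => w; rewrite big_ord_recr/= lerD.
Qed.

Let mY' t : 0 <= t <= T -> meas_wrt measurable (Y t).
Proof. by move=> tT; apply: sub_meas_wrt (mY tT); exact: (wb_meas wb). Qed.

Let mW' t : 0 <= t <= T -> meas_wrt measurable (W t).
Proof. by move=> tT; apply: sub_meas_wrt (wb_adapted wb tT); exact: (wb_meas wb). Qed.

Ltac slra := clear -P T W F T0 wb K K0 y0 B s0 K_gt0 dB cs0 Y cY mY mY' mW'; lra.

Lemma small_step (a : R) : 0 < a -> exists N0, forall N, (N0 <= N)%N -> (0 < N)%N ->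
  T / N%:R < a.
Proof.
move=> a0; exists (Num.truncn (T / a)).+1 => N hN N1.
rewrite ltr_pdivrMr ?ltr0n// mulrC -ltr_pdivrMr// (lt_le_trans (truncnS_gt _))//.
by rewrite ler_nat.
Qed.

(** The Ito integral is replaced by that of a simple process, then by the sum of its samples on the
    grid. The samples differ from [s0 (Y)] by an integrand of small bracket, whose martingale sum is
    controlled by [lenglart]. *)
Lemma solution_grid_error : solution_via_simple -> forall dl e : R, 0 < dl -> 0 < e ->
  exists N0, forall N, (N0 <= N)%N -> (0 < N)%N ->
  pbnd P [set w | exists2 j, (j <= N)%N & dl < `|grid_error y0 s0
     (fun j => increment W (gridt T N j) (gridt T N j.+1)) (path_drift N)
     (fun j => Y (gridt T N j)) j w| ] e.
Proof.
move=> sol dl e dl0 e0; have cW := wb_cont wb.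
pose e6 := e / 6; have e60 : 0 < e6 by rewrite divr_gt0.
have [r r0 hr] := sup_small cY mY' e60.
have [Sr Sr0 hSr] : exists2 Sr : R, 0 <= Sr & forall x, `|x| <= r -> `|s0 x| <= Sr.
  have [M [_ hM]] := @compact_bounded _ _ _
    (continuous_compact (continuous_subspaceT cs0) (@segment_compact R (- r) r)).
  exists (Num.max (M + 1) 1); first by rewrite le_max ler01 orbT.
  move=> x xr; rewrite le_max; apply/orP; left.
  apply: (hM (M + 1)); first by rewrite ltrDl.
  by exists x => //=; rewrite in_itv/= -ler_norml.
pose lam := dl / 4; have lam0 : 0 < lam by rewrite divr_gt0.
(* With this bracket bound [lenglart] at level [lam] has the probability bound
   [kap / lam ^+ 2 = e6]; six exceptional events share [e]. *)
pose kap := e6 * lam ^+ 2; have kap0 : 0 < kap by rewrite mulr_gt0// exprn_gt0.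
have kap60 : 0 < kap / 6 by rewrite divr_gt0.
have [S [simS hS1 hS2]] := sol (kap / 6) lam e6 kap60 lam0 e60.
have [C hC] := sp_bound simS.
have C0 : 0 <= C by apply: le_trans (hC point); apply: sumr_ge0.
pose m := sp_size S.
pose om0 := Num.min 1 (kap / (6 * T)).
have om00 : 0 < om0 by rewrite lt_min ltr01 divr_gt0// mulr_gt0.
have om0k : 2 * T * om0 ^+ 2 <= kap / 3.
  have h1 : om0 <= 1 by rewrite ge_min lexx.
  have h2 : om0 <= kap / (6 * T) by rewrite ge_min lexx orbT.
  have : om0 ^+ 2 <= kap / (6 * T).
    by rewrite (le_trans _ h2)// expr2 ler_piMl// ltW.
  have -> : kap / 3 = 2 * T * (kap / (6 * T)) by field; rewrite gt_eqF.
  by move=> h3; rewrite ler_wpM2l// mulr_ge0// ltW.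
have [d1 d10 hd1] := itv_unif_cont (@continuous_subspaceT _ _ `[- r, r] _ cs0) om00.
pose om1 := Num.min (d1 / 2) (dl / (8 * (K * (1 + T) * T))).
have KT0 : 0 < K * (1 + T) * T by rewrite !mulr_gt0// addr_gt0.
have om10 : 0 < om1 by rewrite lt_min !divr_gt0// mulr_gt0.
have [d2 d20 hd2] := osc_small P T0 cY mY' om10 e60.
pose om2 := dl / (16 * (C + 1)).
have om20 : 0 < om2 by rewrite divr_gt0// mulr_gt0// ltr_wpDl.
have [d3 d30 hd3] := osc_small P T0 cW mW' om20 e60.
(* The step size below which the cells containing a jump time of [S] contribute at most [kap / 3] to
   the bracket. *)
pose a4 := kap / (3 * (m.+1%:R * (C + Sr + 1) ^+ 2)).
have CS0 : 0 < C + Sr + 1 by rewrite ltr_wpDl// addr_ge0.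
have a40 : 0 < a4 by rewrite divr_gt0// !mulr_gt0// exprn_gt0.
have [N0 hN0] : exists N0, forall N, (N0 <= N)%N -> (0 < N)%N ->
    T / N%:R < Num.min (Num.min d2 d3) a4.
  by apply: small_step; rewrite !lt_min d20 d30.
exists N0 => N N0N N1; have := hN0 _ N0N N1; rewrite !lt_min => /andP[/andP[D2 D3] D4].
set D := T / N%:R in D2 D3 D4 *; have D0 : 0 < D by rewrite divr_gt0// ltr0n.
have DT : D <= T by rewrite ler_pdivrMr ?ltr0n// ler_peMr ?ler1n// ltW.
set v := fun j => increment _ _ _; set U := fun j => Y _.
have [_ sF FS Fm [nv _]] := wiener_grid_basis T0 wb N1.
have [tk0 tkT tkS adS _] := simS.
pose bb i w := grid_xi T N m (sp_t S) (sp_xi S ^~ w) i - s0 (U i w).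
have ad_bb i : (i < N)%N -> meas_wrt (F (gridt T N i)) (bb i).
  move=> iN; apply: (measB (sF i)); last first.
    by apply: meas_compc => //; apply: mY; exact: (gridt_itv T0 N1 (ltnW iN)).
  apply: (@meas_sum_ord _ _ _ (sF i) m
    (fun k w => sp_xi S k w * (sp_t S k <= gridt T N i < sp_t S k.+1)%R%:R)) => k km.
  case: (boolP (sp_t S k <= gridt T N i < sp_t S k.+1)) => [/andP[h _]|_]; last first.
    by under eq_fun do rewrite mulr0; exact: (meas_cst (sF i)).
  under eq_fun do rewrite mulr1.
  split=> B' mB'; apply: (wb_mono wb h); exact: adS.
have hL := lenglart sF FS Fm nv D0 (leqnn N) ad_bb lam0 (ltW kap0).
have ek : kap / lam ^+ 2 = e6 by rewrite /kap mulfK// gt_eqF// exprn_gt0.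
rewrite ek in hL.
have -> : e = ((((e6 + e6) + e6) + e6) + e6) + e6 by rewrite /e6; field.
apply: pbnd_le (pbndU (pbndU (pbndU (pbndU (pbndU hr hS1) hS2) hd2) hd3) hL) => //.
move=> w [j jN ge].
have [h1|h1] := pselect (exists2 t, 0 <= t <= T & r < `|Y t w|); first by do 5 left.
have [h2|h2] := pselect ((kap / 6)%:E < \int[lebesgue_measure]_(s in `[0%R, T])
      ((sp_process S s w - s0 (Y s w)) ^+ 2)%:E)%E; first by do 4 left; right.
have [h3|h3] := pselect (exists2 t, 0 <= t <= T &
  lam < `|sp_integral W S t w - (Y t w - y0 - integ 0 t (B ^~ (Y ^~ w)))|); first by do 3 left; right.
have [h4|h4] := pselect (osc_gt T Y d2 om1 w); first by do 2 left; right.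
have [h5|h5] := pselect (osc_gt T W d3 om2 w); first by left; right.
right.
have Yr t : 0 <= t <= T -> `|Y t w| <= r.
  by move=> tT; rewrite leNgt; apply/negP => h; apply: h1; exists t.
have Yom s t : 0 <= s <= T -> 0 <= t <= T -> `|t - s| <= D -> `|Y t w - Y s w| <= om1.
  move=> sT tT st; rewrite leNgt; apply/negP => h; apply: h4; exists s, t; split => //.
  exact: le_lt_trans D2.
have Wom s t : 0 <= s <= T -> 0 <= t <= T -> `|t - s| <= D -> `|W t w - W s w| <= om2.
  move=> sT tT st; rewrite leNgt; apply/negP => h; apply: h5; exists s, t; split => //.
  exact: le_lt_trans D3.
have gT i : (i <= N)%N -> 0 <= gridt T N i <= T by exact: gridt_itv.
pose H s := s0 (Y s w).
have cH : {within `[0, T], continuous H}.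
  apply: continuous_path_eps => s sT e' e'0.
  have /cvgrPdist_lt /(_ e' e'0) := @cs0 (Y s w).
  rewrite -nbhs_nearE => /nbhs_ballP[d5 /= d50 hd5].
  have [d6 d60 hd6] := within_itv_cvg (@cY w) sT d50.
  exists d6 => // t tT ts; rewrite /H distrC; apply: hd5.
  by rewrite /ball/= distrC; exact: hd6.
have ISH : intble 0 T (fun s => (sp_process S s w - H s) ^+ 2).
  have [M M0 hM] := cont_bounded cH.
  apply: (@intble_bnd _ _ _ _ ((C + M) ^+ 2)).
    apply: measurable_funX; apply: measurable_funB; first exact: sp_measurable.
    exact: subspace_continuous_measurable_fun.
  move=> s sT; rewrite normrX lerXn2r ?nnegrE ?addr_ge0//.
  rewrite (le_trans (ler_normB _ _))// lerD// ?hM//.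
  rewrite (le_trans (ler_norm_sum _ _ _))// (le_trans _ (hC w))//; apply: ler_sum => k _.
  by rewrite normrM ler_piMr// norm_ind.
have IH : intble 0 T H by exact: intble_cont.
have IH2 : intble 0 T (fun s => H s ^+ 2).
  apply: intble_cont; apply: continuous_path_eps => s sT e' e'0.
  have [M M0 hM] := cont_bounded cH.
  have M1 : 0 < 2 * M + 1 by rewrite ltr_wpDl// mulr_ge0.
  have [d6 d60 hd6] := within_itv_cvg cH sT (divr_gt0 e'0 M1).
  exists d6 => // t tT ts; have := hd6 t tT ts; rewrite ltr_pdivlMr// => h.
  have -> : H t ^+ 2 - H s ^+ 2 = (H t - H s) * (H t + H s) by ring.
  rewrite normrM (le_lt_trans _ h)// ler_wpM2l// (le_trans (ler_normD _ _))//.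
  by have p1 := hM _ tT; have p2 := hM _ sT; move: p1 p2; slra.
have iSH : integ 0 T (fun s => (sp_process S s w - H s) ^+ 2) <= kap / 6.
  move/negP : h2; rewrite -leNgt /H => h2.
  by rewrite -lee_fin /integ /Rintegral fineK//; exact: integrable_fin_num.
have hq1 i s : (i < N)%N -> gridt T N i <= s <= gridt T N i.+1 ->
    `|H s - s0 (U i w)| <= om0.
  move=> iN hs; have iT := gT _ (ltnW iN); have iT' := gT _ iN.
  have sT : 0 <= s <= T.
    by move: iT iT' hs => /andP[+ +] /andP[+ +] /andP[+ +]; clear -P T W F T0 wb K K0 y0 B s0 K_gt0 dB cs0 Y cY mY mY' mW' => *; apply/andP; split; lra.
  apply/ltW/hd1; rewrite -?ler_norml ?Yr//.
  have si : `|s - gridt T N i| <= D.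
    move: hs => /andP[a1 a2]; rewrite ger0_norm ?subr_ge0//.
    by move: a2; rewrite gridt_step -/D; slra.
  have h := Yom _ _ iT sT si; apply: (le_lt_trans h).
  by rewrite gt_min; apply/orP; left; move: d10; slra.
have hq2 i : (i < N)%N -> `|s0 (U i w)| <= Sr.
  by move=> iN; apply/hSr/Yr/gT/ltnW.
have brk : D * (\sum_(i < N) bb i w ^+ 2) <= kap.
  have h := @grid_xi_square _ T N T0 N1 m (sp_t S) (sp_xi S ^~ w) C (hC w) H (fun i => s0 (U i w)) om0 Sr ISH IH IH2 hq1 hq2.
  apply: (le_trans h).
  have hm : m.+1%:R * D * (C + Sr) ^+ 2 <= kap / 3.
    move: D4; rewrite /a4 ltr_pdivlMr ?mulr_gt0 ?exprn_gt0// => D4.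
    have q1 : (C + Sr) ^+ 2 <= (C + Sr + 1) ^+ 2.
      by rewrite lerXn2r ?nnegrE ?addr_ge0// lerDl.
    have q2 : 0 <= m.+1%:R * D by rewrite mulr_ge0// ltW.
    have q3 := ler_wpM2l q2 q1; move: q3 D4; slra.
  rewrite -/D -/m; move: hm om0k iSH; slra.
split=> //; exists j => //.
have jT := gT _ jN.
pose a := sp_integral W S (gridt T N j) w.
pose I := integ 0 (gridt T N j) (B ^~ (Y ^~ w)).
pose Sb := \sum_(i < j) path_drift N i w.
pose G := \sum_(i < j) grid_xi T N m (sp_t S) (sp_xi S ^~ w) i * v i w.
(* The four errors are the approximation of the Ito integral by that of [S], at most [dl / 4], the
   drift, at most [dl / 8], the sampling of [S], at most [dl / 8], and a martingale sum. As the
   total exceeds [dl], the last one must exceed [lam]. *)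
have eE : grid_error y0 s0 v (path_drift N) U j w =
    (Y (gridt T N j) w - y0 - I - a) + (I - Sb) + (a - G) + dsum bb v j w.
  have -> : dsum bb v j w = G - \sum_(i < j) s0 (U i w) * v i w.
    by rewrite /dsum /G -sumrB; apply: eq_bigr => i _; rewrite /bb mulrBl.
  by rewrite /grid_error big_split/= -/Sb /U; ring.
have b1 : `|Y (gridt T N j) w - y0 - I - a| <= lam.
  rewrite leNgt; apply/negP => h; apply: h3; exists (gridt T N j) => //.
  by rewrite distrC.
have b2 : `|I - Sb| <= dl / 8.
  have hK : K * (1 + T) * om1 * T <= dl / 8.
    have : om1 <= dl / (8 * (K * (1 + T) * T)) by rewrite ge_min lexx orbT.
    move=> /(ler_wpM2l (ltW KT0)); rewrite mulrAC => /le_trans; apply.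
    have -> // : forall x : R, 0 < x -> x * (dl / (8 * x)) = dl / 8.
    by move=> x x0; field; rewrite gt_eqF.
  rewrite distrC (le_trans _ hK)//.
  have IY : intble 0 T (B ^~ (Y ^~ w)) by exact: (drift_intble K_gt0 dB (@cY w)).
  rewrite /I -(sum_integ_cells T0 N1 IY jN) /Sb -sumrB.
  apply: (le_trans (ler_norm_sum _ _ _)).
  apply: (@le_trans _ _ (\sum_(i < j) K * (1 + T) * om1 * D)).
    apply: ler_sum => i _; have iN : (i < N)%N by exact: leq_trans (ltn_ord i) jN.
    have -> : K * (1 + T) * om1 * D = K * (1 + T) * om1 * (gridt T N i.+1 - gridt T N i).
      by rewrite gridt_step -/D; ring.
    apply: (gdrift_close K_gt0 dB D0) => //.
    - exact: gridt_le.
    - by have /andP[] := gT _ iN.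
    - move=> k r' ki h rr0 rr1; have kT : 0 <= gridt T N k <= T.
        by apply: gT; rewrite (leq_trans ki)// ltnW.
      apply: Yom => //; rewrite rr0 (le_trans rr1)//.
      by have /andP[] := gT _ iN.
  rewrite big_const_ord iter_addr_0 -[_ *+ j]mulr_natr -mulrA ler_wpM2l//.
    by rewrite !mulr_ge0 ?addr_ge0// ltW.
  by have /andP[_] := jT; rewrite /gridt mulrC.
have b3 : `|a - G| <= dl / 8.
  have h := grid_xi_integral T0 N1 Wom (sp_xi S ^~ w) tk0 tkT tkS jN.
  apply: (le_trans h); apply: (@le_trans _ _ (2 * om2 * C)).
    by rewrite ler_wpM2l// mulr_ge0// ltW.
  have : om2 * (16 * (C + 1)) = dl by rewrite /om2 mulfVK// gt_eqF// mulr_gt0// ltr_wpDl.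
  by have := mulr_ge0 (ltW om20) C0; move: om20; slra.
move: ge; rewrite eE.
set x1 := _ - a in b1 *; set x2 := I - Sb in b2 *; set x3 := a - G in b3 *.
set x4 := dsum _ _ _ _ => ge.
have t1 := ler_normD (x1 + x2 + x3) x4.
have t2 := ler_normD (x1 + x2) x3.
have t3 := ler_normD x1 x2.
by move: b1 ge; rewrite /lam; move: t1 t2 t3 b2 b3 dl0; slra.
Qed.

End solution_grid_error.

Section uniqueness.
Context {R : realType} {d : measure_display} {Om : measurableType d}.
Variables (P : probability Om R) (T : R) (W : R -> Om -> R) (F : R -> set (set Om)).
Hypothesis T0 : 0 < T.
Hypothesis wb : wiener_basis P T W F.
Variables (K K0 y0 : R) (B : R -> (R -> R) -> R) (s0 : R -> R).
Hypothesis K_gt0 : 0 < K.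
Hypothesis dB : drift T K K0 B.
Hypothesis cs0 : continuous s0.
Hypothesis yw : yamada_watanabe s0.

Lemma grid_point N t : (0 < N)%N -> 0 <= t <= T ->
  exists j, [/\ (j <= N)%N, gridt T N j <= t & t - gridt T N j <= T / N%:R].
Proof.
move=> N0 /andP[t0 tT].
have D0 : 0 < T / N%:R by rewrite divr_gt0// ltr0n.
have h : forall n, (n <= N)%N -> t <= gridt T N n ->
    exists j, [/\ (j <= N)%N, gridt T N j <= t & t - gridt T N j <= T / N%:R].
  elim=> [|n ih] nN tn.
    by exists 0; rewrite gridt0 in tn *; split => //; lra.
  have [h|h] := leP t (gridt T N n); first exact: ih (ltnW nN) h.
  exists n; split => //; [exact: ltnW|exact: ltW|].
  by move: tn; rewrite gridt_step; lra.
by apply: (h N) => //; rewrite gridtN.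
Qed.

Lemma path_drift_meas (Y : R -> Om -> R) N j : (0 < N)%N -> (j < N)%N ->
  (forall t, 0 <= t <= T -> meas_wrt (F t) (Y t)) ->
  meas_wrt (F (gridt T N j)) (path_drift T B Y N j).
Proof.
move=> N0 jN mY; have D0 : 0 < T / N%:R by rewrite divr_gt0// ltr0n.
have DT : T / N%:R <= T by rewrite ler_pdivrMr ?ltr0n// ler_peMr ?ler1n// ltW.
apply: (gdrift_meas T0 K_gt0 dB D0 DT) => //.
- exact: gridt_le.
- exact: gridt_leT.
- exact: (wb_sigma wb).
- move=> i ij; apply: sub_meas_wrt (mY _ _); last first.
    by apply: gridt_itv => //; rewrite (leq_trans ij)// ltnW.
  by apply: (wb_mono wb); exact: gridt_le.
Qed.

Lemma path_drift_lip (Y1 Y2 : R -> Om -> R) N j w : (0 < N)%N -> (j < N)%N ->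
  `|path_drift T B Y1 N j w - path_drift T B Y2 N j w| <= Kg T K * (T / N%:R) *
   (`|Y1 (gridt T N j) w - Y2 (gridt T N j) w| +
    T / N%:R * \sum_(i < j) `|Y1 (gridt T N i) w - Y2 (gridt T N i) w|).
Proof.
move=> N0 jN; have D0 : 0 < T / N%:R by rewrite divr_gt0// ltr0n.
have DT : T / N%:R <= T by rewrite ler_pdivrMr ?ltr0n// ler_peMr ?ler1n// ltW.
have e : T / N%:R = gridt T N j.+1 - gridt T N j by rewrite gridt_step addrC addKr.
rewrite [X in _ <= _ * X * _]e.
apply: (gdrift_lip T0 K_gt0 dB D0 DT) => //; [exact: gridt_le|exact: gridt_leT].
Qed.

Definition process_error (Y : R -> Om -> R) N :=
  grid_error y0 s0 (fun j => increment W (gridt T N j) (gridt T N j.+1))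
    (path_drift T B Y N) (fun j => Y (gridt T N j)).

(** From the grid to all times: a third of [eta] for the oscillation of each process on a cell, and
    a third for the distance at grid points. *)
Lemma stability_process (r eta eta' dl Dt0 : R) (N : nat) (Y1 Y2 : R -> Om -> R) :
  stability_at P T (Kg T K) y0 s0 r eta' dl Dt0 -> (0 < N)%N -> T / N%:R <= Dt0 ->
  eta' <= eta / 3 ->
  (forall t, 0 <= t <= T -> meas_wrt (F t) (Y1 t)) ->
  (forall t, 0 <= t <= T -> meas_wrt (F t) (Y2 t)) ->
  pbnd P [set w | [/\ exists2 t, 0 <= t <= T & eta < `|Y1 t w - Y2 t w|,
    forall t, 0 <= t <= T -> `|Y1 t w| <= r /\ `|Y2 t w| <= r,
    forall s t, 0 <= s <= T -> 0 <= t <= T -> `|t - s| <= T / N%:R ->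
      `|Y1 t w - Y1 s w| <= eta / 3 /\ `|Y2 t w - Y2 s w| <= eta / 3 &
    forall j, (j <= N)%N -> `|process_error Y1 N j w| <= dl /\
      `|process_error Y2 N j w| <= dl]] eta'.
Proof.
move=> stab N0 DN eta'3 m1 m2.
have {}stab := stab N _ _ (fun j => Y1 (gridt T N j)) (fun j => Y2 (gridt T N j))
  (path_drift T B Y1 N) (path_drift T B Y2 N) (wiener_grid_basis T0 wb N0) DN
  (fun j jN => m1 _ (gridt_itv T0 N0 jN)) (fun j jN => m2 _ (gridt_itv T0 N0 jN))
  (fun j jN => path_drift_meas N0 jN m1) (fun j jN => path_drift_meas N0 jN m2)
  (fun j w jN => path_drift_lip Y1 Y2 w N0 jN).
apply: pbnd_le stab => // w [[t tT lt] hr ho hg]; split; last first.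
  move=> j jN; have jT := gridt_itv T0 N0 jN.
  have [h1 h2] := hr _ jT; have [h3 h4] := hg _ jN; split.
  - exact: h1.
  - exact: h2.
  - exact: h3.
  - exact: h4.
have [j [jN jt tj]] := grid_point N0 tT; have jT := gridt_itv T0 N0 jN.
have tj' : `|t - gridt T N j| <= T / N%:R by rewrite ger0_norm// subr_ge0.
have [k1 k2] := ho _ _ jT tT tj'.
exists j => //; apply: (le_lt_trans eta'3).
have : `|Y1 t w - Y2 t w| <= `|Y1 t w - Y1 (gridt T N j) w| +
   `|Y1 (gridt T N j) w - Y2 (gridt T N j) w| + `|Y2 t w - Y2 (gridt T N j) w|.
  rewrite [`|Y2 t w - _|]distrC; set a := Y1 t w; set b := Y2 t w; set c := Y1 _ _; set f := Y2 _ _.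
  have -> : a - b = (a - c) + (c - f) + (f - b) by ring.
  by rewrite (le_trans (ler_normD _ _))// lerD2r ler_normD.
move: lt k1 k2; clear -T0 K_gt0 dB cs0 yw wb; lra.
Qed.

(** The order of choices matters: [r] comes from bounds on the paths, [dl] and [Dt0] from stability,
    and only then is [N] taken large enough for the grid errors and the oscillations. Seven
    exceptional events share [e]. *)
Lemma close_solutions (Y1 Y2 : R -> Om -> R) : continuous_process T Y1 ->
  continuous_process T Y2 ->
  (forall t, 0 <= t <= T -> meas_wrt (F t) (Y1 t)) ->
  (forall t, 0 <= t <= T -> meas_wrt (F t) (Y2 t)) ->
  solution_via_simple P T W F y0 B s0 Y1 -> solution_via_simple P T W F y0 B s0 Y2 ->
  forall eta e : R, 0 < eta -> 0 < e ->
  pbnd P [set w | exists2 t, 0 <= t <= T & eta < `|Y1 t w - Y2 t w|] e.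
Proof.
move=> c1 c2 m1 m2 sol1 sol2 eta e eta0 e0.
have m1' t : 0 <= t <= T -> meas_wrt measurable (Y1 t).
  by move=> tT; apply: sub_meas_wrt (m1 _ tT); exact: (wb_meas wb).
have m2' t : 0 <= t <= T -> meas_wrt measurable (Y2 t).
  by move=> tT; apply: sub_meas_wrt (m2 _ tT); exact: (wb_meas wb).
pose e7 := e / 7; have e70 : 0 < e7 by rewrite divr_gt0.
have eta30 : 0 < eta / 3 by rewrite divr_gt0.
have [r1 r10 hr1] := sup_small P T0 c1 m1' e70.
have [r2 r20 hr2] := sup_small P T0 c2 m2' e70.
pose r := Num.max r1 r2; have r0 : 0 < r by rewrite lt_max r10.
pose eta' := Num.min (eta / 3) e7; have eta'0 : 0 < eta' by rewrite lt_min eta30.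
have [dl dl0 [Dt0 Dt00 stab]] := @stability R d Om P T (Kg T K) y0 s0 r eta' T0
  (Kg_gt0 T0 K_gt0) cs0 yw r0 eta'0.
have [N1 hN1] := solution_grid_error T0 wb K_gt0 dB cs0 c1 m1 sol1 dl0 e70.
have [N2 hN2] := solution_grid_error T0 wb K_gt0 dB cs0 c2 m2 sol2 dl0 e70.
have [d1 d10 hd1] := osc_small P T0 c1 m1' eta30 e70.
have [d2 d20 hd2] := osc_small P T0 c2 m2' eta30 e70.
have [N3 hN3] : exists N0, forall N, (N0 <= N)%N -> (0 < N)%N ->
    T / N%:R < Num.min (Num.min d1 d2) Dt0.
  by apply: small_step => //; rewrite !lt_min d10 d20.
pose N := (maxn (maxn N1 N2) N3).+1.
have NN1 : (N1 <= N)%N by rewrite /N ltnW// ltnS !leq_max leqnn.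
have NN2 : (N2 <= N)%N by rewrite /N ltnW// ltnS !leq_max leqnn orbT.
have NN3 : (N3 <= N)%N by rewrite /N ltnW// ltnS !leq_max leqnn !orbT.
have N0 : (0 < N)%N by [].
have := hN3 N NN3 N0; rewrite !lt_min => /andP[/andP[D1 D2] D3].
have le3 : eta' <= eta / 3 by rewrite ge_min lexx.
have {}stab := stability_process stab N0 (ltW D3) le3 m1 m2.
have e7e : eta' <= e7 by rewrite ge_min lexx orbT.
have {}stab := pbnd_le (@subset_refl _ _) e7e stab.
have -> : e = (((((e7 + e7) + e7) + e7) + e7) + e7) + e7 by rewrite /e7; field.
apply: pbnd_le (pbndU (pbndU (pbndU (pbndU (pbndU (pbndU hr1 hr2) (hN1 N NN1 N0))
  (hN2 N NN2 N0)) hd1) hd2) stab) => //.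
move=> w [t tT lt].
have [h1|h1] := pselect (exists2 t, 0 <= t <= T & r1 < `|Y1 t w|); first by do 6 left.
have [h2|h2] := pselect (exists2 t, 0 <= t <= T & r2 < `|Y2 t w|); first by do 5 left; right.
have [h3|h3] := pselect (exists2 j, (j <= N)%N & dl < `|process_error Y1 N j w|).
  by do 4 left; right.
have [h4|h4] := pselect (exists2 j, (j <= N)%N & dl < `|process_error Y2 N j w|).
  by do 3 left; right.
have [h5|h5] := pselect (osc_gt T Y1 d1 (eta / 3) w); first by do 2 left; right.
have [h6|h6] := pselect (osc_gt T Y2 d2 (eta / 3) w); first by left; right.
right; split.
- by exists t.
- move=> u uT; split.
    rewrite le_max; apply/orP; left; rewrite leNgt; apply/negP => h; apply: h1.
    by exists u.
  rewrite le_max; apply/orP; right; rewrite leNgt; apply/negP => h; apply: h2.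
  by exists u.
- move=> u u' uT u'T uu'; split.
    rewrite leNgt; apply/negP => h; apply: h5; exists u, u'; split => //.
    exact: le_lt_trans D1.
  rewrite leNgt; apply/negP => h; apply: h6; exists u, u'; split => //.
  exact: le_lt_trans D2.
- move=> j jN; split.
    by rewrite leNgt; apply/negP => h; apply: h3; exists j.
  by rewrite leNgt; apply/negP => h; apply: h4; exists j.
Qed.

Lemma pbnd_negligible (A : set Om) : (forall e, 0 < e -> pbnd P A e) -> P.-negligible A.
Proof.
move=> h; have hn (n : nat) : pbnd P A n.+1%:R^-1 by apply: h; rewrite invr_gt0.
pose C n := sval (cid (hn n)).
have hC n : [/\ measurable (C n), A `<=` C n & (P (C n) <= n.+1%:R^-1%:E)%E].
  by rewrite /C; case: cid.
have mC : measurable (\bigcap_n C n) by apply: bigcapT_measurable => n; have [] := hC n.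
exists (\bigcap_n C n); split => //; last first.
  by move=> w Aw n _; have [_ h' _] := hC n; exact: h'.
apply/le_anti; rewrite measure_ge0 andbT; apply/lee_addgt0Pr => e e0; rewrite add0e.
have [n hne] : exists n : nat, e^-1 < n.+1%:R by exists (Num.truncn e^-1); exact: truncnS_gt.
have [mCn _ PCn] := hC n.
apply: (@le_trans _ _ (P (C n))).
  by apply: le_measure => //; rewrite ?inE//; exact: bigcap_inf.
by rewrite (le_trans PCn)// lee_fin -[e]invrK lef_pV2 ?posrE ?invr_gt0// ltW.
Qed.

Lemma unique_solutions (Y1 Y2 : R -> Om -> R) : continuous_process T Y1 ->
  continuous_process T Y2 ->
  (forall t, 0 <= t <= T -> meas_wrt (F t) (Y1 t)) ->
  (forall t, 0 <= t <= T -> meas_wrt (F t) (Y2 t)) ->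
  solution_via_simple P T W F y0 B s0 Y1 -> solution_via_simple P T W F y0 B s0 Y2 ->
  indistinguishable P T Y1 Y2.
Proof.
move=> c1 c2 m1 m2 sol1 sol2.
pose A n := [set w | exists2 t, 0 <= t <= T & n.+1%:R^-1 < `|Y1 t w - Y2 t w|].
have nA n : P.-negligible (A n).
  by apply: pbnd_negligible => e e0; apply: close_solutions => //; rewrite invr_gt0.
apply: (negligibleS _ (negligible_bigcup nA)) => w /= /existsNP[t /not_implyP[tT ne]].
have d0 : 0 < `|Y1 t w - Y2 t w| by rewrite normr_gt0 subr_eq0; exact/eqP.
have [n hn] : exists n : nat, `|Y1 t w - Y2 t w|^-1 < n.+1%:R.
  exists (Num.truncn `|Y1 t w - Y2 t w|^-1); exact: truncnS_gt.
exists n => //; exists t => //.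
by rewrite -[ltRHS]invrK ltf_pV2 ?posrE ?invr_gt0.
Qed.

End uniqueness.

(** * The Euler scheme *)

Section euler_path.
Context {R : realType}.
Variables (T K K0 y0 : R) (B : R -> (R -> R) -> R) (s0 : R -> R).
Hypothesis T0 : 0 < T.
Hypothesis K_gt0 : 0 < K.
Hypothesis dB : drift T K K0 B.
Variables (N : nat) (W : R -> R).
Hypothesis N0 : (0 < N)%N.
Local Notation D := (T / N%:R).
Local Notation t_ := (gridt T N).

(* [euler_hist j] is the Euler scheme up to index [j]: the drift depends on the
   whole history, hence the course-of-values recursion. *)
Fixpoint euler_hist (j : nat) : nat -> R :=
  if j is j'.+1 then fun i => if (i <= j')%N then euler_hist j' i else
    euler_hist j' j' + gdrift B D j' (euler_hist j') (t_ j') (t_ j) +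
    s0 (euler_hist j' j') * (W (t_ j) - W (t_ j'))
  else fun=> y0.

Definition euler (j : nat) : R := euler_hist j j.

Lemma euler_histE i j : (i <= j)%N -> euler_hist j i = euler i.
Proof.
elim: j => [|j ih]; first by rewrite leqn0 => /eqP ->.
rewrite leq_eqVlt => /orP[/eqP -> //|]; rewrite ltnS => ij /=.
by rewrite ij ih.
Qed.

Lemma gdrift_eq j u v a b : (forall i, (i <= j)%N -> u i = v i) ->
  gdrift B D j u a b = gdrift B D j v a b.
Proof.
move=> h; rewrite /gdrift (_ : lin D j u = lin D j v)//.
apply/funext => r; rewrite /lin h//; congr (_ + _); apply: eq_bigr => i _.
by rewrite !h// ltnW.
Qed.

Lemma eulerS j : euler j.+1 = euler j + gdrift B D j euler (t_ j) (t_ j.+1) +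
  s0 (euler j) * (W (t_ j.+1) - W (t_ j)).
Proof.
rewrite /euler /= ltnn -/(euler j); congr (_ + _ + _).
by apply: gdrift_eq => i ij; exact: euler_histE.
Qed.

Definition cell (t : R) : nat := Num.truncn (t / D).

(** The scheme in continuous time: the right end of the current cell is replaced by [t], while the
    coefficients still use the history up to [t_ j] only. *)
Definition eulert (t : R) : R := let j := cell t in
  euler j + gdrift B D j euler (t_ j) t + s0 (euler j) * (W t - W (t_ j)).

Let D0 : 0 < D. Proof. by rewrite divr_gt0// ltr0n. Qed.
Let DT : D <= T. Proof. by rewrite ler_pdivrMr ?ltr0n// ler_peMr ?ler1n// ltW. Qed.

Lemma cellP t j : t_ j <= t < t_ j.+1 -> cell t = j.
Proof.
rewrite /gridt => /andP[h1 h2]; rewrite /cell.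
by apply: truncn_def; rewrite ler_pdivlMr// ltr_pdivrMr// h1.
Qed.

Lemma cell_grid j : cell (t_ j) = j.
Proof. by apply: cellP; rewrite lexx gridt_lt. Qed.

Lemma gdrift_refl j u a : gdrift B D j u a a = 0.
Proof. exact: integ_refl. Qed.

Lemma eulert_grid j : eulert (t_ j) = euler j.
Proof. by rewrite /eulert cell_grid gdrift_refl subrr mulr0 !addr0. Qed.

(** At the right end of the cell [cell t] is already [j.+1]; the two expressions agree there by the
    recursion of the scheme. *)
Lemma eulert_cell j t : t_ j <= t <= t_ j.+1 ->
  eulert t = euler j + gdrift B D j euler (t_ j) t + s0 (euler j) * (W t - W (t_ j)).
Proof.
move=> /andP[jt]; rewrite le_eqVlt => /orP[/eqP ->|tj].
  by rewrite eulert_grid eulerS.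
by rewrite /eulert (@cellP _ j)// jt.
Qed.

Lemma eulert_incr j s t : (j < N)%N -> t_ j <= s -> s <= t -> t <= t_ j.+1 ->
  eulert t - eulert s = gdrift B D j euler s t + s0 (euler j) * (W t - W s).
Proof.
move=> jN js st tj; rewrite !(@eulert_cell j); last 2 first.
- by rewrite js (le_trans st).
- by rewrite (le_trans js st).
have tT : t <= T by rewrite (le_trans tj)// gridt_leT.
rewrite /gdrift (@integ_add _ (t_ j) s t)//; first by ring.
by apply: (gdrift_intble K_gt0 dB D0 (j := j)).
Qed.

Section bounded.
Variables (r Sr : R).
Hypothesis r0 : 0 <= r.
Hypothesis Ur : forall j, (j <= N)%N -> `|euler j| <= r.
Hypothesis Sr_ge : forall x, `|x| <= r -> `|s0 x| <= Sr.

(** Bounds the grid drift per unit of time as long as the scheme stays in [[-r, r]]. *)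
Definition drift_const : R := K0 + Kg T K * (1 + T) * r.

Lemma euler_gdrift_bound j a b : (j < N)%N -> t_ j <= a -> a <= b -> b <= t_ j.+1 ->
  `|gdrift B D j euler a b| <= drift_const * (b - a).
Proof.
move=> jN ja ab bj; have bT : b <= T by rewrite (le_trans bj)// gridt_leT.
apply: (le_trans (gdrift_growth T0 K_gt0 dB D0 DT ja ab bj bT euler)).
rewrite mulrC ler_wpM2r ?subr_ge0// lerD2l -[leRHS]mulrA.
apply: ler_wpM2l; first by apply/ltW/Kg_gt0.
rewrite mulrDl mul1r; apply: lerD; first exact/Ur/ltnW.
apply: (@le_trans _ _ (D * (j%:R * r))).
  apply: ler_wpM2l; first exact: ltW.
  apply: (@le_trans _ _ (\sum_(i < j) r)).
    by apply: ler_sum => i _; apply: Ur; rewrite (leq_trans (ltnW (ltn_ord i)))// ltnW.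
  by rewrite big_const_ord iter_addr_0 mulr_natl.
rewrite mulrA ler_wpM2r// mulrC; exact: (gridt_leT T0 N0 (ltnW jN)).
Qed.

Lemma eulert_cell_bound j s t : (j < N)%N -> t_ j <= s -> s <= t -> t <= t_ j.+1 ->
  `|eulert t - eulert s| <= drift_const * (t - s) + Sr * `|W t - W s|.
Proof.
move=> jN js st tj; rewrite (eulert_incr jN js st tj).
rewrite (le_trans (ler_normD _ _))// lerD//; first exact: euler_gdrift_bound.
by rewrite normrM ler_wpM2r// Sr_ge// Ur// ltnW.
Qed.

Lemma drift_const_ge0 : 0 <= drift_const.
Proof.
have h : (0 : R) <= 0 <= T by rewrite lexx ltW.
have k0 : 0 <= K0 by exact: le_trans (normr_ge0 _) (drift_bnd dB h).
have k1 := Kg_gt0 T0 K_gt0.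
exact: (addr_ge0 k0 (mulr_ge0 (mulr_ge0 (ltW k1) (addr_ge0 ler01 (ltW T0))) r0)).
Qed.

Lemma Sr_ge0 : 0 <= Sr.
Proof. by apply: le_trans (Sr_ge (x := 0) _); rewrite ?normr_ge0// normr0. Qed.

Lemma eulert_modulus (om dl : R) : dl <= D ->
  (forall s t, 0 <= s <= T -> 0 <= t <= T -> `|t - s| <= dl -> `|W t - W s| <= om) ->
  forall s t, 0 <= s <= T -> 0 <= t <= T -> `|t - s| <= dl ->
    `|eulert t - eulert s| <= 2 * (drift_const * dl + Sr * om).
Proof.
move=> dlD Wom s t; wlog st : s t / s <= t => [H sT tT ts|].
  have [st|/ltW ts'] := leP s t; first exact: H.
  by rewrite distrC; apply: H => //; rewrite distrC.
move=> sT tT ts; have /andP[s0' sT'] := sT; have /andP[t0' tT'] := tT.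
have dl0 : 0 <= dl by exact: le_trans ts.
have o0 : 0 <= om by apply: le_trans (Wom s s sT sT _); rewrite ?normr_ge0// subrr normr0.
have b0 : 0 <= drift_const * dl + Sr * om.
  by rewrite addr_ge0// mulr_ge0 ?drift_const_ge0 ?Sr_ge0.
have ts' : t - s <= dl by move: ts; rewrite ger0_norm// subr_ge0.
have one j s' t' : (j < N)%N -> t_ j <= s' -> s' <= t' -> t' <= t_ j.+1 -> s <= s' -> t' <= t ->
    `|eulert t' - eulert s'| <= drift_const * dl + Sr * om.
  move=> jN js st' tj ss tt; apply: (le_trans (eulert_cell_bound jN js st' tj)).
  have d' : t' - s' <= dl by lra.
  apply: lerD; first by apply: ler_wpM2l => //; exact: drift_const_ge0.
  apply: ler_wpM2l; first exact: Sr_ge0.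
  have i1 : 0 <= s' <= T by apply/andP; split; lra.
  have i2 : 0 <= t' <= T by apply/andP; split; lra.
  by apply: Wom => //; rewrite ger0_norm ?subr_ge0.
have [j [jN js sj]] := grid_point T0 N0 sT.
have [jN'|jN'] := ltnP j N; last first.
  have jE : j = N by apply/eqP; rewrite eqn_leq jN.
  have e : t = s.
    by apply/le_anti; rewrite st andbT (le_trans tT')//; move: js; rewrite jE gridtN.
  by rewrite e subrr normr0 mulr_ge0.
have sj' : s <= t_ j.+1 by rewrite gridt_step; lra.
have [tj|tj] := leP t (t_ j.+1).
  rewrite (le_trans (one j s t jN' js st tj (lexx _) (lexx _)))//; lra.
have [jN2|jN2] := ltnP j.+1 N; last first.
  by move: (lt_le_trans tj tT'); rewrite ltNge (_ : j.+1 = N) ?gridtN ?lexx//; apply/eqP; rewrite eqn_leq jN' jN2.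
have -> : eulert t - eulert s = (eulert t - eulert (t_ j.+1)) + (eulert (t_ j.+1) - eulert s) by ring.
have tj2 : t <= t_ j.+2 by rewrite gridt_step; lra.
have b1 := one j.+1 (t_ j.+1) t jN2 (lexx _) (ltW tj) tj2 sj' (lexx _).
have b2 := one j s (t_ j.+1) jN' js sj' (lexx _) (lexx _) (ltW tj).
by rewrite (le_trans (ler_normD _ _))//; lra.
Qed.

End bounded.

Lemma eulert_continuous : continuous s0 -> {within `[0, T], continuous W} ->
  {within `[0, T], continuous eulert}.
Proof.
move=> cs0 cW.
pose r := \sum_(j < N.+1) `|euler j|.
have r0 : 0 <= r by apply: sumr_ge0.
have Ur j : (j <= N)%N -> `|euler j| <= r.
  move=> jN; rewrite /r (bigD1 (Ordinal (jN : (j < N.+1)%N)))//= lerDl.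
  exact: sumr_ge0.
have [Sr hSr] : exists Sr : R, forall x, `|x| <= r -> `|s0 x| <= Sr.
  have [M [_ hM]] := @compact_bounded _ _ _
    (continuous_compact (continuous_subspaceT cs0) (@segment_compact R (- r) r)).
  exists (M + 1) => x xr; apply: (hM (M + 1)); first by rewrite ltrDl.
  by exists x => //=; rewrite in_itv/= -ler_norml.
have dc0 := drift_const_ge0 r0; have Sr0 := Sr_ge0 r0 hSr.
apply: continuous_path_eps => s sT e e0.
pose om := e / (4 * (Sr + 1)).
have om0 : 0 < om by rewrite divr_gt0// mulr_gt0// ltr_wpDl.
have [d1 d10 h1] := itv_unif_cont cW om0.
pose dl := Num.min (Num.min D (d1 / 2)) (e / (8 * (drift_const r + 1))).
have dl0 : 0 < dl by rewrite !lt_min D0 (divr_gt0 d10)// divr_gt0// mulr_gt0// ltr_wpDl.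
exists dl => // t tT ts.
have W1 s' t' : 0 <= s' <= T -> 0 <= t' <= T -> `|t' - s'| <= dl -> `|W t' - W s'| <= om.
  move=> s'T t'T st'; apply/ltW/h1 => //; apply: (le_lt_trans st').
  have : dl <= d1 / 2 by rewrite !ge_min lexx !orbT.
  lra.
have dlD : dl <= D by rewrite !ge_min lexx.
apply: (le_lt_trans (eulert_modulus r0 Ur hSr dlD W1 sT tT (ltW ts))).
have q1 : drift_const r * dl <= e / 8.
  have : dl <= e / (8 * (drift_const r + 1)) by rewrite ge_min lexx orbT.
  rewrite ler_pdivlMr ?mulr_gt0 ?ltr_wpDl//.
  by have := dl0; have := mulr_ge0 dc0 (ltW dl0); lra.
have q2 : Sr * om <= e / 4.
  have : om * (4 * (Sr + 1)) = e by rewrite mulfVK// gt_eqF// mulr_gt0// ltr_wpDl.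
  by have := om0; lra.
lra.
Qed.

End euler_path.

(** * Second moments and tightness of the Euler schemes *)

Section moment_inequalities.
Context {R : realType}.

Lemma sqr_sum_le n (x : nat -> R) : (\sum_(i < n) x i) ^+ 2 <= n%:R * \sum_(i < n) x i ^+ 2.
Proof.
elim: n => [|n ih]; first by rewrite !big_ord0 expr2 !mul0r.
rewrite !big_ord_recr/=; set S := \sum_(i < n) x i in ih *.
set Q := \sum_(i < n) x i ^+ 2 in ih *.
have h : 2 * S * x n <= Q + n%:R * x n ^+ 2.
  have -> : Q + n%:R * x n ^+ 2 = \sum_(i < n) (x i ^+ 2 + x n ^+ 2).
    by rewrite big_split/= big_const_ord iter_addr_0 mulr_natl.
  rewrite mulrAC /S mulr_sumr; apply: ler_sum => i _.
  have := sqr_ge0 (x i - x n); lra.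
by rewrite -natr1; move: ih; lra.
Qed.

(** Young's inequality with weight [D]: [(V + a)^2 <= (1 + D) V^2 + (1 + 1 / D) a^2]. As [a] is of
    order [D], the drift costs only a term of order [D] per step. *)
Lemma stopped_square (D K0 Kg T V a S Q : R) : 0 < D -> 0 <= K0 -> 0 <= Kg -> 0 <= S ->
  D ^+ 2 * S ^+ 2 <= T * D * Q -> `|a| <= D * (K0 + Kg * (`|V| + D * S)) ->
  (V + a) ^+ 2 <= (1 + D) * V ^+ 2 +
    (D + D ^+ 2) * (3 * (K0 ^+ 2 + Kg ^+ 2 * (V ^+ 2 + T * D * Q))).
Proof.
move=> D0 k0 kg0 S0 hS ha; set q := K0 + Kg * (`|V| + D * S) in ha.
have nV := normr_ge0 V.
have q0 : 0 <= q by rewrite addr_ge0// mulr_ge0// addr_ge0// mulr_ge0// ltW.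
have ha2 : a ^+ 2 <= D ^+ 2 * q ^+ 2.
  rewrite -[leLHS]real_normK ?num_real// -exprMn lerXn2r ?nnegrE//.
  by rewrite mulr_ge0// ltW.
have h1 : (V + a) ^+ 2 <= (1 + D) * V ^+ 2 + (1 + D^-1) * a ^+ 2.
  have -> : (1 + D) * V ^+ 2 + (1 + D^-1) * a ^+ 2 = (V + a) ^+ 2 + D^-1 * (D * V - a) ^+ 2.
    by field; rewrite gt_eqF.
  by rewrite lerDl mulr_ge0 ?sqr_ge0// invr_ge0 ltW.
have h2 : (1 + D^-1) * a ^+ 2 <= (D + D ^+ 2) * q ^+ 2.
  have -> : (D + D ^+ 2) * q ^+ 2 = (1 + D^-1) * (D ^+ 2 * q ^+ 2) by field; rewrite gt_eqF.
  by rewrite ler_wpM2l// addr_ge0// invr_ge0 ltW.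
have h3 : q ^+ 2 <= 3 * (K0 ^+ 2 + Kg ^+ 2 * (V ^+ 2 + T * D * Q)).
  have t3 (x y z : R) : (x + (y + z)) ^+ 2 <= 3 * (x ^+ 2 + (y ^+ 2 + z ^+ 2)).
    by have := sqr_ge0 (x - y); have := sqr_ge0 (y - z); have := sqr_ge0 (x - z); lra.
  rewrite /q mulrDr; apply: (le_trans (t3 _ _ _)); rewrite ler_wpM2l// lerD2l.
  rewrite mulrDr !exprMn real_normK ?num_real// lerD2l.
  by rewrite ler_wpM2l ?sqr_ge0.
have h4 : (D + D ^+ 2) * q ^+ 2 <= (D + D ^+ 2) * (3 * (K0 ^+ 2 + Kg ^+ 2 * (V ^+ 2 + T * D * Q))).
  by rewrite ler_wpM2l// addr_ge0 ?sqr_ge0// ltW.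
lra.
Qed.

Lemma moment_arith (D T K0 Kg Cs x y f b : R) : 0 < D -> D <= T -> 0 < T -> 0 <= x -> 0 <= y ->
  f <= (1 + D) * x + (D + D ^+ 2) * (3 * (K0 ^+ 2 + Kg ^+ 2 * (x + T * D * y))) ->
  b <= 2 * Cs ^+ 2 * (1 + x) ->
  f + D * b <= x + D * (1 + 3 * (1 + T) * (K0 ^+ 2 + Kg ^+ 2 * (1 + T)) + 2 * Cs ^+ 2)
    * (1 + x + D * y).
Proof.
move=> D0 DT T0 x0 y0 hf hb.
have k0 := sqr_ge0 K0; have kg := sqr_ge0 Kg; have cs := sqr_ge0 Cs.
have dy : 0 <= D * y by rewrite mulr_ge0// ltW.
have h1 : D * b <= D * (2 * Cs ^+ 2 * (1 + x + D * y)).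
  apply: ler_wpM2l; first exact: ltW.
  apply: (le_trans hb); apply: ler_wpM2l; first by rewrite mulr_ge0.
  by rewrite lerDl.
have h2 : K0 ^+ 2 + Kg ^+ 2 * (x + T * D * y) <= (K0 ^+ 2 + Kg ^+ 2 * (1 + T)) * (1 + x + D * y).
  have p1 := mulr_ge0 k0 x0; have p2 := mulr_ge0 k0 dy.
  have p3 := mulr_ge0 kg dy; have p4 := mulr_ge0 (mulr_ge0 kg x0) (ltW T0).
  have p5 := mulr_ge0 kg (ltW T0).
  lra.
have h3 : (D + D ^+ 2) * (3 * (K0 ^+ 2 + Kg ^+ 2 * (x + T * D * y))) <=
    (D * (1 + T)) * (3 * ((K0 ^+ 2 + Kg ^+ 2 * (1 + T)) * (1 + x + D * y))).
  apply: ler_pM.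
  - by rewrite addr_ge0 ?sqr_ge0// ltW.
  - rewrite mulr_ge0// addr_ge0// mulr_ge0// addr_ge0// -mulrA mulr_ge0// ltW//.
  - by rewrite mulrDr mulr1 lerD2l expr2 ler_wpM2l// ltW.
  - by rewrite ler_wpM2l.
have dx := mulr_ge0 (ltW D0) dy.
lra.
Qed.

(** The sum over the past of [i] is enlarged to the past of [n]. Multiplied by [D] and added up over
    at most [T / D] steps, it weighs at most [T] times the plain sum, to which the ordinary
    inequality applies. *)
Lemma gronwall_history (x : nat -> R) (M D T : R) N : 0 <= M -> 0 <= D -> 0 <= T ->
  (forall i, 0 <= x i) -> (forall n, (n <= N)%N -> n%:R * D <= T) ->
  (forall i, (i < N)%N -> x i.+1 <= x i + D * M * (1 + x i + D * \sum_(k < i) x k)) ->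
  forall n, (n <= N)%N -> x n <= (x 0 + M * T) * expR (M * (1 + T) * T).
Proof.
move=> M0 D0 T0 x0 nDT xS.
have rec n : (n <= N)%N -> x n <= (x 0 + M * T) + (M * (1 + T) * D) * \sum_(i < n) x i.
  move=> nN.
  have h : forall m, (m <= n)%N -> x m <= x 0 + \sum_(i < m)
      (D * M * (1 + x i + D * \sum_(k < n) x k)).
    elim=> [|m ih] mn; first by rewrite big_ord0 addr0.
    rewrite big_ord_recr/= addrA; apply: (le_trans (xS _ (leq_trans mn nN))).
    apply: lerD; first exact: ih (ltnW mn).
    apply: ler_wpM2l; first exact: mulr_ge0.
    rewrite lerD2l; apply: ler_wpM2l => //.
    by apply: ler_sum_widen => //; exact: ltnW.
  apply: (le_trans (h n (leqnn n))); rewrite -addrA lerD2l -mulr_sumr.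
  rewrite !big_split/= !big_const_ord !iter_addr_0.
  set S := \sum_(i < n) x i; have S0 : 0 <= S by apply: sumr_ge0.
  rewrite -[_ *+ n]mulr_natl -[D * S *+ n]mulr_natl mulr1.
  have -> : D * M * (n%:R + S + n%:R * (D * S)) =
    M * (n%:R * D) + M * (D * S) + M * (n%:R * D) * (D * S) by ring.
  have p1 := ler_wpM2l M0 (nDT n nN).
  have p2 := ler_wpM2r (mulr_ge0 D0 S0) p1.
  by lra.
move=> n nN; apply: (le_trans (discrete_gronwall _ _ rec nN)).
- by rewrite mulr_ge0// mulr_ge0// addr_ge0.
- by rewrite addr_ge0// mulr_ge0.
apply: ler_wpM2l; first by rewrite addr_ge0// mulr_ge0.
rewrite ler_expR -mulrA; apply: ler_wpM2l; first by rewrite mulr_ge0// addr_ge0.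
by rewrite mulrC; exact: nDT.
Qed.

End moment_inequalities.

Section euler_process.
Context {R : realType} {d : measure_display} {Om : measurableType d}.
Variables (P : probability Om R) (T : R) (W : R -> Om -> R) (F : R -> set (set Om)).
Hypothesis T0 : 0 < T.
Hypothesis wb : wiener_basis P T W F.
Variables (K K0 y0 : R) (B : R -> (R -> R) -> R) (s0 : R -> R).
Hypothesis K_gt0 : 0 < K.
Hypothesis dB : drift T K K0 B.
Hypothesis cs0 : continuous s0.

Definition Eu N j w := euler T y0 B s0 N (W ^~ w) j.
Definition Et N t w := eulert T y0 B s0 N (W ^~ w) t.

Lemma step_le (N : nat) : (0 < N)%N -> T / N%:R <= T.
Proof. by move=> N0; rewrite ler_pdivrMr ?ltr0n// ler_peMr ?ler1n// ltW. Qed.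

Lemma step_gt0 (N : nat) : (0 < N)%N -> 0 < T / N%:R.
Proof. by move=> N0; rewrite divr_gt0// ltr0n. Qed.

Lemma gdrift_euler_meas (G : set (set Om)) N j a b : (0 < N)%N -> (j < N)%N ->
  sigma_algebra setT G -> (forall i, (i <= j)%N -> meas_wrt G (Eu N i)) ->
  gridt T N j <= a -> a <= b -> b <= gridt T N j.+1 ->
  meas_wrt G (fun w => gdrift B (T / N%:R) j (fun i => Eu N i w) a b).
Proof.
move=> N0 jN sG mU ja ab bj.
apply: (gdrift_meas T0 K_gt0 dB (step_gt0 N0) (step_le N0) ja ab bj) => //.
by rewrite (le_trans bj)// gridt_leT.
Qed.

Lemma Eu_meas N j : (0 < N)%N -> (j <= N)%N -> meas_wrt (F (gridt T N j)) (Eu N j).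
Proof.
move=> N0; have sF t := wb_sigma wb t.
suff h : forall j, (j <= N)%N -> forall i, (i <= j)%N -> meas_wrt (F (gridt T N j)) (Eu N i).
  by move=> jN; exact: h.
elim=> {j} [|j ih] jN i.
  by rewrite leqn0 => /eqP ->; rewrite /Eu; exact: (meas_cst (sF _)).
have up i' : (i' <= j)%N -> meas_wrt (F (gridt T N j.+1)) (Eu N i').
  by move=> ij; apply: sub_meas_wrt (ih (ltnW jN) _ ij); apply: (wb_mono wb); exact: gridt_le.
rewrite leq_eqVlt => /orP[/eqP ->|]; last by rewrite ltnS; exact: up.
rewrite (_ : Eu N j.+1 = fun w => Eu N j w +
    gdrift B (T / N%:R) j (fun i => Eu N i w) (gridt T N j) (gridt T N j.+1) +
    s0 (Eu N j w) * (W (gridt T N j.+1) w - W (gridt T N j) w)); last first.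
  by apply/funext => w; exact: (@eulerS R T y0 B s0 N (W ^~ w) j).
apply: (measD (sF _)); first apply: (measD (sF _)).
- exact: up.
- by apply: gdrift_euler_meas => //; exact: gridt_le.
- apply: (measM (sF _)); first by apply: meas_compc => //; exact: up.
  apply: (measB (sF _)).
    by apply: (wb_adapted wb); exact: gridt_itv.
  apply: (sub_meas_wrt (wb_mono wb (gridt_le T0 N (leqnSn j)))).
  by apply: (wb_adapted wb); apply: gridt_itv => //; exact: ltnW.
Qed.

Lemma Et_grid N j w : (0 < N)%N -> Et N (gridt T N j) w = Eu N j w.
Proof. by move=> N0; exact: eulert_grid. Qed.

Lemma Et_meas N t : (0 < N)%N -> 0 <= t <= T -> meas_wrt (F t) (Et N t).
Proof.
move=> N0 tT; have sF := wb_sigma wb; have [j [jN jt tj]] := grid_point T0 N0 tT.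
have up i : (i <= j)%N -> meas_wrt (F t) (Eu N i).
  move=> ij; apply: (sub_meas_wrt _ (Eu_meas N0 (leq_trans ij jN))).
  by apply: (wb_mono wb); rewrite (le_trans _ jt)// gridt_le.
have [jN'|jN'] := ltnP j N; last first.
  have jE : j = N by apply/eqP; rewrite eqn_leq jN.
  have -> : t = gridt T N j.
    by apply/le_anti; rewrite jt andbT jE gridtN//; case/andP: tT.
  rewrite (_ : Et N _ = Eu N j); first exact: Eu_meas.
  by apply/funext => w; exact: Et_grid.
have tj' : t <= gridt T N j.+1 by rewrite gridt_step; lra.
rewrite (_ : Et N t = fun w => Eu N j w +
    gdrift B (T / N%:R) j (fun i => Eu N i w) (gridt T N j) t +
    s0 (Eu N j w) * (W t w - W (gridt T N j) w)); last first.
  by apply/funext => w; apply: eulert_cell => //; rewrite jt.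
apply: (measD (sF _)); first apply: (measD (sF _)).
- exact: up.
- by apply: gdrift_euler_meas => //.
- apply: (measM (sF _)); first by apply: meas_compc => //; exact: up.
  apply: (measB (sF _)); first exact: (wb_adapted wb).
  apply: (sub_meas_wrt (wb_mono wb jt)).
  by apply: (wb_adapted wb); apply: gridt_itv => //; exact: ltnW.
Qed.

Lemma Et_cont N : (0 < N)%N -> continuous_process T (Et N).
Proof.
move=> N0 w.
apply: (@eulert_continuous R T K K0 y0 B s0 T0 K_gt0 dB N (W ^~ w) N0 cs0).
exact: (wb_cont wb).
Qed.

Lemma euler_drift_growth N j w : (0 < N)%N -> (j < N)%N ->
  `|gdrift B (T / N%:R) j (fun i => Eu N i w) (gridt T N j) (gridt T N j.+1)| <=
  T / N%:R * (K0 + Kg T K * (`|Eu N j w| + T / N%:R * \sum_(i < j) `|Eu N i w|)).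
Proof.
move=> N0 jN; have e : T / N%:R = gridt T N j.+1 - gridt T N j by rewrite gridt_step addrC addKr.
rewrite [X in _ <= X * _]e.
apply: (gdrift_growth T0 K_gt0 dB (step_gt0 N0) (step_le N0)) => //; first exact: gridt_le.
exact: gridt_leT.
Qed.

Section tightness.
Variables (Cs : R).
Hypothesis s0_growth : forall x, `|s0 x| <= Cs * (1 + `|x|).
Variables (N : nat) (r : R).
Hypothesis N0 : (0 < N)%N.
Hypothesis r0 : 0 < r.
Local Notation D := (T / N%:R).
Local Notation Fj := (fun j => F (gridt T N j)).
Local Notation v := (fun j => increment W (gridt T N j) (gridt T N j.+1)).

Definition inside j := [set w | forall i, (i <= j)%N -> `|Eu N i w| <= r].
Local Notation J := inside.
Definition stopped_drift j w : R :=
  \1_(J j) w * gdrift B D j (fun i => Eu N i w) (gridt T N j) (gridt T N j.+1).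
Definition stopped_diffusion j w : R := \1_(J j) w * s0 (Eu N j w).
Local Notation al := stopped_drift.
Local Notation be := stopped_diffusion.

(** The scheme frozen after it leaves [[-r, r]]. Bounded coefficients make its second moments finite
    and its martingale terms centred, while the resulting moment bound does not depend on [r]. *)
Definition stopped_euler := dproc v y0 al be.
Local Notation V := stopped_euler.

Lemma stopped_eulerS j w : V j.+1 w = V j w + (al j w + be j w * v j w).
Proof. by rewrite [LHS]/dproc big_ord_recr/= addrA. Qed.

Lemma stopped_eulerE j w : (forall i, (i < j)%N -> `|Eu N i w| <= r) -> V j w = Eu N j w.
Proof.
elim: j => [|j ih] h; first by rewrite /V /dproc big_ord0 addr0.
have Jj : J j w by move=> i ij; apply: h; rewrite ltnS.
rewrite stopped_eulerS ih => [|i ij]; last by apply: h; rewrite ltnW.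
by rewrite /al /be !indicE !mem_set// !mul1r addrA /Eu eulerS.
Qed.

Lemma stopped_euler_after j k w : (j <= k)%N -> r < `|Eu N j w| -> V k w = V j w.
Proof.
move=> jk rj; elim: k jk => [|k ih]; first by rewrite leqn0 => /eqP ->.
rewrite leq_eqVlt => /orP[/eqP ->//|]; rewrite ltnS => jk.
rewrite stopped_eulerS ih// /al /be !indicE memNset.
  by rewrite !mul0r !addr0.
by move=> /(_ j jk); rewrite leNgt rj.
Qed.

(** At the first exit index the stopped scheme still equals the scheme, and it keeps this value
    until [N]. A moment of the terminal value thus controls the whole path. *)
Lemma euler_exceeds w : (exists2 j, (j <= N)%N & r < `|Eu N j w|) -> r < `|V N w|.
Proof.
move=> [j jN rj].
have ex : exists j, (j <= N)%N && (r < `|Eu N j w|) by exists j; rewrite jN.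
case: (ex_minnP ex) => m /andP[mN rm] mmin.
rewrite (stopped_euler_after mN rm) stopped_eulerE// => i im.
rewrite leNgt; apply/negP => h; have := mmin i; rewrite h (leq_trans (ltnW im) mN) => /(_ isT).
by rewrite leqNgt im.
Qed.

Lemma insideE (j : nat) (w : Om) : J j w -> forall i, (i <= j)%N -> V i w = Eu N i w /\ `|Eu N i w| <= r.
Proof.
move=> Jw i ij; split; last exact: Jw.
by apply: stopped_eulerE => k ki; apply: Jw; rewrite (leq_trans (ltnW ki)).
Qed.

Let K0_ge0 : 0 <= K0.
Proof.
have h : (0 : R) <= 0 <= T by rewrite lexx ltW.
exact: le_trans (normr_ge0 _) (drift_bnd dB h).
Qed.

Let Cs0 : 0 <= Cs.
Proof.
by have := s0_growth 0; rewrite normr0 addr0 mulr1; apply: le_trans.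
Qed.

Lemma stopped_drift_growth j w : (j < N)%N -> `|al j w| <=
  D * (K0 + Kg T K * (`|V j w| + D * \sum_(i < j) `|V i w|)).
Proof.
move=> jN; have D0 := step_gt0 N0; have k0 := Kg_gt0 T0 K_gt0.
rewrite /al normrM indicE; have [Jw|Jw] := pselect (J j w); last first.
  rewrite memNset// normr0 mul0r mulr_ge0 ?(ltW D0)// addr_ge0// mulr_ge0 ?(ltW k0)//.
  by rewrite addr_ge0// mulr_ge0 ?(ltW D0)// sumr_ge0.
rewrite mem_set// normr1 mul1r (le_trans (euler_drift_growth w N0 jN))//.
rewrite (insideE Jw (leqnn j)).1; under [X in _ <= _ * (_ + _ * (_ + _ * X))]eq_bigr => i _ do
  rewrite (insideE Jw (ltnW (ltn_ord i))).1.
exact: lexx.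
Qed.

Lemma stopped_diffusion_growth j w : `|be j w| <= Cs * (1 + `|V j w|).
Proof.
rewrite /be normrM indicE; have [Jw|Jw] := pselect (J j w); last first.
  by rewrite memNset// normr0 mul0r mulr_ge0// addr_ge0.
by rewrite mem_set// normr1 mul1r (insideE Jw (leqnn j)).1.
Qed.

(** This bound depends on [r] and [N]. It serves integrability and the choice of test variables, and
    does not appear in the moment estimate. *)
Let Cr := D * (K0 + Kg T K * (r + T * r)) + Cs * (1 + r) + r.

Let J_bound j w : (j < N)%N -> [/\ `|al j w| <= Cr, `|be j w| <= Cr &
  `|(V j w + al j w) * be j w| <= Cr * Cr].
Proof.
move=> jN; have D0 := step_gt0 N0; have k0 := Kg_gt0 T0 K_gt0.
have a1 : 0 <= D * (K0 + Kg T K * (r + T * r)).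
  rewrite mulr_ge0 ?(ltW D0)// addr_ge0// mulr_ge0 ?(ltW k0)// addr_ge0 ?mulr_ge0// ltW//.
have a2 : 0 <= Cs * (1 + r) by rewrite mulr_ge0// addr_ge0// ltW.
have Cr0 : 0 <= Cr by rewrite /Cr !addr_ge0// ltW.
have [Jw|Jw] := pselect (J j w); last first.
  by rewrite /al /be indicE memNset// !mul0r mulr0 normr0 mulr_ge0.
have [Vj Uj] := insideE Jw (leqnn j).
have b1 : `|al j w| <= D * (K0 + Kg T K * (r + T * r)).
  apply: (le_trans (stopped_drift_growth w jN)).
  apply: ler_wpM2l; first exact: ltW.
  rewrite lerD2l; apply: ler_wpM2l; first exact: ltW.
  apply: lerD; first by rewrite Vj.
  have s1 : \sum_(i < j) `|V i w| <= j%:R * r.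
    apply: (@le_trans _ _ (\sum_(i < j) r)).
      by apply: ler_sum => i _; have [-> h] := insideE Jw (ltnW (ltn_ord i)).
    by rewrite big_const_ord iter_addr_0 mulr_natl.
  apply: (le_trans (ler_wpM2l (ltW D0) s1)).
  rewrite mulrA ler_wpM2r ?(ltW r0)// mulrC; exact: (gridt_leT T0 N0 (ltnW jN)).
have b2 : `|be j w| <= Cs * (1 + r).
  apply: (le_trans (stopped_diffusion_growth j w)); apply: ler_wpM2l => //.
  by rewrite lerD2l Vj.
split.
- by rewrite (le_trans b1)// /Cr; have := ltW r0; lra.
- by rewrite (le_trans b2)// /Cr; have := ltW r0; lra.
- rewrite normrM; apply: ler_pM => //.
    by rewrite (le_trans (ler_normD _ _))// Vj /Cr; move: b1; lra.
  by rewrite (le_trans b2)// /Cr; have := ltW r0; lra.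
Qed.

Let sF j : sigma_algebra setT (Fj j). Proof. exact: (wb_sigma wb). Qed.

Lemma inside_meas j : (j <= N)%N -> Fj j (J j).
Proof.
move=> jN; rewrite (_ : J j = \bigcap_(i in [set i | (i <= j)%N]) [set w | `|Eu N i w| <= r]) //.
apply: (sa_bigcap_count (sF j)) => i /= ij.
apply: (sa_le (sF j)); last exact: (meas_cst (sF j)).
apply: meas_norm; apply: (sub_meas_wrt _ (Eu_meas N0 (leq_trans ij jN))).
by apply: (wb_mono wb); exact: gridt_le.
Qed.

Lemma stopped_drift_meas j : (j < N)%N -> meas_wrt (Fj j) (al j).
Proof.
move=> jN; apply: (measM (sF j)).
  exact: (meas_ind (sF j) (inside_meas (ltnW jN))).
apply: gdrift_euler_meas => //; last exact: gridt_le.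
move=> i ij; apply: (sub_meas_wrt _ (Eu_meas N0 (leq_trans ij (ltnW jN)))).
by apply: (wb_mono wb); exact: gridt_le.
Qed.

Lemma stopped_diffusion_meas j : (j < N)%N -> meas_wrt (Fj j) (be j).
Proof.
move=> jN; apply: (measM (sF j)).
  exact: (meas_ind (sF j) (inside_meas (ltnW jN))).
by apply: meas_compc => //; exact: Eu_meas N0 (ltnW jN).
Qed.

Lemma stopped_euler_meas j : (j <= N)%N -> meas_wrt (Fj j) (V j).
Proof.
elim: j => [|j ih] jN.
  by rewrite /V /dproc; under eq_fun do rewrite big_ord0 addr0; exact: (meas_cst (sF 0)).
have up f : meas_wrt (Fj j) f -> meas_wrt (Fj j.+1) (f : Om -> R).
  by apply: sub_meas_wrt; apply: (wb_mono wb); exact: gridt_le.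
rewrite (funext (stopped_eulerS j)).
have [_ _ _ _ [nv _]] := wiener_grid_basis T0 wb N0; have [mv _ _ _] := nv j jN.
apply: (measD (sF j.+1)); first exact/up/ih/ltnW.
apply: (measD (sF j.+1)); first exact/up/stopped_drift_meas.
by apply: (measM (sF j.+1)) => //; exact/up/stopped_diffusion_meas.
Qed.

Definition moment_const : R := 1 + 3 * (1 + T) * (K0 ^+ 2 + Kg T K ^+ 2 * (1 + T)) + 2 * Cs ^+ 2.

(** In the square of [(V + al) + be v] the cross term has mean zero and [(be v)^2] has mean
    [D E be^2]; the growth bounds on [al] and [be] then give a recursion with memory. *)
Lemma moment_step j : (j < N)%N -> L1 P (fun w => V j w ^+ 2) ->
  (forall i, (i < j)%N -> L1 P (fun w => V i w ^+ 2)) ->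
  L1 P (fun w => V j.+1 w ^+ 2) /\
  Ex P (fun w => V j.+1 w ^+ 2) <= Ex P (fun w => V j w ^+ 2) +
    D * moment_const * (1 + Ex P (fun w => V j w ^+ 2) +
      D * \sum_(i < j) Ex P (fun w => V i w ^+ 2)).
Proof.
move=> jN IV IVi; have D0 := step_gt0 N0; have DT := step_le N0.
have [_ _ _ Fm [nv _]] := wiener_grid_basis T0 wb N0.
have [mv Iv Iv2 vE] := nv j jN.
have m' f : meas_wrt (Fj j) f -> meas_wrt measurable (f : Om -> R).
  by apply: sub_meas_wrt; exact: (wb_meas wb).
have mal := stopped_drift_meas jN; have mbe := stopped_diffusion_meas jN; have mV := stopped_euler_meas (ltnW jN).
have bnd w := J_bound w jN.
pose f1 w := (V j w + al j w) ^+ 2.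
pose f2 w := (V j w + al j w) * be j w * v j w.
pose f3 w := be j w ^+ 2 * v j w ^+ 2.
have eV w : V j.+1 w ^+ 2 = f1 w + (2 * f2 w + f3 w).
  by rewrite stopped_eulerS /f1 /f2 /f3; ring.
have mf2 : meas_wrt (Fj j) (fun w => (V j w + al j w) * be j w).
  by apply: (measM (sF j)) => //; exact: (measD (sF j)).
have I2 : L1 P f2 by apply: (L1M (m' _ mf2)) Iv => w; have [_ _] := bnd w; exact.
have E2 : Ex P f2 = 0.
  by apply: (vE _ (Cr * Cr) mf2 _).1 => w; have [] := bnd w.
have be2 w : `|be j w ^+ 2| <= Cr ^+ 2.
  by have [_ h _] := bnd w; rewrite normrX lerXn2r ?nnegrE// (le_trans _ h).
have mbe2 : meas_wrt (Fj j) (fun w => be j w ^+ 2) by exact: measX.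
have Ibe2 : L1 P (fun w => be j w ^+ 2) by apply: (L1_bnd _ (m' _ mbe2) be2).
have I3 : L1 P f3 by apply: (L1M (m' _ mbe2) be2 Iv2).
have E3 : Ex P f3 = D * Ex P (fun w => be j w ^+ 2) by exact: (vE _ _ mbe2 be2).2.
pose g w := (1 + D) * V j w ^+ 2 + (D + D ^+ 2) * (3 * (K0 ^+ 2 + Kg T K ^+ 2 *
   (V j w ^+ 2 + T * D * \sum_(i < j) V i w ^+ 2))).
have IS : L1 P (fun w => \sum_(i < j) V i w ^+ 2).
  by apply: (@L1_sum _ _ _ P _ _ (fun (i : 'I_j) w => V i w ^+ 2)) => i; exact: IVi.
have Ih : L1 P (fun w => V j w ^+ 2 + T * D * \sum_(i < j) V i w ^+ 2).
  by apply: L1D => //; exact: L1Z.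
have Ik : L1 P (fun w => cst (K0 ^+ 2) w + Kg T K ^+ 2 *
   (V j w ^+ 2 + T * D * \sum_(i < j) V i w ^+ 2)).
  by apply: L1D; [exact: L1_cst|exact: L1Z].
have Ig1 : L1 P (fun w => (1 + D) * V j w ^+ 2) by exact: L1Z.
have Ig2 : L1 P (fun w => (D + D ^+ 2) * (3 * (K0 ^+ 2 + Kg T K ^+ 2 *
   (V j w ^+ 2 + T * D * \sum_(i < j) V i w ^+ 2)))) by do 2 apply: L1Z.
have Ig : L1 P g by exact: L1D.
have f1g w : f1 w <= g w.
  have al1 := stopped_drift_growth w jN.
  set S := \sum_(i < j) `|V i w| in al1.
  set Q := \sum_(i < j) V i w ^+ 2.
  have Q0 : 0 <= Q by apply: sumr_ge0 => i _; exact: sqr_ge0.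
  have S2 : D ^+ 2 * S ^+ 2 <= T * D * Q.
    have h1 : S ^+ 2 <= j%:R * Q.
      apply: (le_trans (sqr_sum_le j (fun i => `|V i w|))); apply: ler_wpM2l => //.
      by apply: ler_sum => i _; rewrite real_normK ?num_real.
    apply: (le_trans (ler_wpM2l (sqr_ge0 _) h1)).
    have -> : D ^+ 2 * (j%:R * Q) = gridt T N j * (D * Q) by rewrite /gridt; ring.
    rewrite -[leRHS]mulrA; apply: ler_wpM2r; first by rewrite mulr_ge0// ltW.
    exact: (gridt_leT T0 N0 (ltnW jN)).
  apply: (stopped_square D0 K0_ge0 (ltW (Kg_gt0 T0 K_gt0)) _ S2 al1).
  exact: sumr_ge0.
have I1 : L1 P f1.
  apply: (L1_le _ Ig) => [|w]; last by rewrite ger0_norm ?sqr_ge0.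
  by apply/m'/measX/(measD (sF j)).
have I23 : L1 P (fun w => 2 * f2 w + f3 w) by apply: L1D => //; exact: L1Z.
rewrite (funext eV); split; first exact: L1D.
rewrite (ExD I1 I23) (ExD (L1Z 2 I2) I3) (ExZ 2 I2) E2 mulr0 add0r E3.
have e1 : Ex P f1 <= Ex P g by exact: le_Ex.
set x := Ex P (fun w => V j w ^+ 2).
set y := \sum_(i < j) Ex P (fun w => V i w ^+ 2).
have eg : Ex P g = (1 + D) * x + (D + D ^+ 2) * (3 * (K0 ^+ 2 + Kg T K ^+ 2 * (x + T * D * y))).
  rewrite (ExD Ig1 Ig2) (ExZ _ IV) (ExZ _ (L1Z 3 Ik)) (ExZ _ Ik).
  rewrite (ExD (L1_cst P (K0 ^+ 2)) (L1Z _ Ih)) Ex_cst (ExZ _ Ih) (ExD IV (L1Z _ IS)) (ExZ _ IS).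
  rewrite (@Ex_sum _ _ _ P _ _ (fun (i : 'I_j) w => V i w ^+ 2))// => i; exact: IVi.
have e3 : Ex P (fun w => be j w ^+ 2) <= 2 * Cs ^+ 2 * (1 + x).
  have I1V : L1 P (fun w => cst 1 w + V j w ^+ 2) by apply: L1D => //; exact: L1_cst.
  rewrite -[X in _ * (X + _)](Ex_cst P) -(ExD (L1_cst P 1) IV) -(ExZ _ I1V).
  apply: le_Ex => //; first exact: L1Z.
  move=> w; have h := stopped_diffusion_growth j w.
  rewrite -[be j w ^+ 2]real_normK ?num_real//.
  apply: (@le_trans _ _ ((Cs * (1 + `|V j w|)) ^+ 2)).
    by rewrite lerXn2r ?nnegrE// (le_trans _ h).
  have -> : 2 * Cs ^+ 2 * (cst 1 w + V j w ^+ 2) = Cs ^+ 2 * (2 * (1 + V j w ^+ 2)).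
    by rewrite /cst; ring.
  rewrite exprMn; apply: ler_wpM2l; first exact: sqr_ge0.
  rewrite -[V j w ^+ 2]real_normK ?num_real//.
  by have := sqr_ge0 (1 - `|V j w|); lra.
have x0 : 0 <= x by apply: Ex_ge0 => w; exact: sqr_ge0.
have y0' : 0 <= y by apply: sumr_ge0 => i _; apply: Ex_ge0 => w; exact: sqr_ge0.
move: e1; rewrite eg => e1.
exact: (moment_arith D0 DT T0 x0 y0' e1 e3).
Qed.

Lemma stopped_moment j : (j <= N)%N -> L1 P (fun w => V j w ^+ 2) /\
  Ex P (fun w => V j w ^+ 2) <= (y0 ^+ 2 + moment_const * T) *
    expR (moment_const * (1 + T) * T).
Proof.
have D0 := step_gt0 N0; have DT := step_le N0.
have M0 : 0 <= moment_const.
  have q1 : 0 <= Kg T K ^+ 2 * (1 + T) by rewrite mulr_ge0 ?sqr_ge0// addr_ge0// ltW.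
  have q2 : 0 <= 3 * (1 + T) by rewrite mulr_ge0// addr_ge0// ltW.
  have q3 := mulr_ge0 q2 (addr_ge0 (sqr_ge0 K0) q1).
  exact: (addr_ge0 (addr_ge0 ler01 q3) (mulr_ge0 (ler0n R 2) (sqr_ge0 Cs))).
have Vint : forall j, (j <= N)%N -> L1 P (fun w => V j w ^+ 2).
  suff h : forall j, (j <= N)%N -> forall i, (i <= j)%N -> L1 P (fun w => V i w ^+ 2).
    by move=> i iN; exact: h iN _ (leqnn i).
  elim=> [|i ih] iN k.
    rewrite leqn0 => /eqP ->.
    rewrite (_ : (fun w => V 0 w ^+ 2) = cst (y0 ^+ 2)); first exact: L1_cst.
    by apply/funext => w; rewrite /V /dproc big_ord0 addr0.
  rewrite leq_eqVlt => /orP[/eqP ->|]; last by rewrite ltnS; apply: ih; exact: ltnW.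
  apply: (moment_step iN _ _).1; first exact: ih (ltnW iN) _ (leqnn i).
  by move=> k' ki; apply: ih (ltnW iN) _ (ltnW ki).
move=> jN; split; first exact: Vint.
pose x i := Ex P (fun w => V i w ^+ 2).
have x0 i : 0 <= x i by apply: Ex_ge0 => w; exact: sqr_ge0.
have xS i : (i < N)%N -> x i.+1 <= x i + D * moment_const * (1 + x i + D * \sum_(k < i) x k).
  move=> iN; apply: (moment_step iN _ _).2; first exact: Vint (ltnW iN).
  by move=> k ki; apply: Vint; rewrite (leq_trans (ltnW ki))// ltnW.
have h0 : x 0 = y0 ^+ 2.
  rewrite /x (_ : (fun w => V 0 w ^+ 2) = cst (y0 ^+ 2)) ?Ex_cst//.
  by apply/funext => w; rewrite /V /dproc big_ord0 addr0.
rewrite -h0; apply: (gronwall_history M0 (ltW D0) (ltW T0) x0 _ xS jN) => n nN.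
exact: (gridt_leT T0 N0 nN).
Qed.

Lemma euler_tight_at : pbnd P [set w | exists2 j, (j <= N)%N & r < `|Eu N j w|]
  ((y0 ^+ 2 + moment_const * T) * expR (moment_const * (1 + T) * T) / r ^+ 2).
Proof.
have [I hI] := stopped_moment (leqnn N).
have r2 : 0 < r ^+ 2 by rewrite exprn_gt0.
apply: pbnd_le (markov_L1 r2 I (fun w => sqr_ge0 _)).
- move=> w /euler_exceeds h /=; rewrite -[leRHS]real_normK ?num_real//.
  by rewrite lerXn2r ?nnegrE// ltW.
- by rewrite ler_pM2r// invr_gt0.
Qed.

End tightness.

Lemma euler_tight (e : R) : linear_growth s0 -> 0 < e -> exists2 r, 0 < r &
  forall N, (0 < N)%N -> pbnd P [set w | exists2 j, (j <= N)%N & r < `|Eu N j w|] e.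
Proof.
move=> [Cs hCs] e0.
set A := (y0 ^+ 2 + moment_const Cs * T) * expR (moment_const Cs * (1 + T) * T).
(* The lower bound 1 gives [A / e <= r <= r ^+ 2], so that the Markov bound [A / r ^+ 2] is at most
   [e]. *)
pose r := Num.max 1 (A / e).
have r0 : 0 < r by rewrite lt_max ltr01.
exists r => // N N0; apply: pbnd_le (euler_tight_at hCs N0 r0) => //.
rewrite ler_pdivrMr ?exprn_gt0// -/A.
have -> : A = e * (A / e) by rewrite mulrC divfK// gt_eqF.
apply: ler_wpM2l; first exact: ltW.
have h1 : A / e <= r by rewrite le_max lexx orbT.
have h2 : 1 <= r by rewrite le_max lexx.
by rewrite (le_trans h1)// expr2 ler_peMl// ltW.
Qed.

End euler_process.

(** * The Euler schemes form a Cauchy sequence *)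

Section euler_cauchy.
Context {R : realType} {d : measure_display} {Om : measurableType d}.
Variables (P : probability Om R) (T : R) (W : R -> Om -> R) (F : R -> set (set Om)).
Hypothesis T0 : 0 < T.
Hypothesis wb : wiener_basis P T W F.
Variables (K K0 y0 : R) (B : R -> (R -> R) -> R) (s0 : R -> R).
Hypothesis K_gt0 : 0 < K.
Hypothesis dB : drift T K K0 B.
Hypothesis cs0 : continuous s0.
Local Notation Eu := (Eu T W y0 B s0).
Local Notation Et := (Et T W y0 B s0).
Local Notation perr := (process_error T W y0 B s0).

Ltac slra := clear -P T W F T0 wb K K0 y0 B s0 K_gt0 dB cs0; lra.

Lemma continuous_bound (r : R) : 0 <= r ->
  exists2 S : R, 0 <= S & forall x, `|x| <= r -> `|s0 x| <= S.
Proof.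
move=> r0; have [M [_ hM]] := @compact_bounded _ _ _
  (continuous_compact (continuous_subspaceT cs0) (@segment_compact R (- r) r)).
exists (Num.max (M + 1) 1); first by rewrite le_max ler01 orbT.
move=> x xr; rewrite le_max; apply/orP; left.
apply: (hM (M + 1)); first by rewrite ltrDl.
by exists x => //=; rewrite in_itv/= -ler_norml.
Qed.

(** [omW] and [a] are chosen before [N]: as long as they stay in [[-r, r]], the schemes on all fine
    grids have oscillations controlled by that of [W] alone. *)
Lemma Et_modulus_small (r om : R) : 0 <= r -> 0 < om ->
  exists2 omW, 0 < omW & exists2 a, 0 < a & forall N, (0 < N)%N -> T / N%:R < a ->
  forall dl w, dl <= T / N%:R -> (forall j, (j <= N)%N -> `|Eu N j w| <= r) ->
  (forall s t, 0 <= s <= T -> 0 <= t <= T -> `|t - s| <= dl -> `|W t w - W s w| <= omW) ->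
  forall s t, 0 <= s <= T -> 0 <= t <= T -> `|t - s| <= dl -> `|Et N t w - Et N s w| <= om.
Proof.
move=> r0 om0; have [Sr Sr0 hSr] := continuous_bound r0.
have c0 := drift_const_ge0 T0 K_gt0 dB r0; set c := drift_const T K K0 r in c0.
exists (om / (4 * (Sr + 1))); first by rewrite divr_gt0// mulr_gt0// ltr_wpDl.
exists (om / (4 * (c + 1))); first by rewrite divr_gt0// mulr_gt0// ltr_wpDl.
move=> N N0 Da dl w dlD Ur Wom s t sT tT st.
apply: (le_trans (eulert_modulus T0 K_gt0 dB N0 r0 Ur hSr dlD Wom sT tT st)).
rewrite -/c; have q1 : Sr * (om / (4 * (Sr + 1))) <= om / 4.
  have h : om / (4 * (Sr + 1)) * (4 * (Sr + 1)) = om by rewrite divfK// gt_eqF// mulr_gt0// ltr_wpDl.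
  have h' : 0 < om / (4 * (Sr + 1)) by rewrite divr_gt0// mulr_gt0// ltr_wpDl.
  move: h h'; set z := om / _; slra.
have q2 : c * dl <= om / 4.
  have dl0 : 0 <= dl by exact: le_trans st.
  move: (le_lt_trans dlD Da); rewrite ltr_pdivlMr ?mulr_gt0 ?ltr_wpDl//.
  move: dl0 (mulr_ge0 c0 dl0); slra.
move: q1 q2; slra.
Qed.

Lemma Et_bounded (r om : R) N w : (0 < N)%N -> (forall j, (j <= N)%N -> `|Eu N j w| <= r) ->
  (forall s t, 0 <= s <= T -> 0 <= t <= T -> `|t - s| <= T / N%:R -> `|Et N t w - Et N s w| <= om) ->
  forall t, 0 <= t <= T -> `|Et N t w| <= r + om.
Proof.
move=> N0 Ur ho t tT; have [j [jN jt tj]] := grid_point T0 N0 tT.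
have jT := gridt_itv T0 N0 jN.
have h : `|Et N t w - Et N (gridt T N j) w| <= om.
  by apply: ho => //; rewrite ger0_norm// subr_ge0.
have -> : Et N t w = Eu N j w + (Et N t w - Et N (gridt T N j) w).
  by rewrite Et_grid//; ring.
by rewrite (le_trans (ler_normD _ _))// lerD// Ur.
Qed.

Lemma gridt_refine N q j : (0 < q)%N -> gridt T (N * q) (j * q) = gridt T N j.
Proof.
move=> q0; rewrite /gridt !natrM; have [->|N0] := eqVneq N 0.
  by rewrite !mul0r invr0 !mulr0.
have q1 : q%:R != 0 :> R by rewrite pnatr_eq0 -lt0n.
have n1 : N%:R != 0 :> R by rewrite pnatr_eq0.
by field; rewrite q1 n1.
Qed.

Lemma refined_cell N q i : (0 < N)%N -> (0 < q)%N -> (i < N * q)%N ->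
  [/\ (i %/ q < N)%N, gridt T N (i %/ q) <= gridt T (N * q) i &
      gridt T (N * q) i.+1 <= gridt T N (i %/ q).+1].
Proof.
move=> N0 q0 iM; split; first by rewrite ltn_divLR.
- by rewrite -(gridt_refine N (i %/ q) q0) gridt_le// leq_trunc_div.
- by rewrite -(gridt_refine N (i %/ q).+1 q0) gridt_le// ltn_ceil.
Qed.

Lemma process_error_self N j w : (0 < N)%N -> (j <= N)%N -> perr (Et N) N j w = 0.
Proof.
move=> N0; rewrite /process_error /grid_error.
elim: j => [|j ih] jN.
  by rewrite big_ord0 subr0 Et_grid//; exact: subrr.
rewrite big_ord_recr/=; move: (ih (ltnW jN)); rewrite !Et_grid// => e.
have -> : Eu N j.+1 w = Eu N j w + path_drift T B (Et N) N j w +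
    s0 (Eu N j w) * increment W (gridt T N j) (gridt T N j.+1) w.
  apply: (etrans (eulerS T y0 B s0 N (W ^~ w) j)); congr (_ + _ + _).
  by apply: gdrift_eq => i _; rewrite Et_grid.
by rewrite -[RHS]e; ring.
Qed.

(** On the refined grid the coarse scheme has the form of the fine one, with the diffusion
    coefficient taken at the beginning of the coarse cell. The discrepancy of diffusions is a
    martingale sum of small bracket, and both drifts are close to the integral of [B] along the
    scheme. The threshold [N0] does not depend on [q]. *)
Lemma euler_fine_error (r dl e : R) : 0 < r -> 0 < dl -> 0 < e -> exists N0,
  forall N q, (N0 <= N)%N -> (0 < N)%N -> (0 < q)%N ->
  pbnd P [set w | (forall j, (j <= N)%N -> `|Eu N j w| <= r) /\
    exists2 l, (l <= N * q)%N & dl < `|perr (Et N) (N * q) l w|] e.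
Proof.
move=> r0 dl0 e0; pose lam := dl / 2; have lam0 : 0 < lam by rewrite divr_gt0.
have e20 : 0 < e / 2 by rewrite divr_gt0.
pose kap := e / 2 * lam ^+ 2; have kap0 : 0 < kap by rewrite mulr_gt0// exprn_gt0.
pose om0 := Num.min 1 (kap / T).
have om00 : 0 < om0 by rewrite lt_min ltr01 divr_gt0.
have om0k : T * om0 ^+ 2 <= kap.
  have h1 : om0 <= 1 by rewrite ge_min lexx.
  have h2 : om0 <= kap / T by rewrite ge_min lexx orbT.
  have h3 : om0 ^+ 2 <= kap / T by rewrite (le_trans _ h2)// expr2 ler_piMl// ltW.
  have -> : kap = T * (kap / T) by rewrite mulrC divfK// gt_eqF.
  by rewrite ler_wpM2l// ltW.
pose r1 := r + 1.
have [d1 d10 hd1] := itv_unif_cont (@continuous_subspaceT _ _ `[- r1, r1] _ cs0) om00.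
(* An oscillation small enough for the scheme to stay in [[-(r + 1), r + 1]], for [s0] to vary by at
   most [om0], and for each of the two drift errors to be at most [dl / 4]. *)
pose om := Num.min (Num.min 1 (d1 / 2)) (dl / (4 * (K * (1 + T) * T))).
have KT0 : 0 < K * (1 + T) * T by rewrite !mulr_gt0// addr_gt0.
have om_gt0 : 0 < om by rewrite !lt_min ltr01 (divr_gt0 d10)// divr_gt0// mulr_gt0.
have om1 : om <= 1 by rewrite !ge_min lexx.
have omd1 : om < d1.
  have : om <= d1 / 2 by rewrite !ge_min lexx orbT.
  by move: d10; slra.
have omK : K * (1 + T) * om * T <= dl / 4.
  have : om <= dl / (4 * (K * (1 + T) * T)) by rewrite ge_min lexx orbT.
  move=> /(ler_wpM2l (ltW KT0)); rewrite mulrAC => /le_trans; apply.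
  have -> // : forall x : R, 0 < x -> x * (dl / (4 * x)) = dl / 4.
  by move=> x x0; field; rewrite gt_eqF.
have [omW omW0 [a a0 hmod]] := Et_modulus_small (ltW r0) om_gt0.
have mW t : 0 <= t <= T -> meas_wrt measurable (W t).
  by move=> tT; apply: sub_meas_wrt (wb_adapted wb tT); exact: (wb_meas wb).
have [d3 d30 hd3] := osc_small P T0 (wb_cont wb) mW omW0 e20.
have [N0 hN0] : exists N0, forall N, (N0 <= N)%N -> (0 < N)%N -> T / N%:R < Num.min d3 a.
  by apply: small_step => //; rewrite lt_min d30.
exists N0 => N q N0N N1 q0; have := hN0 _ N0N N1; rewrite lt_min => /andP[D3 Da].
pose M := (N * q)%N; have M0 : (0 < M)%N by rewrite muln_gt0 N1.
set D := T / N%:R in D3 Da; have D0 : 0 < D by exact: step_gt0.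
have DT : D <= T by exact: step_le.
pose DM := T / M%:R; have DM0 : 0 < DM by exact: step_gt0.
have DMD : DM <= D.
  rewrite ler_pM2l// lef_pV2 ?posrE ?ltr0n// ler_nat; exact: leq_pmulr.
have DMT : DM <= T by exact: step_le.
have [_ sF FS Fm [nv _]] := wiener_grid_basis T0 wb M0.
pose bb i w := s0 (Eu N (i %/ q) w) - s0 (Et N (gridt T M i) w).
have ad_bb i : (i < M)%N -> meas_wrt (F (gridt T M i)) (bb i).
  move=> iM; have [jN h1 h2] := refined_cell N1 q0 iM.
  apply: (measB (sF i)); apply: meas_compc => //.
    apply: (sub_meas_wrt _ (Eu_meas T0 wb y0 K_gt0 dB cs0 N1 (ltnW jN))).
    exact: (wb_mono wb).
  apply: (Et_meas T0 wb y0 K_gt0 dB cs0 N1).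
  by apply: gridt_itv => //; exact: ltnW.
have hL := lenglart sF FS Fm nv DM0 (leqnn M) ad_bb lam0 (ltW kap0).
have ek : kap / lam ^+ 2 = e / 2 by rewrite /kap mulfK// gt_eqF// exprn_gt0.
rewrite ek in hL; have -> : e = e / 2 + e / 2 by field.
apply: pbnd_le (pbndU hd3 hL) => // w [Ur [l lM ge]].
have [h5|h5] := pselect (osc_gt T W d3 omW w); first by left.
right.
have Wom s t : 0 <= s <= T -> 0 <= t <= T -> `|t - s| <= D -> `|W t w - W s w| <= omW.
  move=> sT tT st; rewrite leNgt; apply/negP => h; apply: h5; exists s, t; split => //.
  exact: le_lt_trans D3.
have Eom := hmod N N1 Da D w (lexx _) Ur Wom.
have Er t (tT : 0 <= t <= T) : `|Et N t w| <= r1.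
  by apply: (le_trans (Et_bounded N1 Ur Eom tT)); rewrite lerD2l.
have gT i : (i <= M)%N -> 0 <= gridt T M i <= T by exact: gridt_itv.
have b_small i : (i < M)%N -> `|bb i w| <= om0.
  move=> iM; have [jN h1 h2] := refined_cell N1 q0 iM.
  have jT := gridt_itv T0 N1 (ltnW jN); have iT := gT _ (ltnW iM).
  rewrite /bb -(@Et_grid _ _ _ T W T0 y0 B s0 N (i %/ q) w N1).
  apply/ltW/hd1; rewrite -?ler_norml ?Er//.
  apply: (le_lt_trans _ omd1); rewrite distrC; apply: Eom => //.
  rewrite ger0_norm ?subr_ge0// lerBlDl -gridt_step.
  by apply: le_trans h2; exact: gridt_le.
split.
  apply: (le_trans _ om0k).
  apply: (@le_trans _ _ (DM * \sum_(i < M) om0 ^+ 2)).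
    apply: ler_wpM2l; first exact: ltW.
    apply: ler_sum => i _; rewrite -[leLHS]real_normK ?num_real//.
    by rewrite lerXn2r ?nnegrE ?(ltW om00)// b_small.
  rewrite big_const_ord iter_addr_0 -[_ *+ M]mulr_natl mulrA ler_wpM2r ?sqr_ge0//.
  by rewrite divfK// pnatr_eq0 -lt0n.
exists l => //.
pose A := \sum_(i < l) (gdrift B D (i %/ q) (fun j => Eu N j w) (gridt T M i) (gridt T M i.+1)
   - path_drift T B (Et N) M i w).
have eE : perr (Et N) M l w = A + dsum bb
    (fun i => increment W (gridt T M i) (gridt T M i.+1)) l w.
  rewrite /process_error /grid_error.
  have -> : Et N (gridt T M l) w - y0 =
      \sum_(i < l) (Et N (gridt T M i.+1) w - Et N (gridt T M i) w).
    rewrite -(big_mkord xpredT (fun i => Et N (gridt T M i.+1) w - Et N (gridt T M i) w)).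
    rewrite telescope_sumr// gridt0; congr (_ - _).
    by rewrite -(gridt0 T N) Et_grid.
  rewrite /A /dsum -!sumrB -big_split/=; apply: eq_bigr => i _.
  have iM : (i < M)%N by exact: leq_trans (ltn_ord i) lM.
  have [jN h1 h2] := refined_cell N1 q0 iM.
  have -> : Et N (gridt T M i.+1) w - Et N (gridt T M i) w =
      gdrift B D (i %/ q) (fun j => Eu N j w) (gridt T M i) (gridt T M i.+1) +
      s0 (Eu N (i %/ q) w) * (W (gridt T M i.+1) w - W (gridt T M i) w).
    apply: (@eulert_incr R T K K0 y0 B s0 T0 K_gt0 dB N (W ^~ w) N1 (i %/ q)) => //.
    exact: gridt_le.
  by rewrite /bb /increment; ring.
have bA : `|A| <= dl / 2.
  apply: (@le_trans _ _ (\sum_(i < l) (2 * (K * (1 + T) * om) * DM))).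
    apply: (le_trans (ler_norm_sum _ _ _)); apply: ler_sum => i _.
    have iM : (i < M)%N by exact: leq_trans (ltn_ord i) lM.
    have [jN h1 h2] := refined_cell N1 q0 iM.
    have ii : gridt T M i <= gridt T M i.+1 by exact: gridt_le.
    have iT : gridt T M i.+1 <= T by exact: gridt_leT.
    have dt : gridt T M i.+1 - gridt T M i = DM by rewrite gridt_step addrC addKr.
    have cE := @Et_cont R d Om P T W F T0 wb K K0 y0 B s0 K_gt0 dB cs0 N N1 w.
    have c1 : `|gdrift B D (i %/ q) (fun j => Eu N j w) (gridt T M i) (gridt T M i.+1) -
        integ (gridt T M i) (gridt T M i.+1) (B ^~ (Et N ^~ w))| <= K * (1 + T) * om * DM.
      rewrite -dt; apply: (gdrift_close K_gt0 dB D0) => //.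
        by move=> k _; rewrite -(@Et_grid _ _ _ T W T0 y0 B s0 N k w N1).
      move=> k r' ki h rr0 rr1; apply: Eom => //.
        by apply: gridt_itv => //; rewrite (leq_trans ki)// ltnW.
      by rewrite rr0 (le_trans rr1).
    have c2 : `|path_drift T B (Et N) M i w -
        integ (gridt T M i) (gridt T M i.+1) (B ^~ (Et N ^~ w))| <= K * (1 + T) * om * DM.
      rewrite -dt; apply: (gdrift_close K_gt0 dB DM0) => //.
      move=> k r' ki h rr0 rr1; apply: Eom => //.
      - by apply: gT; rewrite (leq_trans ki)// ltnW.
      - by rewrite rr0 (le_trans rr1).
      - exact: le_trans DMD.
    move: c1 c2; set x := gdrift _ _ _ _ _ _; set y := path_drift _ _ _ _ _ _; set z := integ _ _ _.
    have -> : x - y = (x - z) - (y - z) by ring.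
    by move=> c1 c2; rewrite (le_trans (ler_normB _ _))//; move: c1 c2; slra.
  rewrite big_const_ord iter_addr_0 -[_ *+ l]mulr_natr.
  have lT : DM * l%:R <= T.
    by have /andP[_] := gT _ lM; rewrite /gridt mulrC.
  have c0 : 0 <= 2 * (K * (1 + T) * om).
    by rewrite !mulr_ge0 ?addr_ge0// ltW.
  have := ler_wpM2l c0 lT; move: omK; rewrite mulrA; slra.
move: ge; rewrite -/M eE /lam; set x := dsum _ _ _ _ => ge.
have := ler_normD A x; move: bA ge dl0; slra.
Qed.

Hypothesis yw : yamada_watanabe s0.
Hypothesis s0_growth : linear_growth s0.

(** On the grid of size [N * q] the finer scheme has no error and the coarser one a small error, so
    that stability applies to the pair. *)
Lemma euler_cauchy_mul (eta e : R) : 0 < eta -> 0 < e -> exists N0,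
  forall N q, (N0 <= N)%N -> (0 < N)%N -> (0 < q)%N ->
  pbnd P [set w | exists2 t, 0 <= t <= T & eta < `|Et N t w - Et (N * q) t w|] e.
Proof.
move=> eta0 e0; pose e5 := e / 5; have e50 : 0 < e5 by rewrite divr_gt0.
have [r r0 hr] := euler_tight T0 wb y0 K_gt0 dB cs0 s0_growth e50.
have eta30 : 0 < eta / 3 by rewrite divr_gt0.
pose r1 := r + 1; have r10 : 0 < r1 by rewrite addr_gt0.
pose eta' := Num.min (eta / 3) e5; have eta'0 : 0 < eta' by rewrite lt_min eta30.
have [dl dl0 [Dt0 Dt00 stab]] := @stability R d Om P T (Kg T K) y0 s0 r1 eta' T0
  (Kg_gt0 T0 K_gt0) cs0 yw r10 eta'0.
have [N1 hN1] := euler_fine_error r0 dl0 e50.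
pose om := Num.min 1 (eta / 3); have om0 : 0 < om by rewrite lt_min ltr01.
have [omW omW0 [a a0 hmod]] := Et_modulus_small (ltW r0) om0.
have mW t : 0 <= t <= T -> meas_wrt measurable (W t).
  by move=> tT; apply: sub_meas_wrt (wb_adapted wb tT); exact: (wb_meas wb).
have [d3 d30 hd3] := osc_small P T0 (wb_cont wb) mW omW0 e50.
have [N2 hN2] : exists N0, forall N, (N0 <= N)%N -> (0 < N)%N ->
    T / N%:R < Num.min (Num.min d3 a) Dt0.
  by apply: small_step => //; rewrite !lt_min d30 a0.
exists (maxn N1 N2) => N q; rewrite geq_max => /andP[NN1 NN2] N0 q0.
have := hN2 _ NN2 N0; rewrite !lt_min => /andP[/andP[D3 Da] D4].
pose M := (N * q)%N; have M0 : (0 < M)%N by rewrite muln_gt0 N0.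
have DMD : T / M%:R <= T / N%:R.
  by rewrite ler_pM2l// lef_pV2 ?posrE ?ltr0n// ler_nat; exact: leq_pmulr.
have le3 : eta' <= eta / 3 by rewrite ge_min lexx.
have mN t : 0 <= t <= T -> meas_wrt (F t) (Et N t).
  by move=> tT; apply: (Et_meas T0 wb y0 K_gt0 dB cs0 N0).
have mM t : 0 <= t <= T -> meas_wrt (F t) (Et M t).
  by move=> tT; apply: (Et_meas T0 wb y0 K_gt0 dB cs0 M0).
have {}stab := stability_process T0 wb K_gt0 dB stab M0 (le_trans DMD (ltW D4)) le3 mN mM.
have e5e : eta' <= e5 by rewrite ge_min lexx orbT.
have {}stab := pbnd_le (@subset_refl _ _) e5e stab.
have -> : e = (((e5 + e5) + e5) + e5) + e5 by rewrite /e5; field.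
apply: pbnd_le (pbndU (pbndU (pbndU (pbndU (hr N N0) (hr M M0)) hd3)
  (hN1 N q NN1 N0 q0)) stab) => // w ex.
have [h1|h1] := pselect (exists2 j, (j <= N)%N & r < `|Eu N j w|); first by do 4 left.
have [h2|h2] := pselect (exists2 j, (j <= M)%N & r < `|Eu M j w|); first by do 3 left; right.
have [h3|h3] := pselect (osc_gt T W d3 omW w); first by do 2 left; right.
have UN j : (j <= N)%N -> `|Eu N j w| <= r.
  by move=> jN; rewrite leNgt; apply/negP => h; apply: h1; exists j.
have UM j : (j <= M)%N -> `|Eu M j w| <= r.
  by move=> jN; rewrite leNgt; apply/negP => h; apply: h2; exists j.
have [h4|h4] := pselect (exists2 l, (l <= M)%N & dl < `|perr (Et N) M l w|).
  by left; right.
right.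
have Wom (D' : R) : D' <= T / N%:R -> forall s t, 0 <= s <= T -> 0 <= t <= T -> `|t - s| <= D' ->
    `|W t w - W s w| <= omW.
  move=> DD s t sT tT st; rewrite leNgt; apply/negP => h; apply: h3; exists s, t; split => //.
  by rewrite (le_lt_trans (le_trans st DD)).
have EN := hmod N N0 Da _ w (lexx _) UN (Wom _ (lexx _)).
have ENM := hmod N N0 Da _ w DMD UN (Wom _ DMD).
have EM := hmod M M0 (le_lt_trans DMD Da) _ w (lexx _) UM (Wom _ DMD).
have o1 : om <= 1 by rewrite ge_min lexx.
have o3 : om <= eta / 3 by rewrite ge_min lexx orbT.
split=> //.
- move=> t tT; split.
    by rewrite (le_trans (Et_bounded N0 UN EN tT))// lerD2l.
  by rewrite (le_trans (Et_bounded M0 UM EM tT))// lerD2l.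
- move=> s t sT tT st; split; first by rewrite (le_trans (ENM s t sT tT st)).
  by rewrite (le_trans (EM s t sT tT st)).
- move=> j jM; split.
    by rewrite leNgt; apply/negP => h; apply: h4; exists j.
  by rewrite process_error_self// normr0 ltW.
Qed.

(** Both schemes are compared with the one on the common refinement of size [N * N']. *)
Lemma euler_cauchy (eta e : R) : 0 < eta -> 0 < e -> exists N0,
  forall N N', (N0 <= N)%N -> (N0 <= N')%N -> (0 < N)%N -> (0 < N')%N ->
  pbnd P [set w | exists2 t, 0 <= t <= T & eta < `|Et N t w - Et N' t w|] e.
Proof.
move=> eta0 e0; have eta20 : 0 < eta / 2 by rewrite divr_gt0.
have e20 : 0 < e / 2 by rewrite divr_gt0.
have [N0 hN0] := euler_cauchy_mul eta20 e20.
exists N0 => N N' h h' p p'; have -> : e = e / 2 + e / 2 by field.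
apply: pbnd_le (pbndU (hN0 N N' h p p') (hN0 N' N h' p' p)) => // w [t tT lt].
have [h1|h1] := ltP (eta / 2) `|Et N t w - Et (N * N') t w|; first by left; exists t.
right; exists t => //; rewrite [(N' * N)%N]mulnC.
have := ler_distD (Et (N * N') t w) (Et N t w) (Et N' t w).
by rewrite [`|Et (N * N') t w - _|]distrC; move: h1 lt; slra.
Qed.

End euler_cauchy.

(** * Limits in probability, uniformly in time *)

Section ucp_limit.
Context {R : realType}.

(** The sequences [x k - 2^-k] and [x k + 2^-k] are adjacent, the first nondecreasing and the second
    nonincreasing; they enclose the limit, which gives the rate as well. *)
Lemma geometric_cauchy (x : nat -> R) m :
  (forall k, (m <= k)%N -> `|x k - x k.+1| <= (2 ^+ k.+1)^-1) ->
  exists2 l, x k @[k --> \oo] --> l & forall k, (m <= k)%N -> `|x k - l| <= (2 ^+ k)^-1.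
Proof.
move=> hx; pose g k : R := (2 ^+ k)^-1.
have g0 k : 0 < g k by rewrite invr_gt0 exprn_gt0.
have gS k : g k.+1 = g k / 2 by rewrite /g exprS invfM mulrC.
pose y k := x (k + m)%N - g (k + m)%N; pose z k := x (k + m)%N + g (k + m)%N.
have h k : `|x (k + m)%N - x (k + m).+1%N| <= g (k + m)%N / 2.
  by rewrite -gS; apply: hx; rewrite leq_addl.
have yS : nondecreasing_seq y.
  apply/nondecreasing_seqP => k; rewrite /y addSn gS.
  by have := h k; have := g0 (k + m)%N; rewrite ler_norml => ? /andP[? ?]; lra.
have zS : nonincreasing_seq z.
  apply/nonincreasing_seqP => k; rewrite /z addSn gS.
  by have := h k; have := g0 (k + m)%N; rewrite ler_norml => ? /andP[? ?]; lra.
have yz i j : y i <= z j.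
  have lt k : y k <= z k by rewrite /y /z; have := g0 (k + m)%N; lra.
  have [ij|ji] := leqP i j; first exact: le_trans (yS _ _ ij) (lt j).
  exact: le_trans (lt i) (zS _ _ (ltnW ji)).
have yc : cvgn y.
  by apply: nondecreasing_is_cvgn => //; exists (z 0) => _ [k _ <-].
have cg : g k @[k --> \oo] --> 0.
  rewrite (_ : g = fun k => (2^-1) ^+ k); last by apply/funext => k; rewrite /g exprVn.
  by apply: cvg_expr; rewrite ger0_norm// invf_lt1// ltr1n.
pose l : R := limn y.
have xl : x k @[k --> \oo] --> l.
  rewrite -(cvg_shiftn m) /=.
  rewrite (_ : (fun k => x (k + m)%N) = fun k => y k + g (k + m)%N); last first.
    by apply/funext => k; rewrite /y subrK.
  have : y k + g (k + m)%N @[k --> \oo] --> l + 0.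
    by apply: cvgD; [exact: yc|rewrite (cvg_shiftn m g)].
  by rewrite addr0.
exists l => // k mk.
have e : k = (k - m + m)%N by rewrite subnK.
have h1 : y (k - m)%N <= l by exact: nondecreasing_cvgn_le.
have h2 : l <= z (k - m)%N by apply: limr_le => //; apply: nearW => j; exact: yz.
move: h1 h2; rewrite /y /z subnK// -/(g k) ler_norml => h1 h2; apply/andP; split; lra.
Qed.

Context {d : measure_display} {Om : measurableType d}.
Variables (P : probability Om R) (T : R) (F : R -> set (set Om)).
Hypothesis T0 : 0 < T.
Hypothesis sF : forall t, sigma_algebra setT (F t).
Hypothesis Fnull : forall t A, P.-negligible A -> F t A.

Lemma pbnd_bigcup (A : nat -> set Om) (e : R) : 0 <= e ->
  (forall i, pbnd P (A i) (e / 2 ^+ i.+1)) -> pbnd P (\bigcup_i A i) e.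
Proof.
move=> e0 h; pose C i := sval (cid (h i)).
have hC i : [/\ measurable (C i), A i `<=` C i & (P (C i) <= (e / 2 ^+ i.+1)%:E)%E].
  by rewrite /C; case: cid.
have mC i : measurable (C i) by have [] := hC i.
exists (\bigcup_i C i); split.
- exact: bigcupT_measurable.
- by move=> w [i _ Aw]; exists i => //; have [_ sub _] := hC i; exact: sub.
- apply: (@le_trans _ _ (\sum_(0 <= i <oo) P (C i))%E).
    by apply: measure_sigma_subadditive => //; exact: bigcupT_measurable.
  have := @epsilon_trick0 R e xpredT e0; apply: le_trans.
  apply: lee_nneseries => // i _; have [_ _ hi] := hC i.
  by rewrite natrX.
Qed.

Variable Z : nat -> R -> Om -> R.
Hypothesis cZ : forall N, (0 < N)%N -> continuous_process T (Z N).
Hypothesis mZ : forall N t, (0 < N)%N -> 0 <= t <= T -> meas_wrt (F t) (Z N t).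
Hypothesis Z_cauchy : forall eta e : R, 0 < eta -> 0 < e -> exists N0,
  forall N N', (N0 <= N)%N -> (N0 <= N')%N -> (0 < N)%N -> (0 < N')%N ->
  pbnd P [set w | exists2 t, 0 <= t <= T & eta < `|Z N t w - Z N' t w|] e.

(** Along a subsequence with geometric errors, the Borel-Cantelli argument gives uniform convergence
    outside a negligible set. This set belongs to every [F t], so the limit, set equal to [y0]
    there, is adapted and has only continuous paths. *)
Lemma ucp_limit (y0 : R) : (forall N w, (0 < N)%N -> Z N 0 w = y0) ->
  exists Y : R -> Om -> R, [/\ continuous_process T Y,
  (forall t, 0 <= t <= T -> meas_wrt (F t) (Y t)), (forall w, Y 0 w = y0) &
  forall eta e : R, 0 < eta -> 0 < e -> exists N0, forall N, (N0 <= N)%N -> (0 < N)%N ->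
    pbnd P [set w | exists2 t, 0 <= t <= T & eta < `|Z N t w - Y t w|] e].
Proof.
move=> Z0; pose g k : R := (2 ^+ k)^-1.
have g0 k : 0 < g k by rewrite invr_gt0 exprn_gt0.
pose M k := sval (cid (Z_cauchy (g0 k.+1) (g0 k.+1))).
have hM k : forall N N', (M k <= N)%N -> (M k <= N')%N -> (0 < N)%N -> (0 < N')%N ->
    pbnd P [set w | exists2 t, 0 <= t <= T & g k.+1 < `|Z N t w - Z N' t w|] (g k.+1).
  by rewrite /M; case: cid.
(* Partial sums make the subsequence nondecreasing and at least [M k]; the successor keeps it
   positive. *)
pose n k := (\sum_(i < k.+1) M i).+1.
have n0 k : (0 < n k)%N by [].
have nM k : (M k <= n k)%N by rewrite /n big_ord_recr/= -addnS addnC; apply: leq_trans (leq_addr _ _).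
have nS k : (n k <= n k.+1)%N by rewrite /n ltnS [X in (_ <= X)%N]big_ord_recr/= leq_addr.
pose S k := [set w | exists2 t, 0 <= t <= T & g k.+1 < `|Z (n k) t w - Z (n k.+1) t w|].
have pS k : pbnd P (S k) (g k.+1).
  by apply: hM => //; exact: leq_trans (nM k) (nS k).
pose U m := \bigcup_i S (m + i)%N.
have pU m : pbnd P (U m) (g m).
  apply: pbnd_bigcup => [|i]; first exact: ltW.
  by have := pS (m + i)%N; rewrite /g -addnS exprD invfM.
pose Bad := \bigcap_m U m.
have small (e : R) : 0 < e -> exists k, g k < e.
  move=> e0; exists (Num.truncn e^-1).+1; rewrite /g -[ltRHS]invrK ltf_pV2 ?posrE ?exprn_gt0 ?invr_gt0//.
  apply: (lt_le_trans (truncnS_gt _)).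
  by rewrite -natrX ler_nat ltnW// ltn_expl.
have nBad : P.-negligible Bad.
  apply: pbnd_negligible => e e0; have [k hk] := small _ e0.
  by apply: pbnd_le (pU k); [exact: bigcap_inf|exact: ltW].
have good m w : ~ U m w -> forall t, 0 <= t <= T -> forall k, (m <= k)%N ->
    `|Z (n k) t w - Z (n k.+1) t w| <= (2 ^+ k.+1)^-1.
  move=> Uw t tT k mk; rewrite leNgt; apply/negP => h; apply: Uw.
  by exists (k - m)%N => //; rewrite subnKC//; exists t.
pose Y t w := if `[< Bad w >] then y0 else limn (fun k => Z (n k) t w).
have Ylim m w : ~ U m w -> forall t, 0 <= t <= T ->
    Z (n k) t w @[k --> \oo] --> Y t w /\ forall k, (m <= k)%N -> `|Z (n k) t w - Y t w| <= g k.
  move=> Uw t tT; have [l cl hl] := geometric_cauchy (good m w Uw t tT).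
  have -> : Y t w = l.
    rewrite /Y; case: asboolP => [Bw|_]; first by case: Uw; exact: Bw.
    exact: cvg_lim cl.
  by [].
have notBad w : ~ Bad w -> exists m, ~ U m w.
  by move=> Bw; apply: contrapT => h; apply: Bw => m _; apply: contrapT => h'; apply: h; exists m.
exists Y; split.
- move=> w; have [Bw|Bw] := pselect (Bad w).
    rewrite (_ : Y^~ w = fun=> y0); last by apply/funext => t; rewrite /Y; case: asboolP.
    by apply: continuous_subspaceT => x; exact: cvg_cst.
  have [m Um] := notBad w Bw.
  apply: continuous_path_eps => s sT e e0.
  have e30 : 0 < e / 3 by rewrite divr_gt0.
  have [k hk] := small _ e30.
  have gk : g (k + m)%N <= e / 3.
    rewrite (le_trans _ (ltW hk))// /g lef_pV2 ?posrE ?exprn_gt0//.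
    by rewrite ler_eXn2l ?ltr1n// leq_addr.
  have km : (m <= k + m)%N by exact: leq_addl.
  have [dl dl0 hdl] := within_itv_cvg (@cZ _ (n0 (k + m)%N) w) sT e30.
  exists dl => // t tT ts; have h1 := hdl t tT ts.
  have h2 := (Ylim m w Um s sT).2 _ km; have h3 := (Ylim m w Um t tT).2 _ km.
  move: h1 h2 h3; set a := Z _ t w; set b := Z _ s w => h1 h2 h3.
  have -> : Y t w - Y s w = (a - b) - (a - Y t w) + (b - Y s w) by ring.
  have t1 := ler_normD ((a - b) - (a - Y t w)) (b - Y s w).
  have t2 := ler_normB (a - b) (a - Y t w).
  lra.
- move=> t tT.
  (* These approximations converge for every [w], also in the negligible set, so that measurability
     passes to the limit. *)
  pose V k w : R := \1_Bad w * y0 + (1 - \1_Bad w) * Z (n k) t w.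
  have mB : meas_wrt (F t) (\1_Bad : Om -> R) by apply: (meas_ind (sF t)); exact: Fnull.
  apply: (@meas_wrt_cvg _ _ _ (sF t) V (Y t)) => [k|w].
    apply: (measD (sF t)); first by apply: (measM (sF t)) => //; exact: (meas_cst (sF t)).
    apply: (measM (sF t)); last exact: mZ.
    by apply: (measB (sF t)) => //; exact: (meas_cst (sF t)).
  rewrite /V; have [Bw|Bw] := pselect (Bad w).
    rewrite indicE mem_set// (_ : Y t w = y0); last by rewrite /Y; case: asboolP.
    by under eq_fun do rewrite mul1r subrr mul0r addr0; exact: cvg_cst.
  rewrite indicE memNset//; under eq_fun do rewrite mul0r add0r subr0 mul1r.
  by have [m Um] := notBad w Bw; exact: (Ylim m w Um t tT).1.
- have z0 : (0 : R) <= 0 <= T by rewrite lexx ltW.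
  move=> w; rewrite /Y; case: asboolP => // Bw.
  rewrite (_ : (fun k => _) = fun=> y0); last by apply/funext => k; rewrite Z0.
  exact: lim_cst.
- move=> eta e eta0 e0.
  have [k hk] : exists k, g k < Num.min (eta / 2) (e / 2).
    by apply: small; rewrite lt_min !divr_gt0.
  move: hk; rewrite lt_min => /andP[k1 k2].
  have gS : g k.+1 <= g k.
    by rewrite /g lef_pV2 ?posrE ?exprn_gt0// ler_eXn2l// ltr1n.
  exists (n k) => N nN N0.
  have -> : e = e / 2 + e / 2 by field.
  have h := hM k N (n k) (leq_trans (nM k) nN) (nM k) N0 (n0 k).
  apply: pbnd_le (pbndU h (pU k)) => [w [t tT lt]|]; last by apply: lerD; lra.
  have [Uw|Uw] := pselect (U k w); first by right.
  left; exists t => //.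
  have h2 := (Ylim k w Uw t tT).2 _ (leqnn k).
  have := ler_distD (Z (n k) t w) (Z N t w) (Y t w); lra.
Qed.

End ucp_limit.

(** * The Ito formula for the limit *)

Section cutoff.
Context {R : realType}.
Variables (g g1 g2 : R -> R).
Hypothesis dg : forall x : R, is_derive x (1 : R) g (g1 x).
Hypothesis dg1 : forall x : R, is_derive x (1 : R) g1 (g2 x).
Hypothesis cg2 : continuous g2.

Lemma ramp_out (rho x : R) : rho + 1 <= `|x| -> ramp (rho + 1 - `|x|) = 0.
Proof. by move=> h; rewrite ramp0// subr_le0. Qed.

Lemma derive_eq_on (f f' k k' : R -> R) (rho x : R) :
  (forall x : R, is_derive x (1 : R) f (f' x)) ->
  (forall x : R, is_derive x (1 : R) k (k' x)) -> f 0 = k 0 ->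
  (forall y, `|y| <= rho -> f' y = k' y) -> `|x| <= rho -> f x = k x.
Proof.
move=> df dk e0 h xr.
have d (y : R) : is_derive y (1 : R) (fun y => f y - k y) (f' y - k' y).
  exact: is_deriveB (df y) (dk y).
have [c cx] := mean_value d 0 x; rewrite !subr0 e0 subrr subr0 h ?subrr ?mul0r.
  by move/eqP; rewrite subr_eq0 => /eqP.
by rewrite subr0 in cx; rewrite (le_trans _ xr)//; move: cx; rewrite !subr0.
Qed.

(** [g2] is cut off outside [[-(rho + 1), rho + 1]] and integrated twice, with the initial values of
    [g]. The first integral is constant beyond the cutoff on each side, hence bounded; the second
    may grow linearly, which [smooth2] allows. *)
Lemma smooth_cutoff (rho : R) : 0 < rho -> exists f f1 f2 Bd,
  [/\ smooth2 f f1 f2 Bd, forall x, `|x| <= rho -> f x = g x,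
      forall x, `|x| <= rho -> f1 x = g1 x & forall x, `|x| <= rho -> f2 x = g2 x].
Proof.
move=> rho0; pose f2 x := g2 x * ramp (rho + 1 - `|x|).
have cf2 : continuous f2.
  move=> x; apply: cvgM; first exact: cg2.
  apply: continuous_cvg; first exact: ramp_continuous.
  by apply: cvgB; [exact: cvg_cst|exact: norm_continuous].
pose f1 x := g1 0 + oriented_integral f2 x.
pose f x := g 0 + oriented_integral f1 x.
have df1 (x : R) : is_derive x (1 : R) f1 (f2 x).
  have := is_deriveD (is_derive_cst (g1 0) x 1) (oriented_integral_derive cf2 x).
  by rewrite add0r.
have cf1 : continuous f1 by exact: derive_continuous df1.
have df (x : R) : is_derive x (1 : R) f (f1 x).
  have := is_deriveD (is_derive_cst (g 0) x 1) (oriented_integral_derive cf1 x).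
  by rewrite add0r.
have or0 k : oriented_integral k 0 = 0 :> R by rewrite oriented_ge0// integ_refl.
have e2 x : `|x| <= rho -> f2 x = g2 x.
  by move=> xr; rewrite /f2 ramp1 ?mulr1//; lra.
have e1 x : `|x| <= rho -> f1 x = g1 x.
  by apply: derive_eq_on df1 dg1 _ e2; rewrite /f1 or0 addr0.
have e0 x : `|x| <= rho -> f x = g x.
  by apply: derive_eq_on df dg _ e1; rewrite /f or0 addr0.
pose A := rho + 1; have A0 : 0 < A by rewrite addr_gt0.
have cb (k : R -> R) : continuous k -> exists2 M : R, 0 <= M & forall x, `|x| <= A -> `|k x| <= M.
  by move=> ck; apply: continuous_bound => //; exact: ltW.
have [M2 M20 hM2] := cb _ cf2; have [M1 M10 hM1] := cb _ cf1.
have z2 x : A <= `|x| -> f2 x = 0 by move=> h; rewrite /f2 ramp_out ?mulr0.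
have f2b x : `|f2 x| <= M2.
  by have [h|/ltW h] := leP `|x| A; [exact: hM2|rewrite z2// normr0].
have f1b x : `|f1 x| <= M1.
  have [h|h] := leP `|x| A; first exact: hM1.
  (* With [s] the sign of [x], the mean value theorem shows that [f1] keeps beyond [s * A] the value
     it has there. *)
  have key s : `|s| = 1 -> 0 <= s * x -> `|f1 x| <= M1.
    move=> s1 sx; have ss : s * s = 1 by rewrite -expr2 -[_ ^+ 2]real_normK ?num_real// s1 expr1n.
    have xE : `|x| = s * x by rewrite -(ger0_norm sx) normrM s1 mul1r.
    have [c hc e] := mean_value df1 x (s * A).
    have cz : f2 c = 0.
      apply: z2; have e1' : `|s * A - x| = `|x| - A.
        rewrite distrC -[LHS]mul1r -s1 -normrM mulrBr mulrA ss mul1r -xE ger0_norm// subr_ge0.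
        exact: ltW.
      by have := ler_normB c (c - x); rewrite opprB addrC subrK; move: hc; rewrite e1'; lra.
    move: e; rewrite cz mul0r => /eqP; rewrite subr_eq0 => /eqP <-; apply: hM1.
    by rewrite normrM s1 mul1r gtr0_norm.
  have [x0|/ltW x0] := leP 0 x; first by apply: (key 1); rewrite ?normr1// mul1r.
  by apply: (key (-1)); rewrite ?normrN1// mulN1r oppr_ge0.
exists f, f1, f2, (Num.max M1 M2); split => //.
apply: taylor_smooth2 => //.
- by move=> x; rewrite le_max f1b.
- by move=> x; rewrite le_max f2b orbT.
move=> e e0'.
have [dl dl0 hd] := itv_unif_cont (@continuous_subspaceT _ _ `[- (A + 1), A + 1] _ cf2) e0'.
exists (Num.min (dl / 2) 1); first by rewrite lt_min divr_gt0/=.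
move=> x y; rewrite le_min => /andP[xy xy1].
have [hx|hx] := leP `|x| (A + 1); have [hy|hy] := leP `|y| (A + 1).
- by apply/ltW/hd; rewrite -?ler_norml// (le_lt_trans xy)//; lra.
- have h1 : A <= `|x|.
    by have := ler_normB x (x - y); rewrite opprB addrC subrK; lra.
  by rewrite !z2 ?subrr ?normr0 ?(ltW e0')//; lra.
- have h1 : A <= `|y|.
    by have := ler_normD (x - y) y; rewrite subrK; lra.
  by rewrite !z2 ?subrr ?normr0 ?(ltW e0')//; lra.
- by rewrite !z2 ?subrr ?normr0 ?(ltW e0')//; lra.
Qed.

End cutoff.

(** * Error in the discrete Ito formula for the stopped Euler scheme *)

Section ito_error.
Context {R : realType} {d : measure_display} {Om : measurableType d}.
Variables (P : probability Om R) (T : R) (W : R -> Om -> R) (F : R -> set (set Om)).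
Hypothesis T0 : 0 < T.
Hypothesis wb : wiener_basis P T W F.
Variables (K K0 y0 : R) (B : R -> (R -> R) -> R) (s0 : R -> R).
Hypothesis K_gt0 : 0 < K.
Hypothesis dB : drift T K K0 B.
Hypothesis cs0 : continuous s0.
Variables (r Sr : R).
Hypothesis r0 : 0 < r.
Let r00 : 0 <= r. Proof. exact: ltW. Qed.

Hypothesis Sr_ge : forall x, `|x| <= r -> `|s0 x| <= Sr.
Local Notation V N := (stopped_euler T W y0 B s0 N r).
Local Notation al N := (stopped_drift T W y0 B s0 N r).
Local Notation be N := (stopped_diffusion T W y0 B s0 N r).
Local Notation v N := (fun j => increment W (gridt T N j) (gridt T N j.+1)).
Local Notation D N := (T / N%:R).

Lemma stopped_bound N j w : (0 < N)%N -> (j < N)%N ->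
  `|al N j w| <= (drift_const T K K0 r + Sr) * D N /\
  `|be N j w| <= drift_const T K K0 r + Sr.
Proof.
move=> N0 jN; have D0 := step_gt0 T0 N0; have k0 := Kg_gt0 T0 K_gt0.
have Sr0 : 0 <= Sr by exact: Sr_ge0 r00 Sr_ge.
have dc0 := drift_const_ge0 T0 K_gt0 dB r00.
have dS0 := addr_ge0 dc0 Sr0.
have [Jw|Jw] := pselect (inside T W y0 B s0 N r j w); last first.
  rewrite /stopped_drift /stopped_diffusion indicE memNset// !mul0r normr0.
  by split=> //; rewrite mulr_ge0// ltW.
have [Vj Uj] := insideE Jw (leqnn j); split; last first.
  by rewrite /stopped_diffusion indicE mem_set// mul1r (le_trans (Sr_ge Uj))// lerDr.
apply: (le_trans (stopped_drift_growth W T0 y0 s0 K_gt0 dB r N0 w jN)).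
rewrite [leRHS]mulrC;  apply: ler_wpM2l; first exact: ltW.
apply: (@le_trans _ _ (drift_const T K K0 r)); last by rewrite lerDl.
rewrite /drift_const lerD2l -[X in _ <= X]mulrA; apply: ler_wpM2l; first exact: ltW.
rewrite mulrDl mul1r; apply: lerD; first by rewrite Vj.
have s1 : \sum_(i < j) `|V N i w| <= j%:R * r.
  apply: (@le_trans _ _ (\sum_(i < j) r)).
    by apply: ler_sum => i _; have [-> h] := insideE Jw (ltnW (ltn_ord i)).
  by rewrite big_const_ord iter_addr_0 mulr_natl.
apply: (le_trans (ler_wpM2l (ltW D0) s1)).
rewrite mulrA ler_wpM2r ?r00// mulrC; exact: (gridt_leT T0 N0 (ltnW jN)).
Qed.

(** Two errors remain in the discrete formula: the sum of the Taylor remainders, small in mean, and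
    the martingale sum with increments [v^2 - D], whose bracket is at most [2 D^2 N Bn^2], of order
    [D]. *)
Lemma ito_error_small (f f1 f2 : R -> R) (Bd lam e : R) : smooth2 f f1 f2 Bd ->
  0 < lam -> 0 < e -> exists N0, forall N, (N0 <= N)%N -> (0 < N)%N ->
  pbnd P [set w | exists2 n, (n <= N)%N & lam <=
    `|dsum (fun i w => f1 (V N i w) * be N i w) (v N) n w
      - (f (V N n w) - f y0 - \sum_(i < n) (f1 (V N i w) * al N i w
           + 2^-1 * f2 (V N i w) * be N i w ^+ 2 * D N))| ] e.
Proof.
move=> [[cf cf1 cf2 f1B f2B] taylor] lam0 e0.
set C := drift_const T K K0 r + Sr.
have Sr0 : 0 <= Sr by exact: Sr_ge0 r00 Sr_ge.
have C0 : 0 <= C := addr_ge0 (drift_const_ge0 T0 K_gt0 dB r00) Sr0.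
have Bd0 : 0 <= Bd by exact: le_trans (f1B 0).
pose G := 4 * C ^+ 2 + 32 * C ^+ 4 + Bd * C ^+ 2.
have G0 : 0 <= G by rewrite /G !addr_ge0// mulr_ge0// exprn_ge0.
pose Bn := Bd * C ^+ 2; have Bn0 : 0 <= Bn by rewrite mulr_ge0// exprn_ge0.
have TG : 0 < T * G + 1 by rewrite ltr_wpDl// mulr_ge0// ltW.
have TB : 0 < 2 * T * Bn ^+ 2 + 1 by rewrite ltr_wpDl// mulr_ge0 ?sqr_ge0// mulr_ge0// ltW.
have l20 : 0 < lam / 2 by rewrite divr_gt0.
have e20 : 0 < e / 2 by rewrite divr_gt0.
pose e1 := lam / 2 * (e / 2) / 2 / (T * G + 1).
have e10 : 0 < e1 by rewrite !divr_gt0// mulr_gt0.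
have [K1 K10 tay] := taylor _ e10.
have M0 : 0 < 1 + K1 + e1^-1 by rewrite !ltr_wpDr// invr_ge0 ltW.
pose a := Num.min (Num.min 1 (e1 / (1 + K1 + e1^-1)))
  ((lam / 2) ^+ 2 * (e / 2) / (2 * T * Bn ^+ 2 + 1)).
have a0 : 0 < a by rewrite !lt_min ltr01 !divr_gt0// mulr_gt0// exprn_gt0.
have [N0 hN0] := small_step T a0; exists N0 => N NN0 Npos.
have := hN0 _ NN0 Npos; rewrite !lt_min => /andP[/andP[/ltW D1 /ltW D2] /ltW D3].
have D0 := step_gt0 T0 Npos.
move: D2 D3; rewrite ler_pdivlMr// => D2; rewrite ler_pdivlMr// => D3.
have [_ sF FS Fm [nv nv2]] := wiener_grid_basis T0 wb Npos.
have mal j : (j < N)%N -> meas_wrt (F (gridt T N j)) (al N j).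
  exact: (stopped_drift_meas T0 wb y0 K_gt0 dB cs0 r Npos).
have mbe j : (j < N)%N -> meas_wrt (F (gridt T N j)) (be N j).
  exact: (stopped_diffusion_meas T0 wb y0 K_gt0 dB cs0 r Npos).
have mV j : (j <= N)%N -> meas_wrt (F (gridt T N j)) (V N j).
  exact: (stopped_euler_meas T0 wb y0 K_gt0 dB cs0 r Npos).
have alC j w (jN : (j < N)%N) := (stopped_bound w Npos jN).1.
have beC j w (jN : (j < N)%N) := (stopped_bound w Npos jN).2.
pose rem := ito_rem (v N) y0 (al N) (be N) f f1 f2.
have hrem j : (j < N)%N -> L1 P (rem j) /\ Ex P (fun w => `|rem j w|) <= D N * (G * (2 * e1)).
  move=> jN; have [I h] := ito_rem_bound sF FS Fm D0 nv nv2 y0 mal mbe alC beC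
    cf1 cf2 cf f1B f2B jN e10 K10 D1 tay.
  split=> //; apply: (le_trans h); apply: ler_wpM2l; first exact: ltW.
  by apply: ler_wpM2l => //; move: D2; lra.
pose srem w := \sum_(i < N) `|rem i w|.
have Isrem : L1 P srem.
  have -> : srem = fun w => \sum_(i < N) `|rem i w| by [].
  by apply: (@L1_sum _ _ _ P _ _ (fun (i : 'I_N) w => `|rem i w|)) => i; apply/L1_norm/(hrem i (ltn_ord i)).1.
have ND : N%:R * D N = T by rewrite mulrC divfK// pnatr_eq0 -lt0n.
have Esrem : Ex P srem <= T * G * (2 * e1).
  rewrite /srem Ex_sum; last by move=> i; apply/L1_norm/(hrem i (ltn_ord i)).1.
  apply: (@le_trans _ _ (\sum_(i < N) D N * (G * (2 * e1)))).
    by apply: ler_sum => i _; exact: (hrem i (ltn_ord i)).2.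
  by rewrite big_const_ord iter_addr_0 -[leLHS]mulr_natl (mulrA N%:R) ND mulrA.
have p1 : pbnd P [set w | lam / 2 <= srem w] (e / 2).
  apply: pbnd_le (markov_L1 l20 Isrem (fun w => sumr_ge0 _ (fun i _ => normr_ge0 _))) => //.
  rewrite ler_pdivrMr//; apply: (le_trans Esrem).
  have -> : T * G * (2 * e1) = T * G / (T * G + 1) * (e / 2 * (lam / 2)).
    by rewrite /e1; field; apply: lt0r_neq0.
  by rewrite ler_piMl ?(ltW (mulr_gt0 e20 l20))// ler_pdivrMr// mul1r lerDl.
pose bn i w := 2^-1 * f2 (V N i w) * be N i w ^+ 2.
have mbn j : (j < N)%N -> meas_wrt (F (gridt T N j)) (bn j).
  move=> jN; apply: measM => //; last by apply: measX => //; exact: mbe.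
  apply: measZ => //; apply: meas_compc => //; exact: mV (ltnW jN).
have bnB j w : (j < N)%N -> bn j w ^+ 2 <= Bn ^+ 2.
  move=> jN; rewrite -[bn j w ^+ 2]real_normK ?num_real// lerXn2r ?nnegrE//.
  rewrite /bn 2!normrM ger0_norm ?invr_ge0//.
  have h1 : `|be N j w ^+ 2| <= C ^+ 2 by rewrite normrX lerXn2r ?nnegrE//; exact: beC.
  rewrite /Bn; apply: ler_pM => //.
  by rewrite (le_trans _ (f2B (V N j w)))// ler_piMl// invf_le1// ler1n.
have c0 : 0 < 2 * D N ^+ 2 by rewrite mulr_gt0// exprn_gt0.
have k0 : 0 <= 2 * T * Bn ^+ 2 * D N.
  by rewrite mulr_ge0 ?(ltW D0)// mulr_ge0 ?sqr_ge0// mulr_ge0// ltW.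
have p2 := lenglart sF FS Fm nv2 c0 (leqnn N) mbn l20 k0.
have -> : e = e / 2 + e / 2 by lra.
apply: pbnd_le (pbndU p1 p2); last first.
  rewrite lerD2l ler_pdivrMr ?exprn_gt0// [leRHS]mulrC; apply: le_trans D3.
  by rewrite [leRHS]mulrC; apply: ler_wpM2r; [exact: ltW|rewrite lerDl].
move=> w [n nN hn]; have [?|h1] := leP (lam / 2) (srem w); [by left|right; split].
  apply: (@le_trans _ _ (2 * D N ^+ 2 * \sum_(i < N) Bn ^+ 2)).
    by apply: ler_wpM2l; [exact: ltW|apply: ler_sum => i _; exact: bnB].
  rewrite big_const_ord iter_addr_0 -[X in _ * X]mulr_natl.
  rewrite [leLHS](_ : _ = 2 * (N%:R * D N) * Bn ^+ 2 * D N); first by rewrite ND.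
  by ring.
exists n => //; rewrite leNgt; apply/negP => h2.
have := ito_sum (v N) (D N) y0 (al N) (be N) f f1 f2 n w.
rewrite -/(V N n w) -/rem -/bn.
have h3 : `|\sum_(i < n) rem i w| <= srem w.
  apply: (le_trans (ler_norm_sum _ _ _)).
  rewrite /srem -(big_mkord xpredT (fun i => `|rem i w|)).
  rewrite -(big_mkord xpredT (fun i => `|rem i w|)) [leRHS](big_cat_nat (n := n))//=.
  by rewrite lerDl sumr_ge0.
move: hn h1 h2 h3; set q1 := dsum _ _ _ _; set q2 := \sum_(i < n) (_ + _).
set q3 := dsum _ _ _ _; set q4 := \sum_(i < n) _; set q5 := srem w; set q6 := f _.
set q7 := f y0 => hn h1 h2 h3 e2.
have : q1 - (q6 - q7 - q2) = - (q3 + q4) by rewrite e2; ring.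
move=> e3; move: hn; rewrite e3 normrN => hn.
have := ler_normD q3 q4; move: hn h1 h2 h3; clear; lra.
Qed.

End ito_error.

Section ito_path.
Context {R : realType}.
Variables (T K K0 : R) (B : R -> (R -> R) -> R).
Hypothesis T0 : 0 < T.
Hypothesis K_gt0 : 0 < K.
Hypothesis dB : drift T K K0 B.
Variables (g g1 q : R -> R) (y0 : R).
Hypothesis cg1 : continuous g1.
Hypothesis cq : continuous q.

(** The expression that the Ito formula identifies with the stochastic integral of [g1 (Y) s0 (Y)];
    [q] is later half the second derivative of [g] times the squared diffusion coefficient. *)
Definition ito_path (Y : R -> R) (t : R) : R := g (Y t) - g y0
  - integ 0 t (fun s => q (Y s)) - integ 0 t (fun s => g1 (Y s) * B s Y).

Variable Y : R -> R.
Hypothesis cY : {within `[0, T], continuous Y}.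

Let comp_cont (k : R -> R) : continuous k -> {within `[0, T], continuous (k \o Y)}.
Proof. by move=> ck; apply: within_continuous_comp => // x _; exact: ck. Qed.

Let Iq : intble 0 T (fun s => q (Y s)).
Proof. by apply: intble_cont; exact: (comp_cont cq). Qed.

Let IB : intble 0 T (fun s => g1 (Y s) * B s Y).
Proof.
have [M M0 hM] := cont_bounded cY.
have [M1 M10 hM1] := cont_bounded (comp_cont cg1).
apply: (@intble_bnd _ _ _ _ (M1 * (K0 + K * (1 + T) * M))).
  apply: measurable_funM; last exact: drift_meas dB _ cY.
  by apply: subspace_continuous_measurable_fun => //; exact: comp_cont cg1.
move=> s sT; rewrite normrM; apply: ler_pM => //; first exact: hM1.
apply: (drift_bound K_gt0 dB sT cY) => t /andP[t0 ts]; apply: hM.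
by case/andP: sT => _ sT; rewrite t0 (le_trans ts).
Qed.

Variables (N : nat) (u : nat -> R) (r1 th eps G1 Qb CB : R).
Hypothesis N0 : (0 < N)%N.
Local Notation D := (T / N%:R).
Local Notation t_ := (gridt T N).
Hypothesis Y_le : forall t, 0 <= t <= T -> `|Y t| <= r1.
Hypothesis u_le : forall i, (i <= N)%N -> `|u i| <= r1.
Hypothesis g1_le : forall x, `|x| <= r1 -> `|g1 x| <= G1.
Hypothesis q_le : forall x, `|x| <= r1 -> `|q x| <= Qb.
Hypothesis B_le : forall s, 0 <= s <= T -> `|B s Y| <= CB.
Hypothesis close : forall x y, `|x| <= r1 -> `|y| <= r1 -> `|x - y| <= th ->
  [/\ `|g x - g y| <= eps, `|g1 x - g1 y| <= eps & `|q x - q y| <= eps].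
Hypothesis uY : forall i s, (i <= N)%N -> t_ i <= s -> s <= t_ i.+1 -> s <= T -> `|u i - Y s| <= th.
Hypothesis linY : forall i s, (i < N)%N -> 0 <= s -> s <= t_ i.+1 -> `|lin D i u s - Y s| <= th.

Let D0 : 0 < D. Proof. by rewrite divr_gt0// ltr0n. Qed.
Let DT : D <= T. Proof. exact: step_le. Qed.

Let r10 : 0 <= r1. Proof. exact: le_trans (normr_ge0 _) (u_le (leq0n N)). Qed.
Let G10 : 0 <= G1.
Proof. by apply: le_trans (normr_ge0 (g1 0)) (g1_le _); rewrite normr0. Qed.

(** Per unit of time, the errors made in [q], in the factor [g1] of the drift, and in the drift
    itself. *)
Let cell_err := eps + eps * CB + G1 * (K * (1 + T) * th).

Lemma ito_cell i : (i < N)%N ->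
  `|g1 (u i) * gdrift B D i u (t_ i) (t_ i.+1) + q (u i) * D
    - (integ (t_ i) (t_ i.+1) (fun s => q (Y s))
       + integ (t_ i) (t_ i.+1) (fun s => g1 (Y s) * B s Y))| <= cell_err * D.
Proof.
move=> iN; have ti0 := gridt_ge0 T0 N i; have tT := gridt_leT T0 N0 iN.
have ii : t_ i <= t_ i.+1 by exact: gridt_le.
have tE : t_ i.+1 - t_ i = D by rewrite gridt_step addrAC subrr add0r.
have Il : intble (t_ i) (t_ i.+1) (B ^~ (lin D i u)).
  exact: (gdrift_intble K_gt0 dB D0 (lexx _) tT).
have Iq' := intble_sub Iq ti0 tT; have IB' := intble_sub IB ti0 tT.
have Il' := intbleZ (g1 (u i)) Il; have Ic := intble_cst (t_ i) (t_ i.+1) (q (u i)).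
have -> : g1 (u i) * gdrift B D i u (t_ i) (t_ i.+1) + q (u i) * D =
    integ (t_ i) (t_ i.+1) (fun s => g1 (u i) * B s (lin D i u) + q (u i)).
  by rewrite integD// integZ// integ_cst// tE.
rewrite -integD// -[X in _ <= _ * X]tE; apply: integ_dist_le => //.
- exact: intbleD.
- exact: intbleD.
move=> s /andP[s1 s2]; have sT := le_trans s2 tT.
  have s0 := le_trans ti0 s1; have sT' : 0 <= s <= T by rewrite s0.
  have [_ c1 c2] := close (u_le (ltnW iN)) (Y_le sT') (uY (ltnW iN) s1 s2 sT).
  have b1 : `|B s (lin D i u) - B s Y| <= K * (1 + T) * th.
    apply: (drift_dist K_gt0 dB sT') => //.
    - by apply: continuous_subspaceT; exact: lin_continuous.
    - by move=> r' /andP[r0 rs]; apply: linY => //; exact: le_trans rs s2.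
  have -> : g1 (u i) * B s (lin D i u) + q (u i) - (q (Y s) + g1 (Y s) * B s Y) =
    (q (u i) - q (Y s)) + (g1 (u i) - g1 (Y s)) * B s Y +
    g1 (u i) * (B s (lin D i u) - B s Y) by ring.
  rewrite /cell_err; apply: (le_trans (ler_normD _ _)); apply: lerD.
    apply: (le_trans (ler_normD _ _)); apply: lerD => //.
    by rewrite normrM; apply: ler_pM => //; exact: B_le.
  by rewrite normrM; apply: ler_pM => //; apply: g1_le; exact: u_le (ltnW iN).
Qed.

Lemma ito_grid n : (n <= N)%N -> `|g (u n) - g y0
    - \sum_(i < n) (g1 (u i) * gdrift B D i u (t_ i) (t_ i.+1) + q (u i) * D)
    - ito_path Y (t_ n)| <= eps + cell_err * T.
Proof.
move=> nN; rewrite /ito_path -(sum_integ_cells T0 N0 Iq nN) -(sum_integ_cells T0 N0 IB nN).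
have tn : 0 <= t_ n <= T by exact: gridt_itv.
have [c0 _ _] : [/\ `|g (u n) - g (Y (t_ n))| <= eps, `|g1 (u n) - g1 (Y (t_ n))| <= eps &
    `|q (u n) - q (Y (t_ n))| <= eps].
  apply: close; [exact: u_le|exact: Y_le|].
  by case/andP: tn => _ tn; apply: uY => //; exact: gridt_le.
set s1 := \sum_(i < n) (_ + _); set s2 := \sum_(i < n) _; set s3 := \sum_(i < n) _.
have -> : g (u n) - g y0 - s1 - (g (Y (t_ n)) - g y0 - s2 - s3) =
  (g (u n) - g (Y (t_ n))) - (s1 - (s2 + s3)) by ring.
apply: (le_trans (ler_normB _ _)); apply: lerD => //.
rewrite /s1 /s2 /s3 -big_split/= -sumrB; apply: (le_trans (ler_norm_sum _ _ _)).
have ce0 : 0 <= cell_err * D.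
  by apply: le_trans (ito_cell (_ : (0 < N)%N)) => //.
apply: (@le_trans _ _ (\sum_(i < n) cell_err * D)).
  by apply: ler_sum => i _; apply: ito_cell; exact: leq_trans (ltn_ord i) nN.
rewrite big_const_ord iter_addr_0.
apply: (@le_trans _ _ (cell_err * D *+ N)); first exact: ler_wpMn2l.
by rewrite -mulr_natr -mulrA divfK// pnatr_eq0 -lt0n.
Qed.

Lemma ito_within j t : (j <= N)%N -> t_ j <= t -> t <= t_ j.+1 -> t <= T ->
  `|ito_path Y t - ito_path Y (t_ j)| <= 2 * eps + (Qb + G1 * CB) * D.
Proof.
move=> jN jt tj tT; have tj0 := gridt_ge0 T0 N j; have t0 := le_trans tj0 jt.
have tT' : 0 <= t <= T by rewrite t0.
have jT : 0 <= t_ j <= T by exact: gridt_itv.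
have [c0 _ _] := close (u_le jN) (Y_le tT') (uY jN jt tj tT).
have [c1 _ _] := close (u_le jN) (Y_le jT)
  (uY jN (lexx _) (gridt_le T0 N (leqnSn j)) (le_trans jt tT)).
have bd (f : R -> R) C : intble 0 T f -> (forall s, 0 <= s <= T -> `|f s| <= C) ->
    `|integ 0 t f - integ 0 (t_ j) f| <= C * D.
  move=> If fC; rewrite (integ_add tj0 jt); last exact: intble_sub If _ _.
  rewrite addrAC subrr add0r.
  have C0 : 0 <= C by exact: le_trans (normr_ge0 _) (fC _ tT').
  apply: (@le_trans _ _ (C * (t - t_ j))).
    apply: integ_norm_le => //; first exact: intble_sub If _ _.
    by move=> s /andP[s1 s2]; apply: fC; rewrite (le_trans tj0 s1) (le_trans s2).
  by apply: ler_wpM2l => //; rewrite lerBlDl -gridt_step.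
have b1 := bd _ Qb Iq (fun s sT => q_le (Y_le sT)).
have b2 := bd _ (G1 * CB) IB _.
have {}b2 : `|integ 0 t (fun s => g1 (Y s) * B s Y) - integ 0 (t_ j) (fun s => g1 (Y s) * B s Y)|
    <= G1 * CB * D.
  apply: b2 => s sT; rewrite normrM; apply: ler_pM => //; last exact: B_le.
  by apply: g1_le; exact: Y_le.
rewrite /ito_path; move: b1 b2 c0 c1.
set i1 := integ 0 t _; set i2 := integ 0 (t_ j) _; set i3 := integ 0 t _.
set i4 := integ 0 (t_ j) _; set x := g (Y t); set y := g (Y (t_ j)); set z := g (u j).
move=> b1 b2 c0 c1.
have -> : x - g y0 - i1 - i3 - (y - g y0 - i2 - i4) =
  (z - y) - (z - x) - ((i1 - i2) + (i3 - i4)) by ring.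
apply: (le_trans (ler_normB _ _)); apply: lerD.
  by apply: (le_trans (ler_normB _ _)); rewrite mulr2n mulrDl mul1r lerD.
by rewrite mulrDl; apply: (le_trans (ler_normD _ _)); apply: lerD.
Qed.

End ito_path.

(** * Simple processes with jumps on the grid *)

Section grid_simple_process.
Context {R : realType} {d : measure_display} {Om : measurableType d}.
Variables (T : R) (N : nat) (xi : nat -> Om -> R).
Hypothesis T0 : 0 < T.
Hypothesis N0 : (0 < N)%N.
Local Notation t_ := (gridt T N).
Local Notation D := (T / N%:R).
Local Notation S := (SimpleProcess N t_ xi).

Lemma sp_process_grid i s w : (i < N)%N -> t_ i < s -> s <= t_ i.+1 ->
  sp_process S s w = xi i w.
Proof.
move=> iN is1 si; rewrite /sp_process/= (bigD1 (Ordinal iN))//= big1 ?addr0 => [|k ki].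
  by rewrite indicE mem_set ?mulr1//= in_itv/= is1 si.
rewrite indicE memNset ?mulr0//= in_itv/= => /andP[ks sk].
have : nat_of_ord k <> i by move=> e; move: ki; rewrite -val_eqE/= e eqxx.
case: (ltngtP k i) => // h _.
- by have := lt_le_trans is1 (le_trans sk (gridt_le T0 N h)); rewrite ltxx.
- by have := lt_le_trans ks (le_trans si (gridt_le T0 N h)); rewrite ltxx.
Qed.

Lemma grid_cell s : 0 < s <= T -> exists i, [/\ (i < N)%N, t_ i < s & s <= t_ i.+1].
Proof.
move=> /andP[s0 sT]; have sT' : 0 <= s <= T by rewrite ltW.
have [j [jN js sj]] := grid_point T0 N0 sT'.
have sj' : s <= t_ j.+1 by rewrite gridt_step -lerBlDl.
have [h|h] := eqVneq (t_ j) s; last first.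
  have tjs : t_ j < s by rewrite lt_neqAle h.
  exists j; split => //; rewrite ltn_neqAle jN andbT; apply/eqP => e.
  by move: tjs; rewrite e gridtN// ltNge sT.
case: j h jN {js sj sj'} => [|j] h jN; first by move: s0; rewrite -h gridt0 ltxx.
by exists j; split => //; rewrite -h ?lexx// gridt_lt.
Qed.

(** The cell that contains [t] contributes its increment up to [t]; for [j = N] there is no such
    cell. *)
Lemma sp_integral_grid (W : R -> Om -> R) j t w : (j <= N)%N -> t_ j <= t -> t <= t_ j.+1 ->
  t <= T ->
  sp_integral W S t w = dsum xi (fun i => increment W (t_ i) (t_ i.+1)) j w
    + (if (j < N)%N then xi j w * (W t w - W (t_ j) w) else 0).
Proof.
move=> jN jt tj tT.
pose G i := xi i w * (W (Num.min (t_ i.+1) t) w - W (Num.min (t_ i) t) w).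
have G1 i : (i < j)%N -> G i = xi i w * increment W (t_ i) (t_ i.+1) w.
  move=> ij; have h1 := le_trans (gridt_le T0 N ij) jt.
  by rewrite /G !min_l// (le_trans (gridt_le T0 N (leqnSn i))).
have G2 i : (j < i)%N -> G i = 0.
  move=> ij; have h1 := le_trans tj (gridt_le T0 N ij).
  by rewrite /G !min_r ?subrr ?mulr0// (le_trans h1)// gridt_le.
rewrite /sp_integral/= -(big_mkord xpredT G) (big_cat_nat (n := j))//=; congr (_ + _).
  by rewrite big_mkord; apply: eq_bigr => i _; exact: G1.
case: ifPn => [jN'|]; last first.
  by rewrite -leqNgt => Nj; rewrite big_geq.
rewrite big_ltn// big_nat_cond big1 => [|i]; last by case/andP => /andP[/G2].
by rewrite addr0 /G min_r// min_l.
Qed.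

(** The simple process vanishes at time 0, its intervals being open on the left, so this single time
    is removed from the integral. *)
Lemma sp_grid_error (H : R -> R) (eps : R) w : measurable_fun `[0, T] H ->
  (forall i s, (i < N)%N -> t_ i < s -> s <= t_ i.+1 -> `|xi i w - H s| <= eps) ->
  (\int[lebesgue_measure]_(s in `[0%R, T]) ((sp_process S s w - H s) ^+ 2)%:E
    <= (T * eps ^+ 2)%:E)%E.
Proof.
move=> mH he.
have eps0 : 0 <= eps.
  by apply: le_trans (he 0 (t_ 1) N0 _ _) => //; exact: gridt_lt.
have mS : measurable_fun `[0, T] (fun s => (sp_process S s w - H s) ^+ 2).
  by apply: measurable_funX; apply: measurable_funB => //; exact: sp_measurable.
have mS' : measurable_fun `]0, T] (fun s => (sp_process S s w - H s) ^+ 2).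
  by apply: measurable_funS mS => //; apply: subset_itv; rewrite bnd_simp.
rewrite -integral_itv_obnd_cbnd; last exact/measurable_EFinP.
apply: (@le_trans _ _ (\int[lebesgue_measure]_(s in `]0%R, T]) (eps ^+ 2)%:E)%E).
  apply: ge0_le_integral => //.
  - by move=> s _; rewrite lee_fin sqr_ge0.
  - exact/measurable_EFinP.
  - move=> s /=; rewrite in_itv/= => /grid_cell[i [iN is1 si]].
    rewrite (sp_process_grid w iN)// lee_fin -[leLHS]real_normK ?num_real// lerXn2r ?nnegrE//.
    exact: he.
by rewrite integral_cst//= lebesgue_measure_itv/= lte_fin T0 sube0 -EFinM lee_fin mulrC.
Qed.

End grid_simple_process.

Lemma dist_half {R : realType} (x y z th : R) : `|x - y| <= th / 2 -> `|y - z| <= th / 2 ->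
  `|x - z| <= th.
Proof. by move=> h1 h2; have := ler_normD (x - y) (y - z); rewrite addrA subrK; lra. Qed.

Lemma norm_close {R : realType} (x y r th : R) : `|x| <= r -> `|x - y| <= th -> `|y| <= r + th.
Proof. by move=> h1 h2; have := ler_normB x (x - y); rewrite opprB addrC subrK; lra. Qed.

Lemma close_on {R : realType} (k : R -> R) (r eps : R) : continuous k -> 0 < eps ->
  exists2 dl, 0 < dl & forall x y, `|x| <= r -> `|y| <= r -> `|x - y| < dl -> `|k x - k y| <= eps.
Proof.
move=> ck e0.
have [dl dl0 h] := itv_unif_cont (@continuous_subspaceT _ _ `[- r, r] _ ck) e0.
by exists dl => // x y xr yr xy; apply/ltW/h; rewrite -?ler_norml.
Qed.

Section ito_formula.
Context {R : realType} {d : measure_display} {Om : measurableType d}.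
Variables (P : probability Om R) (T : R) (W : R -> Om -> R) (F : R -> set (set Om)).
Hypothesis T0 : 0 < T.
Hypothesis wb : wiener_basis P T W F.
Variables (K K0 y0 : R) (B : R -> (R -> R) -> R) (s0 : R -> R).
Hypothesis K_gt0 : 0 < K.
Hypothesis dB : drift T K K0 B.
Hypothesis cs0 : continuous s0.
Hypothesis s0_growth : linear_growth s0.
Local Notation Eu := (Eu T W y0 B s0).
Local Notation Et := (Et T W y0 B s0).
Variable Y : R -> Om -> R.
Hypothesis cY : continuous_process T Y.
Hypothesis Y_lim : forall eta e : R, 0 < eta -> 0 < e -> exists N0, forall N,
  (N0 <= N)%N -> (0 < N)%N ->
  pbnd P [set w | exists2 t, 0 <= t <= T & eta < `|Et N t w - Y t w|] e.
Variables (g g1 g2 : R -> R).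
Hypothesis dg : forall x : R, is_derive x (1 : R) g (g1 x).
Hypothesis dg1 : forall x : R, is_derive x (1 : R) g1 (g2 x).
Hypothesis cg2 : continuous g2.
Local Notation q := (fun x => 2^-1 * g2 x * s0 x ^+ 2).
Local Notation M := (fun t w => ito_path B g g1 q y0 (Y ^~ w) t).

Section pathwise.
Variables (r th eps om Sr G1 Qb : R) (f f1 f2 : R -> R) (N : nat) (w : Om).
Hypothesis r0 : 0 < r.

Hypothesis th1 : th <= 1.
Hypothesis N0 : (0 < N)%N.
Local Notation D := (T / N%:R).
Local Notation t_ := (gridt T N).
Local Notation V := (stopped_euler T W y0 B s0 N r).
Local Notation al := (stopped_drift T W y0 B s0 N r).
Local Notation be := (stopped_diffusion T W y0 B s0 N r).
Hypothesis Ur : forall j, (j <= N)%N -> `|Eu N j w| <= r.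
Hypothesis hE : forall t, 0 <= t <= T -> `|Et N t w - Y t w| <= th / 2.
Hypothesis hmod : forall s t, 0 <= s <= T -> 0 <= t <= T -> `|t - s| <= D ->
  `|Et N t w - Et N s w| <= th / 2.
Hypothesis hW : forall s t, 0 <= s <= T -> 0 <= t <= T -> `|t - s| <= D ->
  `|W t w - W s w| <= om.
Hypothesis fg : forall x, `|x| <= r + 1 -> [/\ f x = g x, f1 x = g1 x & f2 x = g2 x].
Hypothesis s0_le : forall x, `|x| <= r -> `|s0 x| <= Sr.
Hypothesis g1_le : forall x, `|x| <= r + 1 -> `|g1 x| <= G1.
Hypothesis q_le : forall x, `|x| <= r + 1 -> `|q x| <= Qb.
Hypothesis close : forall x y, `|x| <= r + 1 -> `|y| <= r + 1 -> `|x - y| <= th ->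
  [/\ `|g x - g y| <= eps, `|g1 x - g1 y| <= eps & `|q x - q y| <= eps].
Hypothesis closep : forall x y, `|x| <= r + 1 -> `|y| <= r + 1 -> `|x - y| <= th ->
  `|g1 x * s0 x - g1 y * s0 y| <= eps.

Let CB := K0 + K * (1 + T) * (r + 1).
Let xi i w := f1 (V i w) * be i w.

Let VE j : (j <= N)%N -> V j w = Eu N j w.
Proof.
by move=> jN; apply: stopped_eulerE => i ij; apply: Ur; rewrite (leq_trans (ltnW ij)).
Qed.

Let inw j : (j <= N)%N -> inside T W y0 B s0 N r j w.
Proof. by move=> jN i ij; apply: Ur; rewrite (leq_trans ij). Qed.

Let Ur1 j : (j <= N)%N -> `|Eu N j w| <= r + 1.
Proof. by move=> jN; rewrite (le_trans (Ur jN))// lerDl. Qed.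

Let uY i s : (i <= N)%N -> t_ i <= s -> s <= t_ i.+1 -> s <= T -> `|Eu N i w - Y s w| <= th.
Proof.
move=> iN is1 si sT; have iT := gridt_itv T0 N0 iN.
have sT' : 0 <= s <= T by case/andP: iT => ti0 _; rewrite (le_trans ti0).
have h1 := hE sT'.
have h2 : `|Et N s w - Et N (t_ i) w| <= th / 2.
  by apply: hmod => //; rewrite ger0_norm ?subr_ge0// lerBlDl -gridt_step.
by rewrite Et_grid// distrC in h2; exact: dist_half h2 h1.
Qed.

Let Y_le t : 0 <= t <= T -> `|Y t w| <= r + 1.
Proof.
move=> tT; have [j [jN jt tj]] := grid_point T0 N0 tT.
have tj' : t <= t_ j.+1 by rewrite gridt_step -lerBlDl.
have h1 := Ur jN; have h2 : `|Eu N j w - Y t w| <= th by apply: uY => //; case/andP: tT.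
by rewrite (le_trans (norm_close h1 h2))// lerD2l.
Qed.

Let linY i s : (i < N)%N -> 0 <= s -> s <= t_ i.+1 ->
  `|lin D i (fun k => Eu N k w) s - Y s w| <= th.
Proof.
move=> iN s1 si; have sT := le_trans si (gridt_leT T0 N0 iN).
have sT' : 0 <= s <= T by rewrite s1.
have h1 := hE sT'.
have h2 : `|lin D i (fun k => Eu N k w) s - Et N s w| <= th / 2.
  apply: (@lin_close _ _ (grid_step_gt0 T0 N0) i _ (fun s => Et N s w)); last by rewrite s1.
  - by move=> k ki; rewrite -/(gridt T N k) Et_grid.
  - move=> k s' ki ks s'0 s'i; apply: hmod => //.
      by apply: gridt_itv => //; exact: leq_trans ki (ltnW iN).
    by rewrite s'0 (le_trans s'i)//; exact: gridt_leT.
exact: dist_half h2 h1.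
Qed.

Lemma ito_integrand_close : (\int[lebesgue_measure]_(s in `[0%R, T])
  ((sp_process (SimpleProcess N t_ xi) s w - g1 (Y s w) * s0 (Y s w)) ^+ 2)%:E
   <= (T * eps ^+ 2)%:E)%E.
Proof.
apply: (sp_grid_error T0 N0) => [|i s iN is1 si].
  apply: subspace_continuous_measurable_fun => //.
  apply: (@within_continuous_comp _ _ _ _ (Y ^~ w) (fun x => g1 x * s0 x)); last exact: (@cY w).
  by move=> x _; apply: cvgM; [exact: (derive_continuous dg1)|exact: cs0].
have sT := le_trans si (gridt_leT T0 N0 iN).
rewrite /xi VE ?(ltnW iN)// /stopped_diffusion indicE mem_set ?mul1r; last exact: inw (ltnW iN).
have [_ -> _] := fg (Ur1 (ltnW iN)).
apply: closep; [exact: Ur1 (ltnW iN)|apply: Y_le|exact: uY (ltnW iN) (ltW is1) si sT].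
by rewrite sT (le_trans (gridt_ge0 T0 N i) (ltW is1)).
Qed.

(** The four summands are the error of the discrete Ito formula, the comparison of the discrete
    expression with [ito_path] at a grid point, the variation of [ito_path] inside a cell, and the
    last incomplete increment of [W]. *)
Lemma ito_integral_close lam : (forall n, (n <= N)%N ->
    `|dsum xi (fun j => increment W (t_ j) (t_ j.+1)) n w
      - (f (V n w) - f y0 - \sum_(i < n) (f1 (V i w) * al i w
           + 2^-1 * f2 (V i w) * be i w ^+ 2 * D))| <= lam) -> `|y0| <= r ->
  forall t, 0 <= t <= T -> `|sp_integral W (SimpleProcess N t_ xi) t w - M t w| <=
    lam + (eps + (eps + eps * CB + G1 * (K * (1 + T) * th)) * T) +
    (2 * eps + (Qb + G1 * CB) * D) + G1 * Sr * om.
Proof.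
move=> hlam y0r t tT; have [j [jN jt tj]] := grid_point T0 N0 tT.
have tj' : t <= t_ j.+1 by rewrite gridt_step -lerBlDl.
have tT' : t <= T by case/andP: tT.
have cq : continuous q.
  move=> x; apply: cvgM; first by apply: cvgM; [exact: cvg_cst|exact: cg2].
  by apply: (@continuous_comp _ _ _ s0 (fun x => x ^+ 2)); [exact: cs0|exact: exprn_continuous].
have cg1 : continuous g1 by exact: derive_continuous dg1.
have B_le s : 0 <= s <= T -> `|B s (Y ^~ w)| <= CB.
  move=> sT; apply: (drift_bound K_gt0 dB sT (@cY w)) => s' /andP[s1 s2].
  by apply: Y_le; case/andP: sT => _ sT; rewrite s1 (le_trans s2).
have h1 := ito_within T0 K_gt0 dB y0 cg1 cq (@cY w) N0 Y_le Ur1 g1_le q_le B_le close uY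
  jN jt tj' tT'.
have h2 := ito_grid T0 K_gt0 dB y0 cg1 cq (@cY w) N0 Y_le Ur1 g1_le B_le close uY
  linY jN.
have h3 := hlam _ jN.
have [fgj _ _] := fg (Ur1 jN).
have [fg0 _ _] : [/\ f y0 = g y0, f1 y0 = g1 y0 & f2 y0 = g2 y0].
  by apply: fg; rewrite (le_trans y0r)// lerDl.
rewrite VE// fgj fg0 in h3.
have se : \sum_(i < j) (f1 (V i w) * al i w + 2^-1 * f2 (V i w) * be i w ^+ 2 * D) =
    \sum_(i < j) (g1 (Eu N i w) * gdrift B D i (fun k => Eu N k w) (t_ i) (t_ i.+1)
      + q (Eu N i w) * D).
  apply: eq_bigr => i _; have iN : (i <= N)%N := leq_trans (ltnW (ltn_ord i)) jN.
  rewrite VE//; have [_ -> ->] := fg (Ur1 iN).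
  by rewrite /stopped_drift /stopped_diffusion indicE mem_set ?mul1r//; exact: inw.
rewrite se in h3.
rewrite (@sp_integral_grid _ _ _ _ _ xi T0 W j t w jN jt tj' tT').
have G10 : 0 <= G1 := le_trans (normr_ge0 _) (g1_le (Ur1 (leq0n N))).
have Sr0 : 0 <= Sr := le_trans (normr_ge0 _) (s0_le (Ur (leq0n N))).
have h4 : `|if (j < N)%N then xi j w * (W t w - W (t_ j) w) else 0| <= G1 * Sr * om.
  have hWj : `|W t w - W (t_ j) w| <= om.
    apply: hW => //; first exact: gridt_itv.
    by rewrite ger0_norm ?subr_ge0// lerBlDl -gridt_step.
  have om0 := le_trans (normr_ge0 _) hWj.
  case: ifP => jN'; last by rewrite normr0 !mulr_ge0.
  rewrite normrM; apply: ler_pM => //; rewrite /xi normrM VE//; apply: ler_pM => //.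
    by have [_ -> _] := fg (Ur1 jN); apply: g1_le; exact: Ur1.
  by rewrite /stopped_diffusion indicE mem_set ?mul1r; [apply: s0_le; exact: Ur|exact: inw].
move: h1 h2 h3 h4; set x1 := ito_path _ _ _ _ _ _ _; set x2 := ito_path _ _ _ _ _ _ _.
set x3 := dsum _ _ _ _; set x4 := (if _ then _ else _); set x5 := _ - _ - \sum_(i < j) _.
move=> h1 h2 h3 h4; have -> : x3 + x4 - x1 = (x3 - x5) + (x5 - x2) - (x1 - x2) + x4 by ring.
apply: (le_trans (ler_normD _ _)); apply: lerD => //.
apply: (le_trans (ler_normB _ _)); apply: lerD => //.
by apply: (le_trans (ler_normD _ _)); apply: lerD.
Qed.

End pathwise.

(** The approximating integrands are the grid values [f1 (V) be] of the stopped scheme with a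
    cut-off function. They are bounded and adapted, and outside a small event neither the stopping
    nor the cutoff is active. *)
Theorem ito_formula : ito_via_simple P T W F (fun t w => g1 (Y t w) * s0 (Y t w)) M.
Proof.
move=> kap lam e kap0 lam0 e0; pose e4 := e / 4; have e40 : 0 < e4 by rewrite divr_gt0.
have lam_le : lam / 4 + lam / 8 + lam / 8 + lam / 8 + lam / 8 <= lam by lra.
have e4E : e = e4 + e4 + (e4 + e4) by rewrite /e4; lra.
have [r r0' hr] := euler_tight T0 wb y0 K_gt0 dB cs0 s0_growth e40.
(* The interval must also contain the starting point, at which [f] and [g] have to agree. *)
wlog : r r0' hr / `|y0| <= r.
  move=> /(_ (Num.max r `|y0|)); apply; rewrite ?lt_max ?r0'// ?le_max ?lexx ?orbT//.
  move=> N N0; apply: pbnd_le (hr N N0) => // w [j jN]; rewrite gt_max => /andP[h _].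
  by exists j.
move=> y0r; have r00 : 0 <= r := ltW r0'; have r10 : 0 < r + 1 by rewrite ltr_wpDl.
have r10' := ltW r10.
have cg1 : continuous g1 by exact: derive_continuous dg1.
have cg : continuous g by exact: derive_continuous dg.
have cs2 : continuous (fun x => s0 x ^+ 2).
  by move=> x; apply: (@continuous_comp _ _ _ s0 (fun x => x ^+ 2)); [exact: cs0|exact: exprn_continuous].
have cq : continuous q.
  by move=> x; apply: cvgM; [apply: cvgM; [exact: cvg_cst|exact: cg2]|exact: cs2].
have cp : continuous (fun x => g1 x * s0 x).
  by move=> x; apply: cvgM; [exact: cg1|exact: cs0].
have [Sr Sr0 hSr] := continuous_bound cs0 r00.
have [G1 G10 hG1] := continuous_bound cg1 r10'.
have [Qb Qb0 hQb] := continuous_bound cq r10'.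
have [f [f1 [f2 [Bd [sm fg0 fg1 fg2]]]]] := smooth_cutoff dg dg1 cg2 r10.
set CB := K0 + K * (1 + T) * (r + 1).
have K00 : 0 <= K0.
  by apply: le_trans (normr_ge0 (B 0 (fun=> 0))) (drift_bnd dB _); rewrite lexx ltW.
have CB0 : 0 <= CB by rewrite addr_ge0// !mulr_ge0// ?addr_ge0// ltW.
(* [c1], [c2], [c3] and [c4] are the coefficients of [eps], [th], [om] and the grid step in the
   bound of [ito_integral_close], the last three increased by 1 to be positive. Each product is made
   at most [lam / 8], which leaves room for the discrete Ito error [lam / 4]. *)
pose c1 := 3 + T + CB * T; have c10 : 0 < c1.
  by rewrite /c1 ltr_wpDr ?mulr_ge0// ?(ltW T0)// ltr_wpDr// ltW.
pose eps := Num.min (Num.min 1 (kap / T)) (lam / 8 / c1).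
have eps0 : 0 < eps by rewrite !lt_min ltr01 !divr_gt0.
have eps1 : eps <= 1 by rewrite /eps !ge_min lexx.
have epsk : eps <= kap / T by rewrite /eps !ge_min lexx !orbT.
have epsl : eps * c1 <= lam / 8 by rewrite -ler_pdivlMr// /eps !ge_min lexx !orbT.
have [d1 d10 hd1] := @close_on _ g (r + 1) _ cg eps0.
have [d2 d20 hd2] := @close_on _ g1 (r + 1) _ cg1 eps0.
have [d3 d30 hd3] := @close_on _ q (r + 1) _ cq eps0.
have [d4 d40 hd4] := @close_on _ _ (r + 1) _ cp eps0.
pose c2 := G1 * (K * (1 + T)) * T + 1; have c20 : 0 < c2.
  by rewrite ltr_wpDl// !mulr_ge0// ?addr_ge0// ltW.
pose dd := Num.min (Num.min 1 (lam / 8 / c2)) (Num.min (Num.min d1 d2) (Num.min d3 d4)).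
have dd0 : 0 < dd by rewrite !lt_min ltr01 !divr_gt0// d10 d20 d30 d40.
pose th := dd / 2; have th0 : 0 < th by rewrite divr_gt0.
have thdd : th < dd by rewrite ltr_pdivrMr// ltr_pMr// ltr1n.
move: (thdd); rewrite !lt_min => /andP[/andP[/ltW th1 /ltW thl] /andP[/andP[t1 t2] /andP[t3 t4]]].
rewrite ler_pdivlMr// in thl.
have th20 : 0 < th / 2 by rewrite divr_gt0.
have [omW omW0 [a a0 hmod]] := Et_modulus_small W T0 y0 K_gt0 dB cs0 r00 th20.
pose c3 := G1 * Sr + 1; have c30 : 0 < c3 by rewrite ltr_wpDl// mulr_ge0.
pose om := Num.min omW (lam / 8 / c3); have om0 : 0 < om by rewrite lt_min omW0 !divr_gt0.
have oml : om * c3 <= lam / 8 by rewrite -ler_pdivlMr// ge_min lexx orbT.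
have mW t : 0 <= t <= T -> meas_wrt measurable (W t).
  by move=> tT; apply: (sub_meas_wrt (wb_meas wb (t := t))); exact: (wb_adapted wb).
have [dl dl0 hosc] := osc_small P T0 (wb_cont wb) mW om0 e40.
have [N1 hN1] := Y_lim th20 e40.
have l40 : 0 < lam / 4 by rewrite divr_gt0.
have [N2 hN2] := ito_error_small T0 wb y0 K_gt0 dB cs0 r0' hSr sm l40 e40.
pose c4 := Qb + G1 * CB + 1; have c40 : 0 < c4 by rewrite ltr_wpDl// addr_ge0// mulr_ge0.
have al0 : 0 < Num.min (Num.min a dl) (lam / 8 / c4) by rewrite !lt_min a0 dl0 !divr_gt0.
have [N3 hN3] := small_step T al0.
pose N := (maxn N1 (maxn N2 N3)).+1.
have NN1 : (N1 <= N)%N by rewrite leqW// leq_maxl.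
have NN2 : (N2 <= N)%N by rewrite leqW// !leq_max leqnn orbT.
have NN3 : (N3 <= N)%N by rewrite leqW// !leq_max leqnn !orbT.
have N0 : (0 < N)%N by [].
have := hN3 N NN3 N0; rewrite !lt_min => /andP[/andP[Da Ddl] /ltW]; rewrite ler_pdivlMr// => Dl.
have D0 := step_gt0 T0 N0.
have {}hN1 := hN1 N NN1 N0; have {}hN2 := hN2 N NN2 N0; have {}hr := hr N N0.
set A1 := [set w | _] in hr; set A2 := [set w | _] in hN1; set A4 := [set w | _] in hN2.
pose A := (A1 `|` A2) `|` (osc_gt T W dl om `|` A4).
have pA : pbnd P A e.
  by rewrite e4E; do 2 apply: pbndU.
pose xi i w := f1 (stopped_euler T W y0 B s0 N r i w) * stopped_diffusion T W y0 B s0 N r i w.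
have good w : ~ A w ->
  [/\ forall j, (j <= N)%N -> `|Eu N j w| <= r,
     forall t, 0 <= t <= T -> `|Et N t w - Y t w| <= th / 2,
     forall s t, 0 <= s <= T -> 0 <= t <= T -> `|t - s| <= T / N%:R -> `|W t w - W s w| <= om,
     forall s t, 0 <= s <= T -> 0 <= t <= T -> `|t - s| <= T / N%:R ->
       `|Et N t w - Et N s w| <= th / 2 &
     ~ A4 w].
  move=> nA; have a1 : forall j, (j <= N)%N -> `|Eu N j w| <= r.
    by move=> j jN; rewrite leNgt; apply/negP => h; apply: nA; left; left; exists j.
  have a3 : forall s t, 0 <= s <= T -> 0 <= t <= T -> `|t - s| <= T / N%:R -> `|W t w - W s w| <= om.
    move=> s t sT tT st; rewrite leNgt; apply/negP => h; apply: nA; right; left.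
    by exists s, t; split => //; exact: le_lt_trans Ddl.
  split => //.
  - by move=> t tT; rewrite leNgt; apply/negP => h; apply: nA; left; right; exists t.
  - apply: hmod => // s t sT tT st; rewrite (le_trans (a3 _ _ sT tT st))//.
    by rewrite /om ge_min lexx.
  - by move=> h; apply: nA; right; right.
have fg x : `|x| <= r + 1 -> [/\ f x = g x, f1 x = g1 x & f2 x = g2 x].
  by move=> h; split; [exact: fg0|exact: fg1|exact: fg2].
have close x y : `|x| <= r + 1 -> `|y| <= r + 1 -> `|x - y| <= th ->
    [/\ `|g x - g y| <= eps, `|g1 x - g1 y| <= eps & `|q x - q y| <= eps].
  move=> xr yr xy; split.
  - by apply: hd1 => //; exact: le_lt_trans t1.
  - by apply: hd2 => //; exact: le_lt_trans t2.
  - by apply: (hd3 x y) => //; exact: le_lt_trans t3.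
have closep x y : `|x| <= r + 1 -> `|y| <= r + 1 -> `|x - y| <= th ->
    `|g1 x * s0 x - g1 y * s0 y| <= eps.
  by move=> xr yr xy; apply: (hd4 x y) => //; exact: le_lt_trans t4.
exists (SimpleProcess N (gridt T N) xi); split.
- split => /=.
  + by rewrite gridt0.
  + by rewrite gridtN.
  + by move=> i _; exact: gridt_le.
  + move=> i iN; have sF := wb_sigma wb (gridt T N i).
    have m : meas_wrt (F (gridt T N i)) (xi i).
      apply: (measM sF); last exact: (stopped_diffusion_meas T0 wb y0 K_gt0 dB cs0 r N0).
      apply: meas_compc; first by case: sm => [[]].
      exact: (stopped_euler_meas T0 wb y0 K_gt0 dB cs0 r N0 (ltnW iN)).
    by move=> C mC; exact: meas_preimage m mC.
  + move=> i iN; exists (Bd * (drift_const T K K0 r + Sr)) => w.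
    rewrite normrM; apply: ler_pM => //; first by case: sm => [[]].
    exact: (stopped_bound W T0 y0 K_gt0 dB r0' hSr w N0 iN).2.
- apply: pbnd_le pA => // w; rewrite /= ltNge => /negP h; apply: contrapT => nA; apply: h.
  have [a1 a2 a3 a5 _] := good w nA.
  apply: (le_trans (ito_integrand_close th1 N0 a1 a2 a5 fg closep)).
  rewrite lee_fin; apply: (@le_trans _ _ (T * eps)).
    apply: ler_wpM2l; [exact: ltW|by rewrite expr2 ler_piMl// ltW].
  by rewrite mulrC -ler_pdivlMr.
- apply: pbnd_le pA => // w [t tT]; rewrite ltNge => /negP h; apply: contrapT => nA; apply: h.
  have [a1 a2 a3 a5 a4] := good w nA.
  apply: (le_trans (ito_integral_close th1 N0 a1 a2 a5 a3 fg hSr hG1 hQb close (lam := lam / 4) _ y0r tT)).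
    by move=> n nN; rewrite leNgt; apply/negP => h; apply: a4; exists n => //; exact: ltW.
  have q1 : (T / N%:R) * (Qb + G1 * CB) <= lam / 8.
    by apply: le_trans Dl; apply: ler_wpM2l; [exact: ltW|rewrite /c4 lerDl].
  have q2 : om * (G1 * Sr) <= lam / 8.
    by apply: le_trans oml; apply: ler_wpM2l; [exact: ltW|rewrite /c3 lerDl].
  have q3 : th * (G1 * (K * (1 + T)) * T) <= lam / 8.
    by apply: le_trans thl; apply: ler_wpM2l; [exact: ltW|rewrite /c2 lerDl].
  have -> : lam / 4 + (eps + (eps + eps * CB + G1 * (K * (1 + T) * th)) * T) +
    (2 * eps + (Qb + G1 * CB) * (T / N%:R)) + G1 * Sr * om = lam / 4 + eps * c1 +
    th * (G1 * (K * (1 + T)) * T) + (T / N%:R) * (Qb + G1 * CB) + om * (G1 * Sr).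
    by rewrite /c1; ring.
  by apply: le_trans lam_le; do 4 apply: lerD => //.
Qed.

End ito_formula.

(** * Stochastic integrals on the space and on its completion *)

Section completed_integral.
Context {R : realType} {d : measure_display} {Om : measurableType d}.
Variables (P : probability Om R) (T : R) (W : R -> Om -> R) (H M : R -> Om -> R).
Local Notation F := (canonical_filtration P T W).

Lemma cvg0_pbnd (Z : nat -> Om -> \bar R) (eps e : R) : cvg0_in_probability P Z ->
  0 < eps -> 0 < e -> exists N0, forall n, (N0 <= n)%N -> pbnd P [set w | (eps%:E < Z n w)%E] e.
Proof.
move=> /[apply]-[A [mA ZA PA]] e0.
have [N0 _ h] : \forall n \near \oo, (P (A n) < e%:E)%E.
  have := PA [set x | (x < e%:E)%E]; apply.
  by apply: open_nbhs_nbhs; split; [exact: open_ereal_lt_ereal|rewrite /= lte_fin].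
by exists N0 => n nN; exists (A n); split => //; apply: ltW; exact: h.
Qed.

Lemma pbnd_cvg0 (Z : nat -> Om -> \bar R) :
  (forall eps : R, 0 < eps -> exists N0, forall n, (N0 <= n)%N ->
    pbnd P [set w | (eps%:E < Z n w)%E] (2 / n.+1%:R)) -> cvg0_in_probability P Z.
Proof.
move=> hZ eps /hZ[N0 hN].
have hA n : exists A, [/\ measurable A, [set w | (eps%:E < Z n w)%E] `<=` A &
    (N0 <= n)%N -> (P A <= (2 / n.+1%:R)%:E)%E].
  have [/hN[A [mA ZA PA]]|] := boolP (N0 <= n)%N; first by exists A.
  by exists setT.
have {hA}[A hA] := choice hA.
exists A; split => [n|n|]; try by have [] := hA n.
apply: (squeeze_cvge (f := cst 0%E) (h := fun n => (2 / n.+1%:R)%:E)); last 2 first.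
- exact: cvg_cst.
- apply: cvg_EFin; first by exact: nearW.
  have := @cvgMr _ _ _ _ _ 2 _ (@cvg_harmonic R); rewrite mulr0; exact.
- by exists N0 => // n nN /=; rewrite measure_ge0; have [_ _] := hA n; apply.
Qed.

Lemma ito_of_integral : is_ito_integral P T W H M ->
  ito_via_simple (Pbar P) T W F (H : R -> completed P -> R) M.
Proof.
move=> [S [sS S1 S2]] kap lam e kap0 lam0 e0.
have [N1 h1] := cvg0_pbnd S1 kap0 e0; have [N2 h2] := cvg0_pbnd S2 lam0 e0.
pose n := maxn N1 N2.
exists (SimpleProcess (sp_size (S n)) (sp_t (S n)) (sp_xi (S n) : nat -> completed P -> R)).
split.
- by have [a1 a2 a3 a4 a5] := sS n; split.
- by apply: (@pbnd_Pbar _ _ _ P); exact: h1 (leq_maxl _ _).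
- apply: (@pbnd_Pbar _ _ _ P); apply: pbnd_le (h2 n (leq_maxr _ _)) => // w [t tT h] /=.
  rewrite (@lt_le_trans _ _ (`|sp_integral W (S n) t w - M t w|)%:E)// ?lte_fin//.
  by apply: ereal_sup_ubound; exists t => //; rewrite /= in_itv.
Qed.

(** Accuracy and exceptional probability are both [1 / (n + 1)] for the [n]-th simple process. The
    probability is doubled because the passage from the completion to [P] asks for a strictly larger
    bound. *)
Lemma integral_of_ito : ito_via_simple (Pbar P) T W F (H : R -> completed P -> R) M ->
  is_ito_integral P T W H M.
Proof.
move=> h; have n0 n : 0 < n.+1%:R^-1 :> R by rewrite invr_gt0.
have {}h n : exists S : @simple_process R d Om, [/\ is_simple T F S,
    pbnd P [set w | ((n.+1%:R^-1)%:E < \int[lebesgue_measure]_(s in `[0%R, T])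
      ((sp_process S s w - H s w) ^+ 2)%:E)%E] (2 / n.+1%:R) &
    pbnd P [set w | exists2 t, 0 <= t <= T &
      n.+1%:R^-1 < `|sp_integral W S t w - M t w|] (2 / n.+1%:R)].
  have lt : n.+1%:R^-1 < 2 / n.+1%:R :> R by rewrite ltr_pMl// ltr1n.
  have [S [sS h1 h2]] := h _ _ _ (n0 n) (n0 n) (n0 n).
  exists (SimpleProcess (sp_size S) (sp_t S) (sp_xi S : nat -> Om -> R)); split.
  - by have [a1 a2 a3 a4 a5] := sS; split.
  - exact: Pbar_pbnd lt h1.
  - exact: Pbar_pbnd lt h2.
have {h}[S h] := choice h.
have small (eps : R) : 0 < eps -> exists N0, forall n, (N0 <= n)%N -> n.+1%:R^-1 <= eps.
  move=> e0; exists (Num.truncn eps^-1) => n nN.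
  rewrite -[eps]invrK lef_pV2 ?posrE ?invr_gt0//.
  by apply/ltW/(lt_le_trans (truncnS_gt _)); rewrite ler_nat.
exists S; split.
- by move=> n; have [] := h n.
- apply: pbnd_cvg0 => eps /small[N0 hN]; exists N0 => n /hN le.
  have [_ h1 _] := h n; apply: pbnd_le h1 => // w /=; apply: le_lt_trans.
  by rewrite lee_fin.
- apply: pbnd_cvg0 => eps /small[N0 hN]; exists N0 => n /hN le.
  have [_ _ h1] := h n; apply: pbnd_le h1 => // w /= /ereal_sup_gt[_ [t tT <-]].
  rewrite lte_fin => lt; exists t; first by move: tT; rewrite /= in_itv.
  exact: le_lt_trans lt.
Qed.

End completed_integral.

(** * Mollification and the scale function *)

Section integral_calculus.
Context {R : realType}.
Implicit Types (f F kap g : R -> R).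

Lemma integ_derive F f (a b : R) : (forall x : R, is_derive x (1 : R) F (f x)) ->
  continuous f -> a <= b -> integ a b f = F b - F a.
Proof.
move=> dF cf; rewrite le_eqVlt => /orP[/eqP <-|ab]; first by rewrite integ_refl subrr.
have cF := derive_continuous dF.
rewrite /integ /Rintegral (@continuous_FTC2 _ f F)//.
- exact: continuous_subspaceT.
- split; first by move=> x _; have [] := dF x.
  + by apply: cvg_at_right_filter; exact: cF.
  + by apply: cvg_at_left_filter; exact: cF.
- by move=> x _; rewrite derive1E; have [] := dF x.
Qed.

Lemma shift_continuous kap (n y : R) : continuous kap -> continuous (fun x => kap (n * (x - y))).
Proof.
move=> ck x; apply: (@continuous_comp _ _ _ (fun x => n * (x - y)) kap); last exact: ck.
by apply: cvgM; [exact: cvg_cst|apply: cvgB; [exact: cvg_id|exact: cvg_cst]].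
Qed.

Lemma reflect_continuous kap (n x : R) : continuous kap -> continuous (fun y => kap (n * (x - y))).
Proof.
move=> ck y; apply: (@continuous_comp _ _ _ (fun y => n * (x - y)) kap); last exact: ck.
by apply: cvgM; [exact: cvg_cst|apply: cvgB; [exact: cvg_cst|exact: cvg_id]].
Qed.

Lemma shift_derive kap (kap' : R -> R) (n y x : R) :
  (forall x : R, is_derive x (1 : R) kap (kap' x)) ->
  is_derive x (1 : R) (fun x => kap (n * (x - y))) (kap' (n * (x - y)) * n).
Proof.
move=> dk; apply: (@is_derive1_comp _ kap (fun x => n * (x - y))) => //.
have := @is_deriveZ _ _ _ (fun x => x - y) n x (1 : R) 1; rewrite /GRing.scale/= mulr1.
apply; have := is_deriveB (is_derive_id x (1 : R)) (is_derive_cst y x (1 : R)).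
by rewrite subr0.
Qed.

Lemma reflect_derive kap (kap' : R -> R) (n x y : R) :
  (forall x : R, is_derive x (1 : R) kap (kap' x)) ->
  is_derive y (1 : R) (fun y => kap (n * (x - y))) (kap' (n * (x - y)) * - n).
Proof.
move=> dk; apply: (@is_derive1_comp _ kap (fun y => n * (x - y))) => //.
have := @is_deriveZ _ _ _ (fun y => x - y) n y (1 : R) (-1); rewrite /GRing.scale/= mulrN1.
apply; have := is_deriveB (is_derive_cst x y (1 : R)) (is_derive_id y (1 : R)).
by rewrite sub0r.
Qed.

Variables (kap kap' g : R -> R) (n A : R).
Hypothesis cg : continuous g.
Local Notation conv k := (fun x : R => integ (- A) A (fun y => n * g y * k (n * (x - y)))).

Let conv_int (k : R -> R) x : continuous k ->
  intble (- A) A (fun y => n * g y * k (n * (x - y))).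
Proof.
move=> ck; apply: intble_continuous => y; apply: cvgM; last exact: reflect_continuous.
by apply: cvgM; [exact: cvg_cst|exact: cg].
Qed.

Let conv_bound (k : R -> R) (a : R) : continuous k -> exists2 C, 0 <= C &
  forall x y, a - 1 < x < a + 1 -> - A <= y <= A -> `|n * g y * k (n * (x - y))| <= C.
Proof.
move=> ck; have r0 : 0 <= `|n| * (`|a| + 1 + `|A|) by rewrite mulr_ge0// !addr_ge0.
have [Ck Ck0 hk] := continuous_bound ck r0.
have [Cg Cg0 hg] := continuous_bound cg (normr_ge0 A).
exists (`|n| * Cg * Ck) => [|x y xa yA]; first by rewrite !mulr_ge0.
have yA' : `|y| <= `|A| by rewrite (le_trans _ (ler_norm A))// ler_norml.
rewrite normrM; apply: ler_pM => //; first by rewrite normrM; apply: ler_pM => //; exact: hg.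
apply: hk; rewrite normrM; apply: ler_wpM2l => //; apply: (le_trans (ler_normB _ _)).
apply: lerD => //; have h : `|x - a| <= 1 by rewrite ler_norml; move: xa; lra.
by have := norm_close (lexx `|a|) (_ : `|a - x| <= 1); rewrite distrC => /(_ h).
Qed.

Lemma conv_continuous (k : R -> R) : continuous k -> continuous (conv k).
Proof.
move=> ck a; have [C C0 hC] := conv_bound a ck.
have Ia : a \in `]a - 1, a + 1[ by rewrite inE/= in_itv/=; lra.
apply: (@continuity_under_integral R _ _ (@lebesgue_measure R)
  (fun x y => n * g y * k (n * (x - y))) `[- A, A] _ (a - 1) (a + 1) _ _ (fun=> C)) => //.
- by move=> x _; exact: conv_int.
- apply: aeW => y _ x _; apply: cvgM; first exact: cvg_cst.
  exact: shift_continuous.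
- exact: intble_cst.
- by move=> x /=; rewrite in_itv/= => xa; apply: aeW => y; rewrite /= in_itv/=; exact: hC.
Qed.

Lemma conv_derive1 (a : R) : (forall x : R, is_derive x (1 : R) kap (kap' x)) ->
  continuous kap' ->
  derive1 (conv kap) a = integ (- A) A (fun y => n * g y * (kap' (n * (a - y)) * n)).
Proof.
move=> dk ck'; have ck := derive_continuous dk.
have [C C0 hC] := conv_bound a ck'.
have dE (x y : R) : is_derive x (1 : R) (fun x => n * g y * kap (n * (x - y)))
    (n * g y * (kap' (n * (x - y)) * n)).
  by have := is_deriveZ (n * g y) (shift_derive n y x dk); exact.
have pE x y : partial1of2 (fun x y => n * g y * kap (n * (x - y))) x y =
    n * g y * (kap' (n * (x - y)) * n).
  by rewrite /partial1of2 derive1E; have [] := dE x y.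
have Ia : `]a - 1, a + 1[%classic a by rewrite /= in_itv/=; lra.
have := @differentiation_under_integral R _ _ (@lebesgue_measure R)
  (fun x y => n * g y * kap (n * (x - y))) `[- A, A] (measurable_itv _) a (a - 1) (a + 1) Ia
  _ _ (fun=> C * `|n|).
move=> ->.
- by apply: eq_Rintegral => y _; rewrite pE.
- by move=> x _; exact: conv_int.
- by move=> x y _ _; have [] := dE x y.
- by move=> y; rewrite mulr_ge0.
- exact: intble_cst.
- move=> x y /=; rewrite !in_itv/= => xa yA; rewrite pE mulrA normrM.
  by apply: ler_wpM2r => //; exact: hC.
Qed.

End integral_calculus.

Section mollifier.
Context {R : realType}.
Variables (Phi : R -> R).
Hypothesis hPhi : mollifier Phi.

Lemma mollifier_smooth : [/\ forall x : R, is_derive x (1 : R) Phi (derive1 Phi x),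
  continuous (derive1 Phi) & exists2 M : R, 0 < M & forall x, M < `|x| -> Phi x = 0].
Proof.
have [sm [M hM] _] := hPhi; split.
- by move=> x; have := sm 0 x; rewrite /= => /derivableP; rewrite -derive1E.
- move=> x; have := sm 1 x; rewrite /= => d1.
  by apply: differentiable_continuous; apply/derivable1_diffP.
- exists (Num.max M 1); first by rewrite lt_max ltr01 orbT.
  by move=> x; rewrite gt_max => /andP[/hM].
Qed.

Variable M : R.
Hypothesis M0 : 0 < M.
Hypothesis PhiM : forall x, M < `|x| -> Phi x = 0.
Let dPhi : forall x : R, is_derive x (1 : R) Phi (derive1 Phi x).
Proof. by have [] := mollifier_smooth. Qed.
Let cPhi' : continuous (derive1 Phi).
Proof. by have [] := mollifier_smooth. Qed.
Let cPhi : continuous Phi. Proof. exact: derive_continuous dPhi. Qed.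

Lemma regularizationE n (g : R -> R) (x a b : R) :
  (forall y, ~~ (a <= y <= b) -> M < `|n%:R * (x - y)|) ->
  regularization Phi n g x = integ a b (fun y => n%:R * g y * Phi (n%:R * (x - y))).
Proof.
move=> h; rewrite /integ Rintegral_mkcond; apply: eq_Rintegral => y _.
rewrite patchE; case: ifPn; first by rewrite mulrAC.
rewrite notin_setE/= in_itv/= => /negP/h/PhiM ->; by rewrite mulr0 mul0r.
Qed.

(** A primitive of [Phi] turns the substitution [u = n (x - y)] into two applications of the
    fundamental theorem of calculus. *)
Lemma kernel_integral n (x a b : R) : a <= b ->
  (forall y, ~~ (a <= y <= b) -> M < `|n%:R * (x - y)|) -> (0 < n)%N ->
  integ a b (fun y => n%:R * Phi (n%:R * (x - y))) = 1.
Proof.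
move=> ab h n0; have n1 : 0 < n%:R :> R by rewrite ltr0n.
pose Psi := oriented_integral Phi.
have dPsi : forall x : R, is_derive x (1 : R) Psi (Phi x) by exact: oriented_integral_derive.
pose Fy (y : R) : R := - Psi (n%:R * (x - y)).
have dF (y : R) : is_derive y (1 : R) Fy (n%:R * Phi (n%:R * (x - y))).
  have := is_deriveN (reflect_derive n%:R x y dPsi).
  by rewrite mulrN opprK mulrC.
have cF : continuous (fun y => n%:R * Phi (n%:R * (x - y))).
  by move=> y; apply: cvgM; [exact: cvg_cst|exact: reflect_continuous].
rewrite (integ_derive dF cF ab) /Fy opprK addrC.
rewrite -(integ_derive dPsi cPhi); last by apply: ler_wpM2l; [exact: ltW|lra].
have [_ _ P1] := hPhi; rewrite /integ /Rintegral -[RHS]/(fine 1%:E) -P1; congr fine.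
rewrite integral_mkcond; apply: eq_integral => u _; rewrite patchE; case: ifPn => //.
rewrite notin_setE/= in_itv/= => /negP hu.
have [q uq] : exists q, u = n%:R * q by exists (u / n%:R); rewrite mulrC divfK// lt0r_neq0.
rewrite uq in hu *; rewrite PhiM// (_ : n%:R * q = n%:R * (x - (x - q))); last by ring.
apply: h; apply/negP => /andP[h1 h2]; move/negP: hu; apply.
by rewrite !ler_pM2l//; move: h1 h2; lra.
Qed.

(** [Phi] may change sign, so the kernel is estimated by its absolute mass, at most [2 M S]; its
    total integral 1 serves to write [c x] as an average over the same interval. *)
Lemma regularization_close (c : R -> R) (r eps : R) : continuous c -> 0 <= r -> 0 < eps ->
  exists N0, forall n, (N0 <= n)%N -> (0 < n)%N -> forall x, `|x| <= r ->
    `|regularization Phi n c x - c x| <= eps.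
Proof.
move=> cc r0 e0; have [S S0 hS] := continuous_bound cPhi (ltW M0).
have PhiS x : `|Phi x| <= S.
  by have [/hS//|/PhiM ->] := leP `|x| M; rewrite normr0.
have c0 : 0 < 2 * M * S + 1 by rewrite ltr_wpDl// mulr_ge0// mulr_ge0// ltW.
have [dl dl0 hdl] := @close_on _ c (r + 1) _ cc (divr_gt0 e0 c0).
have m0 : 0 < Num.min dl 1 by rewrite lt_min dl0 ltr01.
have [N0 hN] := small_step M m0; exists N0 => n nN n0 x xr.
have := hN n nN n0; rewrite lt_min => /andP[Md M1].
have n1 : 0 < n%:R :> R by rewrite ltr0n.
have Mn : 0 < M / n%:R by rewrite divr_gt0.
have h y : ~~ (x - M / n%:R <= y <= x + M / n%:R) -> M < `|n%:R * (x - y)|.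
  move=> hy; rewrite ltNge; apply/negP => hM; move/negP: hy; apply.
  move: hM; rewrite normrM ger0_norm ?(ltW n1)// -ler_pdivlMl// mulrC ler_norml.
  by move: (M / n%:R) => q /andP[]; lra.
have ab : x - M / n%:R <= x + M / n%:R by move: Mn; move: (M / n%:R) => q; lra.
have cK : continuous (fun y => n%:R * Phi (n%:R * (x - y))).
  by move=> y; apply: cvgM; [exact: cvg_cst|exact: reflect_continuous].
rewrite (regularizationE c h) [X in _ - X](_ : _ = integ (x - M / n%:R) (x + M / n%:R)
    (fun y => c x * (n%:R * Phi (n%:R * (x - y))))); last first.
  by rewrite integZ; [rewrite kernel_integral ?mulr1|exact: intble_continuous].
have -> : eps = eps / (2 * M * S + 1) * (2 * M * S + 1) by rewrite divfK// lt0r_neq0.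
apply: (@le_trans _ _ (eps / (2 * M * S + 1) * (n%:R * S) * (x + M / n%:R - (x - M / n%:R)))).
  apply: integ_dist_le => //.
  - apply: intble_continuous => y; apply: cvgM; last exact: reflect_continuous.
    by apply: cvgM; [exact: cvg_cst|exact: cc].
  - by apply: intbleZ; exact: intble_continuous.
  move=> y /andP[y1 y2].
  have -> : n%:R * c y * Phi (n%:R * (x - y)) - c x * (n%:R * Phi (n%:R * (x - y))) =
    (c y - c x) * (n%:R * Phi (n%:R * (x - y))) by ring.
  rewrite normrM; apply: ler_pM => //; last first.
    by rewrite normrM ger0_norm ?(ltW n1)//; apply: ler_wpM2l => //; exact: ltW.
  have yx : `|x - y| <= M / n%:R.
    by rewrite ler_norml; move: y1 y2; move: (M / n%:R) => q; lra.
  apply: hdl.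
  - by rewrite (le_trans (norm_close xr yx))// lerD2l ltW.
  - by rewrite (le_trans xr)// lerDl.
  - by rewrite distrC (le_lt_trans yx).
rewrite -mulrA; apply: ler_wpM2l; first by rewrite divr_ge0 ?ltW.
have -> : n%:R * S * (x + M / n%:R - (x - M / n%:R)) = 2 * M * S.
  by field; apply: lt0r_neq0.
by rewrite lerDl.
Qed.

Let far n (r x y : R) : (0 < n)%N -> `|x| < r -> ~~ (- (r + M) <= y <= r + M) ->
  M < `|n%:R * (x - y)|.
Proof.
move=> n0 xr; rewrite -ler_norml -ltNge => yr.
have h : M < `|x - y|.
  have := ler_normB x (x - y); rewrite opprB addrC subrK; move: xr yr.
  by move: `|x| `|y| `|x - y| => p q s; lra.
rewrite normrM (lt_le_trans h)// ler_peMl// ger0_norm// ler1n//.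
Qed.

(** For [x] in a bounded set the interval of integration can be fixed, which opens the way to
    continuity and differentiation under the integral sign. *)
Lemma regularization_cont n (c : R -> R) (r : R) : continuous c -> (0 < n)%N ->
  exists2 k : R -> R, continuous k & forall x, `|x| < r -> regularization Phi n c x = k x.
Proof.
move=> cc n0; exists (fun x => integ (- (r + M)) (r + M) (fun y => n%:R * c y * Phi (n%:R * (x - y)))).
  exact: conv_continuous.
by move=> x xr; apply: regularizationE => y; exact: far.
Qed.

Lemma regularization_derive_cont n (c : R -> R) (r : R) : continuous c -> (0 < n)%N ->
  exists2 k : R -> R, continuous k &
    forall x, `|x| < r -> derive1 (regularization Phi n c) x = k x.
Proof.
move=> cc n0; exists (fun x => integ (- (r + M)) (r + M)
    (fun y => n%:R * c y * (derive1 Phi (n%:R * (x - y)) * n%:R))).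
  have ck : continuous (fun u => derive1 Phi u * n%:R).
    by move=> u; apply: cvgM; [exact: cPhi'|exact: cvg_cst].
  exact: (conv_continuous cc ck).
move=> x xr; rewrite -(conv_derive1 n%:R (r + M) cc x dPhi cPhi') !derive1E.
apply: near_eq_derive; near=> z; apply: regularizationE => y; apply: far => //.
by near: z; apply: cvgr_norm_lt xr; exact: cvg_id.
Unshelve. all: by end_near. Qed.

End mollifier.

(** * Continuity of the limit function Sigma *)

Section Sigma_continuous.
Context {R : realType}.
Variables (Phi b sigma Sigma : R -> R).
Hypothesis hPhi : mollifier Phi.
Hypothesis hsigma : continuous sigma.
Hypothesis hb : continuous b.
Hypothesis sigma_gt0 : forall x, 0 < sigma x.

Lemma oriented_integral_continuous (u v : R -> R) (r : R) : 0 <= r -> continuous v ->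
  (forall x, `|x| <= r -> u x = v x) -> {within `[- r, r], continuous (oriented_integral u)}.
Proof.
move=> r0 cv uv.
have : {within `[- r, r], continuous (oriented_integral v)}.
  by apply: continuous_subspaceT; exact: derive_continuous (oriented_integral_derive cv).
apply: subspace_eq_continuous => x; rewrite inE/= in_itv/= => /andP[rx xr].
change (oriented_integral v x = oriented_integral u x).
rewrite /oriented_integral; case: ifPn => [x0|]; last rewrite -ltNge => /ltW x0.
  apply: eq_Rintegral => y; rewrite inE/= in_itv/= => /andP[y0 yx].
  by rewrite uv// ger0_norm// (le_trans yx).
congr (- _); apply: eq_Rintegral => y; rewrite inE/= in_itv/= => /andP[xy y0].
by rewrite uv// ler0_norm// lerNl (le_trans rx).
Qed.

Lemma clamp_abs_continuous (r : R) : continuous (fun x : R => Num.min (Num.max x (- r)) r).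
Proof.
move=> x; apply: (@continuous_min _ _ (fun x => Num.max x (- r)) (fun=> r)); last exact: cvg_cst.
by apply: (@continuous_max _ _ id (fun=> - r)); [exact: cvg_id|exact: cvg_cst].
Qed.

(** Uniform convergence keeps the regularization of [sigma] away from 0 on [[-r, r]] for large [n],
    so the quotient is continuous there. Composition with the truncation [cl] makes it continuous on
    the whole line without changing it on [[-r, r]]. *)
Lemma regularized_Sigma_continuous (r : R) : 0 < r -> exists N0, forall n, (N0 <= n)%N ->
  {within `[- r, r], continuous (fun x => 2 * oriented_integral
     (fun y => derive1 (regularization Phi n b) y / regularization Phi n sigma y ^+ 2) x)}.
Proof.
move=> r0; have [_ _ [M M0 PhiM]] := mollifier_smooth hPhi.
have ci : continuous (fun x => (sigma x)^-1).
  by move=> x; apply: cvgV; [exact: lt0r_neq0|exact: hsigma].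
have [S S0 hS] := continuous_bound ci (ltW r0).
have S1 : 0 < S + 1 by rewrite ltr_wpDl.
have e0 : 0 < (S + 1)^-1 / 2 by rewrite divr_gt0// invr_gt0.
have sge x : `|x| <= r -> (S + 1)^-1 <= sigma x.
  move=> /hS; rewrite gtr0_norm ?invr_gt0// => h.
  by rewrite -[leRHS]invrK lef_pV2 ?posrE ?invr_gt0// (le_trans h)// lerDl.
have [N0 hN] := regularization_close hPhi M0 PhiM hsigma (ltW r0) e0.
exists N0.+1 => n nN; have n0 : (0 < n)%N by exact: leq_ltn_trans nN.
have [k1 ck1 k1E] := regularization_derive_cont hPhi PhiM (r + 1) hb n0.
have [k2 ck2 k2E] := regularization_cont hPhi PhiM (r + 1) hsigma n0.
pose cl (x : R) := Num.min (Num.max x (- r)) r.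
have clr x : `|cl x| <= r.
  rewrite ler_norml /cl le_min ge_min lexx orbT le_max lexx orbT !andbT.
  by rewrite (le_trans _ (ltW r0))// oppr_le0 ltW.
have clE x : `|x| <= r -> cl x = x.
  by rewrite ler_norml /cl => /andP[h1 h2]; rewrite max_l// min_l.
have r1 (x : R) : `|x| <= r -> `|x| < r + 1 by move=> h; rewrite (le_lt_trans h)// ltrDl.
have k2_gt0 x : `|x| <= r -> 0 < k2 x.
  move=> xr; have := hN n (ltnW nN) n0 x xr; rewrite (k2E _ (r1 _ xr)) ler_norml.
  by have := sge x xr; move: e0; move: ((S + 1)^-1) => q; lra.
have ccl := @clamp_abs_continuous r.
pose v x := k1 (cl x) / k2 (cl x) ^+ 2.
have cv : continuous v.
  move=> x; apply: cvgM.
    by apply: (@continuous_comp _ _ _ cl k1); [exact: ccl|exact: ck1].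
  apply: cvgV; first by rewrite sqrf_eq0 lt0r_neq0// k2_gt0.
  apply: (@continuous_comp _ _ _ (fun x => k2 (cl x)) (fun x => x ^+ 2)); last exact: exprn_continuous.
  by apply: (@continuous_comp _ _ _ cl k2); [exact: ccl|exact: ck2].
apply: (@within_continuous_comp _ _ _ _ (oriented_integral _) (fun x => 2 * x)).
  by move=> x _; apply: cvgM; [exact: cvg_cst|exact: cvg_id].
apply: (oriented_integral_continuous (ltW r0) cv) => x xr.
by rewrite /v clE// k1E ?k2E//; exact: r1.
Qed.

Lemma Sigma_continuous : is_Sigma Phi b sigma Sigma -> continuous Sigma.
Proof.
move=> hS x0; pose r := `|x0| + 1; have r0 : 0 < r by rewrite ltr_wpDl.
have [N0 hN] := regularized_Sigma_continuous r0.
have cK := @segment_compact R (- r) r.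
have : {within `[- r, r], continuous Sigma}.
  apply: (uniform_limit_continuous_subspace _ _ (hS _ cK)).
  by exists N0 => // n nN; exact: hN.
move/(continuous_within_itvP _ (gtrN r0)) => [+ _ _]; apply.
by rewrite in_itv/= -ltr_norml /r ltrDl.
Qed.

End Sigma_continuous.

(** * The scale function and the generator in its coordinate *)

Section scale.
Context {R : realType}.

(** A bounded nondecreasing primitive would have a limit at infinity, and the integral of [f] would
    be finite. *)
Lemma unbounded_primitive (F f : R -> R) : continuous f -> (forall x, 0 < f x) ->
  (forall x : R, is_derive x (1 : R) F (f x)) ->
  (\int[lebesgue_measure]_(x in `[0%R, +oo[) (f x)%:E = +oo)%E ->
  forall C, exists2 x, 0 <= x & C < F x.
Proof.
move=> cf f0 dF fy C; apply: contrapT => hC; have cF := derive_continuous dF.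
have Fmono : {homo F : x y / x <= y}.
  move=> x y xy; rewrite -subr_ge0; have [z _ ->] := mean_value dF x y.
  by rewrite mulr_ge0 ?subr_ge0//; exact: ltW.
have Fub : has_ubound (range F).
  exists C => _ [x _ <-]; have [x0|/ltW x0] := leP 0 x.
    by rewrite leNgt; apply/negP => h; apply: hC; exists x.
  apply: (le_trans (Fmono _ _ x0)).
  by rewrite leNgt; apply/negP => h; apply: hC; exists 0.
have := nondecreasing_cvgr Fmono Fub; move: (sup _) => l Fl.
have : (\int[lebesgue_measure]_(x in `[0%R, +oo[) (f x)%:E = l%:E - (F 0)%:E)%E.
  apply: ge0_continuous_FTC2y => //.
  - by move=> x _; exact: ltW.
  - exact: continuous_subspaceT.
  - by apply: cvg_at_right_filter; exact: cF.
  - by move=> x _; rewrite derive1E; have [] := dF x.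
by rewrite fy.
Qed.

Variables (Sigma h : R -> R).
Hypothesis cSigma : continuous Sigma.
Hypothesis hSigma_l :
  (\int[lebesgue_measure]_(x in `]-oo, 0%R]) (expR (- Sigma x))%:E = +oo)%E.
Hypothesis hSigma_r :
  (\int[lebesgue_measure]_(x in `[0%R, +oo[) (expR (- Sigma x))%:E = +oo)%E.
Hypothesis hh : is_scale Sigma h.
Local Notation e := (fun x => expR (- Sigma x)).
Local Notation k := (invfun h).

Lemma scale_slope_continuous : continuous e.
Proof.
move=> x; apply: (@continuous_comp _ _ _ (fun x => - Sigma x) expR); last exact: continuous_expR.
by apply: cvgN; exact: cSigma.
Qed.

Let dh : forall x : R, is_derive x (1 : R) h (e x). Proof. by have [] := hh. Qed.

Lemma scale_derive1 x : derive1 h x = e x.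
Proof. by rewrite derive1E; have [] := dh x. Qed.

Lemma scale_lt x y : x < y -> h x < h y.
Proof.
move=> xy; rewrite -subr_gt0; have [z _ ->] := mean_value dh x y.
by rewrite mulr_gt0 ?subr_gt0// expR_gt0.
Qed.

Lemma scale_inj : injective h.
Proof.
move=> x y xy; case: (ltgtP x y) => // /scale_lt; by rewrite xy ltxx.
Qed.

(** Unboundedness on the left is reduced to the right half-line by the reflection [x => - h (- x)];
    the intermediate value theorem then applies. *)
Lemma scale_surj y : exists x, h x = y.
Proof.
have [b _ yb] := unbounded_primitive scale_slope_continuous (fun x => expR_gt0 _) dh hSigma_r y.
pose F (x : R) : R := - h (- x).
have dF (x : R) : is_derive x (1 : R) F (e (- x)).
  have dN : is_derive x (1 : R) (fun x => - x) (-1).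
    by have := is_deriveN (is_derive_id x (1 : R)).
  have := is_deriveN (@is_derive1_comp _ h (fun x => - x) x _ _ (dh (- x)) dN).
  by rewrite mulrN1 opprK.
have ceN : continuous (fun x => e (- x)).
  move=> x; apply: (@continuous_comp _ _ _ (fun x => - x) e).
    by apply: cvgN; exact: cvg_id.
  exact: scale_slope_continuous.
have eNy : (\int[lebesgue_measure]_(x in `[0%R, +oo[) (e (- x))%:E = +oo)%E.
  rewrite -hSigma_l -[in RHS]oppr0 ge0_integration_by_substitutionNy//.
  by apply: continuous_subspaceT; exact: scale_slope_continuous.
have [a _ ya] := unbounded_primitive ceN (fun x => expR_gt0 _) dF eNy (- y).
have {}ya : h (- a) < y by rewrite -ltrN2.
have ab : - a <= b.
  by rewrite leNgt; apply/negP => /scale_lt; rewrite ltNge (ltW (lt_trans ya yb)).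
have yI : Num.min (h (- a)) (h b) <= y <= Num.max (h (- a)) (h b).
  by rewrite ge_min (ltW ya)/= le_max (ltW yb) orbT.
by have [c _ hc] := IVT ab (continuous_subspaceT (derive_continuous dh)) yI; exists c.
Qed.

Lemma scaleK : cancel h k.
Proof.
by move=> x; apply: pinvKV; rewrite ?inE//; move=> u v _ _; exact: scale_inj.
Qed.

Lemma invscaleK : cancel k h.
Proof.
move=> y; apply: pinvK; rewrite inE; have [x hx] := scale_surj y.
by exists x.
Qed.

Lemma invscale_derive (y : R) : is_derive y (1 : R) k (e (k y))^-1.
Proof.
rewrite -{1}[y]invscaleK; apply: is_derive_inverse => //.
- by near=> z; exact: scaleK.
- by near=> z; exact: (derive_continuous dh).
- by rewrite lt0r_neq0// expR_gt0.
Unshelve. all: by end_near. Qed.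

Lemma invscale_continuous : continuous k.
Proof. exact: derive_continuous invscale_derive. Qed.

Lemma compose_continuous (f g : R -> R) : continuous f -> continuous g -> continuous (f \o g).
Proof. by move=> cf cg x; apply: continuous_comp; [exact: cg|exact: cf]. Qed.

Variable sigma : R -> R.
Hypothesis csigma : continuous sigma.

Lemma sigma0E y : sigma0 sigma h y = sigma (k y) * e (k y).
Proof. by rewrite /sigma0 scale_derive1. Qed.

Lemma sigma0_continuous : continuous (sigma0 sigma h).
Proof.
have -> : sigma0 sigma h = (fun x => sigma x * e x) \o k by apply/funext => y; rewrite sigma0E.
apply: compose_continuous; last exact: invscale_continuous.
by move=> x; apply: cvgM; [exact: csigma|exact: scale_slope_continuous].
Qed.

Section generator.
Variables f Lf phi : R -> R.
Hypothesis cf : C1 f.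
Hypothesis cphi : C1 phi.
Hypothesis fE : forall x, derive1 f x = e x * phi x.
Hypothesis LfE : forall x, Lf x = derive1 phi x * e x * (sigma x ^+ 2 / 2).

Let C1_derive (g : R -> R) : C1 g -> forall x : R, is_derive x (1 : R) g (derive1 g x).
Proof. by move=> [dg _] x; rewrite derive1E; apply/derivableP. Qed.

Let comp_derive (g g' : R -> R) (y : R) : (forall x : R, is_derive x (1 : R) g (g' x)) ->
  is_derive y (1 : R) (fun y => g (k y)) (g' (k y) * (e (k y))^-1).
Proof. by move=> dg; apply: (@is_derive1_comp _ g k) => //; exact: invscale_derive. Qed.

(** The second derivative of [f o h^-1]. Its first derivative is [phi o h^-1], since the factor
    [exp (- Sigma)] of [f'] is cancelled by the change of variable: functions of the domain become
    twice continuously differentiable in the new coordinate. *)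
Definition phi2 y := derive1 phi (k y) * (e (k y))^-1.

Lemma generator_derive (y : R) : is_derive y (1 : R) (fun y => f (k y)) (phi (k y)).
Proof.
have := comp_derive y (C1_derive cf); rewrite fE mulrAC divff ?mul1r//.
by rewrite lt0r_neq0// expR_gt0.
Qed.

Lemma generator_derive2 (y : R) : is_derive y (1 : R) (fun y => phi (k y)) (phi2 y).
Proof. exact: comp_derive (C1_derive cphi). Qed.

Lemma generator_derive2_continuous : continuous phi2.
Proof.
apply: (@compose_continuous (fun x => derive1 phi x * (e x)^-1) k); last exact: invscale_continuous.
move=> x; apply: cvgM; first by have [_] := cphi; exact.
by apply: cvgV; [rewrite lt0r_neq0// expR_gt0|exact: scale_slope_continuous].
Qed.

Lemma generator_second_order y : 2^-1 * phi2 y * sigma0 sigma h y ^+ 2 = Lf (k y).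
Proof.
rewrite sigma0E LfE /phi2; have : e (k y) != 0 by rewrite lt0r_neq0// expR_gt0.
by move: (e (k y)) => q q0; field.
Qed.

Lemma generator_diffusion y :
  phi (k y) * sigma0 sigma h y = derive1 f (k y) * sigma (k y).
Proof. by rewrite sigma0E fE; ring. Qed.

Lemma generator_drift (Gamma : R -> (R -> R) -> R) (s : R) (Y : R -> R) :
  phi (k (Y s)) * Gamma_bar h Gamma s Y = derive1 f (k (Y s)) * Gamma s (stop s (k \o Y)).
Proof. by rewrite /Gamma_bar scale_derive1 fE; rewrite mulrA [phi _ * _]mulrC. Qed.

End generator.

(** The choice [phi = 1] shows that [h] is harmonic for [L]; as a test function it yields the
    equation of [h (X)]. *)
Lemma scale_generator : generator sigma Sigma h (fun=> 0).
Proof.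
have ce := scale_slope_continuous; split.
  split; first by move=> x; have [] := dh x.
  by rewrite (_ : derive1 h = e) //; apply/funext => x; exact: scale_derive1.
have d1 : derive1 (fun=> 1 : R) = (fun=> 0 : R).
  by apply/funext => x; exact: derive1_cst.
exists (fun=> 1); split.
- by split=> [x|]; [exact: derivable_cst|rewrite d1 => x; exact: cvg_cst].
- by move=> x; rewrite scale_derive1 mulr1.
- by move=> x; rewrite d1 !mul0r.
Qed.

Variables (T : R) (Gamma : R -> (R -> R) -> R) (K K0 : R).
Hypothesis T0 : 0 < T.
Hypothesis hGamma : borel_functional T Gamma.
Hypothesis hLip : forall (s : R) (eta1 eta2 : R -> R),
  Lambda T (s, eta1) -> Lambda T (s, eta2) ->
  `|Gamma_bar h Gamma s eta1 - Gamma_bar h Gamma s eta2|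
    <= K * (`|eta1 s - eta2 s| + Rintegral lebesgue_measure `[0, s] (fun r => `|eta1 r - eta2 r|)).
Hypothesis hzero : forall s, 0 <= s <= T -> `|Gamma_bar h Gamma s (fun=> 0)| <= K0.

Lemma Gamma_bar_stop s eta : Gamma_bar h Gamma s (stop s eta) = Gamma_bar h Gamma s eta.
Proof.
rewrite /Gamma_bar /stop minxx; congr (_ * Gamma s _); apply/funext => t /=.
by rewrite -minA minxx.
Qed.

(** The Lipschitz hypothesis concerns stopped paths; it extends to all continuous paths because
    [Gamma_bar] stops its argument. *)
Lemma Gamma_bar_drift : drift T K K0 (Gamma_bar h Gamma).
Proof.
split => // [s e1 e2 sT c1 c2|z cz].
  rewrite -[X in `|X - _|]Gamma_bar_stop -[X in `|_ - X|]Gamma_bar_stop.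
  apply: (le_trans (hLip _ _)); [exact: stop_Lambda|exact: stop_Lambda|].
  rewrite {1 2}/stop minxx.
  rewrite (_ : Rintegral _ _ _ = integ 0 s (fun r => `|e1 r - e2 r|))//.
  by apply: eq_integ => r /andP[_ rs]; rewrite /stop min_l.
apply: measurable_funM.
  apply: subspace_continuous_measurable_fun => //.
  apply: (@within_continuous_comp _ _ _ _ z (fun x => derive1 h (k x))) => // x _.
  rewrite (_ : (fun x => derive1 h (k x)) = e \o k).
    by apply: (compose_continuous scale_slope_continuous invscale_continuous).
  by apply/funext => y; rewrite scale_derive1.
apply: (borel_functional_path T0 hGamma (z := k \o z)).
by apply: within_continuous_comp => // x _; exact: invscale_continuous.
Qed.

End scale.

(** * The martingale problem *)

Section martingale_problem.
Context {R : realType}.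
Variables (T : R) (sigma Sigma h : R -> R) (Gamma : R -> (R -> R) -> R) (K K0 : R).
Hypothesis T0 : 0 < T.
Hypothesis csigma : continuous sigma.
Hypothesis cSigma : continuous Sigma.
Hypothesis hSigma_l :
  (\int[lebesgue_measure]_(x in `]-oo, 0%R]) (expR (- Sigma x))%:E = +oo)%E.
Hypothesis hSigma_r :
  (\int[lebesgue_measure]_(x in `[0%R, +oo[) (expR (- Sigma x))%:E = +oo)%E.
Hypothesis hh : is_scale Sigma h.
Hypothesis K_gt0 : 0 < K.
Local Notation B := (Gamma_bar h Gamma).
Local Notation s0 := (sigma0 sigma h).
Local Notation k := (invfun h).
Hypothesis dB : drift T K K0 B.
Hypothesis yw : yamada_watanabe s0.

Let ck : continuous k. Proof. exact: invscale_continuous cSigma hSigma_l hSigma_r hh. Qed.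
Let ch : continuous h. Proof. by apply: derive_continuous; case: hh. Qed.
Let hK : cancel h k. Proof. exact: scaleK hh. Qed.
Let cs0 : continuous s0. Proof. exact: sigma0_continuous cSigma hSigma_l hSigma_r hh _ csigma. Qed.

Context {d : measure_display} {Om : measurableType d}.
Variables (P : probability Om R) (W : R -> Om -> R).
Hypothesis bW : brownian_motion P T W.
Local Notation F := (canonical_filtration P T W).
Let wb : wiener_basis (Pbar P) T W F. Proof. exact: canonical_wiener_basis. Qed.

(** The test function is [h]: the generator term vanishes, [h' sigma] is [sigma0] at [h (X)], and
    the drift becomes [Gamma_bar] because [h^-1 o h] is the identity. *)
Lemma scaled_solution (x0 : R) X : strong_mp_solution P T sigma Sigma Gamma W x0 X ->
  solution_via_simple (Pbar P) T W F (h x0) B s0 (fun t w => h (X t w)).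
Proof.
move=> [_ _ _ /(_ _ _ (scale_generator cSigma hh sigma))] /ito_of_integral hI.
move=> kap lam e kap0 lam0 e0; have [S [sS S1 S2]] := hI _ _ _ kap0 lam0 e0.
have BX w s : B s (fun r => h (X r w)) = derive1 h (X s w) * Gamma s (stop s (X ^~ w)).
  rewrite /Gamma_bar hK; congr (_ * Gamma s _); apply/funext => t.
  by rewrite /stop /= hK.
exists S; split=> //.
- apply: pbnd_le S1 => // w /=; congr (_ < _)%E; apply: eq_integral => s _.
  by rewrite /sigma0 hK [sigma _ * _]mulrC.
- apply: pbnd_le S2 => // w [t tT lt]; exists t => //.
  move: lt; congr (_ < `|_ - _|); have /andP[t0 _] := tT.
  transitivity (h (X t w) - h x0 - integ 0 t (fun=> 0)
    - integ 0 t (fun s => derive1 h (X s w) * Gamma s (stop s (X ^~ w)))) => //.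
  rewrite integ_cst// mul0r subr0; congr (_ - _); apply: eq_integ => s _; exact: BX.
Qed.

Lemma indistinguishable_solutions (x1 x2 : R) X1 X2 :
  strong_mp_solution P T sigma Sigma Gamma W x1 X1 ->
  strong_mp_solution P T sigma Sigma Gamma W x2 X2 ->
  {ae P, forall w, X1 0 w = X2 0 w} -> indistinguishable P T X1 X2.
Proof.
move=> s1 s2 e12.
(* The starting points are constants that agree almost surely on a space of mass 1, hence they are
   equal. *)
have x12 : x1 = x2.
  have [_ _ a1 _] := s1; have [_ _ a2 _] := s2.
  have : {ae P, forall w, x1 = x2}.
    by apply: filterS3 a1 a2 e12 => w /= -> ->.
  move=> [A [mA PA hA]]; apply: contrapT => n; move: PA.
  rewrite (_ : A = setT) ?probability_setT; first by move/eqP; rewrite onee_eq0.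
  by apply/seteqP; split => // w _; apply: hA.
rewrite -x12 in s2.
have cont X : continuous_process T X -> continuous_process T (fun t (w : completed P) => h (X t w)).
  by move=> cX w; apply: within_continuous_comp; [move=> x _; exact: ch|exact: (cX w)].
have adp X : adapted T F X -> forall t, 0 <= t <= T ->
    @meas_wrt R (completed P) (F t) (fun w => h (X t w)).
  move=> aX t tT; apply: (@meas_compc R (completed P) (F t) h (X t) ch).
  by split=> C mC; exact: aX.
have [c1 a1 _ _] := s1; have [c2 a2 _ _] := s2.
have := unique_solutions T0 wb K_gt0 dB cs0 yw (cont _ c1) (cont _ c2) (adp _ a1) (adp _ a2)
  (scaled_solution s1) (scaled_solution s2).
move=> /Pbar_negligible hn; apply: negligibleS hn => w /= nh h'; apply: nh => t tT.
by apply: (can_inj hK); exact: h'.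
Qed.

Hypothesis s0_growth : linear_growth s0.

(** The limit of the Euler schemes lives on the given space and is adapted to the canonical
    filtration, so that [h^-1 (Y)] is a strong solution. For [f] in the domain, the Ito formula for
    [Y] is applied to [f o h^-1]. *)
Lemma solution_exists (x0 : R) : exists X, strong_mp_solution P T sigma Sigma Gamma W x0 X.
Proof.
have cauchy := euler_cauchy T0 wb (h x0) K_gt0 dB cs0 yw s0_growth.
have cZ N (N0 : (0 < N)%N) := Et_cont T0 wb (y0 := h x0) K_gt0 dB cs0 N0.
have mZ N t (N0 : (0 < N)%N) (tT : 0 <= t <= T) := Et_meas T0 wb (h x0) K_gt0 dB cs0 N0 tT.
have Z0 N (w : completed P) : (0 < N)%N -> Et T W (h x0) B s0 N 0 w = h x0.
  by move=> N0; rewrite -(gridt0 T N) Et_grid.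
have [Y [cY aY Y0 Ylim]] := ucp_limit T0 (wb_sigma wb) (wb_null wb) cZ mZ cauchy Z0.
exists (fun t w => k (Y t w)); split.
- by move=> w; apply: within_continuous_comp; [move=> x _; exact: ck|exact: (cY w)].
- move=> t tT C mC; apply: (@meas_preimage R (completed P) (F t) (fun w => k (Y t w)) C _ mC).
  exact: (@meas_compc R (completed P) (F t) k (Y t) ck (aY _ tT)).
- by apply: aeW => w; rewrite Y0 hK.
move=> f Lf [cf [phi [cphi fE LfE]]]; apply: integral_of_ito.
have := ito_formula T0 wb K_gt0 dB cs0 s0_growth cY Ylim
  (generator_derive cSigma hSigma_l hSigma_r hh cf fE)
  (generator_derive2 cSigma hSigma_l hSigma_r hh cphi)
  (generator_derive2_continuous cSigma hSigma_l hSigma_r hh cphi).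
congr ito_via_simple.
- apply/funext => s; apply/funext => w; exact: (generator_diffusion hh).
- apply/funext => t; apply/funext => w; rewrite /ito_path hK; congr (_ - _ - _).
  + by apply: eq_Rintegral => s _; rewrite (generator_second_order hh LfE).
  + by apply: eq_Rintegral => s _; rewrite (generator_drift hh fE).
Qed.

End martingale_problem.

Theorem corollary4p30 (R : realType) (T : R) (hT : 0 < T)
  (Phi : R -> R) (hPhi : mollifier Phi)
  (sigma b : R -> R) (hsigma : continuous sigma) (hb : continuous b)
  (sigma_gt0 : forall x, 0 < sigma x)
  (Sigma : R -> R) (hSigma : is_Sigma Phi b sigma Sigma)
  (hSigma_l :
    (\int[lebesgue_measure]_(x in `]-oo, 0%R]) (expR (- Sigma x))%:E = +oo)%E)
  (hSigma_r :
    (\int[lebesgue_measure]_(x in `[0%R, +oo[) (expR (- Sigma x))%:E = +oo)%E)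
  (h : R -> R) (hh : is_scale Sigma h)
  (Gamma : R -> (R -> R) -> R)
  (hGamma_bounded : locally_bounded_functional T Gamma)
  (hGamma_borel : borel_functional T Gamma)
  (hi : exists l : R -> R,
    [/\ forall u, 0 <= u -> 0 <= l u,
        measurable_fun (`[0, +oo[ : set R) l,
        forall eps : R, 0 < eps ->
          (\int[lebesgue_measure]_(u in `]0%R, eps]) inve (l u ^+ 2)%:E
             = +oo)%E &
        forall x y,
          `|sigma0 sigma h x - sigma0 sigma h y| <= l `|x - y|])
  (hii : linear_growth (sigma0 sigma h))
  (hiii : exists2 K : R, 0 < K &
    forall (s : R) (eta1 eta2 : R -> R),
      Lambda T (s, eta1) -> Lambda T (s, eta2) ->
      `|Gamma_bar h Gamma s eta1 - Gamma_bar h Gamma s eta2|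
        <= K * (`|eta1 s - eta2 s|
                + Rintegral lebesgue_measure `[0, s]
                    (fun r => `|eta1 r - eta2 r|)))
  (hiv : [bounded Gamma_bar h Gamma s (cst 0) | s in `[0, T]])
  (hor :
    [bounded Gamma_tilde sigma Gamma p.1 p.2 | p in Lambda T]
    \/ ([bounded sigma0 sigma h x | x in setT]
        /\ [bounded (sigma0 sigma h x)^-1 | x in setT])) :
  strong_existence T sigma Sigma Gamma
  /\ pathwise_uniqueness T sigma Sigma Gamma.
Proof.
have cSigma := Sigma_continuous hPhi hsigma hb sigma_gt0 hSigma.
have cs0 := sigma0_continuous cSigma hSigma_l hSigma_r hh hsigma.
have [l [l0 ml l_div s0l]] := hi.
have yw := yamada_watanabe_modulus cs0 l0 ml l_div s0l.
have [K K_gt0 hLip] := hiii.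
have [K0 hK0] : exists K0, forall s, 0 <= s <= T -> `|Gamma_bar h Gamma s (fun=> 0)| <= K0.
  have [M [_ hM]] := hiv; exists (M + 1) => s sT.
  by apply: (hM (M + 1)); [rewrite ltrDl|rewrite /= in_itv].
have dB := Gamma_bar_drift cSigma hSigma_l hSigma_r hh hT hGamma_borel hLip hK0.
split=> [x0 d Om P W bW|d Om P W bW x1 x2 X1 X2].
  have := solution_exists hT hsigma cSigma hSigma_l hSigma_r hh K_gt0 dB yw bW hii x0; exact.
have := @indistinguishable_solutions _ _ _ _ _ _ _ _ hT hsigma cSigma hSigma_l hSigma_r hh K_gt0 dB yw _ _ _ _ bW x1 x2 X1 X2; exact.
Qed.
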